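(* Suppose $\Omega\subseteq\mathbb{R}^d$ is closed and convex, the weighted graph $\mathcal{G}$ is connected and symmetric, and the interpolation function $\theta$ satisfies (A1)–(A7). Then $W_{\Omega\times\mathcal{G}}$ is a metric on $\mathcal{P}_2(\Omega\times\mathcal{G})$, and for any $\boldsymbol{\mu},\boldsymbol{\nu}\in\mathcal{P}_2(\Omega\times\mathcal{G})$ the infimum defining $W^2_{\Omega\times\mathcal{G}}(\boldsymbol{\mu},\boldsymbol{\nu})$ is achieved by some $(\boldsymbol{\rho},\mathbf{u},\boldsymbol{v})\in\mathcal{C}(\boldsymbol{\mu},\boldsymbol{\nu})$.
   Context: Graph. $\mathcal{G}$ is a weighted graph with nodes $\{1,\dots,n\}$ and edge weights $q_{ij}\ge 0$. It is symmetric if $q_{ij}=q_{ji}$ and connected if any two nodes are joined by a finite sequence of edges with strictly positive weights. Interpolation function. Assumptions on $\theta:[0,\infty)\times[0,\infty)\to[0,\infty)$: (A1) $\theta$ is continuous on $[0,\infty)^2$ and $C^\infty$ on $(0,\infty)^2$; (A2) $\theta(t,s)=\theta(s,t)$; (A3) $\theta>0$ on $(0,\infty)^2$; (A4) $\theta(1,1)=1$; (A5) $\theta(r,t)\le\theta(s,t)$ for $t\ge0$, $0\le r\le s$; (A6) $\theta(\lambda t,\lambda s)=\lambda\theta(t,s)$ for $\lambda>0$, $t,s\ge0$; (A7) $\theta$ is concave. Vector valued measures. $\mathcal{M}(\Omega)$ denotes the finite (nonnegative) Borel measures on $\Omega$. $\mathcal{P}(\Omega\times\mathcal{G})$ is the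 set of $\boldsymbol{\mu}=[\mu_1,\dots,\mu_n]^t$ with $\mu_i\in\mathcal{M}(\Omega)$ and $\sum_i\mu_i(\Omega)=1$, with the topology of componentwise narrow convergence; $\bar\mu:=\sum_i\mu_i$. $\mathcal{P}_2(\Omega\times\mathcal{G})$ is the subset with $\int_\Omega|x|^2d\mu_i<\infty$ for all $i$. Measures on $\Omega$ are regarded as measures on $\mathbb{R}^d$ by zero extension. Vector valued continuity equation. $(\boldsymbol{\rho},\mathbf{u},\boldsymbol{v})$ is a solution on $[t_0,t_1]$ if: (i) $\boldsymbol{\rho}\in C([t_0,t_1];\mathcal{P}(\Omega\times\mathcal{G}))$; (ii) $\mathbf{u}=[u_i]_{i=1}^n:\mathbb{R}^d\times[t_0,t_1]\to(\mathbb{R}^d)^n$ is measurable with $\int_{t_0}^{t_1}\int_\Omega|u_{i,t}|\,d\rho_{i,t}\,dt<\infty$ for all $i$; (iii) $\boldsymbol{v}=[v_{ij}]:\mathbb{R}^d\times[t_0,t_1]\to\mathbb{R}^{n\times n}$ is measurable with $\int_{t_0}^{t_1}\int_\Omega|v_{ij,t}|\,\theta(\frac{d\rho_{i,t}}{d\bar\rho_t},\frac{d\rho_{j,t}}{d\bar\rho_t})\,d\bar\rho_t\,dt<\infty$ for all $i,j$; (iv) for all $\eta\in C_c^\infty(\mathbb{R}^d\times(t_0,t_1))$ and all $i$, $$\int_{t_0}^{t_1}\!\!\int\partial_t\eta\,d\rho_{i,t}dt=-\int_{t_0}^{t_1}\!\!\int\nabla\eta\cdot u_{i,t}\,d\rho_{i,t}dt-\frac12\sum_{j=1}^n\int_{t_0}^{t_1}\!\!\int\eta\,\theta\Big(\frac{d\rho_{i,t}}{d\bar\rho_t},\frac{d\rho_{j,t}}{d\bar\rho_t}\Big)(v_{ij,t}-v_{ji,t})q_{ij}\,d\bar\rho_t\,dt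 .$$ $\mathcal{C}(\boldsymbol{\mu},\boldsymbol{\nu})$ is the set of solutions on $[0,1]$ with $\boldsymbol{\rho}_0=\boldsymbol{\mu}$, $\boldsymbol{\rho}_1=\boldsymbol{\nu}$. Dynamic distance. $\|(\mathbf{u},\boldsymbol{v})\|^2_{\boldsymbol{\rho}}:=\sum_i\int_\Omega|u_i|^2d\rho_i+\frac12\sum_{i,j}\int_\Omega|v_{ij}|^2\theta(\frac{d\rho_i}{d\bar\rho},\frac{d\rho_j}{d\bar\rho})q_{ij}\,d\bar\rho$ and $W^2_{\Omega\times\mathcal{G}}(\boldsymbol{\mu},\boldsymbol{\nu}):=\inf\{\int_0^1\|(\mathbf{u}_t,\boldsymbol{v}_t)\|^2_{\boldsymbol{\rho}_t}dt:(\boldsymbol{\rho},\mathbf{u},\boldsymbol{v})\in\mathcal{C}(\boldsymbol{\mu},\boldsymbol{\nu})\}$. *)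

(* Defs.v *)
From HB Require Import structures.
From mathcomp Require Import all_boot all_order all_algebra.
From mathcomp Require Import all_classical all_reals all_analysis.

Set Implicit Arguments.
Unset Strict Implicit.
Unset Printing Implicit Defensive.

Import Order.TTheory GRing.Theory Num.Theory.
Import numFieldNormedType.Exports.

Local Open Scope classical_set_scope.
Local Open Scope ring_scope.

Section Euclidean.
Context (R : realType) (d : nat).

(* R^d with its Borel sigma-algebra. The library norm on row vectors is the sup
   norm, which induces the usual topology but is not the |.| of the energy. *)
Definition euclid : Type := g_sigma_algebraType (@open 'rV[R]_d).

HB.instance Definition _ := Measurable.on euclid.
HB.instance Definition _ := Pointed.on euclid.

Definition dotr (x y : 'rV[R]_d) : R := \sum_(k < d) x 0 k * y 0 k.
Definition enorm (x : 'rV[R]_d) : R := Num.sqrt (dotr x x).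

End Euclidean.

(* C^k on an open subset U of a finite-dimensional space. *)
Fixpoint Ck_on (R : realType) (V : normedModType R) (k : nat) (U : set V)
    (f : V -> R^o) : Prop :=
  match k with
  | 0 => forall x, U x -> {for x, continuous f}
  | k'.+1 => (forall x, U x -> differentiable f x) /\
             (forall v, Ck_on k' U ('D_v f))
  end.

Definition smooth_on (R : realType) (V : normedModType R) (U : set V)
    (f : V -> R^o) : Prop := forall k, Ck_on k U f.

Definition weight_symmetric (R : realType) (n : nat) (q : 'I_n -> 'I_n -> R) :
  Prop := forall i j, q i j = q j i.

Definition weight_connected (R : realType) (n : nat) (q : 'I_n -> 'I_n -> R) :
  Prop := forall i j, connect (fun a b => 0 < q a b) i j.

Section Interpolation.
Context (R : realType).

Definition quadrant : set (R^o * R^o) := [set p | 0 <= p.1 /\ 0 <= p.2].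
Definition open_quadrant : set (R^o * R^o) := [set p | 0 < p.1 /\ 0 < p.2].

(* The function theta : [0,oo)^2 -> [0,oo) is a total function on R^2 of which
   only the values on the closed quadrant are constrained. *)
Record interpolation (theta : R -> R -> R) : Prop := {
  interp_ge0 : forall t s, 0 <= t -> 0 <= s -> 0 <= theta t s;
  interp_cont : {within quadrant, continuous (fun p => theta p.1 p.2)};
  interp_smooth : smooth_on open_quadrant (fun p => theta p.1 p.2);
  interp_sym : forall t s, 0 <= t -> 0 <= s -> theta t s = theta s t;
  interp_gt0 : forall t s, 0 < t -> 0 < s -> 0 < theta t s;
  interp_11 : theta 1 1 = 1;
  interp_mono : forall r s t, 0 <= t -> 0 <= r -> r <= s ->
    theta r t <= theta s t;
  interp_homog : forall lambda t s, 0 < lambda -> 0 <= t -> 0 <= s ->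
    theta (lambda * t) (lambda * s) = lambda * theta t s;
  interp_concave : convex_function (E := (R^o * R^o)%type) quadrant
    (fun p => - theta p.1 p.2)
}.

End Interpolation.

Section VectorMeasures.
Context (R : realType) (d n : nat).
Let Rd : measurableType _ := euclid R d.

Definition vmeasure : Type := 'I_n -> {finite_measure set Rd -> \bar R}.

(* A measure is a function on all subsets, of which only the values on
   measurable sets are meaningful. *)
Definition vmeasure_eq (mu nu : vmeasure) : Prop :=
  forall (i : 'I_n) (A : set Rd), measurable A -> mu i A = nu i A.

Definition mbar (mu : vmeasure) (A : set Rd) : \bar R :=
  (\sum_(i < n) mu i A)%E.

Section mbar_measure.
Variable mu : vmeasure.

Let mbar0 : mbar mu set0 = 0%E.
Proof. by rewrite /mbar big1. Qed.

Let mbar_ge0 A : (0 <= mbar mu A)%E.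
Proof. by apply: sume_ge0. Qed.

Let mbar_sigma_additive : semi_sigma_additive (mbar mu).
Proof.
move=> F mF tF mUF; rewrite [X in _ --> X](_ : _ =
    lim ((fun m => (\sum_(0 <= k < m) mbar mu (F k))%E) @ \oo)).
  by apply: is_cvg_ereal_nneg_natsum => k _; exact: sume_ge0.
rewrite nneseries_sum//; apply: eq_bigr => /= i _.
exact: measure_semi_bigcup.
Qed.

HB.instance Definition _ := isMeasure.Build _ _ _ (mbar mu)
  mbar0 mbar_ge0 mbar_sigma_additive.

Let mbar_fin : fin_num_fun (mbar mu).
Proof.
by move=> A mA; rewrite /mbar sum_fin_num; apply/allP => x /mapP[i _ ->];
  exact: fin_num_measure.
Qed.

HB.instance Definition _ := Measure_isFinite.Build _ _ _ (mbar mu) mbar_fin.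

End mbar_measure.

(* The derivative of mu_i with respect to the sum of the mu_j, in the library's
   pointwise nonnegative version. *)
Definition density (mu : vmeasure) (i : 'I_n) (x : Rd) : R :=
  fine (Radon_Nikodym_SigmaFinite.f (mu i) (mbar mu) x).

Definition theta_density (theta : R -> R -> R) (mu : vmeasure) (i j : 'I_n)
    (x : Rd) : R :=
  theta (density mu i x) (density mu j x).

(* Measures on Omega are identified with their extensions by zero to R^d. *)
Definition vprob (Omega : set Rd) : set vmeasure :=
  [set mu | (forall i, mu i (~` Omega) = 0%E) /\
            (\sum_(i < n) mu i Omega = 1)%E].

Definition vprob2 (Omega : set Rd) : set vmeasure :=
  [set mu | vprob Omega mu /\
    forall i, (\int[mu i]_(x in Omega) (enorm x ^+ 2)%:E < +oo)%E].

Definition narrow_cvg (Omega : set Rd) (F : set_system R) (rho : R -> vmeasure)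
    (mu : vmeasure) : Prop :=
  forall (i : 'I_n) (phi : 'rV[R]_d -> R),
    {within Omega : set 'rV[R]_d, continuous phi} ->
    (exists M, forall x, Omega x -> `|phi x| <= M) ->
    \int[rho t i]_(x in Omega) phi x @[t --> F] -->
    \int[mu i]_(x in Omega) phi x.

Definition curve_vprob (Omega : set Rd) (t0 t1 : R) (rho : R -> vmeasure) :
  Prop :=
  forall t, t \in `[t0, t1] ->
    vprob Omega (rho t) /\
    narrow_cvg Omega (within [set` `[t0, t1]] (nbhs t)) rho (rho t).

End VectorMeasures.

Section ContinuityEquation.
Context (R : realType) (d n : nat).
Let Rd : measurableType _ := euclid R d.
Let leb := @lebesgue_measure R.

Definition test_function (t0 t1 : R) (eta : 'rV[R]_d * R^o -> R^o) : Prop :=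
  [/\ smooth_on setT eta,
      compact (closure [set p | eta p != 0]) &
      closure [set p | eta p != 0] `<=` [set p | t0 < p.2 < t1]].

Definition time_derivative (eta : 'rV[R]_d * R^o -> R^o) (p : 'rV[R]_d * R^o) :
  R := 'D_((0, 1) : 'rV[R]_d * R^o) eta p.

Definition space_gradient (eta : 'rV[R]_d * R^o -> R^o) (p : 'rV[R]_d * R^o) :
  'rV[R]_d :=
  \row_k 'D_((delta_mx 0 k, 0) : 'rV[R]_d * R^o) eta p.

Definition velocity : Type := 'I_n -> Rd -> R -> Rd.
Definition edge_velocity : Type := 'I_n -> 'I_n -> Rd -> R -> R.

Record continuity_equation (Omega : set Rd) (q : 'I_n -> 'I_n -> R)
    (theta : R -> R -> R) (t0 t1 : R)
    (rho : R -> vmeasure R d n) (u : velocity) (v : edge_velocity) : Prop := {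
  ce_curve : curve_vprob Omega t0 t1 rho;
  ce_u_measurable : forall i,
    measurable_fun (setT `*` [set` `[t0, t1]])
      (fun p : Rd * measurableTypeR R => u i p.1 p.2);
  ce_u_integrable : forall i,
    (\int[leb]_(t in [set` `[t0, t1]])
       \int[rho t i]_(x in Omega) (enorm (u i x t))%:E < +oo)%E;
  ce_v_measurable : forall i j,
    measurable_fun (setT `*` [set` `[t0, t1]])
      (fun p : Rd * measurableTypeR R => v i j p.1 p.2);
  ce_v_integrable : forall i j,
    (\int[leb]_(t in [set` `[t0, t1]])
       \int[mbar (rho t)]_(x in Omega)
         (`|v i j x t| * theta_density theta (rho t) i j x)%:E < +oo)%E;
  ce_weak : forall eta, test_function t0 t1 eta -> forall i,
    \int[leb]_(t in [set` `[t0, t1]])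
      (\int[rho t i]_x time_derivative eta (x, t)) =
    - (\int[leb]_(t in [set` `[t0, t1]])
         (\int[rho t i]_x dotr (space_gradient eta (x, t)) (u i x t)))
    - 2^-1 * \sum_(j < n)
        \int[leb]_(t in [set` `[t0, t1]])
          (\int[mbar (rho t)]_x
             (eta (x, t) * theta_density theta (rho t) i j x
              * (v i j x t - v j i x t) * q i j))
}.

Definition connecting (Omega : set Rd) (q : 'I_n -> 'I_n -> R)
    (theta : R -> R -> R) (mu nu : vmeasure R d n)
    (rho : R -> vmeasure R d n) (u : velocity) (v : edge_velocity) : Prop :=
  [/\ continuity_equation Omega q theta 0 1 rho u v,
      vmeasure_eq (rho 0) mu & vmeasure_eq (rho 1) nu].

Definition sqnorm (Omega : set Rd) (q : 'I_n -> 'I_n -> R)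
    (theta : R -> R -> R) (rho : vmeasure R d n)
    (u : 'I_n -> Rd -> Rd) (v : 'I_n -> 'I_n -> Rd -> R) : \bar R :=
  (\sum_(i < n) \int[rho i]_(x in Omega) (enorm (u i x) ^+ 2)%:E
   + (2^-1)%:E * \sum_(i < n) \sum_(j < n)
       \int[mbar rho]_(x in Omega)
         (`|v i j x| ^+ 2 * theta_density theta rho i j x * q i j)%:E)%E.

Definition action (Omega : set Rd) (q : 'I_n -> 'I_n -> R)
    (theta : R -> R -> R) (rho : R -> vmeasure R d n) (u : velocity)
    (v : edge_velocity) : \bar R :=
  (\int[leb]_(t in [set` `[0, 1]%R])
     sqnorm Omega q theta (rho t) (fun i x => u i x t)
       (fun i j x => v i j x t))%E.

Definition W2 (Omega : set Rd) (q : 'I_n -> 'I_n -> R) (theta : R -> R -> R)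
    (mu nu : vmeasure R d n) : \bar R :=
  ereal_inf [set a | exists rho u v,
    connecting Omega q theta mu nu rho u v /\
    a = action Omega q theta rho u v].

Definition W (Omega : set Rd) (q : 'I_n -> 'I_n -> R) (theta : R -> R -> R)
    (mu nu : vmeasure R d n) : \bar R := sqrte (W2 Omega q theta mu nu).

End ContinuityEquation.

(* D is a (finite) metric on the subset P of T, where points of T are compared
   up to the relation E. *)
Definition is_metric_on (R : realType) (T : Type) (E : T -> T -> Prop)
    (P : set T) (D : T -> T -> \bar R) : Prop :=
  [/\ forall x y, P x -> P y -> (0 <= D x y < +oo)%E,
      forall x y, P x -> P y -> (D x y = 0%E <-> E x y),
      forall x y, P x -> P y -> D x y = D y x &
      forall x y z, P x -> P y -> P z -> (D x z <= D x y + D y z)%E].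

(* Main.v *)
(* Densities and velocities are transported to measures on space-time, where the
   continuity equation pairs test functions with the momenta [Y w], [w] being either a
   density or [theta] of two densities. Along a minimizing sequence (an ultrafilter finer
   than it) the curves converge narrowly by tightness and equicontinuity, and the momenta
   converge as linear functionals on test functions. As [theta] is concave and
   1-homogeneous it is an infimum of linear functions, so the mobilities [w] are upper
   semicontinuous along the sequence; a Riesz argument in [L^2] then writes the limit
   functionals as [Y w], with action at most the limit of the actions.

   Reversing and gluing curves give symmetry and the triangle inequality, and a minimizer of
   zero action is constant in time. The distance is finite because every measure with second
   moments can be contracted to a point of the convex set [Omega], where the masses can be
   made uniform by a flow along the edges of the connected graph. *)

Require Import Defs.
From HB Require Import structures.
From mathcomp Require Import all_boot all_order all_algebra.
From mathcomp Require Import all_classical all_reals all_analysis.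
From mathcomp Require Import measurable_realfun ring lra zify.

Set Implicit Arguments.
Unset Strict Implicit.
Unset Printing Implicit Defensive.

Import Order.TTheory GRing.Theory Num.Theory.
Import numFieldNormedType.Exports.

Local Open Scope classical_set_scope.
Local Open Scope ring_scope.

(** * Smooth functions *)

(** Densities [f] and momenta [Y w] pass to weak limits, the velocities [Y] do not, and [theta] of
    the densities is only upper semicontinuous. This suffices because the action enters through
    [2 M(z) - int z^2 w <= int Y^2 w] for every test function [z], where [M] is the momentum: the
    mobility [w] stands there with a minus sign, so an upper bound on its limit is the right one,
    and the supremum over [z] controls the action of the limit field. Along a fixed ultrafilter
    every bounded real sequence converges, so limits at all times and for all test functions exist
    at once and are linear, with no diagonal extraction.

    The weak equation sees only test functions that vanish near the end times. Growing time windows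
    recover boundary values on every subinterval, and this formula yields equicontinuity, tightness,
    gluing and rigidity at zero action. Mobilities may vanish when one of two nodes is empty, so the
    exchange of mass at a point has to start slowly. *)

Section Smooth.
Context (R : realType).
Implicit Types V W : normedModType R.

Lemma Ck_onS V k (f : V -> R^o) : Ck_on k.+1 setT f -> Ck_on k setT f.
Proof.
elim: k f => [|k IH] f [df Df].
  by move=> x _; apply: differentiable_continuous; exact: df.
by split=> // v; apply: IH; exact: Df.
Qed.

Lemma Ck_on_cst V k (c : R^o) : Ck_on k setT (cst c : V -> R^o).
Proof.
elim: k c => [|k IH] c /=; first by move=> x _; exact: cst_continuous.
split=> [x _|v]; first exact: differentiable_cst.
rewrite (_ : 'D_v (cst c) = cst 0); first exact: IH.
by apply/funext => x; rewrite derive_cst.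
Qed.

Lemma Ck_onD V k (f g : V -> R^o) :
  Ck_on k setT f -> Ck_on k setT g -> Ck_on k setT (fun x => f x + g x).
Proof.
elim: k f g => [|k IH] f g /=.
  by move=> cf cg x _; apply: continuousD; [exact: cf|exact: cg].
move=> [df Df] [dg Dg]; split=> [x _|v].
  by apply: differentiableD; [exact: df|exact: dg].
rewrite (_ : 'D_v _ = fun x => 'D_v f x + 'D_v g x).
  exact: IH (Df v) (Dg v).
by apply/funext => x; rewrite deriveD//; apply: diff_derivable; [exact: df|exact: dg].
Qed.

Lemma Ck_onM V k (f g : V -> R^o) :
  Ck_on k setT f -> Ck_on k setT g -> Ck_on k setT (fun x => f x * g x : R^o).
Proof.
elim: k f g => [|k IH] f g.
  by move=> cf cg x _; apply: (@continuousM R); [exact: cf|exact: cg].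
move=> Cf Cg; have [df Df] := Cf; have [dg Dg] := Cg.
have df' x v : derivable f x v by apply: diff_derivable; exact: df.
have dg' x v : derivable g x v by apply: diff_derivable; exact: dg.
split=> [x _|v].
  by apply: (@differentiableM _ _ f g); [exact: df|exact: dg].
rewrite (_ : 'D_v _ = fun x => f x * 'D_v g x + g x * 'D_v f x).
  by apply: Ck_onD; apply: IH;
    [exact: Ck_onS Cf|exact: Dg|exact: Ck_onS Cg|exact: Df].
by apply/funext => x; rewrite (deriveM (df' x v) (dg' x v)).
Qed.

Lemma Ck_onV V k (f : V -> R^o) : (forall x, f x != 0) ->
  Ck_on k setT f -> Ck_on k setT (fun x => (f x)^-1 : R^o).
Proof.
move=> f0; elim: k => [|k IH].
  by move=> cf x _; apply: (@continuousV R) => //; exact: cf.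
move=> Cf; have [df Df] := Cf.
have df' x v : derivable f x v by apply: diff_derivable; exact: df.
split=> [x _|v].
  by apply: (@differentiableV _ _ f) => //; exact: df.
have IHf := IH (Ck_onS Cf).
rewrite (_ : 'D_v _ = fun x => (- 1) * (((f x)^-1 * (f x)^-1) * 'D_v f x)).
  apply: Ck_onM; first exact: Ck_on_cst.
  by apply: Ck_onM; [exact: Ck_onM|exact: Df].
apply/funext => x; rewrite (deriveV (f0 x) (df' x v)).
by rewrite mulN1r expr2 invfM scaleNr.
Qed.

Section Affine.
Context V W (L A : W -> V).
Hypothesis AL : forall w h (r : R), A (r *: h + w) = r *: L h + A w.
Hypothesis dA : forall w, differentiable A w.

(** [L] is the linear part of [A], so the difference quotients of [f \o A] along [v] are literally
    those of [f] along [L v]. The result is an identity of functions, which the induction on the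
    order of differentiability can iterate. *)
Lemma derive_affine (f : V -> R^o) v :
  'D_v (f \o A) = ('D_(L v) f) \o A.
Proof.
apply/funext => w; rewrite /derive /comp /shift /=.
suff -> : (fun h : R => h^-1 *: (f (A (h *: v + w)) - f (A w))) =
  (fun h : R => h^-1 *: (f (h *: L v + A w) - f (A w))) by [].
by apply/funext => h; rewrite AL.
Qed.

Lemma Ck_on_affine k (f : V -> R^o) :
  Ck_on k setT f -> Ck_on k setT (f \o A).
Proof.
elim: k f => [|k IH] f.
  move=> cf x _; apply: continuous_comp; last exact: cf.
  exact: differentiable_continuous.
move=> [df Df]; split=> [x _|v].
  exact: (differentiable_comp (dA x) (df (A x) I)).
by rewrite derive_affine; exact: IH (Df _).
Qed.

End Affine.

Definition smooth V (f : V -> R^o) := smooth_on setT f.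

Lemma smooth_differentiable V (f : V -> R^o) x : smooth f -> differentiable f x.
Proof. by move=> /(_ 1%N)[+ _]; exact. Qed.

Lemma smooth_derivable V (f : V -> R^o) x v : smooth f -> derivable f x v.
Proof. by move=> sf; exact/diff_derivable/smooth_differentiable. Qed.

Lemma smooth_continuous V (f : V -> R^o) : smooth f -> continuous f.
Proof. by move=> /(_ 0%N) /= + x; exact. Qed.

Lemma smooth_derive V (f : V -> R^o) v : smooth f -> smooth ('D_v f).
Proof. by move=> sf k; have [_] := sf k.+1; exact. Qed.

Lemma smooth_cst V (c : R) : smooth (cst c : V -> R^o).
Proof. by move=> k; exact: Ck_on_cst. Qed.

Lemma smoothD V (f g : V -> R^o) : smooth f -> smooth g ->
  smooth (fun x => f x + g x).
Proof. by move=> sf sg k; exact: Ck_onD. Qed.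

Lemma smoothM V (f g : V -> R^o) : smooth f -> smooth g ->
  smooth (fun x => f x * g x : R^o).
Proof. by move=> sf sg k; exact: Ck_onM. Qed.

Lemma smoothV V (f : V -> R^o) : (forall x, f x != 0) -> smooth f ->
  smooth (fun x => (f x)^-1 : R^o).
Proof. by move=> f0 sf k; exact: Ck_onV. Qed.

Lemma smooth_onem V (f : V -> R^o) : smooth f -> smooth (fun x => 1 - f x : R^o).
Proof.
move=> sf; rewrite (_ : (fun _ => _) = (fun x => 1 + (- 1) * f x : R^o)).
  by apply: smoothD; [|apply: smoothM => //]; exact: smooth_cst.
by apply/funext => x; rewrite mulN1r.
Qed.

Lemma smooth_prod V (I : Type) (s : seq I) (f : I -> V -> R^o) :
  (forall i, smooth (f i)) -> smooth (fun x => \prod_(i <- s) f i x : R^o).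
Proof.
move=> sf; elim: s => [|a s IH].
  rewrite (_ : (fun _ => _) = cst 1); first exact: smooth_cst.
  by apply/funext => x; rewrite big_nil.
rewrite (_ : (fun _ => _) = fun x => f a x * \prod_(i <- s) f i x).
  exact: smoothM.
by apply/funext => x; rewrite big_cons.
Qed.

End Smooth.

(** * Flat functions and the smooth transition from 0 to 1 *)

Section Bump.
Context (R : realType).

(* The derivative of [x |-> p(1/x) exp(-1/x)] has the same shape, with
   [X^2 (p - p')] instead of [p]. *)
Definition flat (p : {poly R}) (x : R) : R :=
  if 0 < x then p.[x^-1] * expR (- x^-1) else 0.

(** Each monomial is at most a factorial times the exponential, by the term of the same degree in
    the exponential series, and a polynomial is a finite sum of monomials. *)
Lemma poly_le_expR (p : {poly R}) :
  exists C, forall y, 0 <= y -> `|p.[y]| <= C * expR y.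
Proof.
elim/poly_ind: p => [|p c [C HC]].
  by exists 0 => y _; rewrite horner0 normr0 mul0r.
have [C' HC'] : exists C', forall y, 0 <= y -> `|(p * 'X).[y]| <= C' * expR y.
  have E n : exists C', forall y : R, 0 <= y -> y ^+ n <= C' * expR y.
    case: n => [|n].
      by exists 1 => y y0; rewrite expr0 mul1r -expR0 ler_expR.
    exists (n.+1)`!%:R => y y0.
    have := expR_ge1Dxn n y0; have f0 : (0 : R) < (n.+1)`!%:R by rewrite ltr0n fact_gt0.
    rewrite -ler_pdivrMl// mulrC => /(le_trans _) -> //.
    by rewrite lerDr.
  have [D HD] := choice E.
  exists (\sum_(i < size (p * 'X)) `|(p * 'X)`_i| * D i) => y y0.
  rewrite horner_coef (le_trans (ler_norm_sum _ _ _))// mulr_suml ler_sum// => i _.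
  rewrite normrM -mulrA ler_wpM2l// ger0_norm ?exprn_ge0//; exact: HD.
exists (C' + `|c|) => y y0; rewrite hornerD hornerC (le_trans (ler_normD _ _))//.
rewrite mulrDl lerD ?HC'// ler_peMr// -expR0 ler_expR//.
Qed.

(** At [y = x^-1] the factor [y ^+ 2] is absorbed into the polynomial [p * 'X^2], which the
    exponential still dominates. The quadratic order is what makes the derivative at the origin
    vanish. *)
Lemma flat_le (p : {poly R}) : exists C, forall x, `|flat p x| <= C * `|x| ^+ 2.
Proof.
have [C HC] := poly_le_expR (p * 'X^2); exists C => x.
have C0 : 0 <= C by have := HC 0 (lexx _); rewrite expR0 mulr1; apply: le_trans.
rewrite /flat; case: ifPn => x0; last by rewrite normr0 mulr_ge0 ?exprn_ge0.
have y0 : 0 < x^-1 by rewrite invr_gt0.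
have := HC _ (ltW y0); rewrite hornerM hornerXn normrM expRN.
rewrite (ger0_norm (exprn_ge0 _ (ltW y0))) => h.
rewrite normrM normfV (gtr0_norm (expR_gt0 _)) (gtr0_norm x0).
rewrite ler_pdivrMr ?expR_gt0// -[leLHS]mulr1 -(@divff _ (x ^+ 2)) ?expf_neq0 ?gt_eqF//.
rewrite [x ^+ 2 / _]mulrC mulrA -exprVn [leRHS]mulrAC.
by apply: ler_wpM2r => //; exact/exprn_ge0/ltW.
Qed.

Lemma is_derive_flat (p : {poly R}) (x : R) :
  is_derive x 1 (flat p) (flat ('X^2 * (p - p^`())) x).
Proof.
have [x0|x0|<-] := ltgtP 0 x.
- have near_x : \forall y \near x, p.[y^-1] * expR (- y^-1) = flat p y.
    near=> y; rewrite /flat ifT//; near: y; exact: lt_nbhsr.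
  have ip : is_derive (x^-1) 1 (horner p) (p^`()).[x^-1].
    by have := derivableP (@derivable_horner R p x^-1); rewrite -derive1E -derivE.
  have nx0 : (id x : R) != 0 by rewrite gt_eqF.
  have iV : is_derive x 1 (fun y : R => y^-1) (- (x ^- 2)).
    have := @is_deriveV _ id x 1 1 nx0 (is_derive_id x 1).
    by rewrite /GRing.scale /= mulr1.
  have iN : is_derive x 1 (fun y : R => - y^-1) (x ^- 2).
    by rewrite -[X in is_derive _ _ _ X]opprK; exact: is_deriveN.
  have ie := is_derive_expR (- x^-1).
  have i1 := is_derive1_comp ip iV.
  have i2 := @is_derive1_comp _ (@expR R) (fun y : R => - y^-1) _ _ _ ie iN.
  have i12 := is_deriveM i1 i2.
  apply: (near_eq_is_derive near_x).
  apply: is_derive_eq i12 _; rewrite /= /flat x0 hornerM hornerD hornerN hornerXn exprVn.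
  by rewrite /GRing.scale /=; ring.
- have -> : flat ('X^2 * (p - p^`())) x = 0 by rewrite /flat ltNge (ltW x0).
  have i0 : is_derive x 1 (cst 0 : R -> R) 0 by exact: is_derive_cst.
  apply: near_eq_is_derive i0.
  near=> y; rewrite /flat /= ifF//; apply/negbTE; rewrite -leNgt; apply: ltW.
  by near: y; exact: lt_nbhsl.
- have -> : flat ('X^2 * (p - p^`())) 0 = 0 by rewrite /flat ltxx.
  have [C HC] := flat_le p.
  (* At the junction the difference quotient is at most [C * |h|] by the quadratic bound. *)
  have lim0 : h^-1 *: ((flat p \o shift 0) (h *: 1) - flat p 0) @[h --> (0 : R)^'] --> (0 : R).
    apply/cvgr0Pnorm_lt => e e0.
    have D0 : 0 < `|C| + 1 by rewrite ltr_wpDl.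
    near=> h.
    have h0 : h != 0 by near: h; exact: nbhs_dnbhs_neq.
    rewrite {2}/flat ltxx subr0 /= addr0 /GRing.scale /= mulr1.
    rewrite normrM normfV ltr_pdivrMl ?normr_gt0//.
    apply: (le_lt_trans (HC h)); rewrite expr2 mulrA mulrC ltr_pM2l ?normr_gt0//.
    rewrite (@le_lt_trans _ _ ((`|C| + 1) * `|h|))//.
      by rewrite ler_wpM2r// (le_trans (ler_norm _))// lerDl.
    rewrite mulrC -ltr_pdivlMr//; near: h.
    apply: dnbhs0_lt; exact: divr_gt0.
  by split; [apply/cvg_ex; exists 0|exact/cvg_lim].
Unshelve. all: by end_near. Qed.

(** The family of all [flat p] is closed under differentiation, so the induction on the order runs
    over every [p] at once. *)
Lemma smooth_flat (p : {poly R}) : smooth (flat p : R^o -> R^o).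
Proof.
move=> k; elim: k p => [|k IH] p.
  move=> x _; apply: differentiable_continuous; apply/derivable1_diffP.
  by have [] := is_derive_flat p x.
have dp (x : R^o) : differentiable (flat p : R^o -> R^o) x.
  by apply/derivable1_diffP; have [] := is_derive_flat p x.
split=> [x _|v]; first exact: dp.
rewrite (_ : 'D_v _ = fun x => v * flat ('X^2 * (p - p^`())) x).
  by apply: Ck_onM; [exact: Ck_on_cst|exact: IH].
apply/funext => x; rewrite deriveE//.
have [di Di] := is_derive_flat p x.
rewrite -[in LHS](mulr1 v) -/(v *: (1 : R^o)) linearZ /= -deriveE// Di.
by rewrite /GRing.scale.
Qed.

(** The standard smooth transition function: 0 left of 0, 1 right of 1. The denominator is positive
    because [x] and [1 - x] cannot both be nonpositive. *)
Definition step (x : R^o) : R^o := flat 1 x / (flat 1 x + flat 1 (1 - x)).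

Lemma flat1E x : flat 1 x = if 0 < x then expR (- x^-1) else 0.
Proof. by rewrite /flat; case: ifP => // _; rewrite hornerC mul1r. Qed.

Lemma flat1_ge0 x : 0 <= flat 1 x.
Proof. by rewrite flat1E; case: ifP => // _; exact: expR_ge0. Qed.

Lemma flat1_gt0 x : 0 < x -> 0 < flat 1 x.
Proof. by move=> x0; rewrite flat1E x0 expR_gt0. Qed.

Lemma step_den_gt0 (x : R) : 0 < flat 1 x + flat 1 (1 - x).
Proof.
have [x0|x0] := ltP 0 x; first by rewrite ltr_pwDl ?flat1_gt0 ?flat1_ge0.
by rewrite ltr_pwDr ?flat1_ge0// flat1_gt0// subr_gt0 (le_lt_trans x0).
Qed.

Lemma smooth_step : smooth step.
Proof.
apply: smoothM; first exact: smooth_flat.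
apply: smoothV; first by move=> x; rewrite gt_eqF// step_den_gt0.
apply: smoothD; first exact: smooth_flat.
move=> k; apply: (@Ck_on_affine _ _ _ (fun x => - x) (fun x : R^o => 1 - x : R^o)).
- by move=> w h r; rewrite scalerN opprD addrCA.
- by move=> w; apply: differentiableB => //; exact: differentiable_cst.
- exact: smooth_flat.
Qed.

Lemma step_ge0 x : 0 <= step x.
Proof. by rewrite /step divr_ge0 ?flat1_ge0// ltW// step_den_gt0. Qed.

Lemma step_le1 x : step x <= 1.
Proof. by rewrite /step ler_pdivrMr ?step_den_gt0// mul1r lerDl flat1_ge0. Qed.

Lemma step_eq0 x : x <= 0 -> step x = 0.
Proof. by move=> x0; rewrite /step flat1E ltNge x0 mul0r. Qed.

Lemma step_eq1 x : 1 <= x -> step x = 1.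
Proof.
move=> x1; rewrite /step (_ : flat 1 (1 - x) = 0) ?addr0 ?divff//.
  by rewrite gt_eqF// flat1_gt0// (lt_le_trans ltr01).
by rewrite flat1E ltNge subr_le0 x1.
Qed.

End Bump.

(** * Test functions on space-time *)

Section TestFunctions.
Context (R : realType) (d : nat).
Local Notation E := ('rV[R]_d).
Local Notation ST := (E * R^o)%type.

Lemma rV_norm_le (x : E) (M : R) : 0 <= M -> (forall k, `|x 0 k| <= M) -> `|x| <= M.
Proof.
move=> M0 xM; rewrite [leLHS]/Num.norm /= mx_normrE; apply/bigmax_leP; split=> //.
by move=> -[i j] _ /=; rewrite (ord1 i).
Qed.

Lemma rV_norm_ge (x : E) k : `|x 0 k| <= `|x|.
Proof.
rewrite [leRHS]/Num.norm /= mx_normrE.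
by apply/bigmax_geP; right => /=; exists (0, k).
Qed.

Lemma continuous_fst : continuous (fst : ST -> E).
Proof. by move=> p; exact: cvg_fst. Qed.

Lemma continuous_snd : continuous (snd : ST -> R^o).
Proof. by move=> p; exact: cvg_snd. Qed.

Lemma differentiable_fst p : differentiable (fst : ST -> E) p.
Proof. by apply: (@linear_differentiable _ _ _ fst); exact: continuous_fst. Qed.

Lemma differentiable_snd p : differentiable (snd : ST -> R^o) p.
Proof. by apply: (@linear_differentiable _ _ _ snd); exact: continuous_snd. Qed.

(** Compact support is expressed by vanishing outside a ball. In contrast to [test_function],
    nothing is asked at the end times, so that values at times 0 and 1 can be tested. *)
Definition tfun (eta : ST -> R^o) :=
  smooth eta /\ exists M, forall p, M < `|p| -> eta p = 0.

Lemma tfun_smooth eta : tfun eta -> smooth eta.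
Proof. by case. Qed.

Lemma tfun_continuous eta : tfun eta -> continuous eta.
Proof. by move=> /tfun_smooth /smooth_continuous. Qed.

Lemma tfunM f g : smooth f -> tfun g -> tfun (fun p => f p * g p).
Proof.
move=> sf [sg [M gM]]; split; first exact: smoothM.
by exists M => p /gM ->; rewrite mulr0.
Qed.

Lemma tfunMr f g : tfun f -> smooth g -> tfun (fun p => f p * g p).
Proof.
move=> tf sg; rewrite (_ : (fun _ => _) = fun p => g p * f p); first exact: tfunM.
by apply/funext => p; rewrite mulrC.
Qed.

Lemma tfunD f g : tfun f -> tfun g -> tfun (fun p => f p + g p).
Proof.
move=> [sf [M fM]] [sg [N gN]]; split; first exact: smoothD.
exists (Num.max M N) => p; rewrite gt_max => /andP[/fM -> /gN ->].
by rewrite addr0.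
Qed.

Lemma tfunZ (c : R) f : tfun f -> tfun (fun p => c * f p).
Proof. by move=> tf; apply: tfunM => //; exact: smooth_cst. Qed.

Lemma tfun_cst0 : tfun (cst 0).
Proof. by split; [exact: smooth_cst|exists 0]. Qed.

Lemma tfun_derive f v : tfun f -> tfun ('D_v f).
Proof.
move=> [sf [M fM]]; split; first exact: smooth_derive.
exists M => p Mp.
have nearp : \forall q \near p, cst 0 q = f q.
  have : \forall q \near p, M < `|q|.
    exact: (cvgr_gt _ (@norm_continuous _ _ p) _ Mp).
  by apply: filterS => q /fM ->.
have i0 : is_derive p v (cst 0 : ST -> R^o) 0 by exact: is_derive_cst.
by have [_ ->] := near_eq_is_derive nearp i0.
Qed.

Lemma closed_norm_le (V : normedModType R) (M : R) : closed [set p : V | `|p| <= M].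
Proof.
apply: (@preimage_closed _ _ (fun p : V => `|p|) [set s | s <= M]) => //.
by move=> p _; exact: norm_continuous.
Qed.

Lemma compact_ball_ST (M : R) : compact [set p : ST | `|p| <= M].
Proof.
have -> : [set p : ST | `|p| <= M] =
    [set x : E | `|x| <= M] `*` [set t : R^o | `|t| <= M].
  apply/seteqP; split=> -[x t]; rewrite /setX/= prod_normE /= ge_max.
    by move/andP.
  by move=> [-> ->].
apply: compact_setX.
  apply: bounded_closed_compact; last exact: closed_norm_le.
  exists M; split=> [|N MN x /= xM]; first exact: num_real.
  by rewrite (le_trans xM)// ltW.
have [M0|M0] := ltP M 0.
  rewrite (_ : [set _ | _] = set0); first exact: compact0.
  by apply/seteqP; split=> // t /= /le_lt_trans /(_ M0); rewrite ltNge normr_ge0.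
rewrite (_ : [set _ | _] = `[- M, M]%classic); first exact: segment_compact.
by apply/seteqP; split=> t /=; rewrite in_itv /= ler_norml.
Qed.

Lemma tfun_bounded f : tfun f -> exists C, 0 <= C /\ forall p, `|f p| <= C.
Proof.
move=> tf; have [sf [M fM]] := tf.
have cf := tfun_continuous tf.
have : compact (f @` [set p : ST | `|p| <= M]).
  apply: continuous_compact; last exact: compact_ball_ST.
  exact: continuous_subspaceT.
move=> /compact_bounded[C [Cr HC]].
exists (`|C| + 1); split=> [|p]; first by rewrite addr_ge0.
have [pM|/fM ->] := leP `|p| M; last by rewrite normr0 addr_ge0.
apply: (HC (`|C| + 1)); last by exists p.
by rewrite (le_lt_trans (ler_norm _))// ltrDl.
Qed.

Lemma test_function_tfun (t0 t1 : R) eta : test_function t0 t1 eta -> tfun eta.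
Proof.
move=> [se /compact_bounded[M [_ HM]] _]; split=> //; exists (M + 1) => p.
apply: contraPP => /eqP ep0; apply/negP; rewrite -leNgt.
by apply: HM; [rewrite ltrDl|apply: subset_closure].
Qed.

Lemma test_function_eq0 (t0 t1 : R) eta (p : ST) : test_function t0 t1 eta ->
  ~ (t0 < p.2 < t1) -> eta p = 0.
Proof.
move=> [_ _ sub] pt; apply: contra_notP pt => /eqP ep0.
by apply: sub; apply: subset_closure.
Qed.

Lemma tfun_test_function (t0 t1 a b : R) eta : tfun eta -> t0 < a -> b < t1 ->
  (forall p, eta p != 0 -> a <= p.2 <= b) -> test_function t0 t1 eta.
Proof.
move=> [se [M eM]] t0a bt1 eab.
have csub : closure [set p | eta p != 0] `<=` [set p : ST | `|p| <= M].
  rewrite [X in _ `<=` X](closure_id _).1; last exact: closed_norm_le.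
  apply: closure_subset => p /=; apply: contraNT; rewrite -ltNge.
  by move=> /eM ->.
split=> //.
- apply: subclosed_compact csub; [exact: closed_closure|exact: compact_ball_ST].
- apply: (@subset_trans _ [set p : ST | a <= p.2 <= b]); last first.
    by move=> p /= /andP[/(lt_le_trans t0a) -> /le_lt_trans ->].
  rewrite [X in _ `<=` X](closure_id _).1; first exact: closure_subset.
  rewrite (_ : [set _ | _] = snd @^-1` `[a, b]%classic).
    apply: preimage_closed; last exact: itv_closed.
    by move=> p _; exact: continuous_snd.
  by apply/seteqP; split=> p; rewrite /= in_itv.
Qed.

End TestFunctions.

(** * Affine changes of variables and cutoffs in space *)

Section Cutoff.
Context (R : realType) (d : nat).
Local Notation E := ('rV[R]_d).
Local Notation ST := (E * R^o)%type.

Lemma smooth_coord (h : R^o -> R^o) k (a b : R) : smooth h ->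
  smooth (fun p : ST => h (a * p.1 0 k + b) : R^o).
Proof.
move=> sh m; apply: (@Ck_on_affine _ _ _ (fun p : ST => a * p.1 0 k : R^o)
  (fun p : ST => a * p.1 0 k + b : R^o)); last exact: sh.
- by move=> w v r; rewrite /= !mxE mulrDr addrA mulrCA.
- move=> w; apply: differentiableD; last exact: differentiable_cst.
  apply: (@differentiableM _ _ (cst a) (fun p : ST => p.1 0 k)) => //.
  apply: (@differentiable_comp _ _ _ _ fst (fun x : E => x 0 k)).
    exact: differentiable_fst.
  exact: differentiable_coord.
Qed.

Lemma smooth_time (h : R^o -> R^o) (a b : R) : smooth h ->
  smooth (fun p : ST => h (a * p.2 + b) : R^o).
Proof.
move=> sh m; apply: (@Ck_on_affine _ _ _ (fun p : ST => a * p.2 : R^o)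
  (fun p : ST => a * p.2 + b : R^o)); last exact: sh.
- by move=> w v r; rewrite /= mulrDr addrA mulrCA.
- move=> w; apply: differentiableD; last exact: differentiable_cst.
  apply: (@differentiableM _ _ (cst a) (fun p : ST => p.2)) => //.
  exact: differentiable_snd.
Qed.

(** Dilation in space and affine map in time; its linear part is [affine_ST r a 0]. It serves both
    for large cutoffs and for changes of the time parameter. *)
Definition affine_ST (r a b : R) (p : ST) : ST := (r *: p.1, a * p.2 + b).

Lemma affine_ST_linear r a b w v (s : R) :
  affine_ST r a b (s *: v + w) = s *: affine_ST r a 0 v + affine_ST r a b w.
Proof.
rewrite /affine_ST /=; congr pair; last first.
  by rewrite addr0 mulrDr addrA [a * _]mulrCA.
by rewrite /= scalerDr !scalerA [r * s]mulrC.
Qed.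

Lemma differentiable_affine_ST r a b w : differentiable (affine_ST r a b) w.
Proof.
apply: differentiable_pair.
  by apply: differentiableZ; exact: differentiable_fst.
apply: differentiableD; last exact: differentiable_cst.
apply: (@differentiableM _ _ (cst a) (fun p : ST => p.2)) => //.
exact: differentiable_snd.
Qed.

Lemma derive_affine_ST r a b (f : ST -> R^o) v p :
  'D_v (fun q => f (affine_ST r a b q)) p = 'D_(affine_ST r a 0 v) f (affine_ST r a b p).
Proof.
have := @derive_affine R _ _ (affine_ST r a 0) (affine_ST r a b)
  (affine_ST_linear r a b) f v.
by move=> /(congr1 (fun g => g p)).
Qed.

Lemma tfun_affine_ST r a b (f : ST -> R^o) : r != 0 -> a != 0 ->
  tfun f -> tfun (fun q => f (affine_ST r a b q)).
Proof.
move=> r0 a0 [sf [M fM]]; split.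
  move=> k; apply: (@Ck_on_affine R _ _ (affine_ST r a 0)); last exact: sf.
    exact: affine_ST_linear.
  exact: differentiable_affine_ST.
exists (Num.max (`|M| / `|r|) ((`|M| + `|b|) / `|a|)) => p.
rewrite {1}prod_normE /= lt_max !gt_max => /orP[]/andP[h1 h2]; apply: fM; rewrite prod_normE /= lt_max.
  rewrite normrZ; apply/orP; left; rewrite (le_lt_trans (ler_norm _))//.
  by rewrite mulrC -ltr_pdivrMr ?normr_gt0.
apply/orP; right; rewrite (le_lt_trans (ler_norm _))//.
rewrite ltr_pdivrMr ?normr_gt0// -normrM mulrC -ltrBrDr in h2.
by rewrite (lt_le_trans h2)// lerBlDr (le_trans _ (ler_normB _ _))// addrK.
Qed.

Definition plateau (s : R) : R := @step R (1 * s + 3) * @step R (- 1 * s + 3).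

Lemma plateau_ge0 s : 0 <= plateau s.
Proof. by rewrite mulr_ge0 ?step_ge0. Qed.

Lemma plateau_le1 s : plateau s <= 1.
Proof. by rewrite mulr_ile1 ?step_ge0 ?step_le1. Qed.

Lemma plateau_eq1 s : `|s| <= 2 -> plateau s = 1.
Proof. by rewrite ler_norml => /andP[? ?]; rewrite /plateau !step_eq1 ?mulr1; lra. Qed.

Lemma plateau_eq0 s : 3 < `|s| -> plateau s = 0.
Proof.
rewrite lter_normr => /orP[h|h]; rewrite /plateau.
  by rewrite [X in _ * X]step_eq0 ?mulr0; lra.
by rewrite step_eq0 ?mul0r; lra.
Qed.

Definition cutoff1 (p : ST) : R^o := (\prod_(k < d) plateau (p.1 0 k)) * plateau p.2.

Lemma tfun_cutoff1 : tfun cutoff1.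
Proof.
split.
  apply: smoothM; last first.
    by apply: smoothM; apply: smooth_time; exact: smooth_step.
  apply: smooth_prod => k.
  by apply: smoothM; apply: (smooth_coord k); exact: smooth_step.
exists 3 => p; rewrite prod_normE lt_max => /orP[h|h]; rewrite /cutoff1; last first.
  by rewrite plateau_eq0 ?mulr0.
have [k hk] : exists k, 3 < `|p.1 0 k|.
  apply: contrapT => /forallNP hn; move: h; apply/negP; rewrite -leNgt.
  by apply: rV_norm_le => // k; rewrite leNgt; apply/negP; exact: hn.
by rewrite (bigD1 k)//= plateau_eq0 ?mul0r.
Qed.

Lemma cutoff1_ge0 p : 0 <= cutoff1 p.
Proof. by rewrite mulr_ge0 ?plateau_ge0// prodr_ge0// => k _; exact: plateau_ge0. Qed.

Lemma cutoff1_le1 p : cutoff1 p <= 1.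
Proof.
rewrite mulr_ile1 ?plateau_ge0 ?plateau_le1//.
  by rewrite prodr_ge0// => k _; exact: plateau_ge0.
by rewrite prodr_ile1// => k _; rewrite plateau_ge0 plateau_le1.
Qed.

Lemma cutoff1_eq1 p : `|p| <= 2 -> cutoff1 p = 1.
Proof.
rewrite prod_normE ge_max => /andP[h1 h2].
rewrite /cutoff1 plateau_eq1// mulr1 big1// => k _.
by rewrite plateau_eq1// (le_trans (rV_norm_ge _ _)).
Qed.

(** Only space is dilated. The time factor is 1 on [[-2, 2]], beyond the interval [[0, 1]] of
    interest, so that for small [r] the derivatives that matter are the space derivatives, of size
    [r]. *)
Definition cutoff (r : R) (p : ST) : R^o := cutoff1 (affine_ST r 1 0 p).

Lemma tfun_cutoff r : r != 0 -> tfun (cutoff r).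
Proof. by move=> r0; apply: tfun_affine_ST => //; exact: tfun_cutoff1. Qed.

Lemma cutoff_ge0 r p : 0 <= cutoff r p. Proof. exact: cutoff1_ge0. Qed.

Lemma cutoff_le1 r p : cutoff r p <= 1. Proof. exact: cutoff1_le1. Qed.

Lemma cutoff_eq1 r p : 0 <= r -> r * `|p.1| <= 2 -> `|p.2| <= 2 -> cutoff r p = 1.
Proof.
move=> r0 h1 h2; apply: cutoff1_eq1; rewrite prod_normE /= mul1r addr0 ge_max h2 andbT.
by rewrite normrZ ger0_norm.
Qed.

Lemma cutoff_derive_space : exists C, 0 <= C /\
  forall r p k, 0 < r -> `|'D_((delta_mx 0 k, 0) : ST) (cutoff r) p| <= r * C.
Proof.
have H k : exists C, 0 <= C /\ forall p, `|'D_((delta_mx 0 k, 0) : ST) cutoff1 p| <= C.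
  exact/tfun_bounded/tfun_derive/tfun_cutoff1.
have [C HC] := choice H.
exists (\sum_(k < d) C k); split=> [|r p k r0].
  by rewrite sumr_ge0// => k _; case: (HC k).
rewrite /cutoff derive_affine_ST.
have -> : affine_ST r 1 0 ((delta_mx 0 k, 0) : ST) = r *: ((delta_mx 0 k, 0) : ST).
  by rewrite /affine_ST; congr pair; rewrite /= ?scaler0 ?mulr0 ?addr0.
have df := smooth_differentiable (affine_ST r 1 0 p) (tfun_smooth tfun_cutoff1).
rewrite deriveE// linearZ /= -deriveE// normrZ gtr0_norm// ler_pM2l//.
rewrite (le_trans (proj2 (HC k) _))// (bigD1 k)//= lerDl sumr_ge0// => j _.
by case: (HC j).
Qed.

Lemma cutoff_derive_time r p : `|p.2| < 2 -> r != 0 ->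
  'D_((0, 1) : ST) (cutoff r) p = 0.
Proof.
move=> p2 r0; rewrite /derive.
have E : \forall h \near (0 : R)^', h^-1 *: ((cutoff r \o shift p) (h *: ((0, 1) : ST)) - cutoff r p) = 0.
  have : \forall h \near (0 : R)^', `|h| < 2 - `|p.2|.
    by apply: dnbhs0_lt; rewrite subr_gt0.
  apply: filterS => h hp; rewrite (_ : _ - _ = 0) ?scaler0//.
  rewrite /cutoff /cutoff1 /affine_ST /= scaler0 add0r; apply/eqP; rewrite subr_eq0; apply/eqP.
  rewrite !mul1r !addr0 !plateau_eq1//; first exact: ltW.
  rewrite (le_trans (ler_normD _ _))//.
  have -> : h *: (1 : R^o) = h by rewrite /GRing.scale /= mulr1.
  by rewrite -lerBrDr ltW.
apply/cvg_lim => //; apply: cvg_near_cst; exact: E.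
Qed.

End Cutoff.

Section FiniteIntegral.
Context d (X : measurableType d) (R : realType).
Implicit Types (mu : {finite_measure set X -> \bar R}) (f g : X -> R).

Lemma bounded_integrable mu f C : measurable_fun setT f ->
  (forall x, `|f x| <= C) -> mu.-integrable setT (EFin \o f).
Proof.
move=> mf fC; apply: measurable_bounded_integrable => //.
  by rewrite ltey_eq fin_num_measure.
exists C; split; first exact: num_real.
by move=> M CM x _; apply: le_trans (fC x) _; exact: ltW.
Qed.

Lemma le_integrable mu f g : measurable_fun setT f ->
  (forall x, `|f x| <= `|g x|) -> mu.-integrable setT (EFin \o g) ->
  mu.-integrable setT (EFin \o f).
Proof.
move=> mf fg; apply: le_integrable => //; first exact/measurable_EFinP.
by move=> x _; rewrite /= lee_fin.
Qed.

End FiniteIntegral.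

(** * Open sets and continuous functions in the product sigma-algebra of space-time *)

Section Measurability.
Context (R : realType) (d : nat).
Local Notation E := ('rV[R]_d).
Local Notation ST := (E * R^o)%type.
Local Notation Rd := (euclid R d).
Local Notation X := (Rd * measurableTypeR R)%type.

Lemma continuous_measurable_Rd (f : E -> R) : continuous f ->
  measurable_fun setT (f : Rd -> R).
Proof.
move=> /continuousP cf; apply: (measurability (@RGenOpens.G R)); first exact: RGenOpens.measurableE.
move=> _ [_ [a [b ->]] <-]; rewrite setTI; apply: sub_sigma_algebra.
by apply: cf; exact: interval_open.
Qed.

Definition box (c : ST) (r : R) : set ST := [set p | `|p - c| < r].

Lemma boxE c r p : 0 < r -> box c r p <->
  (forall k, `|p.1 0 k - c.1 0 k| < r) /\ `|p.2 - c.2| < r.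
Proof.
move=> r0; rewrite /box/= prod_normE gt_max /=; split=> [/andP[h ->]|[h ->]].
  by split=> // k; apply: le_lt_trans h; rewrite (le_trans _ (rV_norm_ge _ k))// !mxE.
rewrite andbT.
have [k0|nk] := pselect (exists k : 'I_d, True); last first.
  rewrite (le_lt_trans _ r0)//; apply: rV_norm_le => // k; by case: nk; exists k.
have [k1 _] := k0.
case: (@arg_maxP _ _ _ k1 predT (fun k => `|(p.1 - c.1) 0 k|)) => // k _ hk.
apply: (@le_lt_trans _ _ `|(p.1 - c.1) 0 k|).
  by apply: rV_norm_le => // j; exact: hk.
by rewrite !mxE; exact: h.
Qed.

Lemma box_measurable c r : measurable (box c r : set X).
Proof.
rewrite (_ : box c r = [set x : E | `|x - c.1| < r] `*` [set t : R^o | `|t - c.2| < r]).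
  apply: measurableX.
    apply: sub_sigma_algebra.
    rewrite (_ : [set _ | _] = ball c.1 r); first exact: ball_open.
    by rewrite -ball_normE; apply/seteqP; split=> x /=; rewrite distrC.
  rewrite (_ : [set _ | _] = `]c.2 - r, c.2 + r[%classic); first exact: measurable_itv.
  by apply/seteqP; split=> t /=; rewrite in_itv /= ltr_distl.
apply/seteqP; split=> -[x t]; rewrite /box/= prod_normE /= gt_max.
  by move/andP.
by move=> [-> ->].
Qed.

Definition rbox (i : 'rV[rat]_d * rat * nat) : set ST :=
  box (map_mx ratr i.1.1, ratr i.1.2) (i.2.+1%:R^-1).

Lemma rat_approx (x e : R) : 0 < e -> exists a : rat, `|x - ratr a| < e.
Proof.
move=> e0; have [|a] := @rat_in_itvoo R (x - e) (x + e); first lra.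
rewrite in_itv /= => /andP[h1 h2]; exists a; rewrite distrC ltr_distl; lra.
Qed.

Lemma open_rbox (U : set ST) : open U ->
  U = \bigcup_(i in [set i | rbox i `<=` U]) rbox i.
Proof.
move=> oU; apply/seteqP; split=> [p Up|p [i /= iU /iU//]].
have [e /= e0 eU] : exists2 e : R, 0 < e & forall q, `|p - q| < e -> U q.
  have /nbhs_ballP[e /= e0 eU] : nbhs p U by exact: open_nbhs_nbhs.
  by exists e => // q pq; apply: eU; rewrite -ball_normE.
have [m me] : exists m : nat, m.+1%:R^-1 < e / 2.
  have e20 : 0 < e / 2 by rewrite divr_gt0.
  have := @near_infty_natSinv_lt R (PosNum e20).
  by move=> [m _ hm]; exists m; apply: hm => /=.
have m0 : (0 : R) < m.+1%:R^-1 by rewrite invr_gt0.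
have [a ha] := choice (fun k => rat_approx (p.1 0 k) m0).
have [b hb] := rat_approx p.2 m0.
pose i : 'rV[rat]_d * rat * nat := (\row_k a k, b, m).
have ip : rbox i p.
  by apply/boxE => //=; split=> // k; rewrite !mxE.
exists i => //= q iq; apply: eU; move: ip iq; rewrite /rbox /box /= => h1 h2.
rewrite -(subrKA (map_mx ratr (\row_k a k), ratr b)) (le_lt_trans (ler_normD _ _))//.
rewrite [ltRHS]splitr; apply: ltrD; first exact: lt_trans me.
by rewrite distrC; exact: lt_trans me.
Qed.

Lemma bigcup_rbox_seq (D : set ('rV[rat]_d * rat * nat)) :
  exists s : nat -> set ST, \bigcup_(i in D) rbox i = \bigcup_n s n /\
    forall n, s n = set0 \/ exists i, s n = rbox i.
Proof.
exists (fun n => if unpickle n is Some i then if i \in D then rbox i else set0 else set0).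
split; last first.
  move=> n; case: (unpickle n) => [i|]; last by left.
  by case: ifP => _; [right; exists i|left].
apply/seteqP; split=> p.
  by move=> [i Di ip]; exists (pickle i) => //; rewrite pickleK mem_set.
move=> [n _]; case: (unpickle n) => [i|//].
by case: ifPn => // /set_mem Di ip; exists i.
Qed.

(** The sigma-algebra of [X] is the product of those of space and time. An open set belongs to it
    because it is a countable union of boxes with rational centres and radii [1 / (m + 1)]. *)
Lemma open_measurable_ST (U : set ST) : open U -> measurable (U : set X).
Proof.
move=> oU; rewrite (open_rbox oU).
have [s [-> hs]] := bigcup_rbox_seq [set i | rbox i `<=` U].
apply: bigcup_measurable => n _.
by have [->|[i ->]] := hs n; [exact: measurable0|exact: box_measurable].
Qed.

Lemma continuous_measurable_ST (f : ST -> R^o) : continuous f ->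
  measurable_fun setT (f : X -> R).
Proof.
move=> /continuousP cf; apply: (measurability (@RGenOpens.G R)); first exact: RGenOpens.measurableE.
move=> _ [_ [a [b ->]] <-]; rewrite setTI; apply: open_measurable_ST.
by apply: cf; exact: interval_open.
Qed.

Lemma tfun_measurable f : tfun f -> measurable_fun setT (f : X -> R).
Proof. by move=> /tfun_continuous; exact: continuous_measurable_ST. Qed.

Lemma measurable_coord k : measurable_fun setT (fun x : Rd => (x : E) 0 k).
Proof. by apply: continuous_measurable_Rd => x; exact: coord_continuous. Qed.

Lemma measurable_to_Rd d' (Y : measurableType d') (D : set Y) (f : Y -> Rd) :
  measurable D ->
  (forall k, measurable_fun D (fun y => (f y : E) 0 k)) -> measurable_fun D f.
Proof.
move=> mD mf; apply: (@measurability _ _ Y Rd D f (@open E)) => // _ [U oU <-].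
have oUT : open (fst @^-1` U : set ST) by have /continuousP := @continuous_fst R d; exact.
(* Points are placed at time 0 so that the countable base of space-time boxes also serves for
   space. *)
rewrite (_ : f @^-1` U = (fun y => ((f y, 0) : ST)) @^-1` (fst @^-1` U))//.
rewrite (open_rbox oUT).
have [s [-> hs]] := bigcup_rbox_seq [set i | rbox i `<=` fst @^-1` U].
rewrite preimage_bigcup setI_bigcupr; apply: bigcup_measurable => n _.
have [->|[i ->]] := hs n; first by rewrite preimage_set0 setI0; exact: measurable0.
have i0 : (0 : R) < i.2.+1%:R^-1 by rewrite invr_gt0.
set c : ST := (map_mx ratr i.1.1, ratr i.1.2).
have [c2|c2] := boolP (`|0 - c.2| < i.2.+1%:R^-1); last first.
  rewrite (_ : _ `&` _ = set0); first exact: measurable0.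
  apply/seteqP; split=> // y [_] /(boxE _ _ i0)[_]; by rewrite (negbTE c2).
rewrite (_ : _ `&` _ = D `&` \bigcap_(k in [set: 'I_d])
  (D `&` (fun y => (f y : E) 0 k) @^-1` `]c.1 0 k - i.2.+1%:R^-1, c.1 0 k + i.2.+1%:R^-1[)).
  apply: measurableI => //; apply: fin_bigcap_measurable => [|k _]; first exact: finite_finset.
  by apply: mf => //; exact: measurable_itv.
apply/seteqP; split=> y [Dy].
  move=> /(boxE _ _ i0)[h _]; split=> // k _; split=> //=.
  by rewrite in_itv /= -ltr_distl; exact: h.
move=> h; split=> //; apply/boxE => //; split=> // k.
by have [_] := h k I; rewrite /= in_itv /= -ltr_distl.
Qed.

End Measurability.

Section L1.
Context d (X : measurableType d) (R : realType).
Implicit Types (mu : {finite_measure set X -> \bar R}) (f g h : X -> R).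
Local Open Scope ereal_scope.

Lemma L1_triangle mu f g h : measurable_fun setT f -> measurable_fun setT g ->
  measurable_fun setT h ->
  \int[mu]_x (`|f x - h x|%R)%:E <=
  \int[mu]_x (`|f x - g x|%R)%:E + \int[mu]_x (`|g x - h x|%R)%:E.
Proof.
move=> mf mg mh.
have mD (a b : X -> R) : measurable_fun setT a -> measurable_fun setT b ->
    measurable_fun setT (fun x => (`|a x - b x|%R)%:E).
  move=> ma mb; apply/measurable_EFinP; apply: measurableT_comp => //.
  exact: measurable_funB.
rewrite -ge0_integralD//; [|exact: (mD f g)|exact: (mD g h)].
apply: ge0_le_integral => //.
- exact: (mD f h).
- by apply: emeasurable_funD; [exact: (mD f g)|exact: (mD g h)].
- by move=> x _; rewrite -EFinD lee_fin (le_trans _ (ler_normD _ _))// addrA subrK.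
Qed.

Lemma L1_cvg mu (f_ : nat -> X -> R) f : (forall n, measurable_fun setT (f_ n)) ->
  measurable_fun setT f -> (forall n x, 0 <= f_ n x <= 1)%R ->
  (forall x, f_ n x @[n --> \oo] --> f x) ->
  \int[mu]_x (`|f_ n x - f x|%R)%:E @[n --> \oo] --> 0.
Proof.
move=> mf_ mf f1 cf.
have mE n : measurable_fun setT (EFin \o f_ n) by exact/measurable_EFinP.
have mEf : measurable_fun setT (EFin \o f) by exact/measurable_EFinP.
have cE : \forall x \ae mu, setT x -> (EFin \o f_ n) x @[n --> \oo] --> (EFin \o f) x.
  by apply/aeW => x _; apply: cvg_EFin; [exact: nearW|exact: cf].
have i1 : mu.-integrable setT (EFin \o (cst 1%R : X -> R)).
  by apply: (@bounded_integrable _ _ _ _ _ 1%R) => // x; rewrite normr1.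
have b1 : \forall x \ae mu, forall n, setT x -> `|(EFin \o f_ n) x| <= (EFin \o (cst 1%R : X -> R)) x.
  by apply/aeW => x n _; have /andP[h0 h1] := f1 n x; rewrite lee_fin ger0_norm.
by have [_ + _] := dominated_convergence measurableT mE mEf cE i1 b1.
Qed.

Lemma L1_small (mu nu : {finite_measure set X -> \bar R}) (f_ : nat -> X -> R) f
  (e : R) : (0 < e)%R ->
  (forall n, measurable_fun setT (f_ n)) ->
  measurable_fun setT f -> (forall n x, 0 <= f_ n x <= 1)%R ->
  (forall x, f_ n x @[n --> \oo] --> f x) ->
  exists n, \int[mu]_x (`|f_ n x - f x|%R)%:E < e%:E /\
            \int[nu]_x (`|f_ n x - f x|%R)%:E < e%:E.
Proof.
move=> e0 mf_ mf f1 cf.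
have H (m : {finite_measure set X -> \bar R}) : \forall n \near \oo, \int[m]_x (`|f_ n x - f x|%R)%:E < e%:E.
  have := @L1_cvg m _ _ mf_ mf f1 cf.
  move=> /(_ [set y | y < e%:E]); apply.
  by apply: open_nbhs_nbhs; split; [exact: open_ereal_lt_ereal|rewrite /= lte_fin].
have H2 : \forall n \near \oo, \int[mu]_x (`|f_ n x - f x|%R)%:E < e%:E /\
    \int[nu]_x (`|f_ n x - f x|%R)%:E < e%:E.
  by near=> n; split; near: n; exact: H.
exact: filter_ex H2.
Unshelve. all: by end_near. Qed.

End L1.

Lemma step_cvg (R : realType) (s : R) :
  \forall m \near \oo, @step R (m%:R * s) = (0 < s)%R%:R.
Proof.
have [s0|s0] := ltP 0 s; last first.
  by near=> m; rewrite step_eq0// mulr_ge0_le0.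
near=> m; rewrite step_eq1// -ler_pdivrMr// div1r.
by near: m; exact: nbhs_infty_ger.
Unshelve. all: by end_near. Qed.

(** * Approximation of indicators by test functions *)

Section SmoothApprox.
Context (R : realType) (d : nat).
Local Notation E := ('rV[R]_d).
Local Notation ST := (E * R^o)%type.
Local Notation Rd := (euclid R d).
Local Notation X := (Rd * measurableTypeR R)%type.
Variables mu nu : {finite_measure set X -> \bar R}.

(** Closeness for both measures at once: the same test function must compare [mu B] with [nu B]. *)
Definition L1close (chi f : X -> R) (e : R) :=
  (\int[mu]_x `|chi x - f x|%:E < e%:E)%E /\
  (\int[nu]_x `|chi x - f x|%:E < e%:E)%E.

Definition approximable (B : set X) := measurable B /\
  forall e, 0 < e -> exists chi : ST -> R^o,
    [/\ smooth chi, forall p, 0 <= chi p <= 1 & L1close chi \1_B e].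

Lemma smooth_measurable (f : ST -> R^o) : smooth f -> measurable_fun setT (f : X -> R).
Proof. by move=> /smooth_continuous; exact: continuous_measurable_ST. Qed.

Lemma L1close_trans (f g h : X -> R) e : measurable_fun setT f ->
  measurable_fun setT g -> measurable_fun setT h ->
  L1close f g (e / 2) -> L1close g h (e / 2) -> L1close f h e.
Proof.
move=> mf mg mh [a1 a2] [b1 b2]; split; apply: (le_lt_trans (L1_triangle _ mf mg mh));
  by rewrite [in ltRHS](splitr e) EFinD lteD.
Qed.

Lemma approximable0 : approximable set0.
Proof.
split=> // e e0; exists (cst 0); split; first exact: smooth_cst.
- by move=> p; rewrite lexx ler01.
- by split; rewrite integral0_eq ?lte_fin// => p _; rewrite indic0 subrr normr0.
Qed.

Lemma approximableC B : approximable B -> approximable (~` B).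
Proof.
move=> [mB H]; split; first exact: measurableC.
move=> e /H[chi [sc c1 cB]]; exists (fun p => 1 - chi p); split.
- exact: smooth_onem.
- by move=> p; have /andP[? ?] := c1 p; apply/andP; split; lra.
- have E p : `|1 - chi p - \1_(~` B) p| = `|chi p - \1_B p|.
    rewrite !indicE in_setC -normrN; congr `|_|.
    by case: (p \in B) => /=; lra.
  by case: cB; split; under eq_integral do rewrite E.
Qed.

(** For functions with values in [[0, 1]], [1 - (1 - a) * (1 - b)] plays the union, and its error is
    at most the sum of the two errors. *)
Lemma approximableU A B : approximable A -> approximable B -> approximable (A `|` B).
Proof.
move=> [mA HA] [mB HB]; split; first exact: measurableU.
move=> e e0; have e20 : 0 < e / 2 by rewrite divr_gt0.
have [a [sa a1 [aA aA']]] := HA _ e20; have [b [sb b1 [bB bB']]] := HB _ e20.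
exists (fun p => 1 - (1 - a p) * (1 - b p)); split.
- by apply: smooth_onem; apply: smoothM; exact: smooth_onem.
- move=> p; have /andP[? ?] := a1 p; have /andP[? ?] := b1 p; apply/andP; split; nra.
have E p : `|1 - (1 - a p) * (1 - b p) - \1_(A `|` B) p| <=
    `|a p - \1_A p| + `|b p - \1_B p|.
  have -> : (\1_(A `|` B) p : R) = 1 - (1 - \1_A p) * (1 - \1_B p).
    rewrite !indicE in_setU; case: (p \in A); case: (p \in B) => /=; lra.
  have [A1 B1] : 0 <= (\1_A p : R) <= 1 /\ 0 <= (\1_B p : R) <= 1.
    by split; rewrite indicE; case: (_ \in _); rewrite /= ?lexx ?ler01.
  have /andP[? ?] := a1 p; have /andP[? ?] := b1 p.
  rewrite (_ : _ - _ = (a p - \1_A p) * (1 - \1_B p) + (1 - a p) * (b p - \1_B p)); last by ring.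
  rewrite (le_trans (ler_normD _ _))// !normrM lerD//.
    by rewrite ler_piMr// ler_norml; apply/andP; split; lra.
  by rewrite ler_piMl// ler_norml; apply/andP; split; lra.
have mE chi C : smooth chi -> measurable C ->
    measurable_fun setT (fun p : X => (`|chi p - \1_C p|)%:E).
  move=> sc mC; apply/measurable_EFinP; apply: measurableT_comp => //.
  apply: measurable_funB; [exact: smooth_measurable|exact: measurable_indic].
have S (m : {finite_measure set X -> \bar R}) : (\int[m]_x `|a x - \1_A x|%:E < (e / 2)%:E)%E ->
    (\int[m]_x `|b x - \1_B x|%:E < (e / 2)%:E)%E ->
    (\int[m]_x `|1 - (1 - a x) * (1 - b x) - \1_(A `|` B) x|%:E < e%:E)%E.
  move=> h1 h2; apply: (@le_lt_trans _ _
    (\int[m]_x ((`|a x - \1_A x|)%:E + (`|b x - \1_B x|)%:E))%E).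
    apply: ge0_le_integral => //.
    - apply: (mE (fun x => 1 - (1 - a x) * (1 - b x))); last exact: measurableU.
      by apply: smooth_onem; apply: smoothM; exact: smooth_onem.
    - by apply: emeasurable_funD; [exact: (mE a)|exact: (mE b)].
    - by move=> x _; rewrite -EFinD lee_fin.
  rewrite ge0_integralD//; [|exact: (mE a)|exact: (mE b)].
  by rewrite [in ltRHS](splitr e) EFinD lteD.
by split; apply: S.
Qed.

Lemma approximable_bigcup (F : nat -> set X) :
  (forall n, approximable (F n)) -> approximable (\bigcup_n F n).
Proof.
move=> aF; set U := \bigcup_n F n.
have mU : measurable U by apply: bigcup_measurable => n _; case: (aF n).
pose G n := \big[setU/set0]_(k < n) F k.
have aG n : approximable (G n).
  elim: n => [|n IH]; first by rewrite /G big_ord0; exact: approximable0.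
  by rewrite /G big_ord_recr; exact: approximableU.
split=> // e e0; have e20 : 0 < e / 2 by rewrite divr_gt0.
have [n [h1 h2]] : exists n, L1close \1_(G n) \1_U (e / 2).
  apply: L1_small => //.
  - by move=> n; apply: measurable_indic; case: (aG n).
  - by move=> n x; rewrite indicE; case: (_ \in _); rewrite /= ?lexx ?ler01.
  - move=> x; apply: cvg_near_cst; rewrite indicE.
    have [[k _ Fkx]|nUx] := pselect (U x).
      exists k.+1 => // n /= kn; rewrite indicE !mem_set//; first by exists k.
      by rewrite /G -(bigcup_mkord n F); exists k.
    apply: nearW => n; rewrite indicE !memNset// => Gnx; apply: nUx.
    by move: Gnx; rewrite /G -(bigcup_mkord n F) => -[k _ ?]; exists k.
have [mG /(_ _ e20)[chi [sc c1 cG]]] := aG n.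
exists chi; split=> //; apply: (L1close_trans (g := \1_(G n))) => //.
exact: smooth_measurable.
Qed.

(** Products of steps of slope [m], one for each face, converge pointwise to the indicator of the
    open box as [m] grows, hence in [L^1] by dominated convergence. *)
Lemma approximable_box c r : 0 < r -> approximable (box c r).
Proof.
move=> r0; split=> [|e e0]; first exact: box_measurable.
pose g (m : nat) (s : R) : R := @step R (m%:R * s).
pose chi m (p : ST) : R^o :=
  (\prod_(k < d) (g m (p.1 0 k - c.1 0 k + r) * g m (c.1 0 k + r - p.1 0 k))) *
  (g m (p.2 - c.2 + r) * g m (c.2 + r - p.2)).
have schi m : smooth (chi m).
  have E1 k : (fun p : ST => g m (p.1 0 k - c.1 0 k + r)) =
      (fun p : ST => @step R (m%:R * p.1 0 k + m%:R * (r - c.1 0 k))).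
    by apply/funext => p; rewrite /g; congr step; ring.
  have E2 k : (fun p : ST => g m (c.1 0 k + r - p.1 0 k)) =
      (fun p : ST => @step R (- m%:R * p.1 0 k + m%:R * (r + c.1 0 k))).
    by apply/funext => p; rewrite /g; congr step; ring.
  have E3 : (fun p : ST => g m (p.2 - c.2 + r)) =
      (fun p : ST => @step R (m%:R * p.2 + m%:R * (r - c.2))).
    by apply/funext => p; rewrite /g; congr step; ring.
  have E4 : (fun p : ST => g m (c.2 + r - p.2)) =
      (fun p : ST => @step R (- m%:R * p.2 + m%:R * (r + c.2))).
    by apply/funext => p; rewrite /g; congr step; ring.
  apply: smoothM.
    apply: smooth_prod => k; apply: smoothM; [rewrite E1|rewrite E2];
      apply: smooth_coord; exact: smooth_step.
  by apply: smoothM; [rewrite E3|rewrite E4]; apply: smooth_time; exact: smooth_step.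
have g01 m s : 0 <= g m s <= 1 by rewrite step_ge0 step_le1.
have c01 m p : 0 <= chi m p <= 1.
  have gg a b : 0 <= g m a * g m b <= 1.
    have /andP[? ?] := g01 m a; have /andP[? ?] := g01 m b.
    by rewrite mulr_ge0//= mulr_ile1.
  have pg : 0 <= \prod_(k < d) (g m (p.1 0 k - c.1 0 k + r) * g m (c.1 0 k + r - p.1 0 k)) <= 1.
    by rewrite prodr_ge0 ?prodr_ile1// => k _; case/andP: (gg (p.1 0 k - c.1 0 k + r) (c.1 0 k + r - p.1 0 k)).
  have /andP[? ?] := pg; have /andP[? ?] := gg (p.2 - c.2 + r) (c.2 + r - p.2).
  by rewrite /chi mulr_ge0//= mulr_ile1.
have [n hn] : exists n, L1close (chi n) \1_(box c r) e.
  apply: L1_small => //.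
  - by move=> n; exact: smooth_measurable.
  - by apply: measurable_indic; exact: box_measurable.
  - move=> p; apply: cvg_near_cst.
    have H a b : \forall m \near \oo, g m (a - b + r) * g m (b + r - a) = (`|a - b| < r)%R%:R.
      near=> m; rewrite /g (near (step_cvg (a - b + r)) m)// (near (step_cvg (b + r - a)) m)//.
      rewrite ltr_norml -natrM mulnb; congr (nat_of_bool _)%:R; congr andb.
        by rewrite -ltrBlDr sub0r.
      by rewrite subr_gt0 ltrBlDl.
    have H' : \forall m \near \oo, forall k : 'I_d,
        g m (p.1 0 k - c.1 0 k + r) * g m (c.1 0 k + r - p.1 0 k) = (`|p.1 0 k - c.1 0 k| < r)%R%:R.
      by apply: filter_forall => k; exact: H.
    near=> m; rewrite /chi (near (H p.2 c.2) m)//.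
    under eq_bigr do rewrite (near H' m)//.
    rewrite indicE; have [/set_mem/(boxE _ _ r0)[h1 h2]|/negP pb] := boolP (p \in box c r).
      by rewrite h2 mulr1 big1// => k _; rewrite h1.
    have [h2|_] := boolP (`|p.2 - c.2| < r); last by rewrite mulr0.
    have [[k nk]|/forallNP nk] := pselect (exists k, ~ (`|p.1 0 k - c.1 0 k| < r)).
      by rewrite (bigD1 k)//= (negbTE (introN idP nk)) !mul0r.
    exfalso; apply: pb; apply: mem_set; apply/boxE => //; split=> // k.
    by have /contrapT := nk k.
by exists (chi n).
Unshelve. all: by end_near. Qed.

Lemma open_approximable (U : set ST) : open U -> approximable U.
Proof.
move=> oU; rewrite (open_rbox oU).
have [s [-> hs]] := bigcup_rbox_seq R [set i | rbox i `<=` U].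
apply: approximable_bigcup => n.
have [->|[i ->]] := hs n; first exact: approximable0.
by apply: approximable_box; rewrite invr_gt0.
Qed.

(** Approximable sets form a sigma-algebra and contain the open sets. As the sigma-algebra of [X] is
    generated by rectangles, the argument is run on cylinders over each factor and ends with an
    intersection. *)
Lemma measurable_approximable (B : set X) : measurable B -> approximable B.
Proof.
have approximableI A C : approximable A -> approximable C -> approximable (A `&` C).
  move=> /approximableC aA /approximableC aC; rewrite -[_ `&` _]setCK setCI.
  by apply: approximableC; exact: approximableU.
have sA : sigma_algebra setT approximable.
  split; [exact: approximable0|move=> A|exact: approximable_bigcup].
  by rewrite setTD; exact: approximableC.
rewrite [X in X -> _](_ : _ = (@measurable _ X : set (set X)) B)// measurable_prod_measurableType.
apply: smallest_sub => // _ [A mA [C mC <-]].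
rewrite (_ : A `*` C = (A `*` setT) `&` (setT `*` C)); last first.
  by apply/seteqP; split=> -[x t] /=; rewrite /setX /=; [move=> [? ?]|move=> [[? _] [_ ?]]].
apply: approximableI.
- have s1 : sigma_algebra setT [set A : set Rd | approximable (A `*` setT)].
    split=> [|A'|F] /=.
    + by rewrite set0X; exact: approximable0.
    + move=> /approximableC; rewrite (_ : ~` _ = (setT `\` A') `*` setT)//.
      by apply/seteqP; split=> -[x t]; rewrite /setX /setD /=; [move=> h; split=> //; split=> // Ax; exact: h|move=> [[_ h] _] [/h]].
    + move=> /approximable_bigcup; rewrite (_ : \bigcup_k F k `*` setT = \bigcup_k (F k `*` setT))//.
      by apply/seteqP; split=> -[x t]; rewrite /setX /=; [move=> [[k ? ?] _]; exists k|move=> [k ? [? _]]; split=> //; exists k].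
  apply: (smallest_sub s1 _ mA) => U oU /=; apply: open_approximable.
  rewrite (_ : _ `*` _ = fst @^-1` U); last by apply/seteqP; split=> -[x t] /=; rewrite /setX /=; [case|].
  by have /continuousP := @continuous_fst R d; exact.
- have s2 : sigma_algebra setT [set C : set (measurableTypeR R) | approximable (setT `*` C)].
    split=> [|A'|F] /=.
    + by rewrite setX0; exact: approximable0.
    + move=> /approximableC; rewrite (_ : ~` _ = setT `*` (setT `\` A'))//.
      by apply/seteqP; split=> -[x t]; rewrite /setX /setD /=; [move=> h; split=> //; split=> // Ax; exact: h|move=> [_ [_ h]] [_ /h]].
    + move=> /approximable_bigcup; rewrite (_ : setT `*` \bigcup_k F k = \bigcup_k (setT `*` F k))//.
      by apply/seteqP; split=> -[x t]; rewrite /setX /=; [move=> [_ [k ? ?]]; exists k|move=> [k ? [_ ?]]; split=> //; exists k].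
  have mC' : (@RGenOpens.G R).-sigma.-measurable C by rewrite -RGenOpens.measurableE.
  apply: (smallest_sub s2 _ mC') => _ [a [b ->]] /=; apply: open_approximable.
  rewrite (_ : _ `*` _ = snd @^-1` `]a, b[%classic); last by apply/seteqP; split=> -[x t] /=; rewrite /setX /=; [case|].
  have /continuousP := @continuous_snd R d; apply; exact: interval_open.
Qed.

(** The smooth approximation is multiplied by [cutoff1] dilated in space and in time, which makes
    the support bounded at an arbitrarily small cost in [L^1]. *)
Lemma tfun_approx (B : set X) (e : R) : measurable B -> 0 < e ->
  exists chi, [/\ tfun chi, forall p, 0 <= chi p <= 1 & L1close chi \1_B e].
Proof.
move=> mB e0; have e20 : 0 < e / 2 by rewrite divr_gt0.
have [_ /(_ _ e20)[chi [sc c1 cB]]] := measurable_approximable mB.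
pose r n : R := n.+1%:R^-1.
pose K n (p : ST) : R^o := cutoff1 (affine_ST (r n) (r n) 0 p) * chi p.
have r0 n : r n != 0 by rewrite invr_eq0.
have tK n : tfun (K n).
  apply: tfunMr => //; apply: tfun_affine_ST => //; exact: tfun_cutoff1.
have K1 n p : 0 <= K n p <= 1.
  have /andP[? ?] := c1 p.
  by rewrite /K mulr_ge0 ?cutoff1_ge0//= mulr_ile1 ?cutoff1_ge0 ?cutoff1_le1.
have [n hn] : exists n, L1close (K n) chi (e / 2).
  apply: L1_small => //.
  - by move=> n; exact: tfun_measurable.
  - exact: smooth_measurable.
  - move=> p; apply: cvg_near_cst; near=> n; rewrite /K cutoff1_eq1 ?mul1r//.
    rewrite /affine_ST addr0.
    have -> : (r n *: p.1, r n * p.2) = r n *: p by [].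
    rewrite normrZ ger0_norm ?invr_ge0// ler_pdivrMl//.
    have : `|p| <= n%:R by near: n; exact: nbhs_infty_ger.
    by move=> /le_trans -> //; rewrite -natrM ler_nat muln2 -addnn; lia.
exists (K n); split=> //; apply: (L1close_trans (g := chi)) => //.
- exact: tfun_measurable.
- exact: smooth_measurable.
Unshelve. all: by end_near. Qed.

End SmoothApprox.

(** * Finite measures from set functions, and push-forwards *)

Section MakeMeasure.
Context d (X : measurableType d) (R : realType).

Definition is_fmeasure (m : set X -> \bar R) := [/\ m set0 = 0%E,
  forall A, (0 <= m A)%E, semi_sigma_additive m & fin_num_fun m].

Variables (m : set X -> \bar R) (mP : is_fmeasure m).

(** The proof is a phantom argument through which the measure structures are attached to the bare
    set function. *)
Definition mkfm of is_fmeasure m := m.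

Let m0 : mkfm mP set0 = 0%E. Proof. by case: mP. Qed.
Let m_ge0 A : (0 <= mkfm mP A)%E. Proof. by case: mP. Qed.
Let m_sigma : semi_sigma_additive (mkfm mP). Proof. by case: mP. Qed.
HB.instance Definition _ := isMeasure.Build _ _ _ (mkfm mP) m0 m_ge0 m_sigma.
Let m_fin : fin_num_fun (mkfm mP). Proof. by case: mP. Qed.
HB.instance Definition _ := Measure_isFinite.Build _ _ _ (mkfm mP) m_fin.

Definition fmeasure : {finite_measure set X -> \bar R} := mkfm mP.

End MakeMeasure.

Section PushForward.
Context d d' (X : measurableType d) (Y : measurableType d') (R : realType).
Variables (mu : {finite_measure set X -> \bar R}) (f : X -> Y).
Hypothesis mf : measurable_fun setT f.

Let f_mixin := isMeasurableFun.Build _ _ _ _ _ mf.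
Let f_pack : {mfun _ >-> _} := HB.pack f f_mixin.

Lemma fpush_subproof : is_fmeasure (pushforward mu f).
Proof.
split=> [|A||A mA]; rewrite /pushforward.
- by rewrite preimage_set0 measure0.
- exact: measure_ge0.
- exact: (@measure_semi_sigma_additive _ _ _ (pushforward mu f_pack)).
- by apply: fin_num_measure; rewrite -[_ @^-1` _]setTI; exact: mf.
Qed.

Definition fpush : {finite_measure set Y -> \bar R} := fmeasure fpush_subproof.

Lemma ge0_integral_fpush (g : Y -> \bar R) : measurable_fun setT g ->
  (forall y, 0 <= g y)%E -> (\int[fpush]_y g y = \int[mu]_x g (f x))%E.
Proof. by move=> mg g0; rewrite ge0_integral_pushforward. Qed.

Lemma integral_fpush (g : Y -> \bar R) : measurable_fun setT g ->
  mu.-integrable setT (g \o f) -> (\int[fpush]_y g y = \int[mu]_x g (f x))%E.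
Proof. by move=> mg ig; rewrite integral_pushforward. Qed.

End PushForward.

Section L1Rintegral.
Context d (X : measurableType d) (R : realType).
Implicit Types (mu : {finite_measure set X -> \bar R}) (f g h : X -> R).

Lemma L1_Rintegral mu f g (e : R) : mu.-integrable setT (EFin \o f) ->
  mu.-integrable setT (EFin \o g) -> (\int[mu]_x `|f x - g x|%:E < e%:E)%E ->
  `|\int[mu]_x f x - \int[mu]_x g x| < e.
Proof.
move=> fi gi fge; rewrite -RintegralB//.
have fgi : mu.-integrable setT (EFin \o (fun x => f x - g x)).
  by apply: eq_integrable (integrableB measurableT fi gi).
rewrite (le_lt_trans (le_normr_Rintegral _ fgi))// -lte_fin /Rintegral fineK//.
apply: integrable_fin_num => //.
exact: (integrable_abse fgi).
Qed.

Lemma Rintegral_indicT mu A : measurable A -> \int[mu]_x \1_A x = fine (mu A).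
Proof. by move=> mA; rewrite /Rintegral integral_indic// setIT. Qed.

End L1Rintegral.

Section Unique.
Context (R : realType) (d : nat).
Local Notation E := ('rV[R]_d).
Local Notation ST := (E * R^o)%type.
Local Notation Rd := (euclid R d).
Local Notation X := (Rd * measurableTypeR R)%type.

Lemma tfun_integrable (mu : {finite_measure set X -> \bar R}) eta : tfun eta ->
  mu.-integrable setT (EFin \o (eta : X -> R)).
Proof.
move=> te; have [C [_ HC]] := tfun_bounded te.
exact: (@bounded_integrable _ X R mu (eta : X -> R) C (tfun_measurable te) HC).
Qed.

Lemma tfun_measure_unique (mu nu : {finite_measure set X -> \bar R}) :
  (forall eta : ST -> R^o, tfun eta -> \int[mu]_p eta p = \int[nu]_p eta p) ->
  forall B, measurable B -> mu B = nu B.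
Proof.
move=> H B mB.
suff : fine (mu B) = fine (nu B).
  by move=> h; rewrite -(fineK (fin_num_measure mu B mB)) h fineK// fin_num_measure.
apply/eqP; rewrite -subr_eq0 -normr_le0; apply/ler_addgt0Pl => e e0; rewrite addr0.
have e20 : 0 < e / 2 by rewrite divr_gt0.
have [chi [tc c1 [h1 h2]]] := tfun_approx mu nu mB e20.
have iB (m : {finite_measure set X -> \bar R}) : m.-integrable setT (EFin \o (\1_B : X -> R)).
  apply: (@bounded_integrable _ _ _ _ _ 1) => [|x]; first exact: measurable_indic.
  by rewrite indicE; case: (_ \in _); rewrite /= ?normr0 ?normr1.
have := L1_Rintegral (tfun_integrable mu tc) (iB mu) h1.
have := L1_Rintegral (tfun_integrable nu tc) (iB nu) h2.
rewrite !Rintegral_indicT// H// => k2 k1.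
rewrite (le_trans (ler_distD (\int[nu]_p chi p) _ _))// [leRHS]splitr.
by rewrite lerD// ?ltW// distrC.
Qed.

Lemma measurable_slice (t : R) : measurable_fun setT (fun x : Rd => (x, t) : X).
Proof. by apply: measurable_fun_pair => //; exact: measurable_cst. Qed.

Lemma tfun_slice_integrable (mu : {finite_measure set Rd -> \bar R}) eta t : tfun eta ->
  mu.-integrable setT (EFin \o (fun x : Rd => eta (x, t))).
Proof.
move=> te; have [C [_ HC]] := tfun_bounded te.
apply: (@bounded_integrable _ _ _ _ _ C) => [|x]; last exact: HC.
exact: (measurableT_comp (tfun_measurable te) (measurable_slice t)).
Qed.

(** Pushing both measures to the slice at time [t] turns the claim into uniqueness of measures on
    space-time. *)
Lemma tfun_slice_unique (mu nu : {finite_measure set Rd -> \bar R}) (t : R) :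
  (forall eta : ST -> R^o, tfun eta ->
    \int[mu]_x eta (x, t) = \int[nu]_x eta (x, t)) ->
  forall B, measurable B -> mu B = nu B.
Proof.
move=> H B mB.
have mt := measurable_slice t.
have : fpush mu mt (B `*` setT) = fpush nu mt (B `*` setT).
  apply: tfun_measure_unique; last exact: measurableX.
  move=> eta te; have := H _ te; rewrite /Rintegral => Hte.
  have E1 (m : {finite_measure set Rd -> \bar R}) :
      (\int[fpush m mt]_p (eta p)%:E = \int[m]_x (eta (x, t))%:E)%E.
    apply: (@integral_fpush _ _ _ _ _ m _ mt (fun p : X => (eta p)%:E)).
      by apply/measurable_EFinP; exact: (tfun_measurable te).
    exact: (tfun_slice_integrable m t te).
  by rewrite !E1.
rewrite /= /mkfm /pushforward (_ : _ @^-1` _ = B)//.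
by apply/seteqP; split=> x /=; rewrite /setX /=; [case|].
Qed.

End Unique.

(** * Riesz representation and Prokhorov compactness *)

Lemma half_gt0 (R : realFieldType) (e : R) : 0 < e -> 0 < e / 2.
Proof. by move=> e0; rewrite divr_gt0. Qed.

(** * Distance to the complement of an open set *)

Section DistanceToComplement.
Context (R : realType) (E : normedModType R).
Implicit Type U : set E.

Definition codist U (x : E) : R := inf [set `|x - a| | a in ~` U].

Lemma codist_has_inf U x : ~` U !=set0 -> has_inf [set `|x - a| | a in ~` U].
Proof.
move=> [a Ua]; split; first by exists `|x - a|; exists a.
by exists 0 => _ [b _ <-].
Qed.

Lemma codist_lip U x y : ~` U !=set0 -> codist U x <= codist U y + `|x - y|.
Proof.
move=> U0; have [ne lbd] := codist_has_inf y U0; have [nex lbx] := codist_has_inf x U0.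
rewrite -lerBlDr; apply: lb_le_inf => // _ [a Ua <-].
rewrite lerBlDr (@le_trans _ _ `|x - a|)//.
  by apply: ge_inf => //; exists a.
by rewrite [leRHS]addrC; exact: ler_distD.
Qed.

Lemma codist_ge0 U x : ~` U !=set0 -> 0 <= codist U x.
Proof.
by move=> U0; have [ne _] := codist_has_inf x U0; apply: lb_le_inf => // _ [a _ <-].
Qed.

Lemma codist_eq0 U x : ~ U x -> codist U x = 0.
Proof.
move=> Ux; have U0 : ~` U !=set0 by exists x.
apply/eqP; rewrite eq_le codist_ge0// andbT.
have [ne lbd] := codist_has_inf x U0.
by apply: ge_inf => //; exists x => //; rewrite subrr normr0.
Qed.

Lemma codist_gt0 U x : open U -> U x -> ~` U !=set0 -> 0 < codist U x.
Proof.
move=> oU Ux U0; have /nbhs_ballP[e /= e0 eU] : nbhs x U by exact: open_nbhs_nbhs.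
apply: (lt_le_trans e0); have [ne _] := codist_has_inf x U0.
apply: lb_le_inf => // _ [a Ua <-]; rewrite leNgt; apply/negP => xa.
by apply: Ua; apply: eU; rewrite -ball_normE.
Qed.

Lemma codist_continuous U : ~` U !=set0 -> continuous (codist U).
Proof.
move=> U0 x; apply/cvgrPdist_lt => e e0; apply/nbhs_ballP; exists e => // y.
rewrite -ball_normE /= => xy.
have h1 := codist_lip y x U0; have h2 := codist_lip x y U0; rewrite distrC in h1.
by rewrite ltr_norml; apply/andP; split; lra.
Qed.

(** Continuous functions that increase with [j] to the indicator of an open [U]. If [U] is the whole
    space the set of distances is empty, so the value 1 is imposed. *)
Definition ramp U (j : nat) (x : E) : R :=
  if pselect (~` U !=set0) then Num.min 1 (j%:R * codist U x) else 1.

Lemma ramp_continuous U j : continuous (ramp U j).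
Proof.
rewrite /ramp; case: pselect => U0; last by move=> x; exact: cst_continuous.
move=> x; apply: (@continuous_min R _ (cst 1) (fun x => j%:R * codist U x)).
  exact: cst_continuous.
by apply: (@continuousM R _ (cst j%:R)); [exact: cst_continuous|exact: codist_continuous].
Qed.

Lemma ramp01 U j x : 0 <= ramp U j x <= 1.
Proof.
rewrite /ramp; case: pselect => U0; last by rewrite ler01 lexx.
by rewrite le_min ler01 ge_min lexx/= andbT mulr_ge0// codist_ge0.
Qed.

Lemma ramp_eq0 U j x : ~ U x -> ramp U j x = 0.
Proof.
move=> Ux; rewrite /ramp; case: pselect => U0; last by exfalso; apply: U0; exists x.
by rewrite codist_eq0// mulr0; apply/min_idPr.
Qed.

Lemma le_ramp U x (i j : nat) : (i <= j)%N -> ramp U i x <= ramp U j x.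
Proof.
move=> ij; rewrite /ramp; case: pselect => // U0.
by apply: le_min2 => //; rewrite ler_wpM2r ?codist_ge0// ler_nat.
Qed.

Lemma ramp_eq1 U x : open U -> U x -> \forall j \near \oo, ramp U j x = 1.
Proof.
move=> oU Ux; rewrite /ramp; case: pselect => U0; last exact: nearW.
have c0 := codist_gt0 oU Ux U0; near=> j; apply/min_idPl.
by rewrite -ler_pdivrMr// div1r; near: j; exact: nbhs_infty_ger.
Unshelve. all: by end_near. Qed.

End DistanceToComplement.

Section Dini.
Context (R : realType) (T : ptopologicalType).

(** The open sets [g n < e] increase with [n] and cover [K]; by compactness a single one of them
    already does. *)
Lemma dini (K : set T) (g : nat -> T -> R) (e : R) : compact K ->
  (forall n, continuous (g n)) ->
  (forall x i j, (i <= j)%N -> g j x <= g i x) ->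
  (forall x, exists n, g n x < e) ->
  exists n, forall x, K x -> g n x < e.
Proof.
rewrite compact_cover => cK cg dg ge.
have oD i : setT i -> open [set x | g i x < e].
  move=> _; rewrite (_ : [set _ | _] = g i @^-1` [set y | y < e])//.
  by have /continuousP := cg i; apply; exact: open_lt.
have KD : K `<=` cover setT (fun i => [set x | g i x < e]).
  by move=> x _; have [n gn] := ge x; exists n.
have [D _ KD'] := cK nat setT _ oD KD.
exists (\max_(i <- finmap.enum_fset D) i)%N => x /KD'[i /= iD gi].
by apply: le_lt_trans gi; apply: dg; apply: leq_bigmax_seq.
Qed.

End Dini.

(** * Riesz representation of tight positive functionals *)

Section Riesz.
Context (R : realType) (d : nat).
Local Notation E := ('rV[R]_d).
Local Notation Rd := (euclid R d).
Implicit Types f g : E -> R.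

Definition Cb (f : E -> R) := continuous f /\ exists M, forall x, `|f x| <= M.

Lemma Cb_cst c : Cb (cst c).
Proof. by split; [exact: cst_continuous|exists `|c|]. Qed.

Lemma CbD f g : Cb f -> Cb g -> Cb (fun x => f x + g x).
Proof.
move=> [cf [M fM]] [cg [N gN]]; split.
  by move=> x; apply: continuousD; [exact: cf|exact: cg].
by exists (M + N) => x; rewrite (le_trans (ler_normD _ _))// lerD.
Qed.

Lemma CbZ c f : Cb f -> Cb (fun x => c * f x).
Proof.
move=> [cf [M fM]]; split.
  by move=> x; apply: (@continuousM R _ (cst c)); [exact: cst_continuous|exact: cf].
by exists (`|c| * M) => x; rewrite normrM ler_wpM2l.
Qed.

Lemma Cb01 f : continuous f -> (forall x, 0 <= f x <= 1) -> Cb f.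
Proof.
move=> cf f01; split=> //; exists 1 => x; have /andP[? ?] := f01 x.
by rewrite ger0_norm.
Qed.

Lemma Cb_min f g : Cb f -> Cb g -> Cb (fun x => Num.min (f x) (g x)).
Proof.
move=> [cf [M fM]] [cg [N gN]]; split.
  by move=> x; apply: (@continuous_min R _ f g); [exact: cf|exact: cg].
exists (Num.max M N) => x; rewrite le_max.
by case: (leP (f x) (g x)) => _; rewrite ?fM ?gN ?orbT.
Qed.

Lemma Cb_max f g : Cb f -> Cb g -> Cb (fun x => Num.max (f x) (g x)).
Proof.
move=> [cf [M fM]] [cg [N gN]]; split.
  by move=> x; apply: (@continuous_max R _ f g); [exact: cf|exact: cg].
exists (Num.max M N) => x; rewrite le_max.
by case: (leP (f x) (g x)) => _; rewrite ?fM ?gN ?orbT.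
Qed.

Lemma Cb_sum (I : Type) (s : seq I) (f : I -> E -> R) : (forall i, Cb (f i)) ->
  Cb (fun x => \sum_(i <- s) f i x).
Proof.
move=> Cf; elim: s => [|a s IH].
  by under eq_fun do rewrite big_nil; exact: Cb_cst.
by under eq_fun do rewrite big_cons; exact: CbD.
Qed.

Variable L : (E -> R) -> R.
Hypothesis LD : forall f g, Cb f -> Cb g -> L (fun x => f x + g x) = L f + L g.
Hypothesis LZ : forall c f, Cb f -> L (fun x => c * f x) = c * L f.
Hypothesis L_ge0 : forall f, Cb f -> (forall x, 0 <= f x) -> 0 <= L f.
Hypothesis L_tight : forall e, 0 < e -> exists K : set E, compact K /\
  forall f, Cb f -> (forall x, 0 <= f x <= 1) -> (forall x, K x -> f x = 0) -> L f <= e.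

Lemma L_le f g : Cb f -> Cb g -> (forall x, f x <= g x) -> L f <= L g.
Proof.
move=> Cf Cg fg; rewrite -subr_ge0 -mulN1r -LZ// addrC -LD//; last exact: CbZ.
apply: L_ge0 => [|x]; first by apply: CbD => //; exact: CbZ.
by rewrite mulN1r addrC subr_ge0.
Qed.

Lemma L_sum (I : Type) (s : seq I) (f : I -> E -> R) : (forall i, Cb (f i)) ->
  L (fun x => \sum_(i <- s) f i x) = \sum_(i <- s) L (f i).
Proof.
move=> Cf; elim: s => [|a s IH].
  rewrite (_ : (fun _ => _) = fun x => 0 * cst 0 x).
    by rewrite LZ ?mul0r ?big_nil//; exact: Cb_cst.
  by apply/funext => x; rewrite big_nil mul0r.
rewrite (_ : (fun _ => _) = fun x => f a x + \sum_(i <- s) f i x).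
  by rewrite LD ?big_cons ?IH//; exact: Cb_sum.
by apply/funext => x; rewrite big_cons.
Qed.

Let l1 := L (cst 1).
Let l1_ge0 : 0 <= l1. Proof. by apply: L_ge0 => //; exact: Cb_cst. Qed.

(** On a compact set chosen by tightness, Dini makes the deficit [f - h n] smaller than [a]. The
    part [r] of the deficit above [a] then vanishes on that set, so tightness bounds [L r]. *)
Lemma L_sigma_smooth (h : nat -> E -> R) f e : 0 < e -> Cb f ->
  (forall x, 0 <= f x <= 1) -> (forall n, Cb (h n)) ->
  (forall n x, 0 <= h n x <= f x) ->
  (forall x i j, (i <= j)%N -> h i x <= h j x) ->
  (forall x a, 0 < a -> exists n, f x - h n x < a) ->
  exists n, L f <= L (h n) + e.
Proof.
move=> e0 Cf f01 Ch h0 hmono hcv.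
(* Then [a * l1 <= e / 2]; the added 1 covers the case [l1 = 0]. *)
pose a := e / 2 / (l1 + 1).
have a0 : 0 < a by rewrite /a !divr_gt0// ltr_wpDl.
have [K [cK HK]] := L_tight (half_gt0 e0).
have [n hn] : exists n, forall x, K x -> f x - h n x < a.
  apply: dini => //.
  - move=> n x; apply: (@continuousB R); [exact: (proj1 Cf)|exact: (proj1 (Ch n))].
  - by move=> x i j ij; rewrite lerB// hmono.
  - by move=> x; exact: hcv.
exists n; pose r x := Num.max 0 (f x - h n x - a).
have Cr : Cb r.
  apply: (@Cb_max (cst 0)); first exact: Cb_cst.
  rewrite (_ : (fun _ => _) = fun x => (f x + (- 1) * h n x) + cst (- a) x).
    by apply: CbD; [apply: CbD => //; exact: CbZ|exact: Cb_cst].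
  by apply/funext => x; rewrite mulN1r.
have Lr : L r <= e / 2.
  apply: HK => // x.
    rewrite /r le_max lexx/= ge_max ler01/=.
    have /andP[? ?] := f01 x; have /andP[? ?] := h0 n x; lra.
  by move=> Kx; rewrite /r; apply/max_idPl; rewrite subr_le0 ltW// hn.
have -> : e = e / 2 + e / 2 by rewrite -splitr.
apply: (@le_trans _ _ (L (fun x => h n x + (a * cst 1 x + r x)))).
  apply: L_le => //.
    by apply: CbD => //; apply: CbD => //; apply: CbZ; exact: Cb_cst.
  move=> x; rewrite /r /= mulr1.
  have : f x - h n x - a <= Num.max 0 (f x - h n x - a) by rewrite le_max lexx orbT.
  lra.
have C1 : Cb (fun x : E => a * cst 1 x) by apply: CbZ; exact: Cb_cst.
rewrite LD//; last exact: CbD.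
rewrite LD// LZ; last exact: Cb_cst.
rewrite lerD2l lerD// /a -/l1 mulrAC ler_pdivrMr ?ltr_wpDl//.
by rewrite ler_pM2l ?divr_gt0// lerDl.
Qed.

Definition adm (U : set E) (f : E -> R) :=
  [/\ continuous f, forall x, 0 <= f x <= 1 & forall x, ~ U x -> f x = 0].

Lemma adm_Cb U f : adm U f -> Cb f. Proof. by case=> *; exact: Cb01. Qed.

(** For open [U], the value that the representing measure is going to have on [U]. *)
Definition cont (U : set E) : R := sup [set L f | f in adm U].

Lemma cont_has_sup U : has_sup [set L f | f in adm U].
Proof.
split.
  exists (L (cst 0)); exists (cst 0) => //; split=> //.
    by move=> x; exact: cst_continuous.
  by move=> x; rewrite lexx ler01.
exists l1 => _ [f af <-]; apply: L_le; [exact: adm_Cb af|exact: Cb_cst|].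
by move=> x; case: af => _ /(_ x)/andP[].
Qed.

Lemma le_cont U f : adm U f -> L f <= cont U.
Proof. by move=> af; apply: ub_le_sup; [case: (cont_has_sup U)|exists f]. Qed.

Lemma cont_le U c : (forall f, adm U f -> L f <= c) -> cont U <= c.
Proof.
by move=> H; apply: ge_sup; [case: (cont_has_sup U)|move=> _ [f /H ? <-]].
Qed.

Lemma cont_ge0 U : 0 <= cont U.
Proof.
apply: le_trans (le_cont (f := cst 0) _).
  by apply: L_ge0 => //; exact: Cb_cst.
by split=> // x; [exact: cst_continuous|rewrite lexx ler01].
Qed.

Lemma cont_mono U V : U `<=` V -> cont U <= cont V.
Proof.
move=> UV; apply: cont_le => f [cf f01 f0]; apply: le_cont; split=> // x Vx.
by apply: f0 => /UV.
Qed.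

Lemma cont_approx U e : 0 < e -> exists f, adm U f /\ cont U < L f + e.
Proof.
move=> e0; have [_ [f af <-] h] := sup_adherent e0 (cont_has_sup U).
by exists f; split=> //; rewrite -ltrBlDr.
Qed.

Lemma cont0 : cont set0 = 0.
Proof.
apply/eqP; rewrite eq_le cont_ge0 andbT; apply: cont_le => f [_ _ f0].
rewrite (_ : f = fun x => 0 * cst 0 x); first by rewrite LZ ?mul0r//; exact: Cb_cst.
by apply/funext => x; rewrite f0// mul0r.
Qed.

Lemma ramp_adm U j : adm U (ramp U j).
Proof.
split; [exact: ramp_continuous|move=> x; exact: ramp01|move=> x; exact: ramp_eq0].
Qed.

(** An admissible function for the union is the increasing limit of its minima with finite sums of
    ramps of the [U n]. The functional almost attains its value at a finite stage, where it is at
    most a finite sum of contents. *)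
Lemma cont_bigcup (U : nat -> set E) : (forall n, open (U n)) ->
  ((cont (\bigcup_n U n))%:E <= \sum_(n <oo) (cont (U n))%:E)%E.
Proof.
move=> oU; apply/lee_addgt0Pr => e e0.
have [f [af fe]] := cont_approx (\bigcup_n U n) (half_gt0 e0).
have [cf f01 f0] := af.
(* The number of sets and the slope of their ramps grow together, so one index gives a monotone
   sequence. *)
pose S J x := \sum_(n < J) ramp (U n) J x.
pose h J x := Num.min (f x) (S J x).
have CS J : Cb (S J).
  by apply: Cb_sum => n; exact: adm_Cb (ramp_adm _ _).
have S0 J x : 0 <= S J x.
  by apply: sumr_ge0 => n _; case/andP: (ramp01 (U n) J x).
have [J hJ] : exists J, L f <= L (h J) + e / 2.
  apply: L_sigma_smooth => //.
  - by rewrite divr_gt0.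
  - exact: adm_Cb af.
  - by move=> n; apply: Cb_min => //; exact: adm_Cb af.
  - move=> n x; rewrite /h le_min S0 ge_min lexx/= !andbT.
    by case/andP: (f01 x).
  - move=> x i j ij; rewrite /h le_min2// /S.
    rewrite (big_ord_widen _ (fun n => ramp (U n) i x) ij).
    rewrite [leRHS](bigID (fun n : 'I_j => (n < i)%N))/=.
    rewrite ler_wpDr//; last by apply: ler_sum => n _; exact: le_ramp.
    by apply: sumr_ge0 => n _; case/andP: (ramp01 (U n) j x).
  - move=> x a a0; have [[n _ Unx]|nU] := pselect ((\bigcup_n U n) x); last first.
      exists 0%N; rewrite /h f0// min_l ?S0// subrr//.
    have : \forall j \near \oo, ramp (U n) j x = 1 by exact: ramp_eq1.
    move=> [N _ HN]; exists (maxn N n.+1).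
    rewrite /h min_l ?subrr//; apply: (@le_trans _ _ 1); first by case/andP: (f01 x).
    have nN : (n < maxn N n.+1)%N by rewrite leq_max ltnSn orbT.
    rewrite /S (bigD1 (Ordinal nN))//= HN /= ?leq_maxl// lerDl sumr_ge0// => k _.
    by case/andP: (ramp01 (U k) (maxn N n.+1) x).
have hS : L (h J) <= \sum_(n < J) cont (U n).
  apply: (@le_trans _ _ (L (S J))).
    apply: L_le => //; first by apply: Cb_min => //; exact: adm_Cb af.
    by move=> x; rewrite ge_min lexx orbT.
  rewrite L_sum; last by move=> n; exact: adm_Cb (ramp_adm _ _).
  by apply: ler_sum => n _; apply: le_cont; exact: ramp_adm.
apply: (@le_trans _ _ ((\sum_(n < J) cont (U n) + e)%:E)).
  rewrite lee_fin; move: fe hJ hS; rewrite [in leRHS](splitr e); lra.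
rewrite EFinD leeD2r// -sumEFin -(big_mkord xpredT (fun n => (cont (U n))%:E)).
by apply: nneseries_lim_ge => n _ _; rewrite lee_fin cont_ge0.
Qed.

Definition om (A : set E) : \bar R :=
  ereal_inf [set (cont U)%:E | U in [set U | open U /\ A `<=` U]].

Lemma om_ge0 A : (0 <= om A)%E.
Proof. by apply: le_ereal_inf_tmp => _ [U _ <-]; rewrite lee_fin cont_ge0. Qed.

Lemma le_om A U : open U -> A `<=` U -> (om A <= (cont U)%:E)%E.
Proof. by move=> oU AU; apply: ereal_inf_lbound; exists U. Qed.

Lemma om_open U : open U -> om U = (cont U)%:E.
Proof.
move=> oU; apply/eqP; rewrite eq_le le_om//=.
by apply: le_ereal_inf_tmp => _ [V [oV UV] <-]; rewrite lee_fin cont_mono.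
Qed.

Lemma om_fin A : om A \is a fin_num.
Proof.
rewrite ge0_fin_numE ?om_ge0//.
apply: le_lt_trans (le_om openT (@subsetT _ A)) _; exact: ltry.
Qed.

Let om0 : om set0 = 0%E.
Proof. by rewrite om_open ?cont0//; exact: open0. Qed.

Let om_mono : {homo om : A B / A `<=` B >-> (A <= B)%E}.
Proof.
move=> A B AB; apply: le_ereal_inf_tmp => _ [U [oU BU] <-].
by apply: le_om => //; exact: subset_trans BU.
Qed.

Lemma om_approx A e : 0 < e -> exists U, [/\ open U, A `<=` U &
  ((cont U)%:E < om A + e%:E)%E].
Proof.
move=> e0; have [_ [U [oU AU] <-] h] := lb_ereal_inf_adherent e0 (om_fin A).
by exists U.
Qed.

Let om_sub : sigma_subadditive om.
Proof.
move=> F; apply/lee_addgt0Pr => e e0.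
have H n : exists U, [/\ open U, F n `<=` U &
    ((cont U)%:E < om (F n) + (e / (2 ^ n.+1)%:R)%:E)%E].
  by apply: om_approx; rewrite divr_gt0// ltr0n expn_gt0.
have [U HU] := choice H.
apply: le_trans (epsilon_trick xpredT (fun n => om_ge0 (F n)) (ltW e0)).
apply: (@le_trans _ _ (\sum_(n <oo) (cont (U n))%:E)%E).
  have oU n : open (U n) by case: (HU n).
  apply: le_trans (cont_bigcup oU).
  apply: le_om; first by apply: bigcup_open => n _.
  by move=> x [n _ Fx]; exists n => //; case: (HU n) => _ + _; apply.
apply: lee_nneseries => n _; first by rewrite lee_fin cont_ge0.
by have [_ _ h] := HU n; exact: ltW h.
Qed.

HB.instance Definition _ := isOuterMeasure.Build R E om om0 om_ge0 om_mono om_sub.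

Lemma open_caratheodory U : open U -> om.-caratheodory U.
Proof.
move=> oU; apply: le_caratheodory_measurable => A.
apply/lee_addgt0Pr => e e0.
have [V [oV AV Ve]] := om_approx A (half_gt0 e0).
have e40 : 0 < e / 8 by rewrite divr_gt0.
have oVU : open (V `&` U) by exact: openI.
have [f [af fe]] := cont_approx (V `&` U) e40; have [cf f01 f0] := af.
pose c := e / 8 / (l1 + 1).
have c0 : 0 < c by rewrite /c !divr_gt0// ltr_wpDl.
pose K := [set x | c <= f x].
have oVK : open (V `&` ~` K).
  apply: openI => //; rewrite openC (_ : K = f @^-1` [set y | c <= y])//.
  by apply: preimage_closed => // x _; exact: cf.
have [g [ag ge]] := cont_approx (V `&` ~` K) e40; have [cg g01 g0] := ag.
have h1 : (om (A `&` U) <= (cont (V `&` U))%:E)%E.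
  by apply: le_om => //; exact: setSI.
have h2 : (om (A `&` ~` U) <= (cont (V `&` ~` K))%:E)%E.
  apply: le_om => // x [Ax nUx]; split; first exact: AV.
  by rewrite /K /= => cfx; move: c0; rewrite ltNge => /negP; apply; rewrite -(f0 x)// => -[].
pose f' x := Num.max 0 (f x - c).
have Cf' : Cb f'.
  apply: (@Cb_max (cst 0)); first exact: Cb_cst.
  by apply: (@CbD f (cst (- c))); [exact: adm_Cb af|exact: Cb_cst].
have afg : adm V (fun x => f' x + g x).
  split.
  - by case: (CbD Cf' (adm_Cb ag)).
  - move=> x; have /andP[? ?] := f01 x; have /andP[? ?] := g01 x.
    rewrite addr_ge0//= ?le_max ?lexx//.
    rewrite /f'; case: (leP 0 (f x - c)) => fc; last by rewrite add0r.
    by rewrite g0 ?addr0; [lra|move=> [_]; apply; rewrite /K /= -subr_ge0].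
  - move=> x Vx; rewrite g0; last by move=> [].
    by rewrite /f' f0 ?addr0 ?sub0r ?max_l// ?oppr_le0 ?ltW// => -[].
have Lf' : L f <= L f' + e / 8.
  apply: (@le_trans _ _ (L (fun x => f' x + c * cst 1 x))).
    apply: L_le; [exact: adm_Cb af|apply: CbD => //; apply: CbZ; exact: Cb_cst|].
    by move=> x; rewrite mulr1 -lerBlDr le_max lexx orbT.
  rewrite LD//; last by apply: CbZ; exact: Cb_cst.
  rewrite LZ; last exact: Cb_cst.
  rewrite lerD2l /c -/l1 mulrAC ler_pdivrMr ?ltr_wpDl//.
  by rewrite ler_pM2l// lerDl.
have := le_cont afg; rewrite LD//; last exact: adm_Cb ag.
move=> h3; apply: (le_trans (leeD h1 h2)).
have : cont (V `&` U) + cont (V `&` ~` K) <= cont V + e / 2 by lra.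
rewrite -lee_fin EFinD => /le_trans; apply.
rewrite EFinD [in leRHS](splitr e) EFinD addeA leeD2r// ltW//.
Qed.

Lemma borel_caratheodory (A : set Rd) : measurable A -> om.-caratheodory A.
Proof.
apply: smallest_sub; last exact: open_caratheodory.
split=> [|B HB|F HF].
- exact: caratheodory_measurable_set0.
- by rewrite setTD; exact: caratheodory_measurable_setC.
- exact: caratheodory_measurable_bigcup.
Qed.

Lemma om_is_fmeasure : @is_fmeasure _ Rd R om.
Proof.
split; [exact: om0|exact: om_ge0| |by move=> A _; exact: om_fin].
move=> F mF tF mUF.
exact: (@caratheodory_measure_sigma_additive R E om F
  (fun n => borel_caratheodory (mF n)) tF (borel_caratheodory mUF)).
Qed.

Definition riesz_measure : {finite_measure set Rd -> \bar R} := fmeasure om_is_fmeasure.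

(** Layer-cake decomposition: [N%:R * f] is the sum of layers [g j]. Both [L (g j)] and the integral
    of [g j] lie between the contents of [U j.+1] and [U j], so the [N] errors telescope to at most
    [l1]. *)
Lemma riesz_layer (f : E -> R) (N : nat) : (0 < N)%N -> continuous f ->
  (forall x, 0 <= f x <= 1) ->
  `|L f - \int[riesz_measure]_x f x| <= l1 / N%:R.
Proof.
move=> N0 cf f01; pose mu := riesz_measure.
have N0' : (0 : R) < N%:R by rewrite ltr0n.
pose g (j : nat) x := Num.min 1 (Num.max 0 (N%:R * f x - j%:R)).
have Cf : Cb f by exact: Cb01.
have Cg j : Cb (g j).
  apply: (@Cb_min (cst 1)); first exact: Cb_cst.
  apply: (@Cb_max (cst 0)); first exact: Cb_cst.
  by apply: (@CbD (fun x => N%:R * f x) (cst (- j%:R))); [exact: CbZ|exact: Cb_cst].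
have g01 j x : 0 <= g j x <= 1.
  by rewrite /g le_min ler01 le_max lexx ge_min lexx.
have fg x : N%:R * f x = \sum_(j < N) g j x.
  have : forall M, (M <= N)%N -> \sum_(j < M) g j x = Num.min M%:R (N%:R * f x).
    have fx0 : 0 <= N%:R * f x by rewrite mulr_ge0//; case/andP: (f01 x).
    elim=> [|M IH] MN; first by rewrite big_ord0 min_l.
    rewrite big_ord_recr /= IH ?(ltnW MN)// /g -natr1.
    have [h|h] := leP M%:R (N%:R * f x).
      rewrite max_r ?subr_ge0//.
      by case: (leP 1 (N%:R * f x - M%:R)); case: (leP (M%:R + 1) (N%:R * f x)); lra.
    rewrite max_l ?subr_le0 ?ltW// min_r ?ler01// addr0 min_r//; lra.
  move=> /(_ N (leqnn _)) ->; rewrite min_r//.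
  by rewrite ler_piMr//; case/andP: (f01 x).
pose U j := [set x | j%:R < N%:R * f x].
have oU j : open (U j).
  have -> : U j = (fun x => N%:R * f x) @^-1` [set y | j%:R < y] by [].
  by have /continuousP := (proj1 (CbZ N%:R Cf)); apply; exact: open_gt.
have mU j : measurable (U j : set Rd) by apply: sub_sigma_algebra; exact: oU.
have muU j : mu (U j) = (cont (U j))%:E by rewrite -om_open.
have mg j : measurable_fun setT (g j : Rd -> R).
  by apply: continuous_measurable_Rd; case: (Cg j).
have ig j : mu.-integrable setT (EFin \o (g j : Rd -> R)).
  apply: (@bounded_integrable _ Rd R mu (g j : Rd -> R) 1 (mg j)) => x.
  by have /andP[? ?] := g01 j x; rewrite ger0_norm.
have gU j : adm (U j) (g j).
  split; [by case: (Cg j)|exact: g01|].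
  move=> x /negP; rewrite -leNgt => h.
  by rewrite /g max_l ?subr_le0// min_r.
have g1 j x : U j.+1 x -> g j x = 1.
  rewrite /U /= -natr1 => h; rewrite /g min_l// le_max; apply/orP; right; lra.
have up j : L (g j) <= cont (U j) by exact: le_cont.
have lo j : cont (U j.+1) <= L (g j).
  apply: cont_le => h [ch h01 h0]; apply: L_le => //; first exact: Cb01.
  move=> x; have [Ux|nUx] := pselect (U j.+1 x).
    by rewrite g1//; case/andP: (h01 x).
  by rewrite h0//; case/andP: (g01 j x).
have icU j : \int[mu]_x (\1_(U j) x : R) = cont (U j).
  by rewrite Rintegral_indicT// muU.
have ii j : mu.-integrable setT (EFin \o (\1_(U j) : Rd -> R)).
  apply: (@bounded_integrable _ _ _ _ _ 1) => [|x]; first exact: measurable_indic.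
  by rewrite indicE; case: (_ \in _); rewrite /= ?normr0 ?normr1.
have upi j : \int[mu]_x g j x <= cont (U j).
  rewrite -icU; apply: le_Rintegral => // x _; rewrite indicE.
  have [Ux|nUx] := pselect (U j x); first by rewrite mem_set//; case/andP: (g01 j x).
  by rewrite memNset//; case: (gU j) => _ _ ->.
have loi j : cont (U j.+1) <= \int[mu]_x g j x.
  rewrite -icU; apply: le_Rintegral => // x _; rewrite indicE.
  have [Ux|nUx] := pselect (U j.+1 x); first by rewrite mem_set// g1.
  by rewrite memNset//; case/andP: (g01 j x).
have E1 : N%:R * L f = \sum_(j < N) L (g j).
  rewrite -LZ// -(L_sum (index_enum 'I_N) (fun j : 'I_N => Cg j)).
  by congr L; apply/funext => x; exact: fg.
have iF : mu.-integrable setT (EFin \o (f : Rd -> R)).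
  apply: (@bounded_integrable _ Rd R mu (f : Rd -> R) 1).
    exact: continuous_measurable_Rd.
  by move=> x; have /andP[? ?] := f01 x; rewrite ger0_norm.
have E2 : N%:R * \int[mu]_x f x = \sum_(j < N) \int[mu]_x g j x.
  have H : forall M, mu.-integrable setT (EFin \o (fun x : Rd => \sum_(j < M) g j x)) /\
      \int[mu]_x (\sum_(j < M) g j x) = \sum_(j < M) \int[mu]_x g j x.
    elim=> [|M [IH1 IH2]].
      split; last first.
        rewrite big_ord0 -[RHS](@mul0r _ (fine (mu setT))) -Rintegral_cst//.
        by apply: eq_Rintegral => x _; rewrite big_ord0.
      rewrite (_ : _ \o _ = cst 0%E); first exact: integrable0.
      by apply/funext => x /=; rewrite big_ord0.
    have -> : (fun x : Rd => \sum_(j < M.+1) g j x) =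
        (fun x : Rd => \sum_(j < M) g j x + g M x).
      by apply/funext => x; rewrite big_ord_recr.
    split; first exact: (integrableD measurableT IH1 (ig M)).
    by rewrite RintegralD// IH2 [RHS]big_ord_recr.
  rewrite -RintegralZl// -(proj2 (H N)).
  by apply: eq_Rintegral => x _; exact: fg.
rewrite ler_pdivlMr// mulrC -{1}(gtr0_norm N0') -normrM mulrBr E1 E2 -sumrB.
rewrite (le_trans (ler_norm_sum _ _ _))//.
apply: (@le_trans _ _ (\sum_(j < N) (cont (U j) - cont (U j.+1)))).
  apply: ler_sum => j _; rewrite ler_norml.
  have := up j; have := lo j; have := upi j; have := loi j => ? ? ? ?.
  by apply/andP; split; lra.
have -> : \sum_(j < N) (cont (U j) - cont (U j.+1)) = cont (U 0%N) - cont (U N).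
  have T (c : nat -> R) M : \sum_(j < M) (c j - c j.+1) = c 0%N - c M.
    elim: M => [|M IH]; first by rewrite big_ord0 subrr.
    by rewrite big_ord_recr IH /= subrKA.
  exact: T (fun j => cont (U j)) N.
rewrite lerBlDr ler_wpDr ?cont_ge0//; apply: cont_le => h ah.
apply: L_le; [exact: adm_Cb ah|exact: Cb_cst|].
by move=> x; case: ah => _ /(_ x)/andP[].
Qed.

Lemma riesz_representation01 (f : E -> R) : continuous f ->
  (forall x, 0 <= f x <= 1) -> \int[riesz_measure]_x f x = L f.
Proof.
move=> cf f01; apply/esym/eqP; rewrite -subr_eq0 -normr_le0.
apply/ler_addgt0Pl => e e0; rewrite addr0.
have : \forall N \near \oo, l1 / e <= N%:R by exact: nbhs_infty_ger.
move=> [M _ HM]; have MM : (0 < M.+1)%N by [].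
apply: le_trans (riesz_layer MM cf f01) _.
by rewrite ler_pdivrMr ?ltr0n// mulrC -ler_pdivrMr// HM/=.
Qed.

Lemma riesz_representation (f : E -> R) : Cb f -> \int[riesz_measure]_x f x = L f.
Proof.
move=> Cf; have [cf [M fM]] := Cf; set mu := riesz_measure.
pose N := `|M| + 1; have N0 : 0 < N by rewrite ltr_wpDl.
have fN x : `|f x| <= N by rewrite (le_trans (fM x))// (le_trans (ler_norm _))// lerDl.
(* Affine rescaling of the range [[-N, N]] to [[0, 1]]. *)
pose g x := (2 * N)^-1 * (f x + cst N x).
have Cg : Cb g by apply: CbZ; apply: CbD => //; exact: Cb_cst.
have g01 x : 0 <= g x <= 1.
  have := fN x; rewrite ler_norml => /andP[? ?].
  rewrite /g /= mulr_ge0 ?invr_ge0 ?mulr_ge0 ?(ltW N0)//=; last lra.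
  by rewrite ler_pdivrMl ?mulr_gt0//=; lra.
have fE : f = fun x => (2 * N) * g x + cst (- N) x.
  apply/funext => x; rewrite /g mulrA divff ?mul1r; last by rewrite gt_eqF// mulr_gt0.
  by rewrite /= addrK.
have ig (c : R) : mu.-integrable setT (EFin \o (fun x : Rd => c * g x)).
  apply: (@bounded_integrable _ Rd R mu _ `|c|).
    by apply: continuous_measurable_Rd; case: (CbZ c Cg).
  by move=> x; rewrite normrM ler_piMr// ger0_norm; case/andP: (g01 x).
have ic (c : R) : mu.-integrable setT (EFin \o (cst c : Rd -> R)).
  exact: (@bounded_integrable _ Rd R mu (cst c) `|c|).
have g1 : \int[mu]_x g x = L g by apply: riesz_representation01 => //; case: Cg.
have c1 : \int[mu]_x (1 : R) = L (cst 1).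
  by apply: (@riesz_representation01 (cst 1)) => [x|x]; [exact: cst_continuous|rewrite ler01 lexx].
rewrite [in LHS]fE RintegralD//; try exact: ic; try exact: ig.
rewrite RintegralZl//; last by have := ig 1; congr (integrable _ _ (_ \o _)); apply/funext => x; rewrite mul1r.
rewrite g1.
have -> : \int[mu]_x cst (- N) x = - N * \int[mu]_x (1 : R).
  by rewrite -RintegralZl//; [apply: eq_Rintegral => x _; rewrite mulr1|exact: (ic 1)].
rewrite c1 [in RHS]fE LD; [|exact: CbZ|exact: Cb_cst].
rewrite (LZ (2 * N) Cg); congr (_ + _).
rewrite -(LZ (- N) (Cb_cst 1)).
by congr L; apply/funext => x; rewrite mulr1.
Qed.

End Riesz.

(** * Compactness of tight families along an ultrafilter *)

Section Prokhorov.
Context (R : realType) (d : nat).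
Local Notation E := ('rV[R]_d).
Local Notation Rd := (euclid R d).
Context (I : Type) (F : set_system I) (uF : UltraFilter F).

(** The image of an ultrafilter is an ultrafilter, and one that contains a compact segment
    converges. *)
Lemma ultra_bounded_cvg (a : I -> R) C : (forall k, `|a k| <= C) -> cvg (a k @[k --> F]).
Proof.
move=> aC.
have uG : UltraFilter (a k @[k --> F]).
  split; first exact: fmap_proper_filter.
  move=> G pG FG; apply/seteqP; split=> // A GA.
  have [//|Fn] := in_ultra_setVsetC (a @^-1` A) uF.
  have GnA : G (~` A) by apply: FG.
  have h : G (A `&` ~` A) by exact: filterI.
  by rewrite setICr in h; case: (@filter_not_empty _ G pG h).
have := @segment_compact R (- C) C; rewrite compact_ultra => /(_ _ uG).
case.
  suff : F (a @^-1` `[- C, C]%classic) by [].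
  by apply: filterE => k; rewrite /= in_itv /= -ler_norml; exact: aC.
by move=> l [_ al]; apply/cvg_ex; exists l.
Qed.

Variables (m : I -> {finite_measure set Rd -> \bar R}) (C : R).
Hypothesis mC : forall k, (m k setT <= C%:E)%E.
Hypothesis m_tight : forall e, 0 < e -> exists r : R, forall k,
  (m k [set x : E | (r < `|x|)%R] <= e%:E)%E.

Lemma Cb_measure_integrable (mu : {finite_measure set Rd -> \bar R}) f : Cb f ->
  mu.-integrable setT (EFin \o (f : Rd -> R)).
Proof.
move=> [cf [M fM]].
apply: (@bounded_integrable _ Rd R mu (f : Rd -> R) M) => //.
exact: continuous_measurable_Rd.
Qed.

Lemma Rintegral_le_bound (mu : {finite_measure set Rd -> \bar R}) f M : Cb f ->
  (forall x, `|f x| <= M) -> `|\int[mu]_x f x| <= M * fine (mu setT).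
Proof.
move=> Cf fM; apply: le_trans (le_normr_Rintegral measurableT (Cb_measure_integrable mu Cf)) _.
rewrite -Rintegral_cst//; apply: le_Rintegral => //.
- have := integrable_abse (Cb_measure_integrable mu Cf); exact: eq_integrable.
- exact: (Cb_measure_integrable mu (Cb_cst _ M)).
Qed.

Lemma closed_ball_Rd_measurable r : measurable ([set x : E | (r < `|x|)%R] : set Rd).
Proof.
apply: sub_sigma_algebra => /=; rewrite (_ : [set _ | _] = ~` [set x : E | `|x| <= r]).
  by rewrite openC; exact: closed_norm_le.
by apply/seteqP; split=> x /=; [move=> h; apply/negP; rewrite -ltNge|move/negP; rewrite -ltNge].
Qed.

(* Compactness along an ultrafilter replaces the extraction of subsequences. *)
Lemma prokhorov : exists mu : {finite_measure set Rd -> \bar R},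
  forall f, Cb f -> \int[m k]_x f x @[k --> F] --> \int[mu]_x f x.
Proof.
pose L (f : E -> R) := lim (\int[m k]_x f x @[k --> F]).
have cL f : Cb f -> \int[m k]_x f x @[k --> F] --> L f.
  move=> Cf; have [cf [M fM]] := Cf.
  apply: (@ultra_bounded_cvg _ (`|M| * `|C|)) => k.
  have fM' x : `|f x| <= `|M| by apply: le_trans (fM x) _; exact: ler_norm.
  apply: le_trans (Rintegral_le_bound (m k) Cf fM') _.
  rewrite ler_wpM2l// (le_trans _ (ler_norm _))//.
  by rewrite -lee_fin fineK// fin_num_measure.
have LD f g : Cb f -> Cb g -> L (fun x => f x + g x) = L f + L g.
  move=> Cf Cg; apply: (cvg_lim (@Rhausdorff R)).
  rewrite (_ : (fun k => _) = (fun k => \int[m k]_x f x + \int[m k]_x g x)).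
    by apply: cvgD; exact: cL.
  apply/funext => k; rewrite RintegralD//; exact: Cb_measure_integrable.
have LZ c f : Cb f -> L (fun x => c * f x) = c * L f.
  move=> Cf; apply: (cvg_lim (@Rhausdorff R)).
  rewrite (_ : (fun k => _) = (fun k => c * \int[m k]_x f x)).
    by apply: cvgM; [exact: cvg_cst|exact: cL].
  apply/funext => k; rewrite RintegralZl//; exact: Cb_measure_integrable.
have L0 f : Cb f -> (forall x, 0 <= f x) -> 0 <= L f.
  move=> Cf f0; apply: (cvgr_to_ge (cL _ Cf)).
  by apply: nearW => k; apply: Rintegral_ge0.
have Lt e : 0 < e -> exists K : set E, compact K /\
  forall f, Cb f -> (forall x, 0 <= f x <= 1) -> (forall x, K x -> f x = 0) -> L f <= e.
  move=> e0; have [r Hr] := m_tight e0.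
  exists [set x | `|x| <= r]; split.
    apply: bounded_closed_compact; last exact: closed_norm_le.
    exists r; split=> [|N MN x /= xM]; first exact: num_real.
    by rewrite (le_trans xM)// ltW.
  move=> f Cf f01 fK; apply: (cvgr_to_le (cL _ Cf)).
  apply: nearW => k.
  have mr := closed_ball_Rd_measurable r.
  rewrite (@le_trans _ _ (\int[m k]_x \1_[set x : E | (r < `|x|)%R] x))//.
    apply: le_Rintegral => //; first exact: Cb_measure_integrable.
      apply: (@bounded_integrable _ _ _ _ _ 1) => [|x]; first exact: measurable_indic.
      by rewrite indicE; case: (_ \in _); rewrite /= ?normr0 ?normr1.
    move=> x _; rewrite indicE; have [xr|rx] := leP `|x| r.
      by rewrite fK.
    by rewrite mem_set//; case/andP: (f01 x).
  rewrite Rintegral_indicT// -lee_fin fineK ?fin_num_measure//; exact: Hr.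
exists (riesz_measure LD LZ L0 Lt) => f Cf.
by rewrite riesz_representation//; exact: cL.
Qed.

End Prokhorov.

(** * Momenta as functionals *)

Section OffNull.
Context d (X : measurableType d) (R : realType) (mu : {measure set X -> \bar R}).
Variables (N : set X) (mN : measurable N) (N0 : mu N = 0%E).
Import HBNNSimple.

(* The integral of a nonnegative function is a supremum over simple functions
   below it, so no measurability is needed here. *)
Lemma integral_off_null (D : set X) (f g : X -> \bar R) :
  (forall x, D x -> ~ N x -> f x = g x) ->
  (\int[mu]_(x in D) f x = \int[mu]_(x in D) g x)%E.
Proof.
move=> fg.
have H (a b : X -> \bar R) : (forall x, 0 <= b x)%E -> (forall x, ~ N x -> a x = b x) ->
    (ereal_sup [set sintegral mu h | h in [set h : {nnsfun X >-> R} | forall x, (h x)%:E <= a x]] <=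
     ereal_sup [set sintegral mu h | h in [set h : {nnsfun X >-> R} | forall x, (h x)%:E <= b x]])%E.
  move=> b0 ab; apply: ge_ereal_sup => _ [h ha <-]; apply: ereal_sup_ubound.
  exists (proj_nnsfun h (measurableC mN)) => [x /=|].
    rewrite mindicE; have [Nx|Nx] := pselect (N x).
      by rewrite memNset ?mulr0; [exact: b0|apply].
    by rewrite mem_set// mulr1 -ab.
  rewrite -!integralT_nnsfun; apply: ae_eq_integral => //.
  - exact/measurable_EFinP.
  - exact/measurable_EFinP.
  - exists N; split=> // x /=; apply: contra_notP => Nx _.
    by rewrite mindicE mem_set// mulr1.
have E (a b : X -> \bar R) : (forall x, 0 <= a x)%E -> (forall x, 0 <= b x)%E ->
    (forall x, ~ N x -> a x = b x) ->
    ereal_sup [set sintegral mu h | h in [set h : {nnsfun X >-> R} | forall x, ((h x)%:E <= a x)%E]] =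
    ereal_sup [set sintegral mu h | h in [set h : {nnsfun X >-> R} | forall x, ((h x)%:E <= b x)%E]].
  by move=> a0 b0 ab; apply/eqP; rewrite eq_le !H// => x /ab.
have fgD x : ~ N x -> (f \_ D) x = (g \_ D) x.
  by move=> Nx; rewrite !patchE; case: ifPn => // /set_mem Dx; exact: fg.
rewrite /integral; congr (_ - _)%E; apply: E => x; rewrite ?funepos_ge0 ?funeneg_ge0// => /fgD h.
  by rewrite !funeposE h.
by rewrite !funenegE h.
Qed.

Lemma Rintegral_off_null (D : set X) (f g : X -> R) :
  (forall x, D x -> ~ N x -> f x = g x) ->
  \int[mu]_(x in D) f x = \int[mu]_(x in D) g x.
Proof.
move=> fg; rewrite /Rintegral (integral_off_null (g := fun x => (g x)%:E))// => x Dx Nx.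
by rewrite fg.
Qed.

End OffNull.

(** * Representation of bounded functionals in [L^2] *)

Section SquareIntegrable.
Context d (X : measurableType d) (R : realType) (mu : {finite_measure set X -> \bar R}).
Implicit Types f g h w : X -> R.

Definition L2 f := measurable_fun setT f /\ mu.-integrable setT (EFin \o (fun x => f x ^+ 2)).

Lemma L2_mul f g : L2 f -> L2 g -> mu.-integrable setT (EFin \o (fun x => f x * g x)).
Proof.
move=> [mf f2] [mg g2].
apply: (@le_integrable _ _ _ mu _ (fun x => f x ^+ 2 + g x ^+ 2)).
- exact: measurable_funM.
- move=> x; rewrite [leRHS]ger0_norm ?addr_ge0 ?sqr_ge0// ler_norml.
  have := sqr_ge0 (f x - g x); have := sqr_ge0 (f x + g x) => ? ?.
  by apply/andP; split; nra.
- exact: (integrableD measurableT f2 g2).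
Qed.

Lemma L2D f g : L2 f -> L2 g -> L2 (fun x => f x + g x).
Proof.
move=> lf lg; have [mf f2] := lf; have [mg g2] := lg; split; first exact: measurable_funD.
have fg := L2_mul lf lg.
have := integrableD measurableT (integrableD measurableT f2 g2) (integrableZl measurableT 2 fg).
apply: eq_integrable => // x _; rewrite /= -EFinM -!EFinD; congr EFin; ring.
Qed.

Lemma L2Z c f : L2 f -> L2 (fun x => c * f x).
Proof.
move=> [mf f2]; split; first exact: measurable_funM.
have := integrableZl measurableT (c ^+ 2) f2.
apply: eq_integrable => // x _ /=; rewrite -EFinM; congr EFin; ring.
Qed.

Definition ip f g := \int[mu]_x (f x * g x).

Lemma ipC f g : ip f g = ip g f.
Proof. by apply: eq_Rintegral => x _; rewrite mulrC. Qed.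

Lemma ipDl f g h : L2 f -> L2 g -> L2 h ->
  ip (fun x => f x + g x) h = ip f h + ip g h.
Proof.
move=> lf lg lh; rewrite /ip -RintegralD//; try exact: L2_mul.
by apply: eq_Rintegral => x _; rewrite mulrDl.
Qed.

Lemma ipZl c f h : L2 f -> L2 h -> ip (fun x => c * f x) h = c * ip f h.
Proof.
move=> lf lh; rewrite /ip -RintegralZl//; last exact: L2_mul.
by apply: eq_Rintegral => x _; rewrite mulrA.
Qed.

Lemma ip_ge0 f : 0 <= ip f f.
Proof. by apply: Rintegral_ge0 => x _; rewrite -expr2 sqr_ge0. Qed.

Lemma ip_lincomb a b f g : L2 f -> L2 g ->
  ip (fun x => a * f x + b * g x) (fun x => a * f x + b * g x) =
  a ^+ 2 * ip f f + 2 * a * b * ip f g + b ^+ 2 * ip g g.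
Proof.
move=> lf lg.
have la := L2Z a lf; have lb := L2Z b lg; have lab := L2D la lb.
rewrite ipDl// !ipZl// ![ip _ (fun x => a * f x + b * g x)]ipC !ipDl// !ipZl//.
by rewrite [ip g f]ipC; ring.
Qed.

End SquareIntegrable.

Section L2Riesz.
Context d (X : measurableType d) (R : realType) (mu : {finite_measure set X -> \bar R}).
Variables (U : lmodType R) (S : set U) (T : U -> X -> R) (M : U -> R) (s : R).
Hypothesis S0 : S 0.
Hypothesis SD : forall (a : R) z y, S z -> S y -> S (a *: z + y).
Hypothesis TD : forall (a : R) z y x, S z -> S y -> T (a *: z + y) x = a * T z x + T y x.
Hypothesis MD : forall (a : R) z y, S z -> S y -> M (a *: z + y) = a * M z + M y.
Hypothesis TL : forall z, S z -> L2 mu (T z).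
Hypothesis bounded : forall z, S z -> 2 * M z - ip mu (T z) (T z) <= s.

Let J z := 2 * M z - ip mu (T z) (T z).
Let sJ := sup [set J z | z in S].
Let J_has_sup : has_sup [set J z | z in S].
Proof. by split; [exists (J 0); exists 0|exists s => _ [z /bounded ? <-]]. Qed.
Let J_le z : S z -> J z <= sJ.
Proof. by move=> Sz; apply: ub_le_sup; [case: J_has_sup|exists z]. Qed.

Let J_lincomb (a : R) z y : S z -> S y -> J (a *: z + y) =
  2 * a * M z + 2 * M y - (a ^+ 2 * ip mu (T z) (T z) + 2 * a * ip mu (T z) (T y) + ip mu (T y) (T y)).
Proof.
move=> Sz Sy; rewrite /J MD//.
have -> : T (a *: z + y) = fun x => a * T z x + 1 * T y x.
  by apply/funext => x; rewrite TD// mul1r.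
by rewrite ip_lincomb; [ring|exact: TL|exact: TL].
Qed.

Let T0 x : T 0 x = 0.
Proof. by have := TD (-1) x S0 S0; rewrite scaler0 addr0 mulN1r addNr. Qed.
Let M0 : M 0 = 0.
Proof. by have := MD (-1) S0 S0; rewrite scaler0 addr0 mulN1r addNr. Qed.

(** At the midpoint [J] is the mean of the two values plus a quarter of the squared distance of the
    images, and it is at most [sJ]. Near-maximizers therefore have nearby images. *)
Let parallelogram z y e : S z -> S y -> sJ - e <= J z -> sJ - e <= J y ->
  ip mu (fun x => T z x - T y x) (fun x => T z x - T y x) <= 4 * e.
Proof.
move=> Sz Sy Jz Jy.
have Sh : S ((1 / 2) *: z + ((1 / 2) *: y + 0)) by apply: SD => //; exact: SD.
have := J_le Sh; rewrite J_lincomb//; last exact: SD.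
have Th x : T ((1 / 2) *: y + 0) x = (1 / 2) * T y x by rewrite TD// T0 addr0.
rewrite (funext Th) MD// M0 addr0 (ipC _ _ (fun x => _ * T y x)).
have Lz := TL Sz; have Ly := TL Sy.
rewrite !ipZl//; last exact: L2Z.
rewrite (ipC _ (T y) (fun x => 1 / 2 * T y x)) ipZl//.
rewrite (_ : (fun x => T z x - T y x) = fun x => 1 * T z x + (- 1) * T y x); last first.
  by apply/funext => x; rewrite mul1r mulN1r.
rewrite ip_lincomb// [ip mu (T y) (T z)]ipC; move: Jz Jy; rewrite /J.
lra.
Qed.

(** [4 * eps n] equals [4^-n], so consecutive images are at distance at most [2^-n], which is
    summable. *)
Let eps (n : nat) : R := 4^-1 ^+ n / 4.
Let eps_gt0 n : 0 < eps n. Proof. by rewrite /eps divr_gt0// exprn_gt0. Qed.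
Let eps_le m n : (m <= n)%N -> eps n <= eps m.
Proof.
by move=> mn; rewrite /eps ler_pM2r// ler_wiXn2l// invf_le1// ler1n.
Qed.

(* The representative is the limit of the images [T z] of a maximizing sequence of
   [2 M z - ||T z||^2], so [S] need not be dense. *)
Lemma L2_riesz : exists w, [/\ L2 mu w, forall z, S z -> M z = ip mu (T z) w &
  forall e, 0 < e -> exists z, S z /\ ip mu w w <= 2 * M z - ip mu (T z) (T z) + e].
Proof.
have /choice[z_ Hz] : forall n, exists z, S z /\ sJ - eps n <= J z.
  move=> n; have [_ [z Sz <-] h] := sup_adherent (eps_gt0 n) J_has_sup.
  by exists z; split=> //; exact: ltW.
have Sz n : S (z_ n) by case: (Hz n).
have Jz n : sJ - eps n <= J (z_ n) by case: (Hz n).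
have Lz n : L2 mu (T (z_ n)) by exact: TL.
have mz n : measurable_fun setT (T (z_ n)) by case: (Lz n).
pose D n x := `|T (z_ n.+1) x - T (z_ n) x|.
have Dq m n : (n <= m)%N ->
    ip mu (fun x => T (z_ m) x - T (z_ n) x) (fun x => T (z_ m) x - T (z_ n) x) <= 4 * eps n.
  move=> nm; apply: parallelogram => //.
  by apply: le_trans (Jz m); rewrite lerD2l lerN2 eps_le.
have Lsub m n : L2 mu (fun x => T (z_ m) x - T (z_ n) x).
  rewrite (_ : (fun _ => _) = fun x => T (z_ m) x + (- 1) * T (z_ n) x).
    by apply: L2D => //; exact: L2Z.
  by apply/funext => x; rewrite mulN1r.
have mD n : measurable_fun setT (D n).
  by apply: measurableT_comp => //; exact: measurable_funB.
(* From [|c| <= 2^-n + 2^n * c^2], integrated against a squared distance of at most [4^-n]. *)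
have iD n : (\int[mu]_x (D n x)%:E <= (2^-1 ^+ n * (fine (mu setT) + 1))%:E)%E.
  pose b x : R := 2^-1 ^+ n * cst 1 x + 2 ^+ n * (T (z_ n.+1) x - T (z_ n) x) ^+ 2.
  have i1 : mu.-integrable setT (EFin \o (cst 1 : X -> R)).
    by apply: (@bounded_integrable _ _ _ _ _ 1) => // x; rewrite normr1.
  have i2 : mu.-integrable setT (EFin \o (fun x => (T (z_ n.+1) x - T (z_ n) x) ^+ 2)).
    by case: (Lsub n.+1 n).
  have ib : mu.-integrable setT (EFin \o b).
    exact: (integrableD measurableT (integrableZl measurableT _ i1) (integrableZl measurableT _ i2)).
  apply: (@le_trans _ _ (\int[mu]_x (b x)%:E)%E).
    apply: ge0_le_integral => //.
    - by move=> x _; rewrite lee_fin normr_ge0.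
    - by apply/measurable_EFinP.
    - by case/integrableP: ib.
    - move=> x _; rewrite lee_fin /D /b /= mulr1 -[X in _ + _ * X]real_normK ?num_real//.
      set c := `|_|; have c0 : 0 <= c by exact: normr_ge0.
      have p0 : (0 : R) < 2 ^+ n by rewrite exprn_gt0.
      rewrite exprVn -(ler_pM2l p0) mulrDr divff ?gt_eqF//.
      have := sqr_ge0 (2 ^+ n * c - 2^-1); nra.
  rewrite -(@fineK _ (\int[mu]_x (b x)%:E)%E); last exact: integrable_fin_num ib.
  rewrite lee_fin -[fine _]/(\int[mu]_x b x) RintegralD//; last 2 first.
    exact: (integrableZl measurableT _ i1).
    exact: (integrableZl measurableT _ i2).
  rewrite !RintegralZl// mulrDr lerD//.
    by rewrite Rintegral_cst// mul1r.
  have h := Dq n.+1 n (leqnSn n).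
  rewrite mulr1 (_ : \int[mu]_x _ = ip mu (fun x => T (z_ n.+1) x - T (z_ n) x) (fun x => T (z_ n.+1) x - T (z_ n) x)); last first.
    by apply: eq_Rintegral => x _; rewrite expr2.
  apply: (@le_trans _ _ (2 ^+ n * (4 * eps n))); first by rewrite ler_pM2l ?exprn_gt0.
  rewrite /eps [4 * _]mulrC divfK//.
  have -> : 4^-1 = 2^-1 * 2^-1 :> R by field.
  by rewrite exprMn mulrA -exprMn divff// expr1n mul1r.
pose F x : \bar R := (\sum_(0 <= n <oo) (D n x)%:E)%E.
have mF : measurable_fun setT F.
  apply: ge0_emeasurable_sum.
    by move=> k x _ _; rewrite lee_fin normr_ge0.
  by move=> k _; apply/measurable_EFinP.
have iF : mu.-integrable setT F.
  apply/integrableP; split=> //.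
  have F0 x : (0 <= F x)%E by apply: nneseries_ge0 => k _ _; rewrite lee_fin normr_ge0.
  rewrite (eq_integral F); last by move=> x _; rewrite gee0_abs.
  rewrite integral_nneseries//; last 2 first.
    by move=> n; apply/measurable_EFinP.
    by move=> n x _; rewrite lee_fin normr_ge0.
  apply: (@le_lt_trans _ _ (\sum_(0 <= n <oo) (2^-1 ^+ n * (fine (mu setT) + 1))%:E)%E).
    apply: lee_nneseries => // n _ _; apply: integral_ge0 => x _.
    by rewrite lee_fin normr_ge0.
  apply: (@le_lt_trans _ _ (2 * (fine (mu setT) + 1))%:E); last exact: ltry.
  have c0 : 0 <= fine (mu setT) + 1 by rewrite addr_ge0// fine_ge0.
  apply: lime_le.
    by apply: is_cvg_nneseries => n _ _; rewrite lee_fin mulr_ge0// exprn_ge0.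
  apply: nearW => n; rewrite sumEFin lee_fin -mulr_suml ler_wpM2r//.
  suff : \sum_(0 <= i < n) 2^-1 ^+ i <= 2 - 2 * 2^-1 ^+ n :> R.
    by move=> /le_trans; apply; rewrite lerBlDr lerDl mulr_ge0// exprn_ge0.
  elim: n => [|n IH]; first by rewrite big_nil expr0 mulr1 subrr.
  by rewrite big_nat_recr//= exprS; lra.
pose G := [set x | F x \is a fin_num].
have mG : measurable G by have := emeasurable_fin_num measurableT mF; rewrite setTI.
have muG : mu (~` G) = 0%E.
  have [N [mN N0 sN]] := integrable_ae measurableT iF.
  apply: (subset_measure0 _ mN) => //; first exact: measurableC.
  by apply: subset_trans sN => x /= Gx h; apply: Gx; exact: h.
(* Cut off on the null set where the telescoping series may diverge, so that the limit [w] exists at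
   every point. *)
pose t n x : R := \1_G x * T (z_ n) x.
have mt n : measurable_fun setT (t n).
  by apply: measurable_funM => //; exact: measurable_indic.
have ct x : cvg (t n x @[n --> \oo]).
  have [Gx|Gx] := pselect (G x); last first.
    rewrite (_ : (fun n => _) = cst 0); first exact: is_cvg_cst.
    by apply/funext => n; rewrite /t indicE memNset// mul0r.
  rewrite (_ : (fun n => _) = (fun n => T (z_ n) x)); last first.
    by apply/funext => n; rewrite /t indicE mem_set// mul1r.
  have cD : cvgn (series (D ^~ x)).
    apply: nondecreasing_is_cvgn.
      apply/nondecreasing_seqP => n; rewrite !seriesEnat /= big_nat_recr//= lerDl.
      exact: normr_ge0.
    exists (fine (F x)) => _ [n _ <-].
    rewrite -lee_fin fineK// seriesEnat /= -sumEFin.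
    by apply: nneseries_lim_ge => k _ _; rewrite lee_fin normr_ge0.
  have cd : cvgn (series (telescope (fun n => T (z_ n) x))).
    exact: (@normed_cvg R R^o (telescope (fun n => T (z_ n) x))).
  rewrite (_ : (fun n => _) = (fun n => T (z_ 0%N) x + series (telescope (fun n => T (z_ n) x)) n)).
    by apply: is_cvgD => //; exact: is_cvg_cst.
  by apply/funext => n; rewrite {1}(eq_sum_telescope (fun n => T (z_ n) x) n).
pose w x := lim (t n x @[n --> \oo]).
have tw x : t n x @[n --> \oo] --> w x by exact: ct.
have mw : measurable_fun setT w by apply: (measurable_fun_cvg mt) => x _; exact: tw.
have tT n : forall x, ~ (~` G) x -> t n x = T (z_ n) x.
  by move=> x /contrapT Gx; rewrite /t indicE mem_set// mul1r.
have Fatou n : (\int[mu]_x ((w x - t n x) ^+ 2)%:E <= (4 * eps n)%:E)%E.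
  have mq m : measurable_fun setT (fun x => ((t (m + n)%N x - t n x) ^+ 2)%:E).
    by apply/measurable_EFinP; apply: measurable_funX; exact: measurable_funB.
  have h := @fatou _ X R mu setT measurableT
    (fun m x => ((t (m + n)%N x - t n x) ^+ 2)%:E) mq
    (fun m x _ => @sqr_ge0 R (t (m + n)%N x - t n x)).
  have -> : (\int[mu]_x ((w x - t n x) ^+ 2)%:E = \int[mu]_x limn_einf
      (fun m => ((t (m + n)%N x - t n x) ^+ 2)%:E))%E.
    apply: eq_integral => x _.
    have c1 : ((t (m + n)%N x - t n x) ^+ 2)%:E @[m --> \oo] --> ((w x - t n x) ^+ 2)%:E.
      apply: cvg_EFin; first exact: nearW.
      have c2 : t (m + n)%N x - t n x @[m --> \oo] --> w x - t n x.
        apply: cvgB; last exact: cvg_cst.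
        by rewrite (cvg_shiftn n (fun m => t m x)); exact: tw.
      rewrite (_ : fine \o _ = (fun m => (t (m + n)%N x - t n x) * (t (m + n)%N x - t n x))).
        by rewrite expr2; exact: cvgM.
      by apply/funext => m; rewrite /= expr2.
    rewrite is_cvg_limn_einfE; last by apply/cvg_ex; eexists; exact: c1.
    by apply/esym/cvg_lim.
  apply: (le_trans h); rewrite limn_einf_lim; apply: lime_le; first exact: is_cvg_einfs.
  apply: nearW => m; apply: (@le_trans _ _ (\int[mu]_x ((t (m + n)%N x - t n x) ^+ 2)%:E)%E).
    by apply: ereal_inf_lbound; exists m => //=.
  have [mL iL] := Lsub (m + n)%N n.
  apply: (@le_trans _ _ (\int[mu]_x ((T (z_ (m + n)%N) x - T (z_ n) x) ^+ 2)%:E)%E).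
    apply: ge0_le_integral => //.
    - by move=> x _; rewrite lee_fin sqr_ge0.
    - by case/integrableP: iL.
    - move=> x _; rewrite lee_fin /t -mulrBr exprMn ler_piMl ?sqr_ge0//.
  rewrite -(@fineK _ (\int[mu]_x ((T (z_ (m + n)%N) x - T (z_ n) x) ^+ 2)%:E)%E); last exact: integrable_fin_num iL.
  rewrite lee_fin; apply: le_trans (Dq (m + n)%N n (leq_addl _ _)).
  by rewrite -[fine _]/(\int[mu]_x (T (z_ (m + n)%N) x - T (z_ n) x) ^+ 2) le_eqVlt; apply/orP; left; apply/eqP; apply: eq_Rintegral => x _; rewrite expr2.
have Lt n : L2 mu (t n).
  split=> //; have [_ iz] := Lz n.
  apply: le_integrable iz => [|x]; first exact: measurable_funX.
  rewrite /t exprMn normrM ler_piMl//.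
  by rewrite indicE; case: (_ \in _); rewrite /= ?expr1n ?expr0n ?normr0 ?normr1.
have mG' := measurableC mG.
have ipt n f : ip mu f (t n) = ip mu f (T (z_ n)).
  by apply: (Rintegral_off_null mG' muG) => x _ /(tT n) ->.
have Le n : L2 mu (fun x => w x - t n x).
  split; first exact: measurable_funB.
  apply/integrableP; split; first by apply/measurable_EFinP; apply: measurable_funX; exact: measurable_funB.
  under eq_integral do rewrite gee0_abs ?lee_fin ?sqr_ge0//.
  by apply: le_lt_trans (Fatou n) _; exact: ltry.
have Lw : L2 mu w.
  rewrite (_ : w = fun x => (w x - t 0%N x) + t 0%N x); first exact: L2D.
  by apply/funext => x; rewrite subrK.
have ee n : ip mu (fun x => w x - t n x) (fun x => w x - t n x) <= 4 * eps n.
  rewrite -lee_fin; apply: le_trans (Fatou n).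
  rewrite /ip /Rintegral fineK; last exact: integrable_fin_num (L2_mul (Le n) (Le n)).
  by rewrite le_eqVlt; apply/orP; left; apply/eqP; apply: eq_integral => x _; rewrite expr2.
have eps_small e : 0 < e -> exists n, 5 * eps n < e.
  move=> e0; have : \forall n \near \oo, `|(4^-1 : R) ^+ n| < e / 2.
    have := @cvg_expr R 4^-1; rewrite ger0_norm ?invr_ge0// invf_lt1// ltr1n => /(_ isT).
    by move/cvgr0Pnorm_lt; apply; exact: half_gt0.
  move=> [n _ /(_ n (leqnn n)) h]; exists n; rewrite /eps.
  by move: h; rewrite /= ger0_norm ?exprn_ge0//; lra.
have ipw n f : L2 mu f -> ip mu f w = ip mu f (T (z_ n)) + ip mu f (fun x => w x - t n x).
  move=> Lf; rewrite -ipt !(ipC _ f) -ipDl//.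
  by congr ip; apply/funext => x; rewrite addrC subrK.
have Mw z : S z -> M z = ip mu (T z) w.
  move=> Sz'; set Q := ip mu (T z) (T z); set dl := M z - ip mu (T z) w.
  have Q0 : 0 <= Q by exact: ip_ge0.
  (* First variation: [J] at [a *: z + z_ n] is at most [sJ], hence at most [eps n] above its value
     at [z_ n]. Replacing the image of [z_ n] by [w] costs another [4 * eps n] and a second
     [a ^+ 2 * Q]. *)
  have key a n : 2 * a * dl <= 5 * eps n + 2 * a ^+ 2 * Q.
    have := J_le (SD a Sz' (Sz n)); rewrite J_lincomb// -/Q => h1.
    have := Jz n; rewrite /J => h2.
    have Lz' := TL Sz'.
    have h3 : 0 <= a ^+ 2 * Q + 2 * a * ip mu (T z) (fun x => w x - t n x) +
       ip mu (fun x => w x - t n x) (fun x => w x - t n x).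
      have := ip_ge0 mu (fun x => a * T z x + 1 * (w x - t n x)).
      by rewrite ip_lincomb// -/Q expr1n mulr1 mul1r.
    by rewrite /dl (ipw n)//; have := ee n; lra.
  have key2 a : 2 * a * dl <= 2 * a ^+ 2 * Q.
    apply/ler_addgt0Pl => e /eps_small[n hn].
    by apply: le_trans (key a n) _; rewrite lerD2r ltW.
  have dl0 : dl ^+ 2 <= 0.
    have q1 : 0 < Q + 1 by rewrite ltr_wpDl.
    (* A linear term in [a] bounded by a quadratic one must vanish; this value of [a] shows it, the
       added 1 covering [Q = 0]. *)
    have := key2 (dl / (Q + 1)).
    have -> : 2 * (dl / (Q + 1)) * dl = 2 * (dl ^+ 2 / (Q + 1)) by field; rewrite gt_eqF.
    have -> : 2 * (dl / (Q + 1)) ^+ 2 * Q = 2 * (dl ^+ 2 / (Q + 1) * (Q / (Q + 1))) by field; rewrite gt_eqF.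
    rewrite ler_pM2l// => h.
    have : dl ^+ 2 / (Q + 1) * (1 - Q / (Q + 1)) <= 0 by rewrite mulrBr mulr1 subr_le0.
    have -> : 1 - Q / (Q + 1) = (Q + 1)^-1 by field; rewrite gt_eqF.
    by rewrite pmulr_lle0 ?invr_gt0// pmulr_lle0 ?invr_gt0.
  apply/eqP; rewrite -subr_eq0 -/dl -sqrf_eq0 eq_le dl0 sqr_ge0//.
exists w; split=> // e e0; have [n hn] := eps_small _ e0.
exists (z_ n); split=> //; rewrite Mw// (ipC _ _ w) (ipw n)//.
have := ee n; have := eps_gt0 n.
have -> : ip mu w (T (z_ n)) = ip mu (T (z_ n)) (T (z_ n)) + ip mu (T (z_ n)) (fun x => w x - t n x).
  by rewrite ipC (ipw n).
have -> : ip mu w (fun x => w x - t n x) = ip mu (T (z_ n)) (fun x => w x - t n x) +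
    ip mu (fun x => w x - t n x) (fun x => w x - t n x).
  rewrite ipC (ipw n)// (ipC _ (fun x => w x - t n x) (T (z_ n))).
  by [].
lra.
Qed.

End L2Riesz.

(** * Measures on space-time *)

Lemma measurable_fine_comp d (Y : measurableType d) (R : realType) (F : Y -> \bar R) :
  measurable_fun setT F -> measurable_fun setT (fun x => fine (F x)).
Proof.
move=> mF; apply/measurable_EFinP.
rewrite (_ : _ \o _ = fun x => if F x \is a fin_num then F x else 0%E).
  apply: measurable_fun_ifT => //; apply: (measurable_fun_bool true) => /=.
  by have := emeasurable_fin_num measurableT mF; rewrite setTI.
by apply/funext => x /=; case: (F x).
Qed.

Section SpaceTimeMeasure.
Context (R : realType) (d : nat).
Local Notation Rd := (euclid R d).
Local Notation T := (measurableTypeR R).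
Local Notation X := (Rd * T)%type.
Local Notation leb := (@lebesgue_measure R).
Local Notation I01 := ([set` `[(0 : R), 1]] : set T).

Let m01 : measurable I01. Proof. exact: measurable_itv. Qed.

Lemma leb01 : leb I01 = 1%E.
Proof. by rewrite lebesgue_measure_itv /= lte_fin ltr01 oppr0 adde0. Qed.

(** Lebesgue measure restricted to the unit interval, presented as a kernel from the one-point type
    so that the measure on space-time arises by composition of kernels. *)
Definition time_measure of unit : {measure set T -> \bar R} := mrestr leb m01.

Let time_kernel U : measurable U -> measurable_fun [set: unit] (time_measure ^~ U).
Proof. by move=> _; exact: measurable_cst. Qed.

HB.instance Definition _ := isKernel.Build _ _ _ _ R time_measure time_kernel.

Let time_uub : measure_fam_uub time_measure.
Proof.
exists 2 => x; rewrite /time_measure /= /mrestr setTI leb01 lte_fin.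
by rewrite ltr1n.
Qed.

HB.instance Definition _ := Kernel_isFinite.Build _ _ _ _ R time_measure time_uub.

Lemma integral_time_measure (f : T -> \bar R) : measurable_fun setT f ->
  (forall t, 0 <= f t)%E ->
  (\int[time_measure tt]_t f t = \int[leb]_(t in I01) f t)%E.
Proof.
move=> mf f0; have mC := measurableC m01.
rewrite -[X in (\int[_]_(t in X) _)%E](setUv I01) ge0_integral_setU//; last 2 first.
  by rewrite setUv.
  by apply/disj_set2P; rewrite setICr.
have -> : (\int[time_measure tt]_(t in ~` I01) f t = 0)%E.
  apply: null_set_integral => //; first exact: measurable_funTS.
  by rewrite /time_measure /= /mrestr setICl measure0.
rewrite adde0.
apply: eq_measure_integral => A mA AI; rewrite /time_measure /= /mrestr.
by rewrite setIidl.
Qed.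

Variable k : T -> {finite_measure set Rd -> \bar R}.
Variable C : R.
Hypothesis mk : forall A, measurable A -> measurable_fun setT (fun t => k t A).
Hypothesis kC : forall t, (k t setT <= C%:E)%E.

Definition skernel (mk : forall A, measurable A -> measurable_fun setT (fun t => k t A))
  (kC : forall t, (k t setT <= C%:E)%E) : T -> {measure set Rd -> \bar R} := k.
HB.instance Definition _ := isKernel.Build _ _ _ _ R (skernel mk kC) mk.
Let skernel_uub : measure_fam_uub (skernel mk kC).
Proof. by exists (C + 1) => t; apply: (le_lt_trans (kC t)); rewrite lte_fin ltrDl. Qed.
HB.instance Definition _ := Kernel_isFinite.Build _ _ _ _ R (skernel mk kC) skernel_uub.

Lemma measurable_slice_integral (h : X -> \bar R) : (forall p, 0 <= h p)%E ->
  measurable_fun setT h -> measurable_fun setT (fun t => \int[k t]_x h (x, t))%E.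
Proof.
move=> h0 mh.
apply: (@measurable_fun_integral_finite_kernel _ _ _ _ _
  (fun q : T * Rd => h (q.2, q.1)) (skernel mk kC)) => //.
apply: (measurableT_comp mh).
by apply: measurable_fun_pair; [exact: measurable_snd|exact: measurable_fst].
Qed.

Lemma slice_measureE U t : measurable U ->
  (k t ((fun x : Rd => (x, t)) @^-1` U) = \int[k t]_x (\1_U (x, t) : R)%:E)%E.
Proof.
move=> mU; have mUt : measurable ((fun x : Rd => (x, t)) @^-1` U).
  by rewrite -[_ @^-1` _]setTI; exact: (measurable_slice t).
transitivity (\int[k t]_x (\1_((fun x : Rd => (x, t)) @^-1` U) x)%:E)%E.
  by rewrite integral_indic// setIT.
by apply: eq_integral => x _; rewrite !indicE; congr (_%:R%:E).
Qed.

(** Each [k t] is placed on the slice at time [t]; composing with [time_measure] then gives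
    [k t (dx) dt]. *)
Definition lift_kernel of (forall A, measurable A -> measurable_fun setT (fun t => k t A))
  & (forall t, (k t setT <= C%:E)%E) := fun q : unit * T => fpush (k q.2) (measurable_slice q.2).

Definition slift_kernel : unit * T -> {measure set X -> \bar R} := lift_kernel mk kC.

Let slift_measurable U : measurable U -> measurable_fun setT (slift_kernel ^~ U).
Proof.
move=> mU.
have : measurable_fun setT (fun t => \int[k t]_x (\1_U (x, t) : R)%:E)%E.
  apply: (measurable_slice_integral (h := fun p => (\1_U p)%:E)).
    by move=> p; rewrite lee_fin.
  by apply/measurable_EFinP; exact: measurable_indic.
move=> h1.
have h2 : measurable_fun setT ((fun t => \int[k t]_x (\1_U (x, t) : R)%:E)%E \o (snd : unit * T -> T)).
  by apply: measurableT_comp h1 _; exact: measurable_snd.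
rewrite (_ : slift_kernel ^~ U = (fun t => \int[k t]_x (\1_U (x, t) : R)%:E)%E \o snd)//.
by apply/funext => -[u t]; rewrite /= -slice_measureE.
Qed.

HB.instance Definition _ := isKernel.Build _ _ _ _ R slift_kernel slift_measurable.
Let slift_uub : measure_fam_uub slift_kernel.
Proof. by exists (C + 1) => t; apply: (le_lt_trans (kC t.2)); rewrite lte_fin ltrDl. Qed.
HB.instance Definition _ := Kernel_isFinite.Build _ _ _ _ R slift_kernel slift_uub.

Definition st_fun : set X -> \bar R := kcomp time_measure slift_kernel tt.

Lemma st_funE A : measurable A ->
  st_fun A = (\int[leb]_(t in I01) \int[k t]_x (\1_A (x, t) : R)%:E)%E.
Proof.
move=> mA; rewrite /st_fun /kcomp integral_time_measure.
- by apply: eq_integral => t _; rewrite -slice_measureE.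
- have h1 := slift_measurable mA.
  apply: (measurableT_comp h1 (_ : measurable_fun setT (fun t : T => (tt, t)))).
  by apply: measurable_fun_pair => //; exact: measurable_cst.
- by move=> t; exact: measure_ge0.
Qed.

Lemma st_is_fmeasure : is_fmeasure st_fun.
Proof.
split.
- exact: (@measure0 _ _ _ ((time_measure \; slift_kernel)%E tt)).
- move=> A; exact: (@measure_ge0 _ _ _ ((time_measure \; slift_kernel)%E tt)).
- exact: (@measure_semi_sigma_additive _ _ _ ((time_measure \; slift_kernel)%E tt)).
- move=> A mA; rewrite ge0_fin_numE; last first.
    exact: (@measure_ge0 _ _ _ ((time_measure \; slift_kernel)%E tt)).
  have C0 : 0 <= C by rewrite -lee_fin; apply: le_trans (kC 0).
  have h1 : measurable_fun setT (fun p => (\1_A p : R)%:E).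
    by apply/measurable_EFinP; exact: measurable_indic.
  have h0 p : (0 <= (\1_A p : R)%:E)%E by rewrite lee_fin.
  rewrite st_funE//; apply: (@le_lt_trans _ _ (\int[leb]_(t in I01) C%:E)%E).
    apply: ge0_le_integral => //.
    - by move=> t _; exact: integral_ge0.
    - apply: measurable_funTS; exact: (measurable_slice_integral h0 h1).
    - move=> t _; rewrite -slice_measureE//; apply: le_trans (kC t).
      apply: le_measure; rewrite ?inE//.
      by rewrite -[_ @^-1` _]setTI; exact: (measurable_slice t).
  by rewrite integral_cst//= lebesgue_measure_itv /= lte_fin ltr01 oppr0 adde0 mule1 ltry.
Qed.

Definition stm : {finite_measure set X -> \bar R} := fmeasure st_is_fmeasure.

Lemma stm_integral (h : X -> \bar R) : (forall p, 0 <= h p)%E ->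
  measurable_fun setT h ->
  (\int[stm]_p h p = \int[leb]_(t in I01) \int[k t]_x h (x, t))%E.
Proof.
move=> h0 mh; have := @integral_kcomp _ _ _ _ _ _ _ time_measure slift_kernel tt h h0 mh.
move=> ->.
have E t : (\int[slift_kernel (tt, t)]_z h z = \int[k t]_x h (x, t))%E.
  exact: (ge0_integral_fpush (k t) (measurable_slice t) mh h0).
under eq_integral do rewrite E.
rewrite integral_time_measure//; first exact: measurable_slice_integral.
by move=> t; apply: integral_ge0.
Qed.

(** Positive and negative parts are handled separately. For almost every time the slices are
    integrable; the remaining times, where a slice integral may be infinite, form a null set. *)
Lemma stm_Rintegral (h : X -> R) : stm.-integrable setT (EFin \o h) ->
  \int[leb]_(t in I01) (\int[k t]_x h (x, t)) = \int[stm]_p h p.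
Proof.
move=> ih; have [/measurable_EFinP mh _] := integrableP _ _ _ ih.
pose hp p := Num.max (h p) 0; pose hn p := Num.max (- h p) 0.
have hE p : h p = hp p - hn p.
  by rewrite /hp /hn; case: (leP (h p) 0); case: (leP (- h p) 0); lra.
have hA p : `|h p| = hp p + hn p.
  have [h0|h0] := leP 0 (h p).
    by rewrite ger0_norm// /hp /hn max_l// max_r ?oppr_le0// addr0.
  by rewrite ltr0_norm// /hp /hn max_r ?(ltW h0)// max_l ?oppr_ge0 ?(ltW h0)// add0r.
have hp0 p : 0 <= hp p by rewrite le_max lexx orbT.
have hn0 p : 0 <= hn p by rewrite le_max lexx orbT.
have mhp : measurable_fun setT hp by apply: measurable_maxr => //; exact: measurable_cst.
have mhn : measurable_fun setT hn.
  by apply: measurable_maxr; [exact: measurableT_comp|exact: measurable_cst].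
have ihp : stm.-integrable setT (EFin \o hp).
  by apply: le_integrable ih => // p; rewrite (ger0_norm (hp0 p)) hA lerDl.
have ihn : stm.-integrable setT (EFin \o hn).
  by apply: le_integrable ih => // p; rewrite (ger0_norm (hn0 p)) hA lerDr.
have K (g : X -> R) : (forall p, 0 <= g p) -> measurable_fun setT g ->
    stm.-integrable setT (EFin \o g) ->
    exists N, [/\ measurable N, leb N = 0%E,
      forall t, I01 t -> ~ N t -> (k t).-integrable setT (EFin \o (fun x => g (x, t))) &
      leb.-integrable I01 (fun t => \int[k t]_x (g (x, t))%:E)%E].
  move=> g0 mg ig.
  have mgs : measurable_fun setT (fun t => \int[k t]_x (g (x, t))%:E)%E.
    apply: (measurable_slice_integral (h := fun p => (g p)%:E)); last exact/measurable_EFinP.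
    by move=> p; rewrite lee_fin.
  have igs : leb.-integrable I01 (fun t => \int[k t]_x (g (x, t))%:E)%E.
    apply/integrableP; split; first exact: measurable_funTS.
    rewrite (eq_integral (fun t => \int[k t]_x (g (x, t))%:E)%E); last first.
      by move=> t _; rewrite gee0_abs// integral_ge0// => x _; rewrite lee_fin.
    rewrite -(stm_integral (h := fun p => (g p)%:E)); last exact/measurable_EFinP.
      have := integrable_fin_num measurableT ig.
      by rewrite ge0_fin_numE// integral_ge0// => p _; rewrite lee_fin.
    by move=> p; rewrite lee_fin.
  have [N [mN N0 sN]] := integrable_ae m01 igs.
  exists N; split=> // t It Nt; apply/integrableP; split.
    by apply/measurable_EFinP; apply: (measurableT_comp mg); exact: measurable_slice.
  have := contra_notP (sN t) Nt => /= fin.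
  have {}fin : (\int[k t]_x (g (x, t))%:E)%E \is a fin_num.
    by apply: contrapT => nf; apply: Nt; apply: sN => /= /(_ It).
  rewrite (eq_integral (fun x => (g (x, t))%:E)); last first.
    by move=> x _; rewrite /= ger0_norm.
  by move: fin; rewrite ge0_fin_numE// integral_ge0// => x _; rewrite lee_fin.
have [N1 [mN1 N10 i1 j1]] := K _ hp0 mhp ihp.
have [N2 [mN2 N20 i2 j2]] := K _ hn0 mhn ihn.
have mN : measurable (N1 `|` N2) by exact: measurableU.
have N0 : leb (N1 `|` N2) = 0%E by apply: null_set_setU.
have E1 (g : X -> R) : (forall p, 0 <= g p) -> measurable_fun setT g ->
    stm.-integrable setT (EFin \o g) ->
    \int[leb]_(t in I01) (\int[k t]_x g (x, t)) = \int[stm]_p g p.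
  move=> g0 mg ig; have [N [mN' N0' iN jN]] := K _ g0 mg ig.
  rewrite /Rintegral (stm_integral (h := fun p => (g p)%:E)); last exact/measurable_EFinP.
    congr fine; apply: (integral_off_null mN' N0') => t It Nt.
    by rewrite fineK// integrable_fin_num// iN.
  by move=> p; rewrite lee_fin.
have Rj (g : X -> R) : (forall p, 0 <= g p) -> measurable_fun setT g ->
    leb.-integrable I01 (fun t => \int[k t]_x (g (x, t))%:E)%E ->
    leb.-integrable I01 (EFin \o (fun t => \int[k t]_x g (x, t))).
  move=> g0 mg ig; have [mg0 fg] := integrableP _ _ _ ig.
  have mf : measurable_fun I01 (EFin \o (fun t : T => \int[k t]_x g (x, t))).
    apply/measurable_EFinP/measurable_funTS/measurable_fine_comp.
    apply: (measurable_slice_integral (h := fun p => (g p)%:E)); last exact/measurable_EFinP.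
    by move=> p; rewrite lee_fin.
  apply/integrableP; split=> //; apply: le_lt_trans fg; apply: ge0_le_integral => //.
  - exact: measurableT_comp.
  - exact: measurableT_comp.
  - move=> t _; rewrite /Rintegral /=.
    by case: (\int[k t]_x (g (x, t))%:E)%E => [r| |] //=; rewrite ?normr0 ?leey.
rewrite (_ : \int[stm]_p h p = \int[stm]_p hp p - \int[stm]_p hn p); last first.
  by rewrite -RintegralB//; apply: eq_Rintegral => p _; exact: hE.
rewrite -(E1 _ hp0)// -(E1 _ hn0)// -RintegralB//; [|exact: (Rj hp)|exact: (Rj hn)].
apply: (Rintegral_off_null mN N0) => t It /not_orP[n1 n2].
rewrite -RintegralB//; [|exact: i1|exact: i2].
by apply: eq_Rintegral => x _; exact: hE.
Qed.

End SpaceTimeMeasure.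

(** * Jointly measurable densities of a family of measures *)

Section Densities.
Context d (Y : measurableType d) (R : realType).
Variables (m mb : {finite_measure set Y -> \bar R}) (g : Y -> R).
Hypotheses (mg : measurable_fun setT g) (g0 : forall x, 0 <= g x).
Hypothesis mE : forall A, measurable A -> m A = (\int[mb]_(x in A) (g x)%:E)%E.
Local Notation RN := (Radon_Nikodym_SigmaFinite.f m mb).

Lemma density_dominates : m `<< mb.
Proof.
apply/null_content_dominatesP => A mA mA0; rewrite mE//.
by apply: null_set_integral => //; apply/measurable_EFinP; exact: measurable_funTS.
Qed.

Lemma density_ae : ae_eq mb setT RN (EFin \o g).
Proof.
apply: integral_ae_eq => //.
- exact: (Radon_Nikodym_SigmaFinite.f_integrable density_dominates).
- exact/measurable_EFinP.
- move=> A _ mA; rewrite -mE// -Radon_Nikodym_SigmaFinite.f_integral//.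
  exact: density_dominates.
Qed.

Lemma density_integral (h : Y -> \bar R) : measurable_fun setT h ->
  (forall x, 0 <= h x)%E ->
  (\int[m]_x h x = \int[mb]_x (h x * (g x)%:E))%E.
Proof.
move=> mh h0.
rewrite -(Radon_Nikodym_SigmaFinite.change_of_variables density_dominates)//.
have [mRN _] := integrableP _ _ _ (Radon_Nikodym_SigmaFinite.f_integrable density_dominates).
apply: ae_eq_integral => //.
- exact: emeasurable_funM.
- by apply: emeasurable_funM => //; exact/measurable_EFinP.
- by apply: filterS density_ae => x /= + _ => ->.
Qed.

End Densities.

Section BoxSystem.
Context (R : realType) (d : nat).
Local Notation E := ('rV[R]_d).
Local Notation Rd := (euclid R d).

Definition obox (i : 'rV[rat]_d * 'rV[rat]_d) : set E :=
  [set x | forall k, ratr (i.1 0 k) < x 0 k < ratr (i.2 0 k)].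

(** A countable family stable under intersection, as uniqueness of measures demands. The whole space
    is added so that the family exhausts it and total masses are compared. *)
Definition orec (i : option ('rV[rat]_d * 'rV[rat]_d)) : set E :=
  if i is Some i then obox i else setT.

Lemma orec_measurable i : measurable (orec i : set Rd).
Proof.
case: i => [i|] /=; last exact: measurableT.
rewrite (_ : obox i = \bigcap_(k in [set: 'I_d])
  ((fun x : Rd => (x : E) 0 k) @^-1` `]ratr (i.1 0 k), ratr (i.2 0 k)[)).
  apply: fin_bigcap_measurable => [|k _]; first exact: finite_finset.
  rewrite -[X in measurable X]setTI.
  by apply: (measurable_coord k) => //; exact: measurable_itv.
apply/seteqP; split=> x h k; first by move=> _; rewrite /= in_itv /=; exact: h.
by have := h k I; rewrite /= in_itv /=.
Qed.

Lemma orecI : setI_closed [set A | exists i, A = orec i].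
Proof.
move=> _ _ [[i|] ->] [[j|] ->]; rewrite ?setIT ?setTI; [|by exists (Some i)|by exists (Some j)|by exists None].
exists (Some (\row_k Num.max (i.1 0 k) (j.1 0 k), \row_k Num.min (i.2 0 k) (j.2 0 k))).
have rmax (a b : rat) : ratr (Num.max a b) = Num.max (ratr a) (ratr b) :> R.
  by rewrite /Order.max ltr_rat; case: ifP.
have rmin (a b : rat) : ratr (Num.min a b) = Num.min (ratr a) (ratr b) :> R.
  by rewrite /Order.min ltr_rat; case: ifP.
apply/seteqP; split=> x /=.
  by move=> [hi hj] k; rewrite !mxE rmax rmin gt_max lt_min; have /andP[-> ->] := hi k; have /andP[-> ->] := hj k.
by move=> h; split=> k; have := h k; rewrite !mxE rmax rmin gt_max lt_min => /andP[/andP[? ?] /andP[? ?]]; apply/andP.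
Qed.

Lemma measurable_orec : (@measurable _ Rd : set (set Rd)) = <<s [set A | exists i, A = orec i] >>.
Proof.
apply/seteqP; split=> A mA; last first.
  apply: (smallest_sub _ _ mA) => [|_ [i ->]]; last exact: orec_measurable.
  by split=> [|B mB|F mF]; [exact: measurable0|rewrite setTD; exact: measurableC|exact: bigcup_measurable].
apply: (smallest_sub _ _ mA); first exact: smallest_sigma_algebra.
move=> U oU /=.
pose D := [set i : 'rV[rat]_d * 'rV[rat]_d | obox i `<=` U].
have -> : U = \bigcup_n (if unpickle n is Some i then if i \in D then obox i else set0 else set0).
  apply/seteqP; split=> [x Ux|x [n _]]; last first.
    by case: (unpickle n) => [i|//]; case: ifPn => // /set_mem Di; exact: Di.
  have oUT : open (fst @^-1` U : set (E * R^o)).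
    by have /continuousP := @continuous_fst R d; exact.
  have := open_rbox oUT => /seteqP[+ _] => /(_ (x, 0) Ux)[[[c b] m] /= iU].
  have m0 : (0 : R) < m.+1%:R^-1 by rewrite invr_gt0.
  have rE (a : rat) : ratr a - m.+1%:R^-1 = ratr (a - m.+1%:R^-1) :> R.
    by rewrite rmorphB /= fmorphV rmorph_nat.
  have rE' (a : rat) : ratr a + m.+1%:R^-1 = ratr (a + m.+1%:R^-1) :> R.
    by rewrite rmorphD /= fmorphV rmorph_nat.
  move=> /(boxE _ _ m0) /= [h1 h2].
  pose i := (\row_k (c 0 k - m.+1%:R^-1), \row_k (c 0 k + m.+1%:R^-1)) : 'rV[rat]_d * 'rV[rat]_d.
  exists (pickle i) => //; rewrite pickleK mem_set.
    by move=> k; rewrite /= !mxE -rE -rE' -ltr_distl; have := h1 k; rewrite !mxE.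
  move=> y hy; apply: (iU (y, 0)); apply/boxE => //=; split=> // k.
  by rewrite !mxE ltr_distl rE rE'; have := hy k; rewrite !mxE.
have [s0 sC sU] := smallest_sigma_algebra setT [set A | exists i, A = orec i].
apply: sU => n; case: (unpickle n) => [i|//]; case: ifP => // _.
by apply: sub_sigma_algebra; exists (Some i).
Qed.

End BoxSystem.

Section KernelDensity.
Context (R : realType) (d : nat).
Local Notation Rd := (euclid R d).
Local Notation T := (measurableTypeR R).
Local Notation X := (Rd * T)%type.
Local Notation leb := (@lebesgue_measure R).
Local Notation I01 := ([set` `[(0 : R), 1]] : set T).
Variables (k kb : T -> {finite_measure set Rd -> \bar R}) (C : R).
Hypothesis mk : forall A, measurable A -> measurable_fun setT (fun t => k t A).
Hypothesis kC : forall t, (k t setT <= C%:E)%E.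
Hypothesis mkb : forall A, measurable A -> measurable_fun setT (fun t => kb t A).
Hypothesis kbC : forall t, (kb t setT <= C%:E)%E.
Hypothesis kkb : forall t A, measurable A -> (k t A <= kb t A)%E.

Let P := stm mk kC.
Let mu := stm mkb kbC.
Let mI : measurable I01. Proof. exact: measurable_itv. Qed.

Let stm_indic (k' : T -> {finite_measure set Rd -> \bar R}) (mk' : forall A, measurable A -> measurable_fun setT (fun t => k' t A))
  (kC' : forall t, (k' t setT <= C%:E)%E) A :
  measurable A -> stm mk' kC' A = (\int[leb]_(t in I01) k' t ((fun x : Rd => (x, t)) @^-1` A))%E.
Proof.
move=> mA; rewrite /= /mkfm st_funE//.
by apply: eq_integral => t _; rewrite slice_measureE.
Qed.

Let PmuE A : measurable A -> (P A <= mu A)%E.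
Proof.
move=> mA; rewrite /P /mu !stm_indic//.
have mS t : measurable ((fun x : Rd => (x, t)) @^-1` A).
  by rewrite -[_ @^-1` _]setTI; exact: (measurable_slice t).
have mf (k' : T -> {finite_measure set Rd -> \bar R}) (mk' : forall A, measurable A -> measurable_fun setT (fun t => k' t A))
    (kC' : forall t, (k' t setT <= C%:E)%E) : measurable_fun I01 (fun t => k' t ((fun x : Rd => (x, t)) @^-1` A)).
  apply: measurable_funTS.
  under eq_fun do rewrite slice_measureE//.
  apply: (@measurable_slice_integral _ _ k' C mk' kC' (fun p => (\1_A p : R)%:E)).
    by move=> p; rewrite lee_fin.
  by apply/measurable_EFinP; exact: measurable_indic.
apply: ge0_le_integral => //.
- exact: (mf k).
- exact: (mf kb).
- by move=> t _; exact: kkb.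
Qed.

(** A Radon-Nikodym density on space-time is jointly measurable by construction. Testing it on
    products of a box with a time set shows that its slices are correct on that box for almost every
    time; the boxes are countable and determine the measure. *)
Lemma kernel_density : exists f : X -> R, [/\ measurable_fun setT f,
  forall p, 0 <= f p & exists N : set T, [/\ measurable N, leb N = 0%E &
    forall t, I01 t -> ~ N t -> forall A, measurable A ->
      k t A = (\int[kb t]_(x in A) (f (x, t))%:E)%E]].
Proof.
have Pmu : P `<< mu.
  apply/null_content_dominatesP => A mA mA0; apply/eqP.
  by rewrite eq_le measure_ge0 andbT -mA0 PmuE.
pose RN := Radon_Nikodym_SigmaFinite.f P mu.
have RNi := Radon_Nikodym_SigmaFinite.f_integrable Pmu.
have RN0 := Radon_Nikodym_SigmaFinite.f_ge0 Pmu.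
have RNf := Radon_Nikodym_SigmaFinite.f_fin_num Pmu.
have [mRN _] := integrableP _ _ _ RNi.
pose f p := fine (RN p).
have fE p : (f p)%:E = RN p by rewrite fineK//; exact: RNf.
have mf : measurable_fun setT f by exact: measurable_fine_comp.
have f0 p : 0 <= f p by apply: fine_ge0; exact: RN0.
have mft t : measurable_fun setT (fun x => f (x, t)).
  by apply: (measurableT_comp mf); exact: measurable_slice.
exists f; split=> //.
pose beta A t := (\int[kb t]_x (\1_A x * f (x, t))%:E)%E.
have mh A E' : measurable A -> measurable E' ->
    measurable_fun setT (fun p : X => (\1_(A `*` E') p : R)).
  by move=> mA mE; apply: measurable_indic; exact: measurableX.
have mbeta (A : set Rd) : measurable A -> measurable_fun setT (beta A).
  move=> mA; apply: (@measurable_slice_integral _ _ kb C mkb kbC (fun p => (\1_A p.1 * f p)%:E)).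
    by move=> p; rewrite lee_fin mulr_ge0.
  apply/measurable_EFinP; apply: measurable_funM => //.
  by apply: measurableT_comp; [exact: measurable_indic|exact: measurable_fst].
have patchI (E' : set T) (a : T -> \bar R) : E' `<=` I01 -> (\int[leb]_(t in E') a t = \int[leb]_(t in I01) (a t * (\1_E' t : R)%:E))%E.
  move=> EI; rewrite integral_mkcond [RHS]integral_mkcond; apply: eq_integral => t _.
  rewrite !patchE indicE; have [Et|Et] := pselect (E' t).
    by rewrite !mem_set ?mule1//; exact: EI.
  by rewrite (memNset Et) mule0; case: ifP.
have ind (A : set Rd) (E' : set T) (x : Rd) (t : T) : (\1_(A `*` E') (x, t) : R) = \1_A x * \1_E' t.
  by rewrite !indicE -natrM mulnb in_setX.
have key i : \forall t \ae leb, I01 t -> k t (orec i) = beta (orec i) t.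
  set A := orec i; have mA : measurable (A : set Rd) by exact: orec_measurable.
  apply: (integral_ae_eq mI) => //.
  - apply/integrableP; split; first by apply: measurable_funTS; exact: mk.
    apply: (@le_lt_trans _ _ (\int[leb]_(t in I01) C%:E)%E).
      apply: ge0_le_integral => //.
      + by apply: measurable_funTS; apply: measurableT_comp => //; exact: mk.
      + move=> t _; rewrite gee0_abs//; apply: le_trans (kC t).
        by apply: le_measure; rewrite ?inE.
    by rewrite integral_cst//= lebesgue_measure_itv /= lte_fin ltr01 oppr0 adde0 mule1 ltry.
  - by apply: measurable_funTS; exact: mbeta.
  - move=> E' EI mE.
    have mAE : measurable (A `*` E' : set X) by exact: measurableX.
    transitivity (P (A `*` E')).
      rewrite patchI// /P stm_indic//; apply: eq_integral => t _.
      rewrite indicE; have [Et|Et] := pselect (E' t).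
        rewrite mem_set// mule1; congr (k t _).
        by apply/seteqP; split=> x /=; [move=> ?; split|case].
      rewrite memNset// mule0 (_ : _ @^-1` _ = set0) ?measure0//.
      by apply/seteqP; split=> x //= -[].
    rewrite (Radon_Nikodym_SigmaFinite.f_integral Pmu mAE) [LHS]integral_mkcond.
    transitivity (\int[mu]_p (\1_(A `*` E') p * f p)%:E)%E.
      apply: eq_integral.
      move=> p _; rewrite patchE indicE; case: ifPn => Ap.
        by rewrite mul1r fE.
      by rewrite mul0r.
    rewrite /mu stm_integral; last 2 first.
      by move=> p; rewrite lee_fin mulr_ge0.
      by apply/measurable_EFinP; apply: measurable_funM => //; exact: mh.
    rewrite (patchI E')//; apply: eq_integral => t _.
    rewrite /beta muleC -ge0_integralZl//.
    + by apply: eq_integral => x _; rewrite ind -EFinM; congr EFin; ring.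
    + by apply/measurable_EFinP; apply: measurable_funM.
    + by move=> x _; rewrite lee_fin mulr_ge0.
(* One null set of times for all boxes. *)
have keyall : \forall t \ae leb, forall n : nat, I01 t ->
    if unpickle n is Some i then k t (orec i) = beta (orec i) t else True.
  apply: ae_foralln => n; case: (unpickle n) => [i|]; last exact: aeW.
  exact: key.
have [N [mN N0 sN]] := keyall; exists N; split=> // t It Nt.
have kt i : k t (orec i) = beta (orec i) t.
  have /contrapT := contra_not (sN t) Nt => /(_ (pickle i) It).
  by rewrite pickleK.
pose dm A := (\int[kb t]_(x in A) (f (x, t))%:E)%E.
have dmE A : measurable A -> dm A = beta A t.
  move=> mA; rewrite /dm /beta integral_mkcond; apply: eq_integral => x _.
  rewrite patchE indicE; case: ifPn => Ax; first by rewrite mul1r.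
  by rewrite mul0r.
have dm_fm : is_fmeasure dm.
  split.
  - by rewrite /dm integral_set0.
  - by move=> A; apply: integral_ge0 => x _; rewrite lee_fin.
  - apply: semi_sigma_additive_nng_induced; first exact/measurable_EFinP.
    by move=> x; rewrite lee_fin.
  - move=> A mA; rewrite ge0_fin_numE; last by apply: integral_ge0 => x _; rewrite lee_fin.
    apply: (@le_lt_trans _ _ (dm setT)).
      apply: ge0_subset_integral => //; first exact/measurable_EFinP.
      by move=> x _; rewrite lee_fin.
    rewrite dmE//; have /= <- := kt None.
    by rewrite ltey_eq fin_num_measure.
move=> A mA; rewrite -[RHS]/(fmeasure dm_fm A).
apply: (measure_unique _ (fun _ => setT) (@measurable_orec R d) (@orecI R d)) => //.
- by move=> _; exists None.
- by apply/seteqP; split=> // x _; exists 0%N.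
- move=> _ [i ->]; transitivity (beta (orec i) t); first exact: kt.
  by rewrite -dmE//; exact: orec_measurable.
- by move=> _; rewrite ltey_eq fin_num_measure.
Qed.

End KernelDensity.

Lemma dominated_Rcvg dd (Y : measurableType dd) (R : realType) (mu : {measure set Y -> \bar R})
  (f_ : nat -> Y -> R) (f g : Y -> R) : (forall k, measurable_fun setT (f_ k)) ->
  mu.-integrable setT (EFin \o g) -> (forall k x, `|f_ k x| <= g x) ->
  (forall x, f_ k x @[k --> \oo] --> f x) ->
  \int[mu]_x f_ k x @[k --> \oo] --> \int[mu]_x f x.
Proof.
move=> mf ig fg ff.
have mf' : measurable_fun setT f by apply: (measurable_fun_cvg mf) => x _; exact: ff.
have [||||i1 _ i2] := @dominated_convergence _ _ _ mu setT measurableT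
    (fun k x => (f_ k x)%:E) (fun x => (f x)%:E) (EFin \o g) _ _ _ ig.
- by move=> k; exact/measurable_EFinP.
- exact/measurable_EFinP.
- by apply: aeW => x _; apply: cvg_EFin; [exact: nearW|exact: ff].
- by apply: aeW => x k _; rewrite lee_fin.
by apply: fine_cvg; rewrite fineK//; exact: integrable_fin_num.
Qed.

(** * Monotonicity and measurability of the interpolation function *)

Section ThetaFacts.
Context (R : realType) (theta : R -> R -> R).
Hypothesis hI : interpolation theta.

Lemma theta00 : theta 0 0 = 0.
Proof.
have := interp_homog hI (ltr0Sn R 1) (lexx 0) (lexx 0); rewrite !mulr0 => h.
by lra.
Qed.

Lemma theta_mono a b a' b' : 0 <= a <= a' -> 0 <= b <= b' -> theta a b <= theta a' b'.
Proof.
move=> /andP[a0 aa] /andP[b0 bb]; have a'0 := le_trans a0 aa; have b'0 := le_trans b0 bb.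
apply: (le_trans (interp_mono hI b0 a0 aa)).
by rewrite (interp_sym hI)// [leRHS](interp_sym hI)//; exact: (interp_mono hI).
Qed.

Lemma theta_diag a : 0 <= a -> theta a a = a.
Proof.
rewrite le_eqVlt => /predU1P[<-|a0]; first exact: theta00.
by have := interp_homog hI a0 ler01 ler01; rewrite !mulr1 (interp_11 hI) mulr1.
Qed.

Lemma theta_le1 a b : 0 <= a <= 1 -> 0 <= b <= 1 -> 0 <= theta a b <= 1.
Proof.
move=> a1 b1; have := theta_mono a1 b1; rewrite (interp_11 hI) => ->; rewrite andbT.
by apply: (interp_ge0 hI); [case/andP: a1|case/andP: b1].
Qed.

Lemma theta_right_cvg a b e : 0 <= a -> 0 <= b -> 0 < e ->
  exists d, 0 < d /\ forall r s, a <= r -> r < a + d -> b <= s -> s < b + d ->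
    theta r s < theta a b + e.
Proof.
move=> a0 b0 e0.
have /subspace_continuousP/(_ (a, b) (conj a0 b0)) := interp_cont hI.
move=> /cvgrPdist_lt/(_ e e0); rewrite near_withinE.
move=> /nbhs_ballP[d /= d0 H]; exists d; split=> // r s ar rd bs sd.
have /H : ball ((a, b) : R^o * R^o) d (r, s).
  by split; rewrite /ball /= ltr_distlC; apply/andP; split; lra.
move=> /(_ (conj (le_trans a0 ar) (le_trans b0 bs))) /=.
by rewrite ltr_distlC => /andP[].
Qed.

(** Since [theta] is controlled only on the closed quadrant, measurability comes from monotonicity
    and continuity: the set [theta (f y) (g y) < c] is the union of the sets [f y < r], [g y < s]
    over nonnegative rational pairs with [theta r s < c]. *)
Lemma measurable_theta (dd : measure_display) (Y : measurableType dd) (f g : Y -> R) :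
  (forall y, 0 <= f y) -> (forall y, 0 <= g y) ->
  measurable_fun setT f -> measurable_fun setT g ->
  measurable_fun setT (fun y => theta (f y) (g y)).
Proof.
move=> f0 g0 mf mg.
apply: (measurability _ (RGenInftyO.measurableE R)) => _ [_ [c ->] <-].
rewrite setTI (_ : _ @^-1` _ = \bigcup_n (if unpickle n is Some (r, s) then
   if [&& 0 <= ratr r :> R, 0 <= ratr s :> R & theta (ratr r) (ratr s) < c]
   then (f @^-1` `]-oo, ratr r[) `&` (g @^-1` `]-oo, ratr s[) else set0 else set0)).
  apply: bigcupT_measurable => n; case: (unpickle n) => [[r s]|//]; case: ifP => // _.
  apply: measurableI; rewrite -[X in measurable X]setTI.
    by apply: mf => //; exact: measurable_itv.
  by apply: mg => //; exact: measurable_itv.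
apply/seteqP; split=> y /=; rewrite in_itv /=.
  move=> h; have e0 : 0 < c - theta (f y) (g y) by rewrite subr_gt0.
  have [d [d0 H]] := theta_right_cvg (f0 y) (g0 y) e0.
  have [r] := rat_in_itvoo (ltr_pwDr d0 (lexx (f y))).
  rewrite in_itv /= => /andP[r1 r2].
  have [s] := rat_in_itvoo (ltr_pwDr d0 (lexx (g y))).
  rewrite in_itv /= => /andP[s1 s2].
  exists (pickle (r, s)); first exact: I.
  have -> : unpickle (pickle (r, s)) = Some (r, s) by exact: pickleK.
  rewrite (le_trans (f0 y) (ltW r1)) (le_trans (g0 y) (ltW s1)) /=.
  have := H _ _ (ltW r1) r2 (ltW s1) s2; rewrite addrC subrK => -> /=.
  by rewrite !in_itv /= r1 s1.
move=> [n _]; case: (unpickle n) => [[r s]|//]; case: ifP => // /and3P[r0 s0 rs] [].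
rewrite /= !in_itv /= => h1 h2; apply: le_lt_trans rs.
by apply: theta_mono; rewrite ?f0 ?g0 ltW.
Qed.

End ThetaFacts.

(** * Measurability in time of narrowly continuous curves *)

Section Curves.
Context (R : realType) (d n : nat).
Local Notation E := ('rV[R]_d).
Local Notation Rd := (euclid R d).
Local Notation T := (measurableTypeR R).
Local Notation X := (Rd * T)%type.
Local Notation leb := (@lebesgue_measure R).
Local Notation I01 := ([set` `[(0 : R), 1]] : set T).
Variable Omega : set Rd.
Hypothesis cO : closed (Omega : set E).

Lemma measurable_Omega : measurable Omega.
Proof.
rewrite -(setCK Omega); apply: measurableC; apply: sub_sigma_algebra.
exact: closed_openC.
Qed.

Lemma integral_Omega (m : {finite_measure set Rd -> \bar R}) (f : Rd -> \bar R) :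
  m (~` Omega) = 0%E -> (\int[m]_(x in Omega) f x = \int[m]_x f x)%E.
Proof.
move=> m0; rewrite integral_mkcond.
apply: (integral_off_null (measurableC measurable_Omega) m0) => x _ Ox.
by rewrite patchE mem_set//; exact: contrapT.
Qed.

Lemma Rintegral_Omega (m : {finite_measure set Rd -> \bar R}) (f : Rd -> R) :
  m (~` Omega) = 0%E -> \int[m]_(x in Omega) f x = \int[m]_x f x.
Proof. by move=> m0; rewrite /Rintegral integral_Omega. Qed.

Lemma mbar_compl (m : vmeasure R d n) : vprob Omega m -> mbar m (~` Omega) = 0%E.
Proof. by move=> [m0 _]; rewrite /mbar big1. Qed.

Lemma mbar1 (m : vmeasure R d n) : vprob Omega m -> mbar m setT = 1%E.
Proof.
move=> [m0 <-]; rewrite /mbar; apply: eq_bigr => i _.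
have mO := measurable_Omega.
rewrite -(setUv Omega) measureU ?setICr//; last exact: measurableC.
by rewrite [X in (_ + X)%E](m0 i) adde0.
Qed.

Lemma le_mbar (m : vmeasure R d n) i A : (m i A <= mbar m A)%E.
Proof. by rewrite /mbar (bigD1 i)//= leeDl// sume_ge0. Qed.

Lemma vprob_le1 (m : vmeasure R d n) i : vprob Omega m -> (m i setT <= 1%:E)%E.
Proof. by move=> pm; rewrite -(mbar1 pm); exact: le_mbar. Qed.

(** Projection to the unit interval. Composing with it extends a curve continuously to all times, so
    that kernels and measurability can be stated on the whole line. *)
Definition clamp (t : R) : R := Num.max 0 (Num.min t 1).

Lemma clamp_I01 t : clamp t \in `[(0 : R), 1].
Proof. by rewrite in_itv /= /clamp le_max lexx/= ge_max ler01 ge_min lexx orbT. Qed.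

Lemma clampK t : I01 t -> clamp t = t.
Proof.
by rewrite /= in_itv /= => /andP[t0 t1]; rewrite /clamp (min_l t1) (max_r t0).
Qed.

Lemma clamp_continuous : continuous (clamp : R^o -> R^o).
Proof.
move=> x; apply: (@continuous_max R R^o (cst 0) (fun x => Num.min x 1)).
  exact: cst_continuous.
apply: (@continuous_min R R^o id (cst 1)); last exact: cst_continuous.
by [].
Qed.

Section curve.
Variable rho : R -> vmeasure R d n.
Hypothesis cr : curve_vprob Omega 0 1 rho.

Lemma curve_clamp_cvg i (phi : E -> R) s : Cb phi ->
  (\int[rho (clamp t) i]_x phi x) @[t --> s] --> \int[rho (clamp s) i]_x phi x.
Proof.
move=> [cphi [M phiM]].
have [ps ns] := cr (clamp_I01 s).
have E t : \int[rho (clamp t) i]_x phi x = \int[rho (clamp t) i]_(x in Omega) phi x.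
  by rewrite Rintegral_Omega//; case: (cr (clamp_I01 t)) => -[].
rewrite E; under eq_fun do rewrite E.
have := ns i phi (continuous_subspaceT cphi) (ex_intro _ M (fun x _ => phiM x)).
apply: (@cvg_comp _ _ _ clamp (fun t => \int[rho t i]_(x in Omega) phi x)).
move=> A /=; rewrite !nbhs_simpl /within /= => hA.
have := @clamp_continuous s _ hA; rewrite nbhs_simpl /=; apply: filterS => t /=.
by apply; exact: clamp_I01.
Qed.

(** On an open set the mass is a pointwise limit of integrals of ramps, which are continuous in
    time. The pi-lambda theorem extends this to Borel sets. *)
Lemma curve_measurable i (A : set Rd) : measurable A ->
  measurable_fun setT (fun t : T => rho (clamp t) i A).
Proof.
have H (B : set Rd) : open (B : set E) -> measurable_fun setT (fun t : T => rho (clamp t) i B).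
  move=> oB; have mB : measurable B by exact: sub_sigma_algebra.
  have mr j : measurable_fun setT (fun x : Rd => ramp B j (x : E)).
    by apply: continuous_measurable_Rd; exact: ramp_continuous.
  have : measurable_fun setT (fun t : T => fine (rho (clamp t) i B)).
    apply: (measurable_fun_cvg (h := fun j t => \int[rho (clamp t) i]_x ramp B j x)).
      move=> j; apply: continuous_measurable_fun.
      move=> s; apply: curve_clamp_cvg; apply: Cb01 => [|x]; first exact: ramp_continuous.
      exact: ramp01.
    move=> t _; rewrite -Rintegral_indicT//.
    apply: (@dominated_Rcvg _ _ _ _ _ _ (cst 1)) => //.
    - by apply: (@bounded_integrable _ _ _ _ _ 1) => // x; rewrite normr1.
    - move=> j x; have /andP[? ?] := @ramp01 _ _ B j x; by rewrite ger0_norm.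
    - move=> x; have [Bx|Bx] := pselect (B x).
        rewrite indicE mem_set//; apply: cvg_near_cst.
        exact: (ramp_eq1 oB Bx).
      rewrite indicE memNset//; apply: cvg_near_cst; apply: nearW => j.
      by rewrite ramp_eq0.
  move=> /measurable_EFinP; apply: eq_measurable_fun => t _ /=.
  by rewrite fineK// fin_num_measure.
move=> mA; pose P (B : set Rd) := measurable_fun setT (fun t : T => rho (clamp t) i B).
suff : forall S : set Rd, <<s [set U : set Rd | open (U : set E)] >> S -> P S by apply.
apply: dynkin_induction => //.
- by move=> U V oU oV; exact: openI.
- by apply: H; exact: openT.
- move=> S mS PS; rewrite /P.
  apply: (eq_measurable_fun (fun t : T => rho (clamp t) i setT - rho (clamp t) i S)%E).
    move=> t _; have := @measureD _ _ _ (rho (clamp t) i) setT S measurableT mS.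
    by rewrite setTD setTI => -> //; rewrite ltey_eq fin_num_measure.
  by apply: emeasurable_funB => //; apply: H; exact: openT.
- move=> F mF tF PF; rewrite /P.
  apply: (eq_measurable_fun (fun t : T => \sum_(0 <= k <oo) rho (clamp t) i (F k))%E).
    by move=> t _; rewrite measure_bigcup//; apply: eq_eseriesl => k; rewrite in_setT.
  apply: ge0_emeasurable_sum; last by move=> k _; exact: PF.
  by move=> k t _ _; exact: measure_ge0.
Qed.

Lemma mbar_measurable (A : set Rd) : measurable A ->
  measurable_fun setT (fun t : T => mbar (rho (clamp t)) A).
Proof. by move=> mA; apply: emeasurable_sum => i; exact: curve_measurable. Qed.

End curve.
End Curves.

Lemma density_integral_all dd (Y : measurableType dd) (R : realType)
  (m mb : {finite_measure set Y -> \bar R}) (g : Y -> R) (h : Y -> \bar R) :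
  measurable_fun setT g -> (forall x, 0 <= g x) ->
  (forall A, measurable A -> m A = (\int[mb]_(x in A) (g x)%:E)%E) ->
  measurable_fun setT h -> (\int[m]_x h x = \int[mb]_x (h x * (g x)%:E))%E.
Proof.
move=> mg g0 mE mh; rewrite integralE [RHS]integralE.
rewrite !(density_integral mg mE)//; [|exact: measurable_funeneg|exact: measurable_funepos].
have g0' x : (0 <= (g x)%:E)%E by rewrite lee_fin.
have M (a b : \bar R) : (0 <= b)%E -> (maxe a 0 * b = maxe (a * b) 0)%E.
  move=> b0; have [a0|a0] := leP a 0%E.
    by rewrite max_r ?mul0e// mule_le0_ge0.
  by rewrite max_l// mule_ge0// ltW.
by congr (_ - _)%E; apply: eq_integral => x _; rewrite ?(funeposE, funenegE) M// mulNe.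
Qed.

Section SpaceTimeData.
Context (R : realType) (d n : nat).
Local Notation E := ('rV[R]_d).
Local Notation Rd := (euclid R d).
Local Notation T := (measurableTypeR R).
Local Notation X := (Rd * T)%type.
Local Notation ST := (E * R^o)%type.
Local Notation leb := (@lebesgue_measure R).
Local Notation I01 := ([set` `[(0 : R), 1]] : set T).
Variables (Omega : set Rd) (q : 'I_n -> 'I_n -> R) (theta : R -> R -> R).
Hypothesis cO : closed (Omega : set E).
Hypothesis q0 : forall i j, 0 <= q i j.
Hypothesis hI : interpolation theta.

(** A property rather than a fixed measure, so that solutions are independent of how the measure on
    space-time was built. *)
Definition stmeas (rho : R -> vmeasure R d n) (mu : {finite_measure set X -> \bar R}) :=
  forall h : X -> \bar R, (forall p, 0 <= h p)%E -> measurable_fun setT h ->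
  (\int[mu]_p h p = \int[leb]_(t in I01) \int[mbar (rho t)]_x h (x, t))%E.

Definition good_time (rho : R -> vmeasure R d n) (f : 'I_n -> X -> R) t :=
  forall i A, measurable A ->
    rho t i A = (\int[mbar (rho t)]_(x in A) (f i (x, t))%:E)%E.

Definition dens (rho : R -> vmeasure R d n) (f : 'I_n -> X -> R) :=
  [/\ forall i, measurable_fun setT (f i), forall i p, 0 <= f i p <= 1 &
    exists N : set T, [/\ measurable N, leb N = 0%E &
      forall t, I01 t -> ~ N t -> good_time rho f t]].

Lemma slice_fun dd (Z : measurableType dd) (h : X -> Z) t :
  measurable_fun setT h -> measurable_fun setT (fun x : Rd => h (x, t)).
Proof. by move=> mh; apply: (measurableT_comp mh); exact: measurable_slice. Qed.

Section stdata_exists.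
Variable rho : R -> vmeasure R d n.
Hypothesis cr : curve_vprob Omega 0 1 rho.

Definition ckernel t : {finite_measure set Rd -> \bar R} := mbar (rho (clamp t)).

Lemma ckernel_le1 (t : T) : (ckernel t setT <= (1 : R)%:E)%E.
Proof.
have -> // : ckernel t setT = 1%E.
by apply: (mbar1 cO); case: (cr (clamp_I01 t)).
Qed.

Definition cmu := stm (mbar_measurable cO cr) ckernel_le1.

Lemma stmeas_cmu : stmeas rho cmu.
Proof.
move=> h h0 mh; have := stm_integral (mbar_measurable cO cr) ckernel_le1 h0 mh.
move=> ->; apply: eq_integral => t; rewrite inE => It.
by rewrite /ckernel clampK.
Qed.

Lemma stmeas_cmuE mu : stmeas rho mu -> forall A, measurable A -> mu A = cmu A.
Proof.
move=> smu A mA.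
have mi : measurable_fun setT (fun p : X => (\1_A p : R)%:E).
  by apply/measurable_EFinP; exact: measurable_indic.
have i0 p : (0 <= (\1_A p : R)%:E)%E by rewrite lee_fin.
have := smu _ i0 mi; rewrite -(stmeas_cmu i0 mi).
by rewrite !integral_indic// !setIT.
Qed.

Lemma stmeas_Rintegral mu (h : X -> R) : stmeas rho mu ->
  mu.-integrable setT (EFin \o h) ->
  \int[leb]_(t in I01) (\int[mbar (rho t)]_x h (x, t)) = \int[mu]_p h p.
Proof.
move=> smu ih.
have E1 (g : X -> \bar R) : (\int[mu]_p g p = \int[cmu]_p g p)%E.
  by apply: eq_measure_integral => A mA _; exact: stmeas_cmuE.
have ih' : cmu.-integrable setT (EFin \o h).
  by move/integrableP : ih => [mh fh]; apply/integrableP; split=> //; rewrite -E1.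
have -> : \int[mu]_p h p = \int[cmu]_p h p by rewrite /Rintegral E1.
have := stm_Rintegral ih' => <-.
apply: eq_Rintegral => t; rewrite inE => It.
by rewrite /ckernel clampK.
Qed.

Lemma stmeas_slab mu (B : set T) : stmeas rho mu -> measurable B -> B `<=` I01 ->
  mu (setT `*` B) = leb B.
Proof.
move=> smu mB BI.
have mA : measurable (setT `*` B : set X) by exact: measurableX.
have mi : measurable_fun setT (fun p : X => (\1_(setT `*` B) p : R)%:E).
  by apply/measurable_EFinP; exact: measurable_indic.
have := smu _ _ mi => /(_ (fun p => _)); rewrite integral_indic// setIT => ->; last first.
  by move=> p; rewrite lee_fin.
have -> : (leb B = \int[leb]_(t in I01) (\1_B t : R)%:E)%E.
  by rewrite integral_indic ?setIidl//; exact: measurable_itv.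
apply: eq_integral => t; rewrite inE => It.
rewrite (eq_integral (fun=> (\1_B t : R)%:E)); last first.
  by move=> x _; rewrite !indicE in_setX in_setT.
rewrite integral_cst//= (mbar1 cO) ?mule1//.
by have [] : vprob Omega (rho t) /\ _ := cr It.
Qed.

(** Each component is dominated by the sum, so the densities of the components exist on space-time
    and take values in [[0, 1]] up to a null set. *)
Lemma curve_dens : exists f, dens rho f.
Proof.
have H i := kernel_density (@curve_measurable _ _ _ _ cO _ cr i)
  (fun t => vprob_le1 cO i (proj1 (cr (clamp_I01 t)))) (mbar_measurable cO cr) ckernel_le1
  (fun t A _ => le_mbar (rho (clamp t)) i A).
pose f i := projT1 (cid (H i)).
have [mf f0 gf] : [/\ forall i, measurable_fun setT (f i), forall i p, 0 <= f i p &
    forall i, exists N : set T, [/\ measurable N, leb N = 0%E &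
    forall t, I01 t -> ~ N t -> forall A, measurable A ->
      rho t i A = (\int[mbar (rho t)]_(x in A) (f i (x, t))%:E)%E]].
  split=> [i|i|i]; rewrite /f; case: (cid (H i)) => //= g [mg g0 [N [mN N0 HN]]] //.
  by exists N; split=> // t It Nt A mA; have := HN t It Nt A mA; rewrite (clampK It).
have [N HN] := choice gf.
(* Truncation makes the bound by 1 hold everywhere. Where [f i] exceeds 1 the mass is at most that
   of [mbar], so integrating 1 loses nothing. *)
exists (fun i p => Num.min (f i p) 1); split.
- by move=> i; apply: measurable_minr => //; exact: measurable_cst.
- by move=> i p; rewrite le_min f0 ler01 ge_min lexx orbT.
have [mN N0] : measurable (\big[setU/set0]_i N i) /\ leb (\big[setU/set0]_i N i) = 0%E.
  elim/big_ind : _ => [|A B [mA A0] [mB B0]|i _]; last by case: (HN i).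
    by split; [exact: measurable0|exact: measure0].
  by split; [exact: measurableU|exact: null_set_setU].
exists (\big[setU/set0]_i N i); split=> // t It Nt i A mA.
have [_ _ /(_ t It)] := HN i.
have Nit : ~ N i t by move=> Nit; apply: Nt; rewrite (bigD1 i)//=; left.
move=> /(_ Nit) fE; rewrite /=.
have mft := slice_fun t (mf i).
have mm : measurable_fun setT (fun x : Rd => Num.min (f i (x, t)) 1).
  by apply: measurable_minr => //; exact: measurable_cst.
set B := [set x : Rd | (1 < f i (x, t))%R].
have mB : measurable B.
  rewrite (_ : B = setT `&` (fun x : Rd => f i (x, t)) @^-1` `]1, +oo[).
    by apply: mft => //; exact: measurable_itv.
  by rewrite setTI; apply/seteqP; split=> x; rewrite /B /= in_itv /= andbT.
have m0 x : (0 <= (Num.min (f i (x, t)) 1)%:E)%E by rewrite lee_fin le_min f0/=.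
apply/eqP; rewrite eq_le; apply/andP; split; last first.
  rewrite fE//; apply: ge0_le_integral => //.
  + by apply/measurable_EFinP/measurable_funTS.
  + by apply/measurable_EFinP/measurable_funTS.
  + by move=> x _; rewrite lee_fin ge_min lexx.
have mI1 : measurable (A `&` B) by exact: measurableI.
have mD1 : measurable (A `\` B) by exact: measurableD.
have dj : [disjoint A `&` B & A `\` B]%classic.
  by apply/disj_set2P/seteqP; split=> // x [[_ ?] []].
rewrite -(setUIDK A B) measureU//; last exact/disj_set2P.
rewrite ge0_integral_setU//; last first.
  by apply/measurable_EFinP/measurable_funTS.
apply: leeD.
  rewrite (eq_integral (cst 1%E)); last first.
    by move=> x; rewrite inE => -[_ Bx]; rewrite min_r// ltW.
  by rewrite integral_cst// mul1e; exact: le_mbar.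
rewrite [leLHS](fE _ mD1) (eq_integral (fun x => (Num.min (f i (x, t)) 1)%:E))//.
move=> x; rewrite inE => -[_ Bx]; rewrite min_l// leNgt; exact/negP.
Qed.

End stdata_exists.

End SpaceTimeData.

(** * Solutions of the continuity equation in space-time form *)

Lemma Rintegral_eq0 dd (Y : measurableType dd) (R : realType) (mu : {measure set Y -> \bar R})
  (h : Y -> R) : (forall y, h y = 0) -> \int[mu]_y h y = 0.
Proof.
by move=> h0; rewrite /Rintegral (eq_integral (cst 0%E)) ?integral0// => y _; rewrite h0.
Qed.

Lemma Rintegral_sum dd (Y : measurableType dd) (R : realType) (mu : {measure set Y -> \bar R})
  (I : Type) (s : seq I) (h : I -> Y -> R) : (forall i, mu.-integrable setT (EFin \o h i)) ->
  mu.-integrable setT (EFin \o (fun y => \sum_(i <- s) h i y)) /\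
  \int[mu]_y (\sum_(i <- s) h i y) = \sum_(i <- s) \int[mu]_y h i y.
Proof.
move=> ih; elim: s => [|i s [hs IH]].
  rewrite big_nil; split.
    have := integrable0 mu setT; apply: eq_integrable => // y _ /=.
    by rewrite big_nil.
  by rewrite Rintegral_eq0// => y; rewrite big_nil.
rewrite big_cons -IH -RintegralD//; split; last first.
  by apply: eq_Rintegral => y _; rewrite big_cons.
have := integrableD measurableT (ih i) hs; apply: eq_integrable => // y _ /=.
by rewrite big_cons.
Qed.

Section Solutions.
Context (R : realType) (d n : nat).
Local Notation E := ('rV[R]_d).
Local Notation Rd := (euclid R d).
Local Notation T := (measurableTypeR R).
Local Notation X := (Rd * T)%type.
Local Notation ST := (E * R^o)%type.
Local Notation leb := (@lebesgue_measure R).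
Local Notation I01 := ([set` `[(0 : R), 1]] : set T).
Variables (Omega : set Rd) (q : 'I_n -> 'I_n -> R) (theta : R -> R -> R).
Hypothesis cO : closed (Omega : set E).
Hypothesis q0 : forall i j, 0 <= q i j.
Hypothesis qC : weight_symmetric q.
Hypothesis hI : interpolation theta.

(* All velocities are treated as one field [Y] indexed by [field_index]: [Y (inl (i, k))] is
   the [k]-th coordinate of [u_i] and [Y (inr (i, j))] is [v_ij]; [weight] is the density that
   multiplies it and [price] its coefficient in the action. *)
Definition field_index : finType := ('I_n * 'I_d + 'I_n * 'I_n)%type.
Local Notation K := field_index.

Definition weight (f : 'I_n -> X -> R) (a : K) (p : X) : R :=
  match a with inl (i, _) => f i p | inr (i, j) => theta (f i p) (f j p) end.

Definition price (a : K) : R :=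
  match a with inl _ => 1 | inr (i, j) => q i j / 2 end.

(* The test functions paired with the components of [Y w] in the [i]-th equation. *)
Definition dtest (i : 'I_n) (a : K) (eta : ST -> R^o) (p : ST) : R :=
  match a with
  | inl (i', k) => (i' == i)%:R * 'D_((delta_mx 0 k, 0) : ST) eta p
  | inr (i', j) => 2^-1 * q i' j * ((i' == i)%:R - (j == i)%:R) * eta p
  end.

Definition energy (mu : {finite_measure set X -> \bar R}) f (Y : K -> X -> R) : \bar R :=
  (\sum_a \int[mu]_p (price a * (Y a p ^+ 2 * weight f a p))%:E)%E.

Definition pairing f (Y : K -> X -> R) (eta : ST -> R^o) i (p : X) : R :=
  time_derivative eta p * f i p +
  \sum_a dtest i a eta p * (Y a p * weight f a p).

(* [mu] is the measure [mbar (rho t) (dx) dt] on space-time and [f i] a jointly measurable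
   version of the density of [rho t i] with respect to [mbar (rho t)]. *)
Record solution (rho : R -> vmeasure R d n) (mu : {finite_measure set X -> \bar R})
    (f : 'I_n -> X -> R) (Y : K -> X -> R) : Prop := Solution {
  sol_curve : curve_vprob Omega 0 1 rho;
  sol_stmeas : stmeas rho mu;
  sol_dens : dens rho f;
  sol_measurable : forall a, measurable_fun setT (Y a);
  sol_price0 : forall a, price a = 0 -> forall p, Y a p = 0;
  sol_energy : (energy mu f Y < +oo)%E;
  sol_weak : forall eta, test_function 0 1 eta -> forall i,
    \int[mu]_p pairing f Y eta i p = 0 }.

Lemma price_ge0 a : 0 <= price a.
Proof. by case: a => [//|[i j]] /=; rewrite ?ler01// mulr_ge0// invr_ge0. Qed.

Lemma sum_index (V : nmodType) (F : K -> V) :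
  \sum_a F a = \sum_i \sum_k F (inl (i, k)) + \sum_i \sum_j F (inr (i, j)).
Proof.
by rewrite big_sumType /= !pair_bigA; congr (_ + _); apply: eq_bigr => -[].
Qed.

Lemma weight01 (f : 'I_n -> X -> R) a p : (forall i p, 0 <= f i p <= 1) -> 0 <= weight f a p <= 1.
Proof. by move=> f1; case: a => -[i j] /=; [exact: f1|exact: (theta_le1 hI)]. Qed.

Lemma weight_measurable (f : 'I_n -> X -> R) a : (forall i, measurable_fun setT (f i)) ->
  (forall i p, 0 <= f i p <= 1) -> measurable_fun setT (weight f a).
Proof.
move=> mf f1; case: a => -[i j] //=; first exact: mf.
by apply: (measurable_theta hI) => // p; [case/andP: (f1 i p)|case/andP: (f1 j p)].
Qed.

Lemma summand_ge0 (f : 'I_n -> X -> R) (Y : K -> X -> R) a p : (forall i p, 0 <= f i p <= 1) ->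
  0 <= price a * (Y a p ^+ 2 * weight f a p).
Proof.
move=> f1; rewrite mulr_ge0 ?price_ge0// mulr_ge0 ?sqr_ge0//.
by case/andP: (weight01 a p f1).
Qed.

Lemma summand_measurable (f : 'I_n -> X -> R) (Y : K -> X -> R) a :
  (forall i, measurable_fun setT (f i)) -> (forall i p, 0 <= f i p <= 1) ->
  measurable_fun setT (Y a) ->
  measurable_fun setT (fun p => (price a * (Y a p ^+ 2 * weight f a p))%:E).
Proof.
move=> mf f1 mY; apply/measurable_EFinP; apply: measurable_funM => //.
by apply: measurable_funM; [exact: measurable_funX|exact: weight_measurable].
Qed.

Lemma energy_nonneg mu (f : 'I_n -> X -> R) (Y : K -> X -> R) :
  (forall i p, 0 <= f i p <= 1) -> (0 <= energy mu f Y)%E.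
Proof.
move=> f1; apply: sume_ge0 => a _; apply: integral_ge0 => p _.
by rewrite lee_fin summand_ge0.
Qed.

(** An exchange along an edge conserves total mass: the contributions of its two endpoints
    cancel. *)
Lemma dtest_sum0 i' j eta p : \sum_i dtest i (inr (i', j)) eta p = 0.
Proof.
rewrite /dtest -mulr_suml -mulr_sumr sumrB.
rewrite (bigD1 i')//= eqxx big1 ?addr0; last by move=> i /negbTE; rewrite eq_sym => ->.
rewrite (bigD1 j)//= eqxx big1 ?addr0; last by move=> i /negbTE; rewrite eq_sym => ->.
by rewrite subrr mulr0 mul0r.
Qed.

Section good.
Variables (rho : R -> vmeasure R d n) (f : 'I_n -> X -> R).
Hypothesis mf : forall i, measurable_fun setT (f i).
Hypothesis f1 : forall i p, 0 <= f i p <= 1.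
Variable t : R.
Hypothesis gt : good_time rho f t.

Lemma good_integral i (h : Rd -> \bar R) : measurable_fun setT h ->
  (\int[rho t i]_x h x = \int[mbar (rho t)]_x (h x * (f i (x, t))%:E))%E.
Proof.
move=> mh; apply: density_integral_all => //; first exact: slice_fun.
  by move=> x; case/andP: (f1 i (x, t)).
by move=> A mA; exact: gt.
Qed.

Lemma good_Rintegral i (h : Rd -> R) : measurable_fun setT h ->
  \int[rho t i]_x h x = \int[mbar (rho t)]_x (h x * f i (x, t)).
Proof. by move=> mh; rewrite /Rintegral good_integral//; exact/measurable_EFinP. Qed.

Lemma good_density : exists Z : set Rd, [/\ measurable Z, mbar (rho t) Z = 0%E &
  forall x, ~ Z x -> forall i, density (rho t) i x = f i (x, t)].
Proof.
have H i : exists Z : set Rd, [/\ measurable Z, mbar (rho t) Z = 0%E &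
    forall x, ~ Z x -> density (rho t) i x = f i (x, t)].
  have [N [mN N0 sN]] := density_ae (slice_fun t (mf i)) (fun A mA => gt i mA).
  exists N; split=> // x Nx; have /contrapT := contra_not (sN x) Nx.
  by move=> /(_ I) /= h; rewrite /density h.
have [Z HZ] := choice H.
have [mZ Z0] : measurable (\big[setU/set0]_i Z i) /\ mbar (rho t) (\big[setU/set0]_i Z i) = 0%E.
  elim/big_ind : _ => [|A B [mA A0] [mB B0]|i _]; last by case: (HZ i).
    by split; [exact: measurable0|exact: measure0].
  by split; [exact: measurableU|exact: null_set_setU].
exists (\big[setU/set0]_i Z i); split=> // x Zx i.
have [_ _] := HZ i; apply=> Zix; apply: Zx; rewrite (bigD1 i)//=; by left.
Qed.

(** The two versions of the densities agree off a null set of the slice. An arbitrary integrand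
    [Phi] lets one statement serve the action, the integrability conditions and the weak
    equation. *)
Lemma good_theta (Phi : ('I_n -> 'I_n -> R) -> Rd -> \bar R) :
  (\int[mbar (rho t)]_x Phi (fun i j => theta_density theta (rho t) i j x) x =
   \int[mbar (rho t)]_x Phi (fun i j => theta (f i (x, t)) (f j (x, t))) x)%E.
Proof.
have [Z [mZ Z0 HZ]] := good_density.
apply: (integral_off_null mZ Z0) => x _ Zx; congr (Phi _ x).
by apply/funext => i; apply/funext => j; rewrite /theta_density !HZ.
Qed.

End good.

Section translate.
Variables (rho : R -> vmeasure R d n) (mu : {finite_measure set X -> \bar R}).
Variables (f : 'I_n -> X -> R) (Y : K -> X -> R).
Variables (u : velocity R d n) (v : edge_velocity R d n).
Hypothesis cr : curve_vprob Omega 0 1 rho.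
Hypothesis smu : stmeas rho mu.
Hypothesis df : dens rho f.
Hypothesis mY : forall a, measurable_fun setT (Y a).
Hypothesis Y0 : forall a, price a = 0 -> forall p, Y a p = 0.
Hypothesis uY : forall t, I01 t -> forall x i k, (u i x t : E) 0 k = Y (inl (i, k)) (x, t).
Hypothesis vY : forall t, I01 t -> forall x i j, q i j != 0 -> v i j x t = Y (inr (i, j)) (x, t).

Let mf : forall i, measurable_fun setT (f i). Proof. by case: df. Qed.
Let f1 : forall i p, 0 <= f i p <= 1. Proof. by case: df. Qed.
Let f0 i p : 0 <= f i p. Proof. by case/andP: (f1 i p). Qed.
Let mw a : measurable_fun setT (weight f a). Proof. exact: weight_measurable. Qed.
Let w0 a p : 0 <= weight f a p. Proof. by case/andP: (weight01 a p f1). Qed.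

Let t0 a p : 0 <= price a * (Y a p ^+ 2 * weight f a p).
Proof.
apply: mulr_ge0; first exact: price_ge0.
by apply: mulr_ge0; [exact: sqr_ge0|exact: w0].
Qed.

Lemma enormE (x : E) : enorm x ^+ 2 = \sum_k x 0 k ^+ 2.
Proof.
rewrite /enorm sqr_sqrtr /dotr; first by apply: eq_bigr => k _; rewrite expr2.
by apply: sumr_ge0 => k _; rewrite -expr2 sqr_ge0.
Qed.

Lemma translate_action : action Omega q theta rho u v = energy mu f Y.
Proof.
have [_ _ [N [mN N0 gN]]] := df.
pose h (p : X) := (\sum_a (price a * (Y a p ^+ 2 * weight f a p))%:E)%E.
have ht0 a p : (0 <= (price a * (Y a p ^+ 2 * weight f a p))%:E)%E.
  by rewrite lee_fin t0.
have mht a : measurable_fun setT (fun p => (price a * (Y a p ^+ 2 * weight f a p))%:E).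
  apply/measurable_EFinP; apply: measurable_funM => //; apply: measurable_funM => //.
  exact: measurable_funX.
have h0 p : (0 <= h p)%E by apply: sume_ge0 => a _.
have mh : measurable_fun setT h by apply: emeasurable_sum => a; exact: mht.
rewrite /energy -ge0_integral_sum// -[RHS]/(\int[mu]_p h p)%E (smu h0 mh).
apply: (integral_off_null mN N0) => t It Nt.
have gt := gN t It Nt.
have [pt _] := cr It.
have [mt0 _] := pt.
have sl a : measurable_fun setT (fun x : Rd => (price a * (Y a (x, t) ^+ 2 * weight f a (x, t)))%:E).
  exact: (slice_fun t (mht a)).
rewrite /h ge0_integral_sum// sum_index /sqnorm; congr (_ + _)%E.
  apply: eq_bigr => i _; rewrite (integral_Omega cO)// -ge0_integral_sum//.
  rewrite (eq_integral (fun x : Rd => (\sum_k Y (inl (i, k)) (x, t) ^+ 2)%:E)); last first.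
    by move=> x _; rewrite enormE; congr EFin; apply: eq_bigr => k _; rewrite uY.
  rewrite (good_integral mf f1 gt); last first.
    apply/measurable_EFinP; apply: measurable_sum => k; apply: measurable_funX.
    exact: (slice_fun t (mY _)).
  apply: eq_integral => x _; rewrite -EFinM mulr_suml -sumEFin.
  by apply: eq_bigr => k _; rewrite /= mul1r.
(* The factor 2 undoes the halving contained in [price], since here the action carries its factor
   one half outside the sum. *)
have vE i j : (\int[mbar (rho t)]_(x in Omega)
    (`|v i j x t| ^+ 2 * theta_density theta (rho t) i j x * q i j)%:E =
    \int[mbar (rho t)]_x (2 * (price (inr (i, j)) * (Y (inr (i, j)) (x, t) ^+ 2 *
      weight f (inr (i, j)) (x, t))))%:E)%E.
  rewrite (integral_Omega cO); last exact: (mbar_compl pt).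
  have := good_theta mf gt (fun (th : 'I_n -> 'I_n -> R) (x : Rd) => (`|v i j x t| ^+ 2 * th i j * q i j)%:E).
  move=> /(fun E => eq_trans E _); apply.
  apply: eq_integral => x _; congr EFin; rewrite /= real_normK ?num_real//.
  have [->|qn] := eqVneq (q i j) 0; first by ring.
  by rewrite vY//; field.
have p0 i j x : (0 <= (2 * (price (inr (i, j)) * (Y (inr (i, j)) (x, t) ^+ 2 *
      weight f (inr (i, j)) (x, t))))%:E)%E.
  by rewrite lee_fin mulr_ge0// t0.
under eq_bigr => i _ do under eq_bigr => j _ do rewrite vE.
rewrite ge0_sume_distrr; last by move=> i _; apply: sume_ge0 => j _; exact: integral_ge0.
apply: eq_bigr => i _; rewrite ge0_sume_distrr; last by move=> j _; exact: integral_ge0.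
apply: eq_bigr => j _; rewrite -ge0_integralZl//.
  by apply: eq_integral => x _; rewrite -EFinM; congr EFin; field.
apply/measurable_EFinP; apply: measurable_funM => //.
by have /measurable_EFinP := sl (inr (i, j)).
Qed.

Lemma energy_integrable a : (energy mu f Y < +oo)%E ->
  mu.-integrable setT (EFin \o (fun p => Y a p ^+ 2 * weight f a p)).
Proof.
move=> Yfin; have m2 : measurable_fun setT (fun p => Y a p ^+ 2 * weight f a p).
  by apply: measurable_funM => //; exact: measurable_funX.
have [pa0|pa0] := eqVneq (price a) 0.
  apply: (@bounded_integrable _ _ _ _ _ 0) => // p.
  by rewrite Y0// expr0n mul0r normr0.
have ip : mu.-integrable setT (EFin \o (fun p => price a * (Y a p ^+ 2 * weight f a p))).
  apply/integrableP; split.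
    by apply/measurable_EFinP; apply: measurable_funM.
  apply: le_lt_trans Yfin; rewrite /energy (bigD1 a)//=.
  rewrite (eq_integral (fun p => (price a * (Y a p ^+ 2 * weight f a p))%:E)); last first.
    by move=> p _; rewrite /= ger0_norm// t0.
  rewrite leeDl//; apply: sume_ge0 => b _; apply: integral_ge0 => p _.
  by rewrite lee_fin t0.
have := integrableZl measurableT (price a)^-1 ip.
by apply: eq_integrable => // p _; rewrite /= -EFinM mulKf.
Qed.

(** By [|Y| <= 1 + Y ^+ 2] and [weight <= 1], a field of finite energy has a momentum that is
    integrable against every bounded function. *)
Lemma pair_integrable a (g : X -> R) C : (energy mu f Y < +oo)%E ->
  measurable_fun setT g -> (forall p, `|g p| <= C) ->
  mu.-integrable setT (EFin \o (fun p => g p * (Y a p * weight f a p))).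
Proof.
move=> Yfin mg gC; have C0 : 0 <= C by apply: le_trans (gC point).
have i1 : mu.-integrable setT (EFin \o (fun p => 1 + Y a p ^+ 2 * weight f a p)).
  have i0 : mu.-integrable setT (EFin \o cst 1).
    by apply: (@bounded_integrable _ _ _ mu (cst 1) 1) => // x; rewrite normr1.
  by have := integrableD measurableT i0 (energy_integrable a Yfin); exact: eq_integrable.
have i2 : mu.-integrable setT (EFin \o (fun p => C * (1 + Y a p ^+ 2 * weight f a p))).
  by have := integrableZl measurableT C i1; apply: eq_integrable => // p _.
apply: (le_integrable _ _ i2).
  by apply: measurable_funM => //; apply: measurable_funM.
move=> p; have /andP[w00 w11] := weight01 a p f1.
rewrite normrM (ger0_norm (_ : 0 <= C * _)); last first.
  by rewrite mulr_ge0// addr_ge0// mulr_ge0// sqr_ge0.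
apply: ler_pM => //; rewrite normrM (ger0_norm w00).
have : `|Y a p| <= 1 + Y a p ^+ 2.
  have := sqr_ge0 (`|Y a p| - 1); rewrite sqrrB real_normK ?num_real// => h.
  have := normr_ge0 (Y a p); nra.
move=> h; apply: (@le_trans _ _ ((1 + Y a p ^+ 2) * weight f a p)).
  by rewrite ler_wpM2r.
by rewrite mulrDl mul1r lerD2r.
Qed.

Lemma tfun_dtest i a (eta : ST -> R^o) : tfun eta -> tfun (dtest i a eta).
Proof.
move=> te; case: a => -[i' k] /=; first exact: tfunZ (tfun_derive _ te).
exact: tfunZ te.
Qed.

Lemma pairing_integral i (eta : ST -> R^o) : (energy mu f Y < +oo)%E -> tfun eta ->
  [/\ mu.-integrable setT (EFin \o (fun p => time_derivative eta p * f i p)),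
      mu.-integrable setT (EFin \o pairing f Y eta i) &
      \int[mu]_p pairing f Y eta i p = \int[mu]_p (time_derivative eta p * f i p) +
        \sum_a \int[mu]_p (dtest i a eta p * (Y a p * weight f a p))].
Proof.
move=> Yfin te.
have td : tfun (time_derivative eta : ST -> R^o) by exact: tfun_derive.
have [C [C0 HC]] := tfun_bounded td.
have i1 : mu.-integrable setT (EFin \o (fun p => time_derivative eta p * f i p)).
  apply: (@bounded_integrable _ _ _ _ _ C).
    by apply: measurable_funM => //; exact: (tfun_measurable td).
  move=> p; rewrite normrM -[leRHS]mulr1; apply: ler_pM => //.
  by have /andP[? ?] := f1 i p; rewrite ger0_norm.
have i2 a : mu.-integrable setT (EFin \o (fun p => dtest i a eta p * (Y a p * weight f a p))).
  have ta := tfun_dtest i a te; have [D [D0 HD]] := tfun_bounded ta.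
  by apply: (pair_integrable _ Yfin (tfun_measurable ta) HD).
have [i3 <-] := Rintegral_sum (index_enum K) i2.
split=> //; last by rewrite -RintegralD.
by have := integrableD measurableT i1 i3; exact: eq_integrable.
Qed.

(** By symmetry of [q] and [theta], the antisymmetric difference [v i j - v j i] of the equation at
    node [i] becomes a sum over all directed edges in which [dtest] selects those starting or ending
    at [i]. *)
Lemma translate_weak i (eta : ST -> R^o) : (energy mu f Y < +oo)%E -> tfun eta ->
  \int[leb]_(t in I01) (\int[rho t i]_x time_derivative eta (x, t)) =
    - (\int[leb]_(t in I01)
         (\int[rho t i]_x dotr (space_gradient eta (x, t)) (u i x t)))
    - 2^-1 * \sum_(j < n)
        \int[leb]_(t in I01) (\int[mbar (rho t)]_x
             (eta (x, t) * theta_density theta (rho t) i j x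
              * (v i j x t - v j i x t) * q i j)) <->
  \int[mu]_p pairing f Y eta i p = 0.
Proof.
move=> Yfin te; have [i1 _ ->] := pairing_integral i Yfin te.
have [_ _ [N [mN N0 gN]]] := df.
have int (g : ST -> R^o) a : tfun g ->
    mu.-integrable setT (EFin \o (fun p => g p * (Y a p * weight f a p))).
  move=> tg; have [D [D0 HD]] := tfun_bounded tg.
  by apply: (pair_integrable _ Yfin (tfun_measurable tg) HD).
have -> : \int[leb]_(t in I01) (\int[rho t i]_x time_derivative eta (x, t)) =
    \int[mu]_p (time_derivative eta p * f i p).
  rewrite -(stmeas_Rintegral cO cr smu i1).
  apply: (Rintegral_off_null mN N0) => t It Nt.
  rewrite (good_Rintegral mf f1 (gN t It Nt))//.
  apply: (slice_fun t (h := time_derivative eta)).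
  exact: (tfun_measurable (tfun_derive _ te)).
pose P (g : ST -> R^o) a := \int[mu]_p (g p * (Y a p * weight f a p)).
pose G k : ST -> R^o := 'D_((delta_mx 0 k, 0) : ST) eta.
have tG k : tfun (G k) by exact: tfun_derive.
have -> : \int[leb]_(t in I01) (\int[rho t i]_x dotr (space_gradient eta (x, t)) (u i x t)) =
    \sum_k P (G k) (inl (i, k)).
  have [i3 <-] := Rintegral_sum (index_enum 'I_d) (fun k => int _ (inl (i, k)) (tG k)).
  rewrite -(stmeas_Rintegral cO cr smu i3).
  apply: (Rintegral_off_null mN N0) => t It Nt.
  have uE x : dotr (space_gradient eta (x, t)) (u i x t) =
      \sum_k G k (x, t) * Y (inl (i, k)) (x, t).
    by rewrite /dotr; apply: eq_bigr => k _; rewrite mxE uY.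
  under eq_Rintegral do rewrite uE.
  rewrite (good_Rintegral mf f1 (gN t It Nt)).
    by apply: eq_Rintegral => x _; rewrite mulr_suml; apply: eq_bigr => k _; rewrite mulrA.
  apply: measurable_sum => k; apply: measurable_funM; last exact: (slice_fun t (mY _)).
  by apply: (slice_fun t (h := G k)); exact: (tfun_measurable (tG k)).
have vE j : \int[leb]_(t in I01) (\int[mbar (rho t)]_x
             (eta (x, t) * theta_density theta (rho t) i j x
              * (v i j x t - v j i x t) * q i j)) =
    q i j * (P eta (inr (i, j)) - P eta (inr (j, i))).
  have ib a := int _ a te.
  rewrite /P -RintegralB// -RintegralZl//; last first.
    by have := integrableB measurableT (ib (inr (i, j))) (ib (inr (j, i))); exact: eq_integrable.
  have ic : mu.-integrable setT (EFin \o (fun p => q i j * (eta p * (Y (inr (i, j)) p * weight f (inr (i, j)) p) -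
       eta p * (Y (inr (j, i)) p * weight f (inr (j, i)) p)))).
    have := integrableB measurableT (ib (inr (i, j))) (ib (inr (j, i))).
    by move=> /(integrableZl measurableT (q i j)); exact: eq_integrable.
  rewrite -(stmeas_Rintegral cO cr smu ic).
  apply: (Rintegral_off_null mN N0) => t It Nt.
  rewrite /Rintegral; congr fine.
  have := good_theta mf (gN t It Nt) (fun (th : 'I_n -> 'I_n -> R) (x : Rd) =>
    (eta (x, t) * th i j * (v i j x t - v j i x t) * q i j)%:E).
  move=> /(fun E => eq_trans E _); apply.
  apply: eq_integral => x _; congr EFin; rewrite /weight.
  rewrite [theta (f j _) _](interp_sym hI)//.
  have [->|qn] := eqVneq (q i j) 0; first by ring.
  have qn' : q j i != 0 by rewrite qC.
  by rewrite !vY//; ring.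
under [X in _ - _ * X]eq_bigr do rewrite vE.
have -> : \sum_a \int[mu]_p (dtest i a eta p * (Y a p * weight f a p)) =
    \sum_k P (G k) (inl (i, k)) +
    2^-1 * \sum_j q i j * (P eta (inr (i, j)) - P eta (inr (j, i))).
  rewrite sum_index; congr (_ + _).
    rewrite (bigD1 i)//= [X in _ + X]big1 ?addr0.
      apply: eq_bigr => k _; apply: eq_Rintegral => p _.
      by rewrite eqxx mul1r.
    move=> i' /negbTE i'i; apply: big1 => k _.
    by apply: Rintegral_eq0 => p; rewrite /dtest i'i !mul0r.
  have dE i' j : \int[mu]_p (dtest i (inr (i', j)) eta p * (Y (inr (i', j)) p * weight f (inr (i', j)) p)) =
      2^-1 * q i' j * ((i' == i)%:R - (j == i)%:R) * P eta (inr (i', j)).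
    rewrite /P -RintegralZl//; last exact: int.
    by apply: eq_Rintegral => p _; rewrite /= !mulrA.
  under eq_bigr => i' _ do under eq_bigr => j _ do rewrite dE mulrBr mulrBl.
  under eq_bigr => i' _ do rewrite sumrB.
  rewrite sumrB.
  have -> : \sum_i' \sum_j 2^-1 * q i' j * (i' == i)%:R * P eta (inr (i', j)) =
      \sum_j 2^-1 * q i j * P eta (inr (i, j)).
    rewrite (bigD1 i)//= [X in _ + X]big1 ?addr0.
      by apply: eq_bigr => j _; rewrite eqxx mulr1.
    by move=> i' /negbTE i'i; apply: big1 => j _; rewrite i'i mulr0 mul0r.
  have -> : \sum_i' \sum_j 2^-1 * q i' j * (j == i)%:R * P eta (inr (i', j)) =
      \sum_j 2^-1 * q i j * P eta (inr (j, i)).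
    apply: eq_bigr => i' _; rewrite (bigD1 i)//= [X in _ + X]big1 ?addr0.
      by rewrite eqxx mulr1 qC.
    by move=> j /negbTE ji; rewrite ji mulr0 mul0r.
  by rewrite -sumrB mulr_sumr; apply: eq_bigr => j _; ring.
set A := \int[mu]_p _; set B := \sum_k _; set D := \sum_j _.
by split; lra.
Qed.

End translate.
End Solutions.

Section Equivalence.
Context (R : realType) (d n : nat).
Local Notation E := ('rV[R]_d).
Local Notation Rd := (euclid R d).
Local Notation T := (measurableTypeR R).
Local Notation X := (Rd * T)%type.
Local Notation ST := (E * R^o)%type.
Local Notation leb := (@lebesgue_measure R).
Local Notation I01 := ([set` `[(0 : R), 1]] : set T).
Variables (Omega : set Rd) (q : 'I_n -> 'I_n -> R) (theta : R -> R -> R).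
Hypothesis cO : closed (Omega : set E).
Hypothesis q0 : forall i j, 0 <= q i j.
Hypothesis qC : weight_symmetric q.
Hypothesis hI : interpolation theta.
Local Notation K := (field_index d n).
Local Notation solution := (solution Omega q theta).
Local Notation energy := (energy q theta).
Local Notation weight := (weight theta).

(** From a curve of finite action to the space-time form: densities are jointly measurable, and the
    velocities become fields on all of space-time. *)
Lemma action_solution m0 m1 rho (u : velocity R d n) (v : edge_velocity R d n) :
  connecting Omega q theta m0 m1 rho u v ->
  (action Omega q theta rho u v < +oo)%E ->
  exists mu f (Y : K -> X -> R), solution rho mu f Y /\
    energy mu f Y = action Omega q theta rho u v.
Proof.
move=> [[cr mu_ iu mv iv weak] _ _] Afin.
have [f df] := curve_dens cO cr.
have smu := stmeas_cmu cO cr; set mu := cmu cO cr in smu.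
pose D : set X := setT `*` I01.
have mD : measurable D by apply: measurableX => //; exact: measurable_itv.
(* Velocities are extended by 0 outside the time interval. Edges with [q i j = 0] contribute neither
   to the action nor to the equation, so their field is set to 0. *)
pose Y (a : K) : X -> R := match a with
  | inl (i, k) => (fun p : X => (u i p.1 p.2 : E) 0 k) \_ D
  | inr (i, j) => fun p => (q i j != 0)%:R * ((fun p : X => v i j p.1 p.2) \_ D) p end.
have mY a : measurable_fun setT (Y a).
  case: a => -[i j]; rewrite /Y.
    have h := measurableT_comp (measurable_coord j) (mu_ i).
    exact: ((measurable_restrictT _ mD).1 h).
  have h := (measurable_restrictT _ mD).1 (mv i j).
  by have := measurable_funM (@measurable_cst _ _ X _ setT ((q i j != 0)%:R : R)) h.
have Y0 a : price q a = 0 -> forall p, Y a p = 0.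
  case: a => -[i j] /=; first by move/eqP; rewrite oner_eq0.
  by move/eqP; rewrite mulf_eq0 invr_eq0 pnatr_eq0 orbF => -> p; rewrite mul0r.
have inD x t : I01 t -> (x, t) \in D by move=> It; rewrite mem_set.
have uY t : I01 t -> forall x i k, (u i x t : E) 0 k = Y (inl (i, k)) (x, t).
  by move=> It x i k; rewrite /Y patchE inD.
have vY t : I01 t -> forall x i j, q i j != 0 -> v i j x t = Y (inr (i, j)) (x, t).
  by move=> It x i j qn; rewrite /Y patchE inD// qn mul1r.
have aE := translate_action cO q0 hI cr smu df mY uY vY.
exists mu, f, Y; split=> //; split=> //; first by rewrite -aE.
move=> eta te i.
apply/(translate_weak cO q0 qC hI cr smu df mY Y0 uY vY); last exact: weak.
  by rewrite -aE.
exact: test_function_tfun te.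
Qed.

Lemma solution_action rho mu f (Y : K -> X -> R) : solution rho mu f Y ->
  exists u v, connecting Omega q theta (rho 0) (rho 1) rho u v /\
    action Omega q theta rho u v = energy mu f Y.
Proof.
move=> [cr smu df mY Y0 Yfin weak].
pose u : velocity R d n := fun i x t => \row_k Y (inl (i, k)) (x, t).
pose v : edge_velocity R d n := fun i j x t => Y (inr (i, j)) (x, t).
have uY t : I01 t -> forall x i k, (u i x t : E) 0 k = Y (inl (i, k)) (x, t).
  by move=> It x i k; rewrite /u mxE.
have vY t : I01 t -> forall x i j, q i j != 0 -> v i j x t = Y (inr (i, j)) (x, t) by [].
have aE := translate_action cO q0 hI cr smu df mY uY vY.
exists u, v; split=> //; split=> //; split=> //.
- move=> i; apply: measurable_funTS; apply: measurable_to_Rd => // k.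
  apply: (eq_measurable_fun (Y (inl (i, k)))); last exact: mY.
  by move=> -[x t] _; rewrite /u mxE.
- move=> i.
  have [mf f1 [N [mN N0 gN]]] := df.
  have eE (p : X) : enorm (u i p.1 p.2) = Num.sqrt (\sum_k Y (inl (i, k)) p ^+ 2).
    rewrite /enorm /dotr; congr Num.sqrt; apply: eq_bigr => k _.
    by rewrite !mxE expr2; case: p.
  have me : measurable_fun setT (fun p : X => enorm (u i p.1 p.2)).
    under eq_fun do rewrite eE.
    apply: (measurableT_comp (f := Num.sqrt : R -> R)).
      by apply: continuous_measurable_fun; exact: sqrt_continuous.
    by apply: measurable_sum => k; apply: measurable_funX.
  rewrite (integral_off_null mN N0 (g := fun t => \int[mbar (rho t)]_x (enorm (u i x t) * f i (x, t))%:E)%E); last first.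
    move=> t It Nt; have [[m0 _] _] := cr t It.
    rewrite (integral_Omega cO)// (good_integral mf f1 (gN t It Nt))//.
    by apply/measurable_EFinP; exact: (slice_fun t me).
  have f0 p : 0 <= f i p by case/andP: (f1 i p).
  have e0 (p : X) : 0 <= enorm (u i p.1 p.2) by exact: sqrtr_ge0.
  have m2 : measurable_fun setT (fun p : X => enorm (u i p.1 p.2) * f i p).
    exact: measurable_funM.
  rewrite -(smu (fun p => (enorm (u i p.1 p.2) * f i p)%:E)); last 2 first.
  + by move=> p; rewrite lee_fin mulr_ge0.
  + exact/measurable_EFinP.
  have ik k := energy_integrable q0 hI df mY Y0 (inl (i, k)) Yfin.
  have [is_ _] := Rintegral_sum (index_enum 'I_d) ik.
  have i0 : mu.-integrable setT (EFin \o f i).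
    by apply: (@bounded_integrable _ _ _ _ _ 1) => // p; rewrite ger0_norm//; case/andP: (f1 i p).
  (* Finite action gives the required integrability of speeds through [|u| <= 1 + |u|^2]. *)
  have i2 : mu.-integrable setT (EFin \o (fun p => f i p + \sum_k Y (inl (i, k)) p ^+ 2 * f i p)).
    by have := integrableD measurableT i0 is_; exact: eq_integrable.
  have : mu.-integrable setT (EFin \o (fun p : X => enorm (u i p.1 p.2) * f i p)).
    apply: (le_integrable m2 _ i2) => p.
    have s0 : 0 <= \sum_k Y (inl (i, k)) p ^+ 2 by apply: sumr_ge0 => k _; exact: sqr_ge0.
    rewrite -mulr_suml [leRHS]ger0_norm; last by rewrite addr_ge0// mulr_ge0.
    rewrite ger0_norm ?mulr_ge0// -[X in _ <= X + _]mul1r -mulrDl ler_wpM2r//.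
    have : enorm (u i p.1 p.2) ^+ 2 = \sum_k Y (inl (i, k)) p ^+ 2 by rewrite eE sqr_sqrtr.
    move=> <-; have := sqr_ge0 (enorm (u i p.1 p.2) - 1); have := e0 p; nra.
  move=> /integrableP[_]; apply: le_lt_trans; rewrite le_eqVlt; apply/orP; left.
  by apply/eqP/eq_integral => p _; rewrite /= ger0_norm// mulr_ge0.
- move=> i j; apply: measurable_funTS.
  apply: (eq_measurable_fun (Y (inr (i, j)))); last exact: mY.
  by move=> -[x t] _.
- move=> i j.
  have [mf f1 [N [mN N0 gN]]] := df.
  rewrite (integral_off_null mN N0 (g := fun t => \int[mbar (rho t)]_x
      (`|Y (inr (i, j)) (x, t)| * weight f (inr (i, j)) (x, t))%:E)%E); last first.
    move=> t It Nt; have [pt _] := cr t It.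
    rewrite (integral_Omega cO); last exact: mbar_compl pt.
    have := good_theta theta mf (gN t It Nt) (fun (th : 'I_n -> 'I_n -> R) (x : Rd) =>
      (`|v i j x t| * th i j)%:E).
    by move=> /(fun E => eq_trans E _); apply.
  have w0 p : 0 <= weight f (inr (i, j)) p by case/andP: (weight01 hI (inr (i, j)) p f1).
  rewrite -(smu (fun p => (`|Y (inr (i, j)) p| * weight f (inr (i, j)) p)%:E)); last 2 first.
  + by move=> p; rewrite lee_fin mulr_ge0.
  + apply/measurable_EFinP; apply: measurable_funM; first exact: measurableT_comp.
    exact: (weight_measurable hI).
  have := pair_integrable q0 hI df mY Y0 (inr (i, j)) Yfin (@measurable_cst _ _ X _ setT (1 : R))
    (C := 1).
  move=> H; have {H}/integrableP[_] : mu.-integrable setT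
    (EFin \o (fun p => 1 * (Y (inr (i, j)) p * weight f (inr (i, j)) p))).
    by apply: H => p; rewrite normr1.
  apply: le_lt_trans; rewrite le_eqVlt; apply/orP; left.
  by apply/eqP/eq_integral => p _; rewrite /= mul1r normrM (ger0_norm (w0 p)).
- move=> eta te i.
  apply/(translate_weak cO q0 qC hI cr smu df mY Y0 uY vY); last exact: weak.
    exact: Yfin.
  exact: test_function_tfun te.
Qed.
End Equivalence.

(** * Boundary values *)

Section Lines.
Context (R : realType).
Local Notation T := (measurableTypeR R).
Local Notation leb := (@lebesgue_measure R).
Local Notation I01 := ([set` `[(0 : R), 1]] : set T).

Section line.
Context (V : normedModType R) (f : V -> R^o).
Hypothesis sf : smooth f.
Implicit Types w v : V.

Let aff w v (r : R^o) : V := w + r *: v.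

Let affL w v r h (c : R) : aff w v (c *: h + r) = c *: (h *: v) + aff w v r.
Proof. by rewrite /aff scalerDl scalerA addrCA. Qed.

Let affD w v r : differentiable (aff w v) r.
Proof.
apply: differentiableD; first exact: differentiable_cst.
by apply: (@differentiableZl _ _ _ id).
Qed.

Lemma smooth_line w v : smooth (fun r : R^o => f (w + r *: v)).
Proof. by move=> k; apply: (Ck_on_affine (affL w v) (affD w v)); exact: sf. Qed.

Lemma derive_line w v (r : R^o) :
  'D_(1 : R^o) (fun r : R^o => f (w + r *: v)) r = 'D_v f (w + r *: v).
Proof.
have := derive_affine (affL w v) f (1 : R^o).
by move=> /(congr1 (fun g => g r)); rewrite /= scale1r.
Qed.

Lemma is_derive_line w v (r : R) :
  is_derive r 1 (fun r : R => f (w + r *: v)) ('D_v f (w + r *: v)).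
Proof.
split; last exact: derive_line.
apply/derivable1_diffP; exact: (smooth_differentiable (r : R^o) (smooth_line w v)).
Qed.

Lemma line_continuous w v : continuous (fun r : R => f (w + r *: v)).
Proof. exact: (smooth_continuous (smooth_line w v)). Qed.

Lemma line_lip w v C s t : (forall p, `|'D_v f p| <= C) ->
  `|f (w + s *: v) - f (w + t *: v)| <= C * `|s - t|.
Proof.
move=> fC; wlog st : s t / t <= s => [H|].
  have [/H//|/ltW/H] := leP t s.
  by rewrite distrC [X in _ * X]distrC.
have [|c _ ->] := MVT_segment st (fun x _ => is_derive_line w v x).
  by apply: continuous_subspaceT; exact: line_continuous.
by rewrite normrM ler_wpM2r.
Qed.

End line.

Lemma line_FTC (V : normedModType R) (f : V -> R^o) (w v : V) : smooth f ->
  \int[leb]_(r in I01) 'D_v f (w + r *: v) = f (w + v) - f w.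
Proof.
move=> sf; have := @continuous_FTC2 R (fun r => 'D_v f (w + r *: v))
  (fun r => f (w + r *: v)) 0 1 ltr01.
move=> H; rewrite /Rintegral H.
- by rewrite /= scale1r scale0r addr0.
- apply: continuous_subspaceT; exact: (@line_continuous _ _ (smooth_derive v sf) w v).
- have cl := @line_continuous _ _ sf w v.
  split=> [x _||].
  + by have [] := is_derive_line sf w v x.
  + by apply: cvg_at_right_filter; exact: cl.
  + by apply: cvg_at_left_filter; exact: cl.
- by move=> x _; rewrite derive1E; exact: derive_line.
Qed.

Lemma deriveZdir (V : normedModType R) (f : V -> R^o) (p v : V) (c : R) :
  smooth f -> 'D_(c *: v) f p = c * 'D_v f p.
Proof.
move=> sf; have df := smooth_differentiable p sf.
by rewrite !deriveE// linearZ.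
Qed.

Lemma derive_cstM (V : normedModType R) (f : V -> R^o) (p v : V) (c : R) :
  smooth f -> 'D_v (fun q => c * f q : R^o) p = c * 'D_v f p.
Proof. by move=> sf; have := @deriveZ _ _ _ f c p v (smooth_derivable sf). Qed.

Lemma derive_mul (V : normedModType R) (f g : V -> R^o) (p v : V) : smooth f -> smooth g ->
  'D_v (fun q => f q * g q : R^o) p = f p * 'D_v g p + g p * 'D_v f p.
Proof.
by move=> sf sg; have := @deriveM _ _ f g p v (smooth_derivable sf) (smooth_derivable sg).
Qed.

Lemma derive_add (V : normedModType R) (f g : V -> R^o) (p v : V) : smooth f -> smooth g ->
  'D_v (fun q => f q + g q : R^o) p = 'D_v f p + 'D_v g p.
Proof.
by move=> sf sg; have := @deriveD _ _ _ f g p v (smooth_derivable sf) (smooth_derivable sg).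
Qed.

(** The time derivative of [step (m * r - c)]: of integral 1 when its support [[c / m, (c + 1) / m]]
    lies in the unit interval. *)
Definition tbump (m c r : R) : R := 'D_(m : R^o) (@step R) (- c + r *: (m : R^o)).

Lemma tbumpE m c r : tbump m c r = m * 'D_(1 : R^o) (@step R) (m * r - c).
Proof.
rewrite /tbump addrC [r *: _]mulrC.
rewrite -[X in 'D_X _ _](_ : m *: (1 : R^o) = m); last by rewrite /GRing.scale /= mulr1.
by rewrite deriveZdir//; exact: smooth_step.
Qed.

Lemma dstep_eq0 x : x < 0 \/ 1 < x -> 'D_(1 : R^o) (@step R) x = 0.
Proof.
move=> hx; have H : \forall y \near (x : R^o), @step R y = cst (@step R x) y.
  case: hx => hx.
    have : \forall y \near (x : R^o), y < 0 by exact: lt_nbhsl.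
    by apply: filterS => y y0; rewrite /= !step_eq0// ltW.
  have : \forall y \near (x : R^o), 1 < y by exact: lt_nbhsr.
  by apply: filterS => y y0; rewrite /= !step_eq1// ltW.
by rewrite (near_eq_derive _ H) derive_cst.
Qed.

Lemma dstep_bounded : exists C, 0 < C /\ forall x, `|'D_(1 : R^o) (@step R) x| <= C.
Proof.
have cd : continuous (fun x : R => `|'D_(1 : R^o) (@step R) x|).
  have h := smooth_continuous (smooth_derive (1 : R^o) (@smooth_step R)).
  by move=> x; apply: (@cvg_norm _ R^o); exact: (h x).
have [c _ H] := EVT_max (@ler01 R) (continuous_subspaceT cd).
exists (`|'D_(1 : R^o) (@step R) c| + 1); split=> [|x]; first by rewrite ltr_pwDr.
have [x0|x0] := ltP x 0; first by rewrite dstep_eq0 ?normr0 ?addr_ge0//; left.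
have [x1|x1] := ltP 1 x; first by rewrite dstep_eq0 ?normr0 ?addr_ge0//; right.
by rewrite (le_trans (H x _)) ?lerDl// in_itv /= x0.
Qed.

Lemma tbump_continuous m c : continuous (tbump m c).
Proof. exact: (@line_continuous _ _ (smooth_derive (m : R^o) (@smooth_step R)) (- c : R^o) (m : R^o)). Qed.

Lemma tbump_avg (F : R -> R) x e : continuous F -> 0 < e ->
  exists dl, 0 < dl /\ forall m c, 0 < m -> 0 <= c -> c + 1 <= m ->
    (forall r, c <= m * r -> m * r <= c + 1 -> `|r - x| < dl) ->
    `|\int[leb]_(r in I01) (tbump m c r * F r) - F x| <= e.
Proof.
move=> cF e0; have [C [C0 HC]] := dstep_bounded.
have e'0 : 0 < e / C by rewrite divr_gt0.
have := cF x; move=> /cvgrPdist_le/(_ _ e'0)/nbhs_ballP[dl /= dl0 H].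
exists dl; split=> // m c m0 c0 cm hr.
have cB := @tbump_continuous m c.
have mI : measurable I01 by exact: measurable_itv.
have int (g : R -> R) : continuous g -> leb.-integrable I01 (EFin \o g).
  move=> cg; apply: continuous_compact_integrable; first exact: segment_compact.
  exact: continuous_subspaceT.
have B1 : \int[leb]_(r in I01) tbump m c r = 1.
  rewrite /tbump line_FTC; last exact: smooth_step.
  by rewrite step_eq1 ?step_eq0 ?subr0//; [rewrite oppr_le0|rewrite addrC lerBrDr addrC].
have cBF : continuous (fun r => tbump m c r * F r).
  by move=> r; apply: (@continuousM R); [exact: cB|exact: cF].
have cBx : continuous (fun r => tbump m c r * F x).
  by move=> r; apply: (@continuousM R); [exact: cB|exact: cst_continuous].
have -> : \int[leb]_(r in I01) (tbump m c r * F r) - F x =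
    \int[leb]_(r in I01) (tbump m c r * (F r - F x)).
  have E1 : F x = \int[leb]_(r in I01) (tbump m c r * F x).
    by rewrite RintegralZr//; [rewrite B1 mul1r|exact: int].
  rewrite [X in _ - X]E1 -RintegralB//; [|exact: int|exact: int].
  by apply: eq_Rintegral => r _; rewrite mulrBr.
have cD : continuous (fun r => tbump m c r * (F r - F x)).
  move=> r; apply: (@continuousM R); first exact: cB.
  by apply: (@continuousB R); [exact: cF|exact: cst_continuous].
apply: (le_trans (le_normr_Rintegral mI (int _ cD))).
pose J := [set` `[c / m, (c + 1) / m]] : set T.
have mJ : measurable J by exact: measurable_itv.
have JI : J `<=` I01.
  move=> r; rewrite /J /= !in_itv /= => /andP[r1 r2]; apply/andP; split.
    by apply: le_trans r1; rewrite divr_ge0// ltW.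
  by apply: (le_trans r2); rewrite ler_pdivrMr// mul1r.
have lJ : (\int[leb]_(r in I01) (\1_J r : R)%:E = (m^-1)%:E)%E.
  rewrite integral_indic// (setIidl JI).
  transitivity ((c + 1) / m - c / m)%:E.
    have := @lebesgue_measure_itv R `[c / m, (c + 1) / m]; rewrite /= lte_fin.
    rewrite ltr_pM2r ?invr_gt0// ltrDl ltr01; exact.
  by rewrite -mulrBl addrAC subrr add0r mul1r.
have i1 : leb.-integrable I01 (EFin \o (\1_J : R -> R)).
  apply/integrableP; split; first exact/measurable_EFinP/measurable_indic.
  under eq_integral do rewrite /= ger0_norm//.
  by rewrite lJ ltry.
apply: (@le_trans _ _ (\int[leb]_(r in I01) (m * e * (\1_J r : R)))).
  apply: le_Rintegral => //.
  - have := integrable_norm (int _ cD); exact: eq_integrable.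
  - by have := integrableZl mI (m * e) i1; exact: eq_integrable.
  move=> r _; rewrite indicE; have [Jr|Jr] := pselect (J r).
    rewrite mem_set// mulr1 normrM tbumpE normrM gtr0_norm//.
    move: Jr; rewrite /J /= in_itv /= ler_pdivrMr// ler_pdivlMr// => /andP[r1 r2].
    have /H : ball x dl r by rewrite /ball /= distrC hr// mulrC.
    move=> /= h; rewrite distrC in h; rewrite -mulrA ler_pM2l//.
    have -> : e = C * (e / C) by rewrite mulrC divfK// gt_eqF.
    exact: ler_pM.
  rewrite memNset// mulr0 tbumpE dstep_eq0 ?mulr0 ?mul0r ?normr0//.
  have [h1|h1] := ltP (m * r) c; first by left; lra.
  have [h2|h2] := ltP (c + 1) (m * r); first by right; lra.
  exfalso; apply: Jr; rewrite /J /= in_itv /= ler_pdivrMr// ler_pdivlMr//.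
  by rewrite mulrC h1.
by rewrite RintegralZl// /Rintegral lJ /= mulrAC mulfV ?mul1r// gt_eqF.
Qed.

End Lines.

Section Boundary.
Context (R : realType) (d n : nat).
Local Notation E := ('rV[R]_d).
Local Notation Rd := (euclid R d).
Local Notation T := (measurableTypeR R).
Local Notation X := (Rd * T)%type.
Local Notation ST := (E * R^o)%type.
Local Notation leb := (@lebesgue_measure R).
Local Notation I01 := ([set` `[(0 : R), 1]] : set T).
Variables (Omega : set Rd) (q : 'I_n -> 'I_n -> R) (theta : R -> R -> R).
Hypothesis cO : closed (Omega : set E).
Hypothesis q0 : forall i j, 0 <= q i j.
Hypothesis hI : interpolation theta.
Local Notation K := (field_index d n).
Local Notation solution := (solution Omega q theta).
Local Notation energy := (energy q theta).
Local Notation weight := (weight theta).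
Local Notation pairing := (pairing q theta).

Lemma time_lineE (x : E) (r : R) : ((x, 0) : ST) + r *: ((0, 1) : ST) = (x, r) :> ST.
Proof. by congr pair; rewrite /= ?scaler0 ?addr0// add0r /GRing.scale /= mulr1. Qed.

Lemma tfun_time_lip (eta : ST -> R^o) : tfun eta ->
  exists C, 0 <= C /\ forall x s t, `|eta (x, s) - eta (x, t)| <= C * `|s - t|.
Proof.
move=> te; have [C [C0 HC]] := tfun_bounded (tfun_derive ((0, 1) : ST) te).
exists C; split=> // x s t; rewrite -(time_lineE x s) -(time_lineE x t).
by apply: (line_lip (tfun_smooth te)) => p; exact: HC.
Qed.

Lemma tfun_slice_Cb (eta : ST -> R^o) t : tfun eta -> Cb (fun x : E => eta (x, t) : R).
Proof.
move=> te; split; last by have [C [_ HC]] := tfun_bounded te; exists C => x; exact: HC.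
move=> x; apply: (@continuous_comp _ _ _ (fun x : E => (x, t) : ST) eta); last exact: tfun_continuous.
move=> A [[U V] /= [Ux Vt] UVA]; apply: filterS Ux => y Uy; apply: UVA; split=> //=.
exact: nbhs_singleton Vt.
Qed.

Lemma slice_diff (m : {finite_measure set Rd -> \bar R}) (eta : ST -> R^o) C s t :
  tfun eta -> 0 <= C -> (forall x s t, `|eta (x, s) - eta (x, t)| <= C * `|s - t|) ->
  (m setT <= 1%:E)%E ->
  `|\int[m]_x eta (x, s) - \int[m]_x eta (x, t)| <= C * `|s - t|.
Proof.
move=> te C0 HC m1.
have It := tfun_slice_integrable m _ te.
have iB : m.-integrable setT (EFin \o (fun x : Rd => eta (x, s) - eta (x, t))).
  by have := integrableB measurableT (It s) (It t); exact: eq_integrable.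
rewrite -RintegralB//; [|exact: It|exact: It].
apply: (le_trans (le_normr_Rintegral measurableT iB)).
have i1 : m.-integrable setT (EFin \o cst (C * `|s - t|)).
  by apply: (@bounded_integrable _ _ _ _ _ `|C * `|s - t| |).
apply: (@le_trans _ _ (\int[m]_(_ in setT) (C * `|s - t|))).
  apply: le_Rintegral => //.
    by have := integrable_norm iB; exact: eq_integrable.
rewrite Rintegral_cst// -[leRHS]mulr1 ler_wpM2l ?mulr_ge0//.
by rewrite -lee_fin fineK ?fin_num_measure.
Qed.

Section curve.
Variables (rho : R -> vmeasure R d n).
Hypothesis cr : curve_vprob Omega 0 1 rho.

(** Narrow continuity handles the test function frozen at time [s], and its Lipschitz bound in time
    handles the rest. *)
Lemma curve_slice_continuous i (eta : ST -> R^o) : tfun eta ->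
  continuous (fun t : R => \int[rho (clamp t) i]_x eta (x, clamp t)).
Proof.
move=> te s; have [C [C0 HC]] := tfun_time_lip te.
have Cs := tfun_slice_Cb (clamp s) te.
have h1 := @curve_clamp_cvg _ _ _ _ cO _ cr i _ s Cs.
apply/cvgrPdist_le => e e0; have e20 := half_gt0 e0.
have eC : 0 < e / 2 / (C + 1) by rewrite divr_gt0// ltr_wpDl.
have := @clamp_continuous R s => /cvgrPdist_le/(_ _ eC) h2.
near=> t.
have -> : e = e / 2 + e / 2 by rewrite -splitr.
rewrite (_ : _ - _ = (\int[rho (clamp s) i]_x eta (x, clamp s) - \int[rho (clamp t) i]_x eta (x, clamp s)) +
   (\int[rho (clamp t) i]_x eta (x, clamp s) - \int[rho (clamp t) i]_x eta (x, clamp t))); last by ring.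
apply: (le_trans (ler_normD _ _)); apply: lerD.
  by near: t; move/cvgrPdist_le: h1; exact.
apply: (le_trans (slice_diff (clamp s) (clamp t) te C0 HC (vprob_le1 cO i (proj1 (cr (clamp_I01 t)))))).
have : `|clamp s - clamp t| <= e / 2 / (C + 1) by near: t.
rewrite ler_pdivlMr ?ltr_wpDl// mulrDr mulr1 mulrC.
by apply: le_trans; rewrite lerDl.
Unshelve. all: by end_near. Qed.
End curve.

Section solution.
Variables (rho : R -> vmeasure R d n) (mu : {finite_measure set X -> \bar R}).
Variables (f : 'I_n -> X -> R) (Y : K -> X -> R).
Hypothesis S : solution rho mu f Y.

(** A difference of two steps that rises between [s + 1 / k] and [s + 2 / k] and falls between
    [t - 2 / k] and [t - 1 / k]. The margins keep the support strictly inside the open interval even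
    when [s = 0] or [t = 1]. *)
Definition window (k s t : R) (p : ST) : R^o :=
  @step R (k * p.2 + - (k * s + 1)) + (-1) * @step R (k * p.2 + - (k * t - 2)).

Lemma smooth_window k s t : smooth (window k s t).
Proof.
apply: smoothD; first exact: (smooth_time d _ _ (@smooth_step R)).
by apply: smoothM; [exact: smooth_cst|exact: (smooth_time d _ _ (@smooth_step R))].
Qed.

Lemma derive_time_step (k c : R) (p v : ST) :
  'D_v (fun p : ST => @step R (k * p.2 + - c)) p = v.2 * tbump k c p.2.
Proof.
have AL (w h : ST) (r : R) : k * (r *: h + w).2 + - c = r *: (k * h.2) + (k * w.2 + - c).
  by rewrite /= mulrDr addrA [k * (_ * _)]mulrCA.
have := derive_affine (A := fun p : ST => k * p.2 + - c : R^o) (L := fun p : ST => k * p.2 : R^o) AL (@step R) v.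
move=> /(congr1 (fun g => g p)) /= ->.
rewrite -[X in 'D_X _ _](_ : (k * v.2) *: (1 : R^o) = k * v.2); last by rewrite /GRing.scale /= mulr1.
rewrite deriveZdir; last exact: smooth_step.
by rewrite tbumpE mulrA [v.2 * k]mulrC.
Qed.

Lemma derive_window k s t (p v : ST) :
  'D_v (window k s t) p = v.2 * (tbump k (k * s + 1) p.2 - tbump k (k * t - 2) p.2).
Proof.
have ss c : smooth (fun p : ST => @step R (k * p.2 + - c)).
  exact: (smooth_time d k (- c) (@smooth_step R)).
rewrite /window derive_add; [|exact: ss|]; last first.
  by apply: smoothM; [exact: smooth_cst|exact: ss].
by rewrite derive_cstM; [rewrite !derive_time_step; ring|exact: ss].
Qed.

Lemma pairing_window k s t eta i p : tfun eta ->
  pairing f Y (fun p => window k s t p * eta p) i p =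
  (tbump k (k * s + 1) p.2 - tbump k (k * t - 2) p.2) * (eta p * f i p) +
  window k s t p * pairing f Y eta i p.
Proof.
move=> te.
have dM v : 'D_v (fun p => window k s t p * eta p) p =
    window k s t p * 'D_v eta p + eta p * (v.2 * (tbump k (k * s + 1) p.2 - tbump k (k * t - 2) p.2)).
  rewrite derive_mul ?derive_window//; first exact: smooth_window.
  exact: tfun_smooth.
rewrite /pairing /time_derivative dM /= mul1r [window k s t p * (_ + _)]mulrDr mulr_sumr addrA; congr (_ + _); first by ring.
apply: eq_bigr => -[[i' k']|[i' j]] _ /=; last by ring.
by rewrite dM /= mul0r mulr0 addr0; ring.
Qed.

Lemma window01 k s t p : 0 <= k -> s <= t -> `|window k s t p| <= 1.
Proof.
move=> k0 st; rewrite /window mulN1r ler_norml.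
have := @step_ge0 R (k * p.2 + - (k * s + 1)); have := @step_le1 R (k * p.2 + - (k * s + 1)).
have := @step_ge0 R (k * p.2 + - (k * t - 2)); have := @step_le1 R (k * p.2 + - (k * t - 2)).
by move=> *; apply/andP; split; lra.
Qed.

Lemma window_eq0 k s t p : 0 <= k -> k * s + 3 <= k * t ->
  k * p.2 <= k * s + 1 \/ k * t - 1 <= k * p.2 -> window k s t p = 0.
Proof.
move=> k0 st [h|h]; rewrite /window; first by rewrite !step_eq0; lra.
by rewrite !step_eq1; lra.
Qed.

Lemma window_cvg s t p : s < t ->
  window k%:R s t p @[k --> \oo] --> (\1_(`]s, t[%classic : set R) p.2 : R).
Proof.
move=> st; apply: cvg_near_cst.
have big x y : x < y -> \forall k \near \oo, 4 <= k%:R * (y - x) :> R.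
  move=> xy; near=> k; rewrite -ler_pdivrMr ?subr_gt0//.
  by near: k; exact: nbhs_infty_ger.
have H0 := big _ _ st.
have [ps|sp] := leP p.2 s.
  apply: filterS H0 => k hk; rewrite indicE memNset; last first.
    by rewrite /= in_itv /= ltNge ps.
  apply: window_eq0 => //; first by lra.
  by left; rewrite (le_trans (ler_wpM2l _ ps))// lerDl.
have [tp|pt] := leP t p.2.
  apply: filterS H0 => k hk; rewrite indicE memNset; last first.
    by rewrite /= in_itv /= [p.2 < t]ltNge tp andbF.
  apply: window_eq0 => //; first by lra.
  right; have : k%:R * t <= k%:R * p.2 by rewrite ler_wpM2l.
  by lra.
have H1 := big _ _ sp; have H2 := big _ _ pt.
near=> k; rewrite indicE mem_set /=; last by rewrite in_itv /= sp pt.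
have h1 : 4 <= k%:R * (p.2 - s) by near: k.
have h2 : 4 <= k%:R * (t - p.2) by near: k.
rewrite /window step_eq1 ?step_eq0 ?mulr0 ?addr0//; lra.
Unshelve. all: by end_near. Qed.

(** The weak equation is tested with a window times [eta]. As the window grows to the indicator of
    the interval, its two derivative bumps concentrate at [s] and [t], where the slice integrals are
    continuous. *)
Theorem solution_boundary i (eta : ST -> R^o) s t : tfun eta -> 0 <= s -> s < t -> t <= 1 ->
  \int[rho t i]_x eta (x, t) - \int[rho s i]_x eta (x, s) =
  \int[mu]_p (\1_(`]s, t[%classic : set R) p.2 * pairing f Y eta i p).
Proof.
move=> te s0 st t1; have [cr smu df mY Y0 Yfin weak] := S.
have [mf f1 [N [mN N0 gN]]] := df.
have [_ iP _] := pairing_integral q0 hI df mY Y0 i Yfin te.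
have [mP _] := integrableP _ _ _ iP; move/measurable_EFinP : mP => mP.
pose F r := \int[rho (clamp r) i]_x eta (x, clamp r).
have cF : continuous F by exact: curve_slice_continuous.
have Fe r : 0 <= r <= 1 -> \int[rho r i]_x eta (x, r) = F r.
  by move=> r01; rewrite /F clampK//= in_itv.
rewrite !Fe ?s0 ?t1 ?(le_trans s0 (ltW st)) ?(le_trans (ltW st) t1)//.
pose A (k : nat) := \int[leb]_(r in I01) (tbump k%:R (k%:R * s + 1) r * F r) -
  \int[leb]_(r in I01) (tbump k%:R (k%:R * t - 2) r * F r).
pose B (k : nat) := \int[mu]_p (window k%:R s t p * pairing f Y eta i p).
have big x y c : x < y -> \forall k \near \oo, c <= k%:R * (y - x) :> R.
  move=> xy; near=> k; rewrite -ler_pdivrMr ?subr_gt0//.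
  by near: k; exact: nbhs_infty_ger.
have big1 := big s t 4 st.
have k0 : \forall k \near \oo, (0 : R) < k%:R.
  by near=> k; rewrite ltr0n; near: k; exact: nbhs_infty_gt.
(* The product rule splits the weak equation into the bump terms [A k] and the windowed pairing
   [B k]. *)
have AB : \forall k \near \oo, A k = - B k.
  near=> k.
  have hk : 4 <= k%:R * (t - s) by near: k.
  have kk : 0 < k%:R :> R by near: k.
  have ks : 0 <= k%:R * s by rewrite mulr_ge0.
  have kt : k%:R * t <= k%:R by rewrite ler_piMr.
  pose xi (p : ST) : R^o := window k%:R s t p * eta p.
  have txi : test_function 0 1 xi.
    apply: (@tfun_test_function _ _ 0 1 (s + k%:R^-1) (t - k%:R^-1)).
    - exact: tfunM (smooth_window k%:R s t) te.
    - by rewrite ltr_wpDl// invr_gt0.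
    - by rewrite ltrBlDr (le_lt_trans t1)// ltrDl invr_gt0.
    move=> p; rewrite /xi mulf_eq0 => /norP[wp _]; apply: contraNT wp.
    rewrite negb_and -!ltNge => hp; apply/eqP; apply: window_eq0; [exact: ltW|lra|].
    have kV : k%:R * k%:R^-1 = 1 :> R by rewrite mulfV// gt_eqF.
    move: (k%:R^-1) kV hp => w kV /orP[hp|hp]; [left|right].
      have : k%:R * p.2 < k%:R * (s + w) by rewrite ltr_pM2l.
      by lra.
    have : k%:R * (t - w) < k%:R * p.2 by rewrite ltr_pM2l.
    by lra.
  have := weak _ txi i; rewrite /xi.
  under eq_Rintegral do rewrite pairing_window//.
  pose b r := tbump k%:R (k%:R * s + 1) r - tbump k%:R (k%:R * t - 2) r.
  have cb : continuous b.
    by move=> r; apply: (@continuousB R); exact: tbump_continuous.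
  have mb : measurable_fun setT (fun p : X => b p.2).
    apply: (measurableT_comp (f := b)); last exact: measurable_snd.
    exact: continuous_measurable_fun.
  have [Cb0 [_ HCb]] : exists C, 0 <= C /\ forall r, `|b r| <= C.
    have [C [C0 HC]] := dstep_bounded R.
    exists (k%:R * C + k%:R * C); split=> [|r]; first by rewrite addr_ge0// mulr_ge0// ltW.
    by apply: (le_trans (ler_normB _ _)); apply: lerD; rewrite tbumpE normrM gtr0_norm// ler_pM2l.
  have [Ce [Ce0 HCe]] := tfun_bounded te.
  have i1 : mu.-integrable setT (EFin \o (fun p : X => b p.2 * (eta p * f i p))).
    apply: (@bounded_integrable _ _ _ _ _ (Cb0 * (Ce * 1))).
      apply: measurable_funM => //; apply: measurable_funM => //; exact: (tfun_measurable te).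
    move=> p; rewrite normrM; apply: ler_pM => //; rewrite normrM; apply: ler_pM => //.
    by have /andP[? ?] := f1 i p; rewrite ger0_norm.
  have i2 : mu.-integrable setT (EFin \o (fun p => window k%:R s t p * pairing f Y eta i p)).
    apply: (le_integrable _ _ iP).
      by apply: measurable_funM => //; exact: (smooth_measurable (smooth_window _ _ _)).
    by move=> p; rewrite normrM ler_piMl// window01// ltW.
  rewrite RintegralD// -/(B k) => /eqP; rewrite addr_eq0 => /eqP <-.
  rewrite -(stmeas_Rintegral cO cr smu i1).
  transitivity (\int[leb]_(r in I01) (b r * F r)).
    have int (g : R -> R) : continuous g -> leb.-integrable I01 (EFin \o g).
      move=> cg; apply: continuous_compact_integrable; first exact: segment_compact.
      exact: continuous_subspaceT.
    have cM c : continuous (fun r => tbump k%:R c r * F r).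
      by move=> r; apply: (@continuousM R); [exact: tbump_continuous|exact: cF].
    rewrite /A -RintegralB//; [|exact: int|exact: int].
    by apply: eq_Rintegral => r _; rewrite mulrBl.
  apply: (Rintegral_off_null mN N0) => r Ir Nr.
  rewrite -Fe; last by move: Ir; rewrite /= in_itv.
  rewrite (good_Rintegral mf f1 (gN r Ir Nr)); last exact: (slice_fun r (tfun_measurable te)).
  rewrite -RintegralZl//.
  have := tfun_slice_integrable (mbar (rho r)) r te.
  apply: le_integrable => //.
    by apply: measurable_funM; [exact: (slice_fun r (tfun_measurable te))|exact: slice_fun].
  move=> x; rewrite normrM ler_piMr//.
  by have /andP[? ?] := f1 i (x, r); rewrite ger0_norm.
have Acvg : A k @[k --> \oo] --> F s - F t.
  apply: cvgB.
  - apply/cvgrPdist_le => e e0; have [dl [dl0 H]] := tbump_avg s cF e0.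
    have big2 := big 0 dl 4 dl0.
    near=> k; rewrite distrC.
    have hk : 4 <= k%:R * (t - s) by near: k.
    have kk : 0 < k%:R :> R by near: k.
    have hd : 4 <= k%:R * (dl - 0) by near: k.
    have ks : 0 <= k%:R * s by rewrite mulr_ge0.
    have kt : k%:R * t <= k%:R by rewrite ler_piMr.
    apply: H => //; [by rewrite addr_ge0|by lra|].
    move=> r r1 r2; rewrite -(ltr_pM2l kk) -[X in X * `|_|](gtr0_norm kk) -normrM.
    by rewrite ger0_norm; lra.
  - apply/cvgrPdist_le => e e0; have [dl [dl0 H]] := tbump_avg t cF e0.
    have big2 := big 0 dl 4 dl0.
    near=> k; rewrite distrC.
    have hk : 4 <= k%:R * (t - s) by near: k.
    have kk : 0 < k%:R :> R by near: k.
    have hd : 4 <= k%:R * (dl - 0) by near: k.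
    have ks : 0 <= k%:R * s by rewrite mulr_ge0.
    have kt : k%:R * t <= k%:R by rewrite ler_piMr.
    apply: H => //; [by lra|by lra|].
    move=> r r1 r2; rewrite -(ltr_pM2l kk) -[X in X * `|_|](gtr0_norm kk) -normrM.
    by rewrite ler0_norm; lra.
have Bcvg : B k @[k --> \oo] --> \int[mu]_p (\1_(`]s, t[%classic : set R) p.2 * pairing f Y eta i p).
  apply: (@dominated_Rcvg _ _ _ _ _ _ (fun p => `|pairing f Y eta i p|)).
  - move=> k; apply: measurable_funM => //.
    exact: (smooth_measurable (smooth_window _ _ _)).
  - by have := integrable_norm iP; exact: eq_integrable.
  - by move=> k p; rewrite normrM ler_piMl// window01// ltW.
  - by move=> p; apply: cvgMl; exact: window_cvg.
have Ncvg : (fun k => - B k) k @[k --> \oo] --> F s - F t.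
  by apply: cvg_trans Acvg; apply: near_eq_cvg; apply: filterS AB => k ->.
have E1 := cvg_unique _ Ncvg (cvgN Bcvg).
by apply/eqP; rewrite -eqr_opp -[X in _ == X]E1 ?opprB.
Unshelve. all: by end_near. Qed.

End solution.
End Boundary.

(** * Estimates *)

Section Estimates.
Context (R : realType) (d n : nat).
Local Notation E := ('rV[R]_d).
Local Notation Rd := (euclid R d).
Local Notation T := (measurableTypeR R).
Local Notation X := (Rd * T)%type.
Local Notation ST := (E * R^o)%type.
Local Notation leb := (@lebesgue_measure R).
Local Notation I01 := ([set` `[(0 : R), 1]] : set T).
Variables (Omega : set Rd) (q : 'I_n -> 'I_n -> R) (theta : R -> R -> R).
Hypothesis cO : closed (Omega : set E).
Hypothesis q0 : forall i j, 0 <= q i j.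
Hypothesis hI : interpolation theta.
Local Notation K := (field_index d n).
Local Notation solution := (solution Omega q theta).
Local Notation energy := (energy q theta).
Local Notation weight := (weight theta).
Local Notation pairing := (pairing q theta).

(** The sum of the inverse nonzero prices: it turns a bound on the action into one on each unpriced
    square integral. Fields of price 0 vanish and contribute nothing. *)
Definition capacity : R := \sum_(a : K) (if price q a == 0 then 0 else (price q a)^-1).

Lemma capacity_ge0 : 0 <= capacity.
Proof. by apply: sumr_ge0 => a _; case: ifP => // _; rewrite invr_ge0 price_ge0. Qed.

Section one.
Variables (rho : R -> vmeasure R d n) (mu : {finite_measure set X -> \bar R}).
Variables (f : 'I_n -> X -> R) (Y : K -> X -> R) (A : R).
Hypothesis S : solution rho mu f Y.
Hypothesis EA : (energy mu f Y <= A%:E)%E.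

Lemma sol_w01 a p : 0 <= weight f a p <= 1.
Proof. by apply: (weight01 hI); case: (sol_dens S). Qed.

Lemma sol_square_ge0 a p : 0 <= Y a p ^+ 2 * weight f a p.
Proof. by rewrite mulr_ge0 ?sqr_ge0//; case/andP: (sol_w01 a p). Qed.

Lemma energyE : energy mu f Y =
  (\sum_a price q a * \int[mu]_p (Y a p ^+ 2 * weight f a p))%:E.
Proof.
have [cr smu df mY Y0 Yfin weak] := S.
rewrite -sumEFin; apply: eq_bigr => a _.
have ia := energy_integrable q0 hI df mY Y0 a Yfin.
rewrite EFinM /Rintegral fineK ?integrable_fin_num//.
rewrite -ge0_integralZl ?lee_fin ?price_ge0//; last first.
  by move=> p _; rewrite lee_fin sol_square_ge0.
by case/integrableP: ia.
Qed.

Lemma energy_ge0 : 0 <= A.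
Proof.
rewrite -lee_fin (le_trans _ EA)// energyE lee_fin; apply: sumr_ge0 => a _.
by rewrite mulr_ge0 ?price_ge0// Rintegral_ge0// => p _; exact: sol_square_ge0.
Qed.

Lemma energy_term a : price q a * \int[mu]_p (Y a p ^+ 2 * weight f a p) <= A.
Proof.
move: EA; rewrite energyE lee_fin; apply: le_trans; rewrite (bigD1 a)//= lerDl.
apply: sumr_ge0 => b _.
by rewrite mulr_ge0 ?price_ge0// Rintegral_ge0// => p _; exact: sol_square_ge0.
Qed.

Lemma energy_square a : \int[mu]_p (Y a p ^+ 2 * weight f a p) <= capacity * A.
Proof.
have A0 := energy_ge0.
have [pa|pa] := eqVneq (price q a) 0.
  rewrite Rintegral_eq0 ?mulr_ge0 ?capacity_ge0// => p.
  by rewrite (sol_price0 S)// expr0n mul0r.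
have p0 : 0 < price q a by rewrite lt_def pa price_ge0.
have := energy_term a; rewrite -ler_pdivlMl// => h; apply: (le_trans h).
rewrite ler_wpM2r// /capacity (bigD1 a)//= (negbTE pa) lerDl.
by apply: sumr_ge0 => b _; case: ifP => // _; rewrite invr_ge0 price_ge0.
Qed.

Lemma sol_slab s t : 0 <= s -> s <= t -> t <= 1 ->
  \int[mu]_p (\1_(setT `*` `]s, t[%classic) p : R) = t - s.
Proof.
move=> s0 st t1; have [cr smu _ _ _ _ _] := S.
have mJ : measurable (`]s, t[%classic : set T) by exact: measurable_itv.
have JI : (`]s, t[%classic : set T) `<=` I01.
  move=> r /=; rewrite !in_itv /= => /andP[h1 h2].
  by rewrite (le_trans s0 (ltW h1)) (le_trans (ltW h2) t1).
rewrite Rintegral_indicT; last exact: measurableX.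
rewrite (stmeas_slab cO cr smu mJ JI) lebesgue_measure_itv /= lte_fin.
by move: st; rewrite le_eqVlt => /predU1P[->|->]//; rewrite ltxx subrr.
Qed.

(* AM-GM: [|Y| <= kappa + Y^2 / kappa]. *)
Lemma pair_bound a (g : X -> R) (C kappa s t : R) : measurable_fun setT g ->
  (forall p, `|g p| <= C) -> 0 < kappa -> 0 <= s -> s <= t -> t <= 1 ->
  (forall p, p.2 <= s \/ t <= p.2 -> g p = 0) ->
  `|\int[mu]_p (g p * (Y a p * weight f a p))| <= C * (kappa * (t - s) + capacity * A / kappa).
Proof.
move=> mg gC k0 s0 st t1 gs; have [cr smu df mY Y0 Yfin weak] := S.
have ig := pair_integrable q0 hI df mY Y0 a Yfin mg gC.
have ia := energy_integrable q0 hI df mY Y0 a Yfin.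
have C0 : 0 <= C by apply: le_trans (gC point).
have mD : measurable (setT `*` `]s, t[%classic : set X).
  by apply: measurableX => //; exact: measurable_itv.
have i1 : mu.-integrable setT (EFin \o (fun p : X => kappa * (\1_(setT `*` `]s, t[%classic) p : R))).
  have h : mu.-integrable setT (EFin \o (\1_(setT `*` `]s, t[%classic) : X -> R)).
    apply: (@bounded_integrable _ _ _ _ _ 1) => [|p]; first exact: measurable_indic.
    by rewrite ger0_norm// indicE; case: (_ \in _).
  by have := integrableZl measurableT kappa h; exact: eq_integrable.
have i2 : mu.-integrable setT (EFin \o (fun p : X => kappa^-1 * (Y a p ^+ 2 * weight f a p))).
  by have := integrableZl measurableT kappa^-1 ia; exact: eq_integrable.
have i3 : mu.-integrable setT (EFin \o (fun p : X => kappa * (\1_(setT `*` `]s, t[%classic) p : R) +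
     kappa^-1 * (Y a p ^+ 2 * weight f a p))).
  by have := integrableD measurableT i1 i2; exact: eq_integrable.
apply: (le_trans (le_normr_Rintegral measurableT ig)).
apply: (@le_trans _ _ (\int[mu]_p (C * (kappa * (\1_(setT `*` `]s, t[%classic) p : R) +
     kappa^-1 * (Y a p ^+ 2 * weight f a p))))).
  apply: le_Rintegral => //.
  - by have := integrable_norm ig; exact: eq_integrable.
  - by have := integrableZl measurableT C i3; exact: eq_integrable.
  move=> p _; have /andP[w0 w1] := sol_w01 a p.
  have [ps|ps] := boolP (s < p.2 < t); last first.
    rewrite gs; last by move: ps; rewrite negb_and -!leNgt => /orP.
    rewrite mul0r normr0 mulr_ge0// addr_ge0// mulr_ge0 ?invr_ge0 ?(ltW k0)//.
    exact: sol_square_ge0.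
  rewrite normrM; apply: ler_pM => //; rewrite normrM (ger0_norm w0).
  rewrite indicE mem_set; last by split=> //=; rewrite in_itv.
  rewrite mulr1; set y := Y a p; set w := weight f a p.
  have h : `|y| <= kappa + kappa^-1 * y ^+ 2.
    rewrite -(ler_pM2l k0) mulrDr mulVKf ?gt_eqF// -(real_normK (num_real y)).
    by have := sqr_ge0 (`|y| - kappa); have := normr_ge0 y; nra.
  apply: (@le_trans _ _ ((kappa + kappa^-1 * y ^+ 2) * w)); first by rewrite ler_wpM2r.
  rewrite mulrDl -mulrA lerD2r -[leRHS]mulr1 ler_wpM2l//; exact: ltW.
rewrite RintegralZl// ler_wpM2l// RintegralD// !RintegralZl//; last first.
  apply: (@bounded_integrable _ _ _ _ _ 1) => [|p]; first exact: measurable_indic.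
  by rewrite ger0_norm// indicE; case: (_ \in _).
rewrite sol_slab// lerD2l mulrC ler_pM2r ?invr_gt0//.
exact: energy_square.
Qed.

End one.

Lemma tfun_dtest_bounded (eta : ST -> R^o) : tfun eta ->
  exists C, 0 <= C /\ forall i (a : K) p, `|dtest q i a eta p| <= C.
Proof.
move=> te.
have H (ia : 'I_n * K) : exists C, 0 <= C /\ forall p, `|dtest q ia.1 ia.2 eta p| <= C.
  exact/tfun_bounded/tfun_dtest.
have [C HC] := choice H.
exists (\sum_ia C ia); split=> [|i a p].
  by apply: sumr_ge0 => ia _; case: (HC ia).
have [_ h] := HC (i, a); apply: (le_trans (h p)).
by rewrite (bigD1 (i, a))//= lerDl sumr_ge0// => ia _; case: (HC ia).
Qed.

(** The boundary formula reduces increments to the pairing on a short interval. Its momentum terms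
    are split by the parameter [kappa] into an action part that is small uniformly and a part
    proportional to the length [t - s]; the bound depends on the solution through [A] alone. *)
Lemma equicontinuity (eta : ST -> R^o) (A e : R) : tfun eta -> 0 <= A -> 0 < e ->
  exists dl, 0 < dl /\ forall rho mu f (Y : K -> X -> R), solution rho mu f Y ->
    (energy mu f Y <= A%:E)%E -> forall i s t, 0 <= s -> s <= t -> t <= 1 -> t - s < dl ->
    `|\int[rho t i]_x eta (x, t) - \int[rho s i]_x eta (x, s)| <= e.
Proof.
move=> te A0 e0; have [C [C0 HC]] := tfun_dtest_bounded te.
have td : tfun (time_derivative eta : ST -> R^o) by exact: tfun_derive.
have [D [D0 HD]] := tfun_bounded td.
pose N : R := #|K|%:R; have N0 : 0 <= N by [].
have c0 := capacity_ge0.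
have CA0 : 0 <= N * (C * (capacity * A)) by rewrite !mulr_ge0.
(* Chosen so that all action parts together stay below [e / 2], whatever the interval. *)
pose kappa := 2 * (N * (C * (capacity * A)) + 1) / e.
have k0 : 0 < kappa by rewrite divr_gt0// mulr_gt0// ltr_wpDl.
have k1 : N * (C * (capacity * A / kappa)) <= e / 2.
  rewrite !mulrA ler_pdivrMr// /kappa.
  have -> : e / 2 * (2 * (N * (C * (capacity * A)) + 1) / e) = N * (C * (capacity * A)) + 1.
    by field; rewrite gt_eqF.
  by rewrite -!mulrA lerDl.
pose M := D + N * (C * kappa); have M0 : 0 <= M by rewrite /M addr_ge0// mulr_ge0// mulr_ge0// ltW.
exists (e / 2 / (M + 1)); split=> [|rho mu f Y S EA i s t s0 st t1 ts].
  by rewrite !divr_gt0// ltr_wpDl.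
move: (st); rewrite le_eqVlt => /predU1P[->|st'].
  by rewrite subrr normr0 ltW.
rewrite (solution_boundary cO q0 hI S i te s0 st' t1).
have [cr smu df mY Y0 Yfin weak] := S.
have [mf f1 _] := df.
have [i1 _ _] := pairing_integral q0 hI df mY Y0 i Yfin te.
pose J (p : X) : R := \1_(`]s, t[%classic : set R) p.2.
have mJ : measurable_fun setT J.
  apply: (measurableT_comp (f := \1_(`]s, t[%classic : set R) : R -> R)); last exact: measurable_snd.
  by apply: measurable_indic; exact: measurable_itv.
have J1 p : 0 <= J p <= 1 by rewrite /J indicE; case: (_ \in _); rewrite ?lexx ?ler01.
have JE p : J p = \1_(setT `*` `]s, t[%classic) p.
  by rewrite /J !indicE in_setX in_setT.
have Jg (g : X -> R) B : (forall p, `|g p| <= B) -> forall p, `|J p * g p| <= B.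
  by move=> gB p; rewrite normrM (le_trans _ (gB p))// ler_piMl//; have /andP[? ?] := J1 p; rewrite ger0_norm.
have Jz p : p.2 <= s \/ t <= p.2 -> J p = 0.
  move=> h; rewrite /J indicE memNset// /= in_itv /= => /andP[h1 h2].
  by case: h; rewrite leNgt ?h1 ?h2.
have i2 a : mu.-integrable setT (EFin \o (fun p => (J p * dtest q i a eta p) * (Y a p * weight f a p))).
  apply: (pair_integrable q0 hI df mY Y0 a (C := C) Yfin).
    apply: measurable_funM => //; by apply: tfun_measurable; exact: tfun_dtest.
  by apply: Jg => p; exact: HC.
have ij : mu.-integrable setT (EFin \o (fun p => J p * (time_derivative eta p * f i p))).
  apply: (le_integrable _ _ i1).
    apply: measurable_funM => //; apply: measurable_funM => //.
    exact: (tfun_measurable td).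
  move=> p; rewrite normrM ler_piMl//.
  by have /andP[? ?] := J1 p; rewrite ger0_norm.
have [i3 i3E] := Rintegral_sum (index_enum K) i2.
rewrite (_ : \int[mu]_p _ = \int[mu]_p (J p * (time_derivative eta p * f i p)) +
    \sum_a \int[mu]_p ((J p * dtest q i a eta p) * (Y a p * weight f a p))); last first.
  rewrite -i3E -RintegralD//; apply: eq_Rintegral => p _.
  rewrite /pairing mulrDr mulr_sumr; congr (_ + _).
  by apply: eq_bigr => a _; rewrite -!mulrA.
apply: (@le_trans _ _ (D * (t - s) + \sum_(a : K) C * (kappa * (t - s) + capacity * A / kappa))).
  apply: (le_trans (ler_normD _ _)); apply: lerD.
    apply: (le_trans (le_normr_Rintegral measurableT ij)).
    rewrite -(sol_slab S s0 st t1) -RintegralZl//; last first.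
      apply: (@bounded_integrable _ _ _ _ _ 1) => [|p].
        by apply: measurable_indic; apply: measurableX => //; exact: measurable_itv.
      by rewrite ger0_norm// indicE; case: (_ \in _).
    apply: le_Rintegral => //.
    - by have := integrable_norm ij; exact: eq_integrable.
    - apply: (@bounded_integrable _ _ _ _ _ D) => [|p].
        apply: measurable_funM => //.
        by apply: measurable_indic; apply: measurableX => //; exact: measurable_itv.
      by rewrite ger0_norm ?mulr_ge0// ler_piMr// indicE; case: (_ \in _).
    move=> p _; rewrite -JE normrM mulrC; have /andP[? ?] := J1 p.
    rewrite (ger0_norm (_ : 0 <= J p))// ler_wpM2r// normrM -[leRHS]mulr1.
    by have /andP[? ?] := f1 i p; apply: ler_pM => //; rewrite ger0_norm.
  apply: (le_trans (ler_norm_sum _ _ _)); apply: ler_sum => a _.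
  apply: (pair_bound S EA) => //.
  - apply: measurable_funM => //; by apply: tfun_measurable; exact: tfun_dtest.
  - by apply: Jg => p; exact: HC.
  - by move=> p /Jz ->; rewrite mul0r.
rewrite sumr_const -[X in _ + X]mulr_natl -/N.
have tsM : (t - s) * (M + 1) < e / 2 by rewrite -ltr_pdivlMr// ltr_wpDl.
have := k1; have : 0 <= t - s by rewrite subr_ge0.
by rewrite /M in tsM *; nra.
Qed.

Lemma cutoff_eq0 (r : R) (p : ST) : 0 < r -> 3 < r * `|p.1| -> cutoff r p = 0.
Proof.
move=> r0 h; rewrite /cutoff /cutoff1.
have [k hk] : exists k, 3 < `|(affine_ST r 1 0 p).1 0 k|.
  apply: contrapT => /forallNP hn; move: h; apply/negP; rewrite -leNgt.
  rewrite -(gtr0_norm r0) -normrZ; apply: rV_norm_le => // k.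
  by rewrite leNgt; apply/negP; exact: hn.
by rewrite (bigD1 k)//= plateau_eq0 ?mul0r.
Qed.

Lemma cutoff_time (r t : R) (x : E) : 0 <= t <= 1 -> cutoff r (x, t) = cutoff r (x, 0).
Proof.
move=> /andP[t0 t1]; rewrite /cutoff /cutoff1 /affine_ST /= mulr0 addr0 mul1r addr0.
by rewrite !plateau_eq1// ger0_norm; lra.
Qed.

(** Summed over the nodes, edge terms cancel, and the cutoff is constant in time on the range
    considered. What remains is transport across the region where the cutoff varies in space. *)
Lemma sum_pairing_cutoff f (Y : K -> X -> R) r p : r != 0 -> `|p.2| < 2 ->
  \sum_i pairing f Y (cutoff r) i p =
  \sum_(ik : 'I_n * 'I_d) 'D_((delta_mx 0 ik.2, 0) : ST) (cutoff r) p *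
    (Y (inl ik) p * weight f (inl ik) p).
Proof.
move=> r0 p2; rewrite /pairing big_split /= big1 ?add0r; last first.
  by move=> i _; rewrite /time_derivative cutoff_derive_time// mul0r.
rewrite exchange_big /= sum_index [X in _ + X]big1 ?addr0; last first.
  move=> i' _; apply: big1 => j _; rewrite -mulr_suml dtest_sum0 mul0r//.
rewrite pair_bigA /=; apply: eq_bigr => -[i' k] _ /=.
rewrite -mulr_suml (bigD1 i')//= eqxx big1 ?addr0 ?mul1r// => i.
by rewrite eq_sym => /negbTE ->; rewrite mul0r.
Qed.

(** Total mass under a cutoff changes only by transport, against space derivatives of size [r]. The
    factor [1 + capacity * A] is the bound on a momentum with [kappa = 1] over a time of at most
    1. *)
Lemma tight_mass : exists C, 0 <= C /\ forall r A rho mu f (Y : K -> X -> R) t,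
  0 < r -> solution rho mu f Y -> (energy mu f Y <= A%:E)%E -> 0 <= t <= 1 ->
  \sum_i \int[rho 0 i]_x cutoff r (x, 0) - r * (C * (1 + capacity * A)) <=
  \sum_i \int[rho t i]_x cutoff r (x, 0).
Proof.
have [C [C0 HC]] := @cutoff_derive_space R d.
pose N : R := #|{: 'I_n * 'I_d}|%:R; have N0 : 0 <= N by [].
exists (N * C); split=> [|r A rho mu f Y t r0 S EA /andP[t0 t1]]; first by rewrite mulr_ge0.
have A0 := energy_ge0 S EA; have c0 := capacity_ge0.
move: (t0); rewrite le_eqVlt => /predU1P[<-|t0'].
  by rewrite lerBlDr lerDl !mulr_ge0 ?addr_ge0 ?mulr_ge0// ltW.
have rn0 : r != 0 by rewrite gt_eqF.
have te := @tfun_cutoff R d r rn0.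
have [cr smu df mY Y0 Yfin weak] := S.
pose J (p : X) : R := \1_(`]0, t[%classic : set R) p.2.
have mJ : measurable_fun setT J.
  apply: (measurableT_comp (f := \1_(`]0, t[%classic : set R) : R -> R)); last exact: measurable_snd.
  by apply: measurable_indic; exact: measurable_itv.
have J1 p : 0 <= J p <= 1 by rewrite /J indicE; case: (_ \in _); rewrite ?lexx ?ler01.
have Jz p : p.2 <= 0 \/ t <= p.2 -> J p = 0.
  move=> h; rewrite /J indicE memNset// /= in_itv /= => /andP[h1 h2].
  by case: h; rewrite leNgt ?h1 ?h2.
set b := \sum_i \int[rho t i]_x _; set a := \sum_i \int[rho 0 i]_x _.
suff : `|b - a| <= r * (N * C * (1 + capacity * A)) by rewrite ler_norml => /andP[+ _]; lra.
have -> : b - a = \sum_i \int[mu]_p (J p * pairing f Y (cutoff r) i p).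
  rewrite /a /b -sumrB; apply: eq_bigr => i _.
  have B := solution_boundary cO q0 hI S i te (lexx 0) t0' t1.
  have Bt : \int[rho t i]_x cutoff r (x, t) = \int[rho t i]_x cutoff r (x, 0).
    by apply: eq_Rintegral => x _; rewrite cutoff_time// t0.
  by rewrite -Bt; exact: B.
have iJ i : mu.-integrable setT (EFin \o (fun p => J p * pairing f Y (cutoff r) i p)).
  have [_ i1 _] := pairing_integral q0 hI df mY Y0 i Yfin te.
  have [m1 _] := integrableP _ _ _ i1; move/measurable_EFinP : m1 => m1.
  apply: (le_integrable _ _ i1); first exact: measurable_funM.
  by move=> p; rewrite normrM ler_piMl//; have /andP[? ?] := J1 p; rewrite ger0_norm.
have [_ <-] := Rintegral_sum (index_enum 'I_n) iJ.
pose g (ik : 'I_n * 'I_d) (p : ST) : R := J p * 'D_((delta_mx 0 ik.2, 0) : ST) (cutoff r) p.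
have tD (ik : 'I_n * 'I_d) : tfun ('D_((delta_mx 0 ik.2, 0) : ST) (cutoff r)) by exact: tfun_derive.
have mg ik : measurable_fun setT (g ik : X -> R).
  by apply: measurable_funM => //; exact: (tfun_measurable (tD ik)).
have gC ik p : `|g ik p| <= r * C.
  rewrite normrM; have /andP[? ?] := J1 p; rewrite (ger0_norm (_ : 0 <= J p))//.
  by rewrite -[leRHS]mul1r; apply: ler_pM => //; exact: HC.
have ig ik : mu.-integrable setT (EFin \o (fun p => g ik p * (Y (inl ik) p * weight f (inl ik) p))).
  exact: (pair_integrable q0 hI df mY Y0 (inl ik) Yfin (mg ik) (gC ik)).
have [_ gE] := Rintegral_sum (index_enum ('I_n * 'I_d)%type) ig.
rewrite (_ : \int[mu]_y _ = \sum_ik \int[mu]_p (g ik p * (Y (inl ik) p * weight f (inl ik) p))); last first.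
  rewrite -gE; apply: eq_Rintegral => p _; rewrite -mulr_sumr.
  have [h|h] := boolP (0 < p.2 < t); last first.
    rewrite /g Jz ?mul0r; last by move: h; rewrite negb_and -!leNgt => /orP.
    by rewrite big1// => ik _; rewrite !mul0r.
  rewrite sum_pairing_cutoff//; last by rewrite gtr0_norm; lra.
  by rewrite mulr_sumr; apply: eq_bigr => ik _; exact: mulrA.
apply: (le_trans (ler_norm_sum _ _ _)).
apply: (@le_trans _ _ (\sum_(ik : 'I_n * 'I_d) (r * C * (1 + capacity * A)))).
  apply: ler_sum => ik _.
  have := pair_bound S EA (inl ik) (mg ik) (gC ik) ltr01 (lexx 0) (ltW t0') t1.
  rewrite divr1 mul1r subr0 => H; apply: (le_trans (H _)).
    by move=> p /Jz; rewrite /g => ->; rewrite mul0r.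
  by rewrite ler_wpM2l ?mulr_ge0 ?(ltW r0)// lerD2r.
by rewrite sumr_const -mulr_natl -/N; lra.
Qed.

(** For small [r] the cutoff sees all but [e / 2] of the initial mass, and at most [e / 2] escapes
    later. As the total mass is 1, at most [e] can be outside the support of the cutoff. *)
Lemma tightness (m0 : vmeasure R d n) A e : vprob Omega m0 -> 0 <= A -> 0 < e ->
  exists r, forall rho mu f (Y : K -> X -> R) t i, solution rho mu f Y ->
    vmeasure_eq (rho 0) m0 -> (energy mu f Y <= A%:E)%E -> 0 <= t <= 1 ->
    (rho t i [set x | (r < `|x|)%R] <= e%:E)%E.
Proof.
move=> pm A0 e0; have [C [C0 HC]] := tight_mass.
have e20 := half_gt0 e0; have c0 := capacity_ge0.
pose r (k : nat) : R := k.+1%:R^-1.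
have r0 k : 0 < r k by rewrite invr_gt0.
have tk k : tfun (@cutoff R d (r k)) by apply: tfun_cutoff; rewrite gt_eqF.
have cut1 (p : ST) : `|p.2| <= 2 -> \forall k \near \oo, cutoff (r k) p = 1.
  move=> p2; near=> k; apply: cutoff_eq1 => //; first exact: ltW.
  rewrite mulrC ler_pdivrMr// -ler_pdivrMl//.
  apply: (@le_trans _ _ k%:R); last by rewrite ler_nat.
  by near: k; exact: nbhs_infty_ger.
have cvg1 : \sum_i \int[m0 i]_x cutoff (r k) (x, 0) @[k --> \oo] --> (1 : R).
  have -> : (1 : R) = \sum_i fine (m0 i setT).
    rewrite -[LHS]/(fine 1%E) -(mbar1 cO pm) /mbar -sum_fine//.
    by move=> i _; exact: fin_num_measure.
  apply: cvg_big => [|i _]; first exact: add_continuous.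
  rewrite -Rintegral_indicT//.
  apply: (@dominated_Rcvg _ _ _ _ _ _ (cst 1)) => //.
  - move=> k; exact: (measurableT_comp (tfun_measurable (tk k)) (measurable_slice 0)).
  - by apply: (@bounded_integrable _ _ _ _ _ 1) => // x; rewrite normr1.
  - by move=> k x; rewrite ger0_norm ?cutoff_ge0// cutoff_le1.
  - move=> x; rewrite indicE in_setT; apply: cvg_near_cst; apply: cut1 => /=.
    by rewrite normr0.
have [k [hk1 hk2]] : exists k, 1 - e / 2 <= \sum_i \int[m0 i]_x cutoff (r k) (x, 0) /\
    r k * (C * (1 + capacity * A)) <= e / 2.
  have h1 : \forall k \near \oo, 1 - e / 2 <= \sum_i \int[m0 i]_x cutoff (r k) (x, 0).
    move/cvgrPdist_le: cvg1 => /(_ _ e20); apply: filterS => k.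
    by rewrite ler_distl => /andP[_]; lra.
  have h2 : \forall k \near \oo, r k * (C * (1 + capacity * A)) <= e / 2.
    near=> k; rewrite mulrC ler_pdivrMr// -ler_pdivrMl//.
    apply: (@le_trans _ _ k%:R); last by rewrite ler_nat.
    by near: k; exact: nbhs_infty_ger.
  near \oo => k; exists k; split; near: k; [exact: h1|exact: h2].
(* The cutoff vanishes where the dilated norm exceeds 3. *)
exists (3 / r k) => rho mu f Y t i S eq0 EA t01.
have := HC _ _ _ _ _ _ t (r0 k) S EA t01.
have -> : \sum_i \int[rho 0 i]_x cutoff (r k) (x, 0) = \sum_i \int[m0 i]_x cutoff (r k) (x, 0).
  apply: eq_bigr => j _; rewrite /Rintegral; congr fine.
  by apply: eq_measure_integral => B mB _; exact: eq0.
move=> H; set U : set Rd := [set x : E | (3 / r k < `|x|)%R]; rewrite -/U.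
have mU : measurable U by exact: closed_ball_Rd_measurable.
have It : t \in `[0, 1] by rewrite in_itv.
have pt : vprob Omega (rho t) by case: (sol_curve S It).
rewrite -[leLHS]fineK ?fin_num_measure// lee_fin.
have ic j : (rho t j).-integrable setT (EFin \o (fun x : Rd => cutoff (r k) (x, 0))).
  exact: (tfun_slice_integrable _ 0 (tk k)).
have i1 j : (rho t j).-integrable setT (EFin \o (cst 1 : Rd -> R)).
  by apply: (@bounded_integrable _ _ _ _ _ 1) => // x; rewrite normr1.
have le1 j : \int[rho t j]_x cutoff (r k) (x, 0) <= fine (rho t j setT).
  rewrite -Rintegral_indicT//; apply: le_Rintegral => //; first exact: ic.
    by have := i1 j; apply: eq_integrable => // x _; rewrite /= indicE in_setT.
  by move=> x _; rewrite indicE in_setT cutoff_le1.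
have s1 : \sum_j fine (rho t j setT) = 1.
  rewrite -[RHS]/(fine 1%E) -(mbar1 cO pt) /mbar -sum_fine//.
  by move=> j _; exact: fin_num_measure.
have mains : fine (rho t i U) + \int[rho t i]_x cutoff (r k) (x, 0) <= fine (rho t i setT).
  have iU : (rho t i).-integrable setT (EFin \o (\1_U : Rd -> R)).
    apply: (@bounded_integrable _ _ _ _ _ 1) => [|x]; first exact: measurable_indic.
    by rewrite ger0_norm// indicE; case: (_ \in _).
  rewrite -!Rintegral_indicT// -RintegralD//; last exact: ic.
  apply: le_Rintegral => //.
  - apply: (@bounded_integrable _ _ _ _ _ (1 + 1)) => [|x].
      apply: measurable_funD; first exact: measurable_indic.
      exact: (measurableT_comp (tfun_measurable (tk k)) (measurable_slice 0)).
    rewrite ger0_norm; last by rewrite addr_ge0// cutoff_ge0.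
    by apply: lerD; [rewrite indicE; case: (_ \in _)|exact: cutoff_le1].
  - by have := i1 i; apply: eq_integrable => // x _; rewrite /= indicE in_setT.
  move=> x _; rewrite !indicE in_setT; have [Ux|Ux] := pselect (U x).
    rewrite mem_set// cutoff_eq0 ?addr0//=.
    by move: Ux; rewrite /U /= ltr_pdivrMr// mulrC.
  by rewrite memNset// add0r cutoff_le1.
have lej : \sum_(j < n | j != i) \int[rho t j]_x cutoff (r k) (x, 0) <=
    \sum_(j < n | j != i) fine (rho t j setT) by exact: ler_sum.
have E1 : \sum_j \int[rho t j]_x cutoff (r k) (x, 0) =
  \int[rho t i]_x cutoff (r k) (x, 0) + \sum_(j < n | j != i) \int[rho t j]_x cutoff (r k) (x, 0).
  by rewrite (bigD1 i).
rewrite (bigD1 i)//= in s1; rewrite E1 in H.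
lra.
Unshelve. all: by end_near. Qed.

End Estimates.

(** * Upper semicontinuity in the mobilities *)

Section ThetaMajorants.
Context (R : realType) (theta : R -> R -> R).
Hypothesis hI : interpolation theta.
Local Notation Th := (fun p : R^o * R^o => theta p.1 p.2 : R^o).

(** Midpoint concavity together with homogeneity is superadditivity. *)
Lemma theta_super a b a' b' : 0 <= a -> 0 <= b -> 0 <= a' -> 0 <= b' ->
  theta a b + theta a' b' <= theta (a + a') (b + b').
Proof.
move=> a0 b0 a'0 b'0.
have h0 : (0 : R) <= 2^-1 by rewrite invr_ge0.
have h1 : (2^-1 : R) <= 1 by rewrite invf_le1// ler1n.
have := @interp_concave R theta hI (Itv01 h0 h1) (a, b) (a', b').
rewrite !inE => /(_ (conj a0 b0) (conj a'0 b'0)).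
rewrite convRE /=.
have -> : theta (conv (Itv01 h0 h1) ((a, b) : convex_lmodType (R^o * R^o)%type) (a', b')).1
    (conv (Itv01 h0 h1) ((a, b) : convex_lmodType (R^o * R^o)%type) (a', b')).2 =
    theta (2^-1 * (a + a')) (2^-1 * (b + b')).
  by congr theta; rewrite /conv /= /GRing.scale /= /unstable.onem; field.
rewrite (interp_homog hI) ?invr_gt0 ?addr_ge0// /unstable.onem; lra.
Qed.

Definition majorant (c : R * R) := [/\ 0 <= c.1, 0 <= c.2 &
  forall x y, 0 <= x -> 0 <= y -> theta x y <= c.1 * x + c.2 * y].

(** By superadditivity and homogeneity, [theta x y] is at most every forward difference quotient at
    [(a, b)] in direction [(x, y)], hence at most the derivative. In the direction [(a, b)] itself
    the quotients are constant, which is Euler's relation. *)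
Lemma theta_tangent a b : 0 < a -> 0 < b ->
  exists c, majorant c /\ c.1 * a + c.2 * b = theta a b.
Proof.
move=> a0 b0.
have [dT _] := interp_smooth hI 1%N; have {}dT := dT (a, b) (conj a0 b0).
pose c : R * R := ('D_((1, 0) : R^o * R^o) Th (a, b), 'D_((0, 1) : R^o * R^o) Th (a, b)).
have lin x y : 'D_((x, y) : R^o * R^o) Th (a, b) = c.1 * x + c.2 * y.
  have -> : ((x, y) : R^o * R^o) = x *: ((1, 0) : R^o * R^o) + y *: ((0, 1) : R^o * R^o).
    by congr pair; rewrite /= /GRing.scale /= ?mulr1 ?mulr0 ?addr0 ?add0r.
  rewrite /c !deriveE// linearD !linearZ /=.
  by rewrite /GRing.scale /=; ring.
have cv x y : h^-1 *: (Th (h *: ((x, y) : R^o * R^o) + (a, b)) - Th (a, b)) @[h --> (0 : R)^'+] --> c.1 * x + c.2 * y.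
  rewrite -lin.
  have D : derivable Th (a, b) ((x, y) : R^o * R^o) by exact: diff_derivable.
  apply: cvg_trans D; apply: cvg_app => B; rewrite !nbhs_simpl /at_right /dnbhs /within /=.
  by apply: filterS => u hu u0; apply: hu; rewrite gt_eqF.
have maj x y : 0 <= x -> 0 <= y -> theta x y <= c.1 * x + c.2 * y.
  move=> x0 y0; apply: (cvgr_to_ge (cv x y)).
  near=> h.
  have h0 : 0 < h by near: h; exact: nbhs_right_gt.
  rewrite /GRing.scale /= ler_pdivlMl// -(interp_homog hI h0 x0 y0).
  rewrite lerBrDr; apply: theta_super => //; try exact: ltW.
    by rewrite mulr_ge0// ltW.
  by rewrite mulr_ge0// ltW.
exists c; split.
  split=> //.
    have := maj 1 0 ler01 (lexx 0); rewrite mulr1 mulr0 addr0; apply: le_trans.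
    exact: (interp_ge0 hI).
  have := maj 0 1 (lexx 0) ler01; rewrite mulr1 mulr0 add0r; apply: le_trans.
  exact: (interp_ge0 hI).
suff K : h^-1 *: (Th (h *: ((a, b) : R^o * R^o) + (a, b)) - Th (a, b)) @[h --> (0 : R)^'+] --> theta a b.
  exact: (cvg_unique _ (cv a b) K).
apply: cvg_near_cst; near=> h.
have h0 : 0 < h by near: h; exact: nbhs_right_gt.
rewrite /GRing.scale /=.
have -> : h * a + a = (h + 1) * a by ring.
have -> : h * b + b = (h + 1) * b by ring.
rewrite (interp_homog hI) ?(ltW a0) ?(ltW b0) ?addr_gt0//.
by field; rewrite gt_eqF.
Unshelve. all: by end_near. Qed.

(** Tangents at rational points suffice: their coefficients are nonnegative, so the value at
    [(a, b)] is at most that at a rational point slightly above, where the tangent touches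
    [theta]. *)
Lemma theta_majorants : exists c : nat -> R * R, (forall m, majorant (c m)) /\
  forall a b e, 0 <= a -> 0 <= b -> 0 < e ->
    exists m, (c m).1 * a + (c m).2 * b <= theta a b + e.
Proof.
have m11 : majorant (1, 1).
  split=> //= x y x0 y0; rewrite !mul1r.
  rewrite -[leRHS](theta_diag hI) ?addr_ge0//; apply: (theta_mono hI).
    by rewrite x0 lerDl.
  by rewrite y0 lerDr.
have H (m : nat) : exists c, majorant c /\ forall r s, unpickle m = Some (r, s) ->
    0 < ratr r :> R -> 0 < ratr s :> R ->
    c.1 * ratr r + c.2 * ratr s = theta (ratr r) (ratr s).
  case: (unpickle m) => [[r s]|]; last by exists (1, 1).
  have [/andP[r0 s0]|] := boolP ((0 < ratr r :> R) && (0 < ratr s :> R)).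
    have [c [mc cE]] := theta_tangent r0 s0; exists c; split=> // r' s' [<- <-] _ _.
    exact: cE.
  move=> rs; exists (1, 1); split=> // r' s' [<- <-] r0 s0.
  by move: rs; rewrite r0 s0.
have [c Hc] := choice H; exists c; split=> [m|a b e a0 b0 e0]; first by case: (Hc m).
have [d [d0 Hd]] := theta_right_cvg hI a0 b0 e0.
have [r] := rat_in_itvoo (ltr_pwDr d0 (lexx a)); rewrite in_itv /= => /andP[r1 r2].
have [s] := rat_in_itvoo (ltr_pwDr d0 (lexx b)); rewrite in_itv /= => /andP[s1 s2].
exists (pickle (r, s)).
have [[c1 c2 _] /(_ r s)] := Hc (pickle (r, s)).
have -> : unpickle (pickle (r, s)) = Some (r, s) by exact: pickleK.
move=> /(_ erefl (le_lt_trans a0 r1) (le_lt_trans b0 s1)) E.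
apply: le_trans (ltW (Hd _ _ (ltW r1) r2 (ltW s1) s2)); rewrite -E.
by apply: lerD; rewrite ler_wpM2l// ltW.
Qed.

End ThetaMajorants.

(** * Smooth majorants of the mobilities *)

Section UpperSemicontinuity.
Context (R : realType) (d : nat) (theta : R -> R -> R).
Hypothesis hI : interpolation theta.
Local Notation E := ('rV[R]_d).
Local Notation ST := (E * R^o)%type.
Local Notation Rd := (euclid R d).
Local Notation X := (Rd * measurableTypeR R)%type.

(** Bounded multipliers of the space of test functions. Constants must be included, which are not
    test functions themselves. *)
Definition mult (phi : ST -> R^o) := [/\ forall z, tfun z -> tfun (fun p => z p * phi p),
  measurable_fun setT (phi : X -> R) & exists C, forall p, `|phi p| <= C].

Lemma mult_cst (c : R) : mult (cst c).
Proof.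
split=> [z tz||]; [|exact: measurable_cst|by exists `|c|].
by apply: tfunMr => //; exact: smooth_cst.
Qed.

Lemma multM phi psi : mult phi -> mult psi -> mult (fun p => phi p * psi p).
Proof.
move=> [t1 m1 [C HC]] [t2 m2 [D HD]]; split=> [z tz||].
- have := t2 _ (t1 _ tz); congr tfun; apply/funext => p; exact: esym (mulrA _ _ _).
- exact: measurable_funM.
- by exists (C * D) => p; rewrite normrM; apply: ler_pM.
Qed.

Lemma multD phi psi : mult phi -> mult psi -> mult (fun p => phi p + psi p).
Proof.
move=> [t1 m1 [C HC]] [t2 m2 [D HD]]; split=> [z tz||].
- have := tfunD (t1 _ tz) (t2 _ tz); congr tfun; apply/funext => p; exact: esym (mulrDr _ _ _).
- exact: measurable_funD.
- by exists (C + D) => p; rewrite (le_trans (ler_normD _ _))// lerD.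
Qed.

Lemma mult_tfun phi : tfun phi -> mult phi.
Proof.
move=> tp; split=> [z tz||]; [|exact: tfun_measurable|].
  by apply: tfunM => //; exact: tfun_smooth.
by have [C [_ HC]] := tfun_bounded tp; exists C.
Qed.

Section limit.
Variables (c : nat -> R * R) (g h : X -> R) (mu : {finite_measure set X -> \bar R}).
Hypothesis mc : forall m, majorant theta (c m).
Hypotheses (mg : measurable_fun setT g) (mh : measurable_fun setT h).
Hypotheses (g1 : forall p, 0 <= g p <= 1) (h1 : forall p, 0 <= h p <= 1).

Definition affine_majorant m (p : X) : R := (c m).1 * g p + (c m).2 * h p.

Fixpoint min_majorant m (p : X) : R :=
  if m is m'.+1 then Num.min (min_majorant m' p) (affine_majorant m p)
  else affine_majorant 0 p.

Lemma affine_majorantP m p : theta (g p) (h p) <= affine_majorant m p <= (c m).1 + (c m).2.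
Proof.
have [c1 c2 H] := mc m; have /andP[? ?] := g1 p; have /andP[? ?] := h1 p.
by rewrite H//=; apply: lerD; rewrite ler_piMr.
Qed.

Lemma min_majorantP m p : theta (g p) (h p) <= min_majorant m p <= (c 0).1 + (c 0).2.
Proof.
elim: m => [|m IH] /=; first exact: affine_majorantP.
have /andP[h2 h3] := IH; have /andP[h4 h5] := affine_majorantP m.+1 p.
by rewrite le_min h2 h4 ge_min h3.
Qed.

Lemma theta01 p : 0 <= theta (g p) (h p) <= 1.
Proof. exact: (theta_le1 hI). Qed.

Lemma affine_majorant_measurable m : measurable_fun setT (affine_majorant m).
Proof. by apply: measurable_funD; apply: measurable_funM. Qed.

Lemma min_majorant_measurable m : measurable_fun setT (min_majorant m).
Proof.
elim: m => [|m IH]; first exact: affine_majorant_measurable.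
by apply: measurable_minr => //; exact: affine_majorant_measurable.
Qed.

Lemma majorant_gap_integrable (z phi psi : ST -> R^o) m : tfun z -> mult phi -> mult psi ->
  mu.-integrable setT (EFin \o (fun p : X =>
    z p ^+ 2 * `|phi p * g p + psi p * h p - min_majorant m p|)).
Proof.
move=> tz [_ mp [Cp HCp]] [_ ms [Cs HCs]].
have [Z [Z0 HZ]] := tfun_bounded tz.
have mz : measurable_fun setT (z : X -> R) by exact: tfun_measurable.
have mG := min_majorant_measurable m.
apply: (@bounded_integrable _ _ _ _ _ (Z ^+ 2 * (Cp + Cs + ((c 0).1 + (c 0).2)))).
    apply: measurable_funM; first exact: measurable_funX.
    apply: measurableT_comp => //; apply: measurable_funB => //.
    by apply: measurable_funD; apply: measurable_funM.
  move=> p; rewrite normrM normr_id normrX; apply: ler_pM => //.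
    by rewrite lerXn2r ?nnegrE.
  have /andP[? ?] := g1 p; have /andP[? ?] := h1 p.
  apply: (le_trans (ler_normB _ _)); apply: lerD.
    apply: (le_trans (ler_normD _ _)); apply: lerD; rewrite normrM.
      by rewrite -[Cp]mulr1; apply: ler_pM => //; rewrite ger0_norm.
    by rewrite -[Cs]mulr1; apply: ler_pM => //; rewrite ger0_norm.
  have /andP[k1 k2] := min_majorantP m p; have /andP[t0 _] := theta01 p.
  by rewrite ger0_norm// (le_trans t0).
Qed.

(** Taking a minimum selects one of two linear functions at each point, and the selection set is
    merely measurable. Replacing its indicator by a test function [chi] gives smooth coefficients; a
    convex combination of majorants remains a majorant, and the error is small in [L^1]. *)
Lemma smooth_majorant (z : ST -> R^o) m e : tfun z -> 0 < e -> exists phi psi,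
  [/\ mult phi, mult psi,
    forall p x y, 0 <= x -> 0 <= y -> theta x y <= phi p * x + psi p * y &
    \int[mu]_p (z p ^+ 2 * `|phi p * g p + psi p * h p - min_majorant m p|) <= e].
Proof.
move=> tz; elim: m e => [|m IH] e e0.
  exists (cst (c 0).1), (cst (c 0).2); split; [exact: mult_cst|exact: mult_cst| |].
    by move=> p x y x0 y0; case: (mc 0) => _ _; exact.
  by rewrite Rintegral_eq0 ?ltW// => p; rewrite /= subrr normr0 mulr0.
have [phi [psi [mphi mpsi maj int]]] := IH _ (half_gt0 e0).
have [Z [Z0 HZ]] := tfun_bounded tz.
have [c01 c02 _] := mc 0; have [c1 c2 cmaj] := mc m.+1.
(* Bounds [z ^+ 2] times the gap between the two functions, the factor by which the error of [chi]
   is multiplied. *)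
pose D := Z ^+ 2 * ((c 0).1 + (c 0).2 + ((c m.+1).1 + (c m.+1).2)).
have D0 : 0 <= D by rewrite mulr_ge0 ?sqr_ge0// !addr_ge0.
pose B := [set p : X | (min_majorant m p <= affine_majorant m.+1 p)%R].
have mB : measurable B.
  by rewrite -[B]setTI; apply: measurable_fun_le => //;
    [exact: min_majorant_measurable|exact: affine_majorant_measurable].
have d0 : 0 < e / 2 / (D + 1) by rewrite !divr_gt0// ltr_wpDl.
have [chi [tchi chi1 [chiB _]]] := tfun_approx mu mu mB d0.
pose ochi : ST -> R^o := fun p => 1 + (-1) * chi p.
have mchi := mult_tfun tchi.
have mochi : mult ochi by apply: multD; [exact: mult_cst|apply: multM => //; exact: mult_cst].
have o1 p : ochi p = 1 - chi p by rewrite /ochi mulN1r.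
have mphi' : mult (fun p => chi p * phi p + ochi p * (c m.+1).1).
  apply: multD; first exact: multM.
  by apply: (multM mochi); exact: mult_cst.
have mpsi' : mult (fun p => chi p * psi p + ochi p * (c m.+1).2).
  apply: multD; first exact: multM.
  by apply: (multM mochi); exact: mult_cst.
exists (fun p => chi p * phi p + ochi p * (c m.+1).1), (fun p => chi p * psi p + ochi p * (c m.+1).2).
split=> //.
- move=> p x y x0 y0; rewrite o1.
  have H1 := maj p x y x0 y0; have H2 := cmaj x y x0 y0; have /andP[k0 k1] := chi1 p.
  have : chi p * theta x y <= chi p * (phi p * x + psi p * y) by rewrite ler_wpM2l.
  have : (1 - chi p) * theta x y <= (1 - chi p) * ((c m.+1).1 * x + (c m.+1).2 * y).
    by rewrite ler_wpM2l// subr_ge0.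
  by lra.
have [_ mp [Cp HCp]] := mphi; have [_ ms [Cs HCs]] := mpsi.
have mz : measurable_fun setT (z : X -> R) by exact: tfun_measurable.
have mk : measurable_fun setT (chi : X -> R) by exact: tfun_measurable.
have mG := min_majorant_measurable m; have mA := affine_majorant_measurable m.+1.
pose F1 (p : X) := z p ^+ 2 * `|phi p * g p + psi p * h p - min_majorant m p|.
have i1 : mu.-integrable setT (EFin \o F1) by exact: majorant_gap_integrable.
have i2 : mu.-integrable setT (EFin \o (fun p : X => `|chi p - \1_B p|)).
  apply: (@bounded_integrable _ _ _ _ _ 1).
    by apply: measurableT_comp => //; apply: measurable_funB => //; exact: measurable_indic.
  move=> p; rewrite normr_id; have /andP[? ?] := chi1 p; rewrite ler_norml indicE.
  by case: (_ \in _); rewrite /=; apply/andP; split; lra.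
have i3 : mu.-integrable setT (EFin \o (fun p : X => D * `|chi p - \1_B p|)).
  by have := integrableZl measurableT D i2; exact: eq_integrable.
apply: (@le_trans _ _ (\int[mu]_p (F1 p + D * `|chi p - \1_B p|))).
  apply: le_Rintegral => //.
  - exact: (majorant_gap_integrable m.+1 tz mphi' mpsi').
  - by have := integrableD measurableT i1 i3; exact: eq_integrable.
  move=> p _; rewrite /= o1 /F1.
  set G := min_majorant m p; set Af := affine_majorant m.+1 p.
  have -> : (chi p * phi p + (1 - chi p) * (c m.+1).1) * g p +
      (chi p * psi p + (1 - chi p) * (c m.+1).2) * h p - Num.min G Af =
      chi p * (phi p * g p + psi p * h p - G) + (chi p - \1_B p) * (G - Af).
    have -> : Num.min G Af = \1_B p * G + (1 - \1_B p) * Af.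
      rewrite indicE; have [GA|GA] := leP G Af.
        by rewrite mem_set// mul1r subrr mul0r addr0.
      by rewrite memNset ?mul0r ?add0r ?subr0 ?mul1r// /B /= leNgt GA.
    by rewrite /Af /affine_majorant; ring.
  have /andP[k0 k1] := chi1 p.
  have /andP[G0 G1] := min_majorantP m p; have /andP[A0 A1] := affine_majorantP m.+1 p.
  have /andP[t0 t1] := theta01 p.
  have GA : `|G - Af| <= (c 0).1 + (c 0).2 + ((c m.+1).1 + (c m.+1).2).
    by rewrite ler_norml; apply/andP; split; rewrite /G /Af; lra.
  rewrite (le_trans (ler_wpM2l (sqr_ge0 _) (ler_normD _ _)))// mulrDr; apply: lerD.
    rewrite ler_wpM2l ?sqr_ge0// normrM ler_piMl// ger0_norm//.
  have z2 : z p ^+ 2 <= Z ^+ 2.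
    by rewrite -(real_normK (num_real (z p))) lerXn2r ?nnegrE.
  rewrite normrM [`|_ - _| * _]mulrC mulrA ler_wpM2r// /D.
  by apply: ler_pM => //; exact: sqr_ge0.
rewrite RintegralD// RintegralZl//.
have chi2 : \int[mu]_p `|chi p - \1_B p| <= e / 2 / (D + 1).
  have := chiB; rewrite -[X in (X < _)%E]fineK; last exact: (integrable_fin_num measurableT i2).
  by rewrite lte_fin => /ltW.
have : D * \int[mu]_p `|chi p - \1_B p| <= e / 2.
  apply: (le_trans (ler_wpM2l D0 chi2)).
  rewrite mulrA ler_pdivrMr ?ltr_wpDl// mulrDr mulr1 mulrC lerDl.
  exact: ltW (half_gt0 e0).
by move: int; rewrite -/F1 /F1; lra.
Qed.

Hypothesis cinf : forall a b e, 0 <= a -> 0 <= b -> 0 < e ->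
  exists m, (c m).1 * a + (c m).2 * b <= theta a b + e.

Lemma min_majorant_cvg p : min_majorant m p @[m --> \oo] --> theta (g p) (h p).
Proof.
apply/cvgrPdist_le => e e0.
have /andP[g0 _] := g1 p; have /andP[h0 _] := h1 p.
have [m hm] := cinf g0 h0 e0.
have dec k l : (k <= l)%N -> min_majorant l p <= min_majorant k p.
  move=> /subnK <-; elim: (l - k)%N => [//|j IH].
  by rewrite addSn /= ge_min IH.
have mm : min_majorant m p <= affine_majorant m p.
  by case: {hm dec} m => [//|m] /=; rewrite ge_min lexx orbT.
near=> k; have /andP[k1 _] := min_majorantP k p.
rewrite distrC ger0_norm ?subr_ge0// lerBlDl.
apply: (le_trans _ hm); apply: (le_trans _ mm); apply: dec.
by near: k; exact: nbhs_infty_ge.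
Unshelve. all: by end_near. Qed.

Lemma theta_smooth_majorant (z : ST -> R^o) e : tfun z -> 0 < e -> exists phi psi,
  [/\ mult phi, mult psi,
    forall p x y, 0 <= x -> 0 <= y -> theta x y <= phi p * x + psi p * y &
    \int[mu]_p (z p ^+ 2 * (phi p * g p + psi p * h p)) <=
      \int[mu]_p (z p ^+ 2 * theta (g p) (h p)) + e].
Proof.
move=> tz e0; have [Z [Z0 HZ]] := tfun_bounded tz.
have [c01 c02 _] := mc 0.
have mz : measurable_fun setT (z : X -> R) by exact: tfun_measurable.
have z2 p : z p ^+ 2 <= Z ^+ 2.
  by rewrite -(real_normK (num_real (z p))) lerXn2r ?nnegrE.
have mG := min_majorant_measurable.
have mzG m : measurable_fun setT (fun p : X => z p ^+ 2 * min_majorant m p).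
  by apply: measurable_funM => //; exact: measurable_funX.
have G0 m p : 0 <= min_majorant m p.
  have /andP[h2 _] := min_majorantP m p; have /andP[h3 _] := theta01 p.
  exact: le_trans h2.
have zGle m p : `|z p ^+ 2 * min_majorant m p| <= Z ^+ 2 * ((c 0).1 + (c 0).2).
  rewrite normrM; apply: ler_pM => //; first by rewrite ger0_norm ?sqr_ge0.
  by rewrite ger0_norm//; case/andP: (min_majorantP m p).
have iG m : mu.-integrable setT (EFin \o (fun p : X => z p ^+ 2 * min_majorant m p)).
  exact: (bounded_integrable _ (mzG m) (zGle m)).
have cv : \int[mu]_p (z p ^+ 2 * min_majorant m p) @[m --> \oo] -->
    \int[mu]_p (z p ^+ 2 * theta (g p) (h p)).
  apply: (@dominated_Rcvg _ _ _ _ _ _ (cst (Z ^+ 2 * ((c 0).1 + (c 0).2)))) => //.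
  - by apply: (@bounded_integrable _ _ _ _ _ `|Z ^+ 2 * ((c 0).1 + (c 0).2)|).
  - by move=> p; apply: cvgMr; exact: min_majorant_cvg.
have e20 := half_gt0 e0.
have [m hm] : exists m, \int[mu]_p (z p ^+ 2 * min_majorant m p) <=
    \int[mu]_p (z p ^+ 2 * theta (g p) (h p)) + e / 2.
  have [m _ hm] := (cvgrPdist_le _ _).1 cv _ e20.
  exists m; have := hm m (leqnn m); rewrite /= ler_distl => /andP[+ _]; lra.
have [phi [psi [mphi mpsi maj int]]] := smooth_majorant m tz e20.
exists phi, psi; split=> //.
have [_ mp [Cp HCp]] := mphi; have [_ ms [Cs HCs]] := mpsi.
have iF := majorant_gap_integrable m tz mphi mpsi.
have iS := integrableD measurableT (iG m) iF.
apply: (@le_trans _ _ (\int[mu]_p (z p ^+ 2 * min_majorant m p +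
   z p ^+ 2 * `|phi p * g p + psi p * h p - min_majorant m p|))); last first.
  by rewrite RintegralD//; lra.
apply: le_Rintegral => //.
  apply: (le_integrable (g := fun p : X => z p ^+ 2 * min_majorant m p +
   z p ^+ 2 * `|phi p * g p + psi p * h p - min_majorant m p|)).
  - apply: measurable_funM; first exact: measurable_funX.
    by apply: measurable_funD; apply: measurable_funM.
  - move=> p; rewrite -mulrDr !normrM ler_wpM2l//.
    have /andP[g0 _] := g1 p; have /andP[h0 _] := h1 p.
    have F0 := le_trans (interp_ge0 hI g0 h0) (maj p _ _ g0 h0).
    rewrite ger0_norm// ger0_norm; last by rewrite addr_ge0.
    by rewrite -lerBlDl ler_norm.
  - by move: iS; exact: eq_integrable.
move=> p _; rewrite -mulrDr ler_wpM2l ?sqr_ge0//.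
by rewrite -lerBlDl ler_norm.
Qed.

End limit.

(* A concave 1-homogeneous [theta] is an infimum of countably many linear functions. *)
Lemma theta_usc (I : Type) (F : set_system I) (FF : ProperFilter F)
  (gk hk : I -> X -> R) (muk : I -> {finite_measure set X -> \bar R})
  (g h : X -> R) (mu : {finite_measure set X -> \bar R}) (z : ST -> R^o) e :
  (forall k, measurable_fun setT (gk k)) -> (forall k, measurable_fun setT (hk k)) ->
  (forall k p, 0 <= gk k p <= 1) -> (forall k p, 0 <= hk k p <= 1) ->
  measurable_fun setT g -> measurable_fun setT h ->
  (forall p, 0 <= g p <= 1) -> (forall p, 0 <= h p <= 1) ->
  (forall z, tfun z -> \int[muk k]_p (z p * gk k p) @[k --> F] --> \int[mu]_p (z p * g p)) ->
  (forall z, tfun z -> \int[muk k]_p (z p * hk k p) @[k --> F] --> \int[mu]_p (z p * h p)) ->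
  tfun z -> 0 < e ->
  \forall k \near F, \int[muk k]_p (z p ^+ 2 * theta (gk k p) (hk k p)) <=
    \int[mu]_p (z p ^+ 2 * theta (g p) (h p)) + e.
Proof.
move=> mgk mhk gk1 hk1 mg mh g1 h1 cg ch tz e0.
have [c [mc cinf]] := theta_majorants hI.
have e20 := half_gt0 e0.
have [phi [psi [mphi mpsi maj int]]] := theta_smooth_majorant mu mc mg mh g1 h1 cinf tz e20.
have tz2 : tfun (fun p => z p ^+ 2 : R^o).
  by have := tfunM (tfun_smooth tz) tz; congr tfun; apply/funext => p; rewrite expr2.
have [tp mp [Cp HCp]] := mphi; have [ts ms [Cs HCs]] := mpsi.
have t1 := tp _ tz2; have t2 := ts _ tz2.
(* With smooth coefficients the majorant is linear in the densities, so its integrals converge. *)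
have L : \int[muk k]_p (z p ^+ 2 * phi p * gk k p) + \int[muk k]_p (z p ^+ 2 * psi p * hk k p) @[k --> F] -->
    \int[mu]_p (z p ^+ 2 * phi p * g p) + \int[mu]_p (z p ^+ 2 * psi p * h p).
  by apply: cvgD; [exact: (cg _ t1)|exact: (ch _ t2)].
have ib (nu : {finite_measure set X -> \bar R}) (w : ST -> R^o) (a : X -> R) : tfun w ->
    measurable_fun setT a -> (forall p, 0 <= a p <= 1) ->
    nu.-integrable setT (EFin \o (fun p => w p * a p)).
  move=> tw ma a1; have [W [W0 HW]] := tfun_bounded tw.
  apply: (@bounded_integrable _ _ _ _ _ W).
    by apply: measurable_funM => //; exact: tfun_measurable.
  by move=> p; rewrite normrM -[W]mulr1; apply: ler_pM => //; have /andP[? ?] := a1 p; rewrite ger0_norm.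
have Lim : \int[mu]_p (z p ^+ 2 * phi p * g p) + \int[mu]_p (z p ^+ 2 * psi p * h p) <=
    \int[mu]_p (z p ^+ 2 * theta (g p) (h p)) + e / 2.
  rewrite -RintegralD//; [|exact: (ib mu _ g t1)|exact: (ib mu _ h t2)].
  apply: le_trans int; rewrite le_eqVlt; apply/orP; left; apply/eqP.
  by apply: eq_Rintegral => p _; rewrite mulrDr !mulrA.
move/cvgrPdist_le: L => /(_ _ e20); apply: filterS => k.
rewrite ler_distl => /andP[hk' _].
apply: (@le_trans _ _ (\int[muk k]_p (z p ^+ 2 * phi p * gk k p) + \int[muk k]_p (z p ^+ 2 * psi p * hk k p))); last by lra.
have j1 := ib (muk k) _ (gk k) t1 (mgk k) (gk1 k).
have j2 := ib (muk k) _ (hk k) t2 (mhk k) (hk1 k).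
rewrite -RintegralD//; apply: le_Rintegral => //.
- apply: (ib (muk k) _ (fun p => theta (gk k p) (hk k p)) tz2) => [|p]; last exact: (theta_le1 hI).
  by apply: (measurable_theta hI) => // p; [case/andP: (gk1 k p)|case/andP: (hk1 k p)].
- by have := integrableD measurableT j1 j2; exact: eq_integrable.
move=> p _.
have -> : z p ^+ 2 * phi p * gk k p + z p ^+ 2 * psi p * hk k p = z p ^+ 2 * (phi p * gk k p + psi p * hk k p).
  by ring.
rewrite ler_wpM2l ?sqr_ge0//.
by apply: maj; [case/andP: (gk1 k p)|case/andP: (hk1 k p)].
Qed.

End UpperSemicontinuity.

(** * Limits along ultrafilters, narrow limits and convergence of time integrals *)

Section Ultrafilters.

(** If some neighbourhood [B] of the limit failed, [W] and the preimage of the complement of [B]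
    would generate a proper filter, and an ultrafilter above it would contradict the hypothesis. *)
Lemma cvg_ultra (I : Type) (W : set_system I) (R : realType) (a : I -> R) (l : R) :
  ProperFilter W -> (forall G, UltraFilter G -> W `<=` G -> a k @[k --> G] --> l) ->
  a k @[k --> W] --> l.
Proof.
move=> PW H B nB; apply: contrapT => nW.
pose W' : set_system I := [set C | exists2 D, W D & D `&` (a @^-1` (~` B)) `<=` C].
have PW' : ProperFilter W'.
  split; last split.
  - move=> [D WD] D0; apply: nW; rewrite /nbhs /=; apply: filterS WD => k Dk.
    by apply: contrapT => nBk; apply: (D0 k).
  - by exists setT => //; exact: filterT.
  - move=> C1 C2 [D1 W1 S1] [D2 W2 S2]; exists (D1 `&` D2); first exact: filterI.
    by move=> k [[d1 d2] nb]; split; [exact: S1|exact: S2].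
  - by move=> C1 C2 C12 [D WD S]; exists D => //; exact: subset_trans C12.
have [G [UG W'G]] := ultraFilterLemma PW'.
have WG : W `<=` G by move=> D WD; apply: W'G; exists D => // k [].
have GB : G (a @^-1` B) by exact: (H G UG WG).
have GnB : G (a @^-1` (~` B)).
  by apply: W'G; exists setT; [exact: filterT|move=> k []].
by have [k [kB knB]] := filter_ex (filterI GB GnB).
Qed.

End Ultrafilters.

Section Narrow.
Context (R : realType) (d : nat).
Local Notation E := ('rV[R]_d).
Local Notation Rd := (euclid R d).
Local Notation ST := (E * R^o)%type.

Lemma portmanteau_open (I : Type) (F : set_system I) (m_ : I -> {finite_measure set Rd -> \bar R})
  (m : {finite_measure set Rd -> \bar R}) (U : set Rd) (e : R) : ProperFilter F ->
  (forall f, Cb f -> \int[m_ k]_x f x @[k --> F] --> \int[m]_x f x) ->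
  open (U : set E) -> (\forall k \near F, (m_ k U <= e%:E)%E) -> (m U <= e%:E)%E.
Proof.
move=> PF cv oU Ue; have mU : measurable U by exact: sub_sigma_algebra.
have CbU j : Cb (ramp (U : set E) j).
  by apply: Cb01 => [|x]; [exact: ramp_continuous|exact: ramp01].
have mr j : measurable_fun setT (fun x : Rd => ramp (U : set E) j x).
  by apply: continuous_measurable_Rd; exact: ramp_continuous.
have ir j (nu : {finite_measure set Rd -> \bar R}) : nu.-integrable setT (EFin \o (fun x : Rd => ramp (U : set E) j x)).
  exact: Cb_measure_integrable.
have rle j (nu : {finite_measure set Rd -> \bar R}) : \int[nu]_x ramp (U : set E) j x <= fine (nu U).
  rewrite -Rintegral_indicT//; apply: le_Rintegral => //; first exact: ir.
    apply: (@bounded_integrable _ _ _ _ _ 1) => [|x]; first exact: measurable_indic.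
    by rewrite ger0_norm// indicE; case: (_ \in _).
  move=> x _; rewrite indicE; have [Ux|Ux] := pselect (U x).
    by rewrite mem_set//; case/andP: (@ramp01 _ _ (U : set E) j x).
  by rewrite memNset// ramp_eq0.
have cvj : \int[m]_x ramp (U : set E) j x @[j --> \oo] --> fine (m U).
  rewrite -Rintegral_indicT//; apply: (@dominated_Rcvg _ _ _ _ _ _ (cst 1)) => //.
  - by apply: (@bounded_integrable _ _ _ _ _ 1) => // x; rewrite normr1.
  - by move=> j x; have /andP[? ?] := @ramp01 _ _ (U : set E) j x; rewrite ger0_norm.
  - move=> x; have [Ux|Ux] := pselect (U x).
      by rewrite indicE mem_set//; apply: cvg_near_cst; exact: ramp_eq1.
    rewrite indicE memNset//; apply: cvg_near_cst; apply: nearW => j.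
    by rewrite ramp_eq0.
rewrite -[leLHS]fineK ?fin_num_measure// lee_fin.
apply: (cvgr_to_le cvj); apply: nearW => j.
apply: (cvgr_to_le (cv _ (CbU j))); apply: filterS Ue => k ke.
by apply: (le_trans (rle j _)); rewrite -lee_fin fineK ?fin_num_measure.
Qed.

(** Tietze extension. Narrow convergence is tested by functions continuous on [Omega] only, whereas
    the limit arguments work with functions on the whole space. *)
Lemma Cb_extension (A : set E) (phi : E -> R) M : closed A ->
  {within A, continuous phi} -> (forall x, A x -> `|phi x| <= M) ->
  exists Phi, Cb Phi /\ forall x, A x -> Phi x = phi x.
Proof.
move=> cA cphi phiM.
have M0 : 0 < `|M| + 1 by rewrite ltr_pwDr.
have phiM' x : A x -> `|phi x| <= `|M| + 1.
  by move=> /phiM h; rewrite (le_trans h)// (le_trans (ler_norm _))// lerDl.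
have nE : normal_space E.
  exact: pseudometric_normal.
have [g [gE cg gM]] := continuous_bounded_extension nE cA M0 cphi phiM'.
exists g; split; first by split=> //; exists (`|M| + 1).
by move=> x Ax; rewrite gE ?mem_set.
Qed.

End Narrow.

Section TimeGrid.
Context (R : realType).
Local Notation leb := (@lebesgue_measure R).
Local Notation I01 := ([set` `[(0 : R), 1]] : set (measurableTypeR R)).

(** Dominated convergence concerns sequences, not general filters. Equicontinuity makes the
    convergence uniform in time: it has to be checked only on a finite grid of mesh [1 / N] below
    [dl]. *)
Lemma grid_cvg (I : Type) (F : set_system I) (Phi_ : I -> R -> R) (Phi : R -> R) :
  ProperFilter F ->
  (forall k, leb.-integrable I01 (EFin \o Phi_ k)) -> leb.-integrable I01 (EFin \o Phi) ->
  (forall t, 0 <= t <= 1 -> Phi_ k t @[k --> F] --> Phi t) ->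
  (forall e, 0 < e -> exists dl, 0 < dl /\ forall k s t, 0 <= s -> s <= t -> t <= 1 -> t - s < dl ->
     `|Phi_ k t - Phi_ k s| <= e) ->
  \int[leb]_(t in I01) Phi_ k t @[k --> F] --> \int[leb]_(t in I01) Phi t.
Proof.
move=> PF i_ iP cv eq; apply/cvgrPdist_le => e e0.
have e30 : 0 < e / 3 by rewrite divr_gt0.
have [dl [dl0 H]] := eq _ e30.
pose N := (Num.trunc dl^-1).+1.
have N0 : (0 : R) < N%:R by rewrite ltr0n.
have Ndl : N%:R^-1 < dl.
  by rewrite invf_plt ?posrE// -[ltLHS]/(dl^-1) truncnS_gt.
have HP s t : 0 <= s -> s <= t -> t <= 1 -> t - s < dl -> `|Phi t - Phi s| <= e / 3.
  move=> s0 st t1 ts; have t0 := le_trans s0 st; have s1 := le_trans st t1.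
  have c : `|Phi_ k t - Phi_ k s| @[k --> F] --> `|Phi t - Phi s|.
    by apply: (@cvg_norm _ R^o); apply: cvgB; apply: cv; rewrite ?t0 ?s0.
  by apply: (cvgr_to_le c); apply: nearW => k; exact: H.
have Hgrid : \forall k \near F, forall j : 'I_N.+1, `|Phi (j%:R / N%:R) - Phi_ k (j%:R / N%:R)| <= e / 3.
  apply: filter_forall => j.
  have j01 : 0 <= (j%:R / N%:R : R) <= 1.
    by rewrite divr_ge0//= ler_pdivrMr// mul1r ler_nat -ltnS.
  by have := cv _ j01 => /cvgrPdist_le/(_ _ e30).
apply: filterS Hgrid => k Hk.
rewrite -RintegralB//.
have mI : measurable I01 by exact: measurable_itv.
have iB : leb.-integrable I01 (EFin \o (fun t => Phi t - Phi_ k t)).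
  by have := integrableB mI iP (i_ k); exact: eq_integrable.
apply: (le_trans (le_normr_Rintegral mI iB)).
apply: (@le_trans _ _ (\int[leb]_(t in I01) e)); last first.
  rewrite Rintegral_cst// (_ : fine _ = 1) ?mulr1//; exact: (congr1 fine (leb01 R)).
apply: le_Rintegral => //.
- by have := integrable_norm iB; exact: eq_integrable.
- apply: continuous_compact_integrable; first exact: segment_compact.
  by apply: continuous_subspaceT => x; exact: cst_continuous.
move=> t; rewrite /= in_itv /= => /andP[t0 t1].
pose j := Num.trunc (N%:R * t).
have Nt0 : 0 <= N%:R * t by rewrite mulr_ge0.
have /andP[j1 j2] : j%:R <= N%:R * t < j.+1%:R by rewrite truncn_itv.
have jN : (j < N.+1)%N.
  rewrite ltnS -(ler_nat R); apply: (le_trans j1).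
  by rewrite ler_piMr.
have := Hk (Ordinal jN) => /= hk.
set s := j%:R / N%:R in hk *.
have s0 : 0 <= s by rewrite divr_ge0.
have st : s <= t by rewrite ler_pdivrMr// mulrC.
have ts : t - s < dl.
  apply: lt_trans Ndl; rewrite -(ltr_pM2l N0) mulfV ?gt_eqF// mulrBr.
  have -> : N%:R * s = j%:R by rewrite mulrC divfK ?gt_eqF.
  by rewrite ltrBlDr nat1r.
have h1 := HP s t s0 st t1 ts; have h2 := H k s t s0 st t1 ts.
have -> : Phi t - Phi_ k t = (Phi t - Phi s) + (Phi s - Phi_ k s) - (Phi_ k t - Phi_ k s) by ring.
apply: (le_trans (ler_normB _ _)).
have := ler_normD (Phi t - Phi s) (Phi s - Phi_ k s).
by lra.
Qed.

End TimeGrid.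

(** * Existence of minimizers *)

Section Existence.
Context (R : realType) (d n : nat).
Local Notation E := ('rV[R]_d).
Local Notation Rd := (euclid R d).
Local Notation T := (measurableTypeR R).
Local Notation X := (Rd * T)%type.
Local Notation ST := (E * R^o)%type.
Local Notation leb := (@lebesgue_measure R).
Local Notation I01 := ([set` `[(0 : R), 1]] : set T).
Variables (Omega : set Rd) (q : 'I_n -> 'I_n -> R) (theta : R -> R -> R).
Hypothesis cO : closed (Omega : set E).
Hypothesis q0 : forall i j, 0 <= q i j.
Hypothesis hI : interpolation theta.
Local Notation K := (field_index d n).
Local Notation solution := (solution Omega q theta).
Local Notation energy := (energy q theta).
Local Notation weight := (weight theta).
Local Notation pairing := (pairing q theta).

Lemma dens_time_integral (rho : R -> vmeasure R d n) mu f i (h : ST -> R^o) : curve_vprob Omega 0 1 rho ->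
  stmeas rho mu -> dens rho f -> tfun h ->
  mu.-integrable setT (EFin \o (fun p => h p * f i p)) /\
  \int[mu]_p (h p * f i p) =
  \int[leb]_(t in I01) (\int[rho (clamp t) i]_x h (x, clamp t)).
Proof.
move=> cr smu [mf f1 [N [mN N0 gN]]] th.
have [H [H0 HH]] := tfun_bounded th.
have ih : mu.-integrable setT (EFin \o (fun p => h p * f i p)).
  apply: (@bounded_integrable _ _ _ _ _ H).
    by apply: measurable_funM => //; exact: tfun_measurable.
  move=> p; rewrite normrM -[H]mulr1; apply: ler_pM => //.
  by have /andP[? ?] := f1 i p; rewrite ger0_norm.
split=> //; rewrite -(stmeas_Rintegral cO cr smu ih).
apply: (Rintegral_off_null mN N0) => t It Nt; rewrite clampK//.
rewrite (good_Rintegral mf f1 (gN t It Nt))//.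
exact: (slice_fun t (tfun_measurable th)).
Qed.

(** Integrate [(z - Y) ^+ 2 * w >= 0]. The action is thus bounded below by expressions in the
    momentum and the mobility, both of which have limits to compare with. *)
Lemma weight_quad rho mu f (Y : K -> X -> R) a (z : ST -> R^o) : solution rho mu f Y -> tfun z ->
  2 * \int[mu]_p (z p * (Y a p * weight f a p)) - \int[mu]_p (z p ^+ 2 * weight f a p) <=
  \int[mu]_p (Y a p ^+ 2 * weight f a p).
Proof.
move=> S tz; have [cr smu df mY Y0 Yfin weak] := S.
have [mf f1 _] := df; have [Z [Z0 HZ]] := tfun_bounded tz.
have mz : measurable_fun setT (z : X -> R) by exact: tfun_measurable.
have i1 := pair_integrable q0 hI df mY Y0 a Yfin mz HZ.
have i2 : mu.-integrable setT (EFin \o (fun p => z p ^+ 2 * weight f a p)).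
  apply: (@bounded_integrable _ _ _ _ _ (Z ^+ 2)).
    by apply: measurable_funM; [exact: measurable_funX|exact: (weight_measurable hI)].
  move=> p; rewrite normrM -[Z ^+ 2]mulr1; have /andP[? ?] := sol_w01 hI S a p.
  by apply: ler_pM => //; rewrite ?normrX ?lerXn2r ?nnegrE// ger0_norm.
have i3 := energy_integrable q0 hI df mY Y0 a Yfin.
have i1' : mu.-integrable setT (EFin \o (fun p => 2 * (z p * (Y a p * weight f a p)))).
  by have := integrableZl measurableT 2 i1; exact: eq_integrable.
rewrite -RintegralZl// -RintegralB//; apply: le_Rintegral => //.
  by have := integrableB measurableT i1' i2; exact: eq_integrable.
move=> p _; have /andP[w0 _] := sol_w01 hI S a p.
have := mulr_ge0 (sqr_ge0 (z p - Y a p)) w0; nra.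
Qed.

Lemma sol_mu1 rho mu f (Y : K -> X -> R) : solution rho mu f Y -> mu setT = 1%E.
Proof.
move=> [cr smu _ _ _ _ _].
have := stmeas_slab cO cr smu (measurable_itv `[(0 : R), 1]) (@subset_refl _ _).
have -> : (setT `*` I01 : set X) = setT `&` (setT `*` I01) by rewrite setTI.
move=> h.
have h2 := smu (cst 1%E) (fun _ => lee01) (@measurable_cst _ _ X _ setT (1%E : \bar R)).
move: h2; rewrite integral_cst// mul1e => ->.
transitivity (\int[leb]_(t in I01) (1 : \bar R))%E; last first.
  by rewrite integral_cst ?mul1e; [exact: leb01|exact: measurable_itv].
apply: eq_integral => t; rewrite inE => It; rewrite integral_cst// mul1e.
by apply: (mbar1 cO); case: (cr t It).
Qed.

Section limit.
Variables (m0 : vmeasure R d n) (en A : R).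
Hypothesis p0 : vprob Omega m0.
Variables (rk : nat -> R -> vmeasure R d n) (muk : nat -> {finite_measure set X -> \bar R}).
Variables (fk : nat -> 'I_n -> X -> R) (Yk : nat -> K -> X -> R).
Hypothesis Sk : forall k, solution (rk k) (muk k) (fk k) (Yk k).
Hypothesis rk0 : forall k, vmeasure_eq (rk k 0) m0.
Hypothesis EA : forall k, (energy (muk k) (fk k) (Yk k) <= A%:E)%E.
Variable F : set_system nat.
Hypothesis uF : UltraFilter F.
Hypothesis enF : forall e, 0 < e -> \forall k \near F, (energy (muk k) (fk k) (Yk k) <= (en + e)%:E)%E.

Let crk k : curve_vprob Omega 0 1 (rk k). Proof. exact: sol_curve (Sk k). Qed.
Let A0 : 0 <= A. Proof. exact: (energy_ge0 q0 hI (Sk 0) (EA 0)). Qed.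

(** Times and nodes are treated one by one, along the same ultrafilter; regularity in time is
    recovered later. *)
Lemma limit_exists : exists rho : R -> vmeasure R d n, forall t i (phi : E -> R), Cb phi ->
  \int[rk k (clamp t) i]_x phi x @[k --> F] --> \int[rho t i]_x phi x.
Proof.
have H (ti : R * 'I_n) : exists m : {finite_measure set Rd -> \bar R}, forall phi : E -> R, Cb phi ->
    \int[rk k (clamp ti.1) ti.2]_x phi x @[k --> F] --> \int[m]_x phi x.
  apply: (prokhorov uF (C := 1)) => [k|e e0].
    by apply: (vprob_le1 cO); case: (crk k (clamp_I01 ti.1)).
  have [r Hr] := tightness cO q0 hI p0 A0 e0.
  exists r => k; apply: (Hr _ _ _ _ _ _ (Sk k) (rk0 k) (EA k)).
  by have := clamp_I01 ti.1; rewrite in_itv.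
have [m Hm] := choice H.
by exists (fun t i => m (t, i)) => t i phi; exact: (Hm (t, i)).
Qed.

Variable rho : R -> vmeasure R d n.
Hypothesis rhoE : forall t i (phi : E -> R), Cb phi ->
  \int[rk k (clamp t) i]_x phi x @[k --> F] --> \int[rho t i]_x phi x.

Lemma limit_tight e : 0 < e -> exists r, forall t i, (rho t i [set x | (r < `|x|)%R] <= e%:E)%E.
Proof.
move=> e0; have [r Hr] := tightness cO q0 hI p0 A0 e0.
exists r => t i; apply: (@portmanteau_open _ _ nat F (fun k => rk k (clamp t) i)).
- by move=> phi Cphi; exact: rhoE.
- apply: (@open_comp _ _ (fun x : E => `|x|) [set y : R | (r < y)%R]); last exact: open_gt.
  by move=> x _; exact: norm_continuous.
- apply: nearW => k; apply: (Hr _ _ _ _ _ _ (Sk k) (rk0 k) (EA k)).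
  by have := clamp_I01 t; rewrite in_itv.
Qed.

Lemma limit_vprob t : vprob Omega (rho t).
Proof.
have z i : rho t i (~` Omega) = 0%E.
  apply/eqP; rewrite eq_le measure_ge0 andbT.
  apply: (@portmanteau_open _ _ nat F (fun k => rk k (clamp t) i)).
  - by move=> phi Cphi; exact: rhoE.
  - exact: closed_openC.
  - by apply: nearW => k; have [[-> _] _] := crk k (clamp_I01 t).
split=> //.
have mO := measurable_Omega cO.
have fin1 (m : {finite_measure set Rd -> \bar R}) : m (~` Omega) = 0%E ->
    fine (m Omega) = \int[m]_x cst 1 x.
  by move=> m00; rewrite -(Rintegral_Omega cO)// Rintegral_cst// mul1r.
have cv : \sum_i \int[rk k (clamp t) i]_x cst 1 x @[k --> F] --> \sum_i \int[rho t i]_x cst 1 x.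
  apply: cvg_big => [|i _]; first exact: add_continuous.
  by apply: rhoE; exact: Cb_cst.
have fE (m : vmeasure R d n) : (forall i, m i (~` Omega) = 0%E) ->
    (\sum_i m i Omega = (\sum_i \int[m i]_x cst 1 x)%:E)%E.
  move=> h; rewrite -sumEFin; apply: eq_bigr => i _.
  by rewrite -fin1// fineK// fin_num_measure.
rewrite fE//; congr EFin.
have c1 : (fun k => \sum_i \int[rk k (clamp t) i]_x cst 1 x) k @[k --> F] --> (1 : R).
  apply: cvg_near_cst; apply: nearW => k.
  have [[h1 h2] _] := crk k (clamp_I01 t).
  by have := fE _ h1; rewrite h2 => -[].
exact: (cvg_unique _ cv c1).
Qed.

Lemma limit_equicontinuity (eta : ST -> R^o) e : tfun eta -> 0 < e ->
  exists dl, 0 < dl /\ forall i s t, 0 <= s -> s <= t -> t <= 1 -> t - s < dl ->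
    `|\int[rho t i]_x eta (x, t) - \int[rho s i]_x eta (x, s)| <= e.
Proof.
move=> te e0; have [dl [dl0 H]] := equicontinuity cO q0 hI te A0 e0.
exists dl; split=> // i s t s0 st t1 ts.
have ct : clamp t = t by rewrite clampK//= in_itv /= (le_trans s0 st).
have cs : clamp s = s by rewrite clampK//= in_itv /= s0 (le_trans st t1).
have c : `|\int[rk k (clamp t) i]_x eta (x, t) - \int[rk k (clamp s) i]_x eta (x, s)| @[k --> F] -->
    `|\int[rho t i]_x eta (x, t) - \int[rho s i]_x eta (x, s)|.
  apply: (@cvg_norm _ R^o); apply: cvgB.
    by apply: rhoE; exact: tfun_slice_Cb.
  by apply: rhoE; exact: tfun_slice_Cb.
apply: (cvgr_to_le c); apply: nearW => k; rewrite ct cs.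
exact: (H _ _ _ _ (Sk k) (EA k)).
Qed.

Lemma limit_slice_cvg t0 i (eta : ST -> R^o) : I01 t0 -> tfun eta ->
  \int[rho t i]_x eta (x, t0) @[t --> within I01 (nbhs t0)] --> \int[rho t0 i]_x eta (x, t0).
Proof.
move=> It0 te; have [C [C0 HC]] := tfun_time_lip te.
apply/cvgrPdist_le => e e0; have e20 := half_gt0 e0.
have [dl [dl0 H]] := limit_equicontinuity te e20.
have d0 : 0 < Num.min dl (e / 2 / (C + 1)) by rewrite lt_min dl0 divr_gt0// ltr_wpDl.
rewrite near_withinE; apply/nbhs_ballP; exists (Num.min dl (e / 2 / (C + 1))) => // t.
rewrite /ball /= lt_min => /andP[h1 h2] It.
move: (It) (It0); rewrite /= !in_itv /= => /andP[t00 t1] /andP[t0' t01].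
have h3 := slice_diff t t0 te C0 HC (vprob_le1 cO i (limit_vprob t)).
have h4 : C * `|t - t0| <= e / 2.
  rewrite distrC; have := ltW h2; rewrite ler_pdivlMr ?ltr_wpDl// mulrDr mulr1 mulrC.
  by apply: le_trans; rewrite lerDl.
have h5 : `|\int[rho t i]_x eta (x, t) - \int[rho t0 i]_x eta (x, t0)| <= e / 2.
  have [tt|/ltW tt] := leP t0 t.
    by apply: H => //; move: h1; rewrite distrC ger0_norm ?subr_ge0.
  by rewrite distrC; apply: H => //; move: h1; rewrite ger0_norm ?subr_ge0.
have -> : \int[rho t0 i]_x eta (x, t0) - \int[rho t i]_x eta (x, t0) =
  (\int[rho t i]_x eta (x, t) - \int[rho t i]_x eta (x, t0)) -
  (\int[rho t i]_x eta (x, t) - \int[rho t0 i]_x eta (x, t0)) by ring.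
apply: (le_trans (ler_normB _ _)); lra.
Qed.

(** Equicontinuity gives continuity in time only against test functions. Along any ultrafilter of
    times, tightness provides a narrow limit, which test functions identify with [rho t0]; so
    bounded continuous functions converge too. *)
Lemma limit_curve : curve_vprob Omega 0 1 rho.
Proof.
move=> t0 It0; split; first exact: limit_vprob.
move=> i phi cphi [M phiM].
have [Phi [CPhi PhiE]] := Cb_extension cO cphi phiM.
have E1 t : \int[rho t i]_(x in Omega) phi x = \int[rho t i]_x Phi x.
  have [h _] := limit_vprob t.
  rewrite -(Rintegral_Omega cO _ (h i)); apply: eq_Rintegral => x; rewrite inE => Ox.
  by rewrite PhiE.
rewrite E1; under eq_fun do rewrite E1.
have PW : ProperFilter (within I01 (nbhs t0)).
  by apply: within_nbhs_proper; apply: subset_closure; move: It0; rewrite inE.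
apply: cvg_ultra => G UG WG.
have [nu Hnu] := prokhorov UG (m := fun t => rho t i) (C := 1)
  (fun t => vprob_le1 cO i (limit_vprob t))
  (fun e e0 => let: ex_intro r Hr := limit_tight e0 in ex_intro _ r (fun t => Hr t i)).
have PG : ProperFilter G by exact: ultra_proper.
have nuE : forall B, measurable B -> nu B = rho t0 i B.
  apply: (tfun_slice_unique (t := t0)) => eta te.
  have c1 := Hnu _ (tfun_slice_Cb t0 te).
  have c2 := @limit_slice_cvg t0 i eta It0 te.
  have c3 : \int[rho t i]_x eta (x, t0) @[t --> G] --> \int[rho t0 i]_x eta (x, t0).
    by move=> B nB; apply: WG; exact: c2.
  exact: (cvg_unique _ c1 c3).
have -> : \int[rho t0 i]_x Phi x = \int[nu]_x Phi x.
  rewrite /Rintegral; congr fine; apply: eq_measure_integral => B mB _.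
  exact: esym (nuE B mB).
exact: Hnu.
Qed.

Lemma limit_ends (m1 : vmeasure R d n) : (forall k, vmeasure_eq (rk k 1) m1) ->
  vmeasure_eq (rho 0) m0 /\ vmeasure_eq (rho 1) m1.
Proof.
move=> rk1.
have H (m : vmeasure R d n) (t : R) : clamp t = t -> (forall k, vmeasure_eq (rk k t) m) -> vmeasure_eq (rho t) m.
  move=> ct km i; apply: (tfun_slice_unique (t := 0)) => eta te.
  have c1 := @rhoE t i _ (tfun_slice_Cb 0 te).
  have c2 : \int[rk k (clamp t) i]_x eta (x, 0) @[k --> F] --> \int[m i]_x eta (x, 0).
    apply: cvg_near_cst; apply: nearW => k; rewrite ct /Rintegral; congr fine.
    by apply: eq_measure_integral => B mB _; exact: km.
  exact: (cvg_unique _ c1 c2).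
by split; apply: H => //; rewrite clampK//= in_itv /= ?lexx ler01.
Qed.

Variables (mu : {finite_measure set X -> \bar R}) (f : 'I_n -> X -> R).
Hypothesis smu : stmeas rho mu.
Hypothesis df : dens rho f.

Let mf : forall i, measurable_fun setT (f i). Proof. by case: df. Qed.
Let f1 : forall i p, 0 <= f i p <= 1. Proof. by case: df. Qed.
Let fk1 k : forall i p, 0 <= fk k i p <= 1. Proof. by case: (sol_dens (Sk k)). Qed.
Let mfk k : forall i, measurable_fun setT (fk k i). Proof. by case: (sol_dens (Sk k)). Qed.
Let PF : ProperFilter F. Proof. exact: ultra_proper. Qed.

Lemma limit_density i (h : ST -> R^o) : tfun h ->
  \int[muk k]_p (h p * fk k i p) @[k --> F] --> \int[mu]_p (h p * f i p).
Proof.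
move=> th.
have cl := limit_curve.
rewrite (proj2 (dens_time_integral i cl smu df th)).
have E1 k := proj2 (dens_time_integral i (crk k) (sol_stmeas (Sk k)) (sol_dens (Sk k)) th).
under eq_fun do rewrite E1.
have int (g : R -> R) : continuous g -> leb.-integrable I01 (EFin \o g).
  move=> cg; apply: continuous_compact_integrable; first exact: segment_compact.
  exact: continuous_subspaceT.
apply: grid_cvg.
- by move=> k; apply: int; exact: (curve_slice_continuous cO (crk k)).
- by apply: int; exact: (curve_slice_continuous cO cl).
- move=> t t01; have := @rhoE (clamp t) i _ (tfun_slice_Cb (clamp t) th).
  by rewrite {1}clampK//; exact: clamp_I01.
- move=> e e0; have [dl [dl0 H]] := equicontinuity cO q0 hI th A0 e0.
  exists dl; split=> // k s t s0 st t1 ts.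
  have ct : clamp t = t by rewrite clampK//= in_itv /= (le_trans s0 st).
  have cs : clamp s = s by rewrite clampK//= in_itv /= s0 (le_trans st t1).
  by rewrite ct cs; exact: (H _ _ _ _ (Sk k) (EA k)).
Qed.

(** Node weights are densities and converge; for edge weights only the upper bound survives, by
    concavity of [theta]. *)
Lemma limit_weight a (z : ST -> R^o) e : tfun z -> 0 < e ->
  \forall k \near F, \int[muk k]_p (z p ^+ 2 * weight (fk k) a p) <=
    \int[mu]_p (z p ^+ 2 * weight f a p) + e.
Proof.
move=> tz e0; case: a => -[i j] /=; last first.
  exact: (@theta_usc R d theta hI nat F PF (fun k => fk k i) (fun k => fk k j) muk (f i) (f j) mu z e
    (fun k => mfk k i) (fun k => mfk k j) (fun k => fk1 k i) (fun k => fk1 k j) (mf i) (mf j) (f1 i) (f1 j)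
    (fun w tw => @limit_density i w tw) (fun w tw => @limit_density j w tw) tz e0).
have tz2 : tfun (fun p => z p ^+ 2 : R^o).
  by have := tfunM (tfun_smooth tz) tz; congr tfun; apply/funext => p; rewrite expr2.
move/cvgrPdist_le: (@limit_density i _ tz2) => /(_ _ e0); apply: filterS => k.
by rewrite ler_distl => /andP[+ _]; rewrite lerBlDr.
Qed.

Definition momentum a (z : ST -> R^o) : R :=
  lim (\int[muk k]_p (z p * (Yk k a p * weight (fk k) a p)) @[k --> F]).

Definition actionlim a : R := lim (\int[muk k]_p (Yk k a p ^+ 2 * weight (fk k) a p) @[k --> F]).

Lemma actionlim_cvg a :
  \int[muk k]_p (Yk k a p ^+ 2 * weight (fk k) a p) @[k --> F] --> actionlim a.
Proof.
apply: (@ultra_bounded_cvg _ _ _ uF _ (capacity d q * A)) => k.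
rewrite ger0_norm; first exact: (energy_square q0 hI (Sk k) (EA k)).
by apply: Rintegral_ge0 => p _; exact: (sol_square_ge0 hI (Sk k)).
Qed.

Lemma momentum_cvg a (z : ST -> R^o) : tfun z ->
  \int[muk k]_p (z p * (Yk k a p * weight (fk k) a p)) @[k --> F] --> momentum a z.
Proof.
move=> tz; have [Z [Z0 HZ]] := tfun_bounded tz.
apply: (@ultra_bounded_cvg _ _ _ uF _ (Z ^+ 2 + capacity d q * A)) => k.
have h1 := weight_quad a (Sk k) tz.
have tzN : tfun (fun p => -1 * z p : R^o) by exact: tfunZ.
have h2 := weight_quad a (Sk k) tzN.
have h3 := energy_square q0 hI (Sk k) (EA k) a.
have w01 := sol_w01 hI (Sk k) a.
have mw : measurable_fun setT (weight (fk k) a) by exact: (weight_measurable hI).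
have mz : measurable_fun setT (z : X -> R) by exact: tfun_measurable.
have h4 : \int[muk k]_p (z p ^+ 2 * weight (fk k) a p) <= Z ^+ 2.
  have iZ : (muk k).-integrable setT (EFin \o cst (Z ^+ 2)).
    by apply: (@bounded_integrable _ _ _ _ _ `|Z ^+ 2|).
  apply: (@le_trans _ _ (\int[muk k]_(_ in setT) (Z ^+ 2))).
    have zb p : `|z p ^+ 2 * weight (fk k) a p| <= Z ^+ 2.
      have /andP[? ?] := w01 p; rewrite normrM -[Z ^+ 2]mulr1.
      by apply: ler_pM => //; rewrite ?normrX ?lerXn2r ?nnegrE// ger0_norm.
    apply: le_Rintegral => //; last by move=> p _; apply: le_trans (zb p); exact: ler_norm.
    apply: (@bounded_integrable _ _ _ _ _ (Z ^+ 2)) => [|p]; last exact: zb.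
    by apply: measurable_funM => //; exact: measurable_funX.
  rewrite Rintegral_cst// (_ : fine _ = 1) ?mulr1//.
  exact: (congr1 fine (sol_mu1 (Sk k))).
have e1 : \int[muk k]_p ((-1 * z p) ^+ 2 * weight (fk k) a p) = \int[muk k]_p (z p ^+ 2 * weight (fk k) a p).
  by apply: eq_Rintegral => p _; rewrite mulN1r sqrrN.
have iz := pair_integrable q0 hI (sol_dens (Sk k)) (sol_measurable (Sk k)) (sol_price0 (Sk k)) a (sol_energy (Sk k)) mz HZ.
have e2 : \int[muk k]_p ((-1 * z p) * (Yk k a p * weight (fk k) a p)) = - \int[muk k]_p (z p * (Yk k a p * weight (fk k) a p)).
  by rewrite -[RHS]mulN1r -RintegralZl//; apply: eq_Rintegral => p _; rewrite -mulrA.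
rewrite e1 e2 in h2; have Z20 := sqr_ge0 Z.
have B0 : 0 <= \int[muk k]_p (Yk k a p ^+ 2 * weight (fk k) a p).
  by apply: Rintegral_ge0 => p _; exact: (sol_square_ge0 hI (Sk k)).
by rewrite ler_norml; apply/andP; split; lra.
Qed.

(** The quadratic inequality passes to the limit because the mobility is subtracted and is upper
    semicontinuous. *)
Lemma momentum_bound a (z : ST -> R^o) : tfun z ->
  2 * momentum a z - \int[mu]_p (z p ^+ 2 * weight f a p) <= actionlim a.
Proof.
move=> tz; apply/ler_addgt0Pr => e e0.
have c1 : 2 * \int[muk k]_p (z p * (Yk k a p * weight (fk k) a p)) - \int[muk k]_p (Yk k a p ^+ 2 * weight (fk k) a p)
    @[k --> F] --> 2 * momentum a z - actionlim a.
  by apply: cvgB; [apply: cvgMr; exact: momentum_cvg|exact: actionlim_cvg].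
suff : 2 * momentum a z - actionlim a <= \int[mu]_p (z p ^+ 2 * weight f a p) + e by lra.
apply: (cvgr_to_le c1); apply: filterS (limit_weight a tz e0) => k hk.
have := weight_quad a (Sk k) tz; lra.
Qed.

(** The bound on momenta is exactly the boundedness required by the [L^2] representation, applied to
    the images [z * sqrt w]. It yields [om] with momentum [om * sqrt w], and the squared norm of
    [om] is at most the limit of the actions. *)
Lemma momentum_representation a : exists Y : X -> R, [/\ measurable_fun setT Y,
  mu.-integrable setT (EFin \o (fun p => Y p ^+ 2 * weight f a p)),
  forall z, tfun z -> momentum a z = \int[mu]_p (z p * (Y p * weight f a p)) &
  \int[mu]_p (Y p ^+ 2 * weight f a p) <= actionlim a].
Proof.
pose w := weight f a; have w01 p : 0 <= w p <= 1 by exact: (weight01 hI).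
have w0 p : 0 <= w p by case/andP: (w01 p).
have mw : measurable_fun setT w by exact: (weight_measurable hI).
have msw : measurable_fun setT (fun p => Num.sqrt (w p)).
  apply: (measurableT_comp (f := Num.sqrt : R -> R)) => //.
  by apply: continuous_measurable_fun; exact: sqrt_continuous.
pose Tz (z : ST -> R^o) (p : X) : R := z p * Num.sqrt (w p).
have TzE z : ip mu (Tz z) (Tz z) = \int[mu]_p (z p ^+ 2 * w p).
  by rewrite /ip; apply: eq_Rintegral => p _; rewrite /Tz mulrACA -!expr2 sqr_sqrtr.
have L2T z : tfun z -> L2 mu (Tz z).
  move=> tz; have [Z [Z0 HZ]] := tfun_bounded tz.
  have mT : measurable_fun setT (Tz z).
    by apply: measurable_funM => //; exact: tfun_measurable.
  split=> //; apply: (@bounded_integrable _ _ _ _ _ (Z ^+ 2)) => [|p].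
    exact: measurable_funX.
  rewrite /Tz exprMn sqr_sqrtr// normrM -[Z ^+ 2]mulr1; have /andP[? ?] := w01 p.
  by apply: ler_pM => //; rewrite ?normrX ?lerXn2r ?nnegrE// ger0_norm.
have lin (b : R) (z y : ST -> R^o) : b *: z + y = (fun p => b * z p + y p) :> (ST -> R^o) by [].
have S0 : tfun (0 : ST -> R^o) by exact: tfun_cst0.
have SD (b : R) (z y : ST -> R^o) : tfun z -> tfun y -> tfun (b *: z + y).
  by move=> tz ty; rewrite lin; apply: tfunD => //; exact: tfunZ.
have TD (b : R) (z y : ST -> R^o) p : tfun z -> tfun y -> Tz (b *: z + y) p = b * Tz z p + Tz y p.
  by move=> _ _; rewrite lin /Tz; ring.
have MD (b : R) (z y : ST -> R^o) : tfun z -> tfun y ->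
    momentum a (b *: z + y) = b * momentum a z + momentum a y.
  move=> tz ty; have t3 := SD b z y tz ty.
  have c1 := @momentum_cvg a _ t3.
  have c2 : b * \int[muk k]_p (z p * (Yk k a p * weight (fk k) a p)) +
      \int[muk k]_p (y p * (Yk k a p * weight (fk k) a p)) @[k --> F] -->
      b * momentum a z + momentum a y.
    by apply: cvgD; [apply: cvgMr; exact: momentum_cvg|exact: momentum_cvg].
  suff c3 : \int[muk k]_p ((b *: z + y) p * (Yk k a p * weight (fk k) a p)) @[k --> F] -->
      b * momentum a z + momentum a y by exact: (cvg_unique _ c1 c3).
  apply: cvg_trans c2; apply: near_eq_cvg; apply: nearW => k.
  have [Z [Z0 HZ]] := tfun_bounded tz; have [V [V0 HV]] := tfun_bounded ty.
  have iz := pair_integrable q0 hI (sol_dens (Sk k)) (sol_measurable (Sk k)) (sol_price0 (Sk k)) a (sol_energy (Sk k)) (tfun_measurable tz) HZ.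
  have iy := pair_integrable q0 hI (sol_dens (Sk k)) (sol_measurable (Sk k)) (sol_price0 (Sk k)) a (sol_energy (Sk k)) (tfun_measurable ty) HV.
  have iz' : (muk k).-integrable setT (EFin \o (fun p => b * (z p * (Yk k a p * weight (fk k) a p)))).
    by have := integrableZl measurableT b iz; exact: eq_integrable.
  rewrite -RintegralZl// -RintegralD//; apply: eq_Rintegral => p _.
  by rewrite lin; ring.
have bd z : tfun z -> 2 * momentum a z - ip mu (Tz z) (Tz z) <= actionlim a.
  by move=> tz; rewrite TzE; exact: momentum_bound.
have [om [L2om Mom omB]] := @L2_riesz _ _ _ mu (ST -> R^o) (@tfun R d) Tz (momentum a) (actionlim a) S0 SD TD MD L2T bd.
(* Where [w] vanishes the quotient is 0 by convention, consistent with a zero momentum there. *)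
pose Y p := om p / Num.sqrt (w p).
have Yw p : Y p * w p = om p * Num.sqrt (w p).
  rewrite /Y -{2}(sqr_sqrtr (w0 p)) expr2 mulrA.
  have [->|s0] := eqVneq (Num.sqrt (w p)) 0; first by rewrite !mulr0.
  by rewrite divfK.
have Y2w p : Y p ^+ 2 * w p <= om p ^+ 2.
  rewrite /Y exprMn exprVn sqr_sqrtr// -mulrA.
  have [->|s0] := eqVneq (w p) 0; first by rewrite mulr0 mulr0 sqr_ge0.
  by rewrite mulVf// mulr1.
have [mom iom] := L2om.
have mY : measurable_fun setT Y.
  (* The power with exponent -1 agrees with the inverse on nonnegative reals up to its value at 0,
     where [sqrt w = 0] is treated apart, and it is measurable. *)
  rewrite (_ : Y = fun p => om p * powR (Num.sqrt (w p)) (-1)).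
    apply: measurable_funM => //.
    by apply: (measurableT_comp (f := fun x : R => powR x (-1)) _ msw); exact: measurable_powR.
  apply/funext => p; rewrite /Y; congr (_ * _).
  have := sqrtr_ge0 (w p); rewrite le_eqVlt => /predU1P[<-|s0].
    by rewrite invr0 powR0// oppr_eq0 oner_eq0.
  by rewrite powR_inv1// ltW.
have iY : mu.-integrable setT (EFin \o (fun p => Y p ^+ 2 * weight f a p)).
  apply: (le_integrable _ _ iom).
    by apply: measurable_funM => //; exact: measurable_funX.
  move=> p; have h := mulr_ge0 (sqr_ge0 (Y p)) (w0 p).
  by rewrite (ger0_norm h) (ger0_norm (sqr_ge0 (om p))).
exists Y; split=> //.
  move=> z tz; rewrite Mom// /ip; apply: eq_Rintegral => p _.
  by rewrite Yw /Tz; ring.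
apply: (@le_trans _ _ (ip mu om om)).
  rewrite /ip; apply: le_Rintegral => //.
apply/ler_addgt0Pr => e e0; have [z [tz hz]] := omB _ e0.
by apply: (le_trans hz); rewrite lerD2r; exact: bd.
Qed.

(** The weak equation is linear in densities and momenta, so it survives the limit as it stands, and
    the actions are compared field by field. Fields of price 0 are chosen to be 0, which agrees with
    their vanishing momenta. *)
Lemma limit_solution : exists Y, solution rho mu f Y /\ (energy mu f Y <= en%:E)%E.
Proof.
have [Ya HYa] := choice momentum_representation.
pose Y (a : K) : X -> R := if price q a == 0 then cst 0 else Ya a.
have mY a : measurable_fun setT (Y a).
  by rewrite /Y; case: ifP => _; [exact: measurable_cst|case: (HYa a)].
have Y0 a : price q a = 0 -> forall p, Y a p = 0 by move=> pa p; rewrite /Y pa eqxx.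
have iY a : mu.-integrable setT (EFin \o (fun p => Y a p ^+ 2 * weight f a p)).
  have [_ i1 _ _] := HYa a; rewrite /Y; case: ifP => _ //.
  apply: (@bounded_integrable _ _ _ _ _ 0) => [|p]; last by rewrite expr0n mul0r normr0.
  by apply: measurable_funM; [apply: measurable_funX; exact: measurable_cst|exact: (weight_measurable hI)].
have YB a : price q a * \int[mu]_p (Y a p ^+ 2 * weight f a p) <= price q a * actionlim a.
  rewrite /Y; case: ifPn => [/eqP ->|pa]; first by rewrite !mul0r.
  by rewrite ler_wpM2l ?price_ge0//; case: (HYa a).
have EE : energy mu f Y = (\sum_a price q a * \int[mu]_p (Y a p ^+ 2 * weight f a p))%:E.
  rewrite /energy -sumEFin; apply: eq_bigr => a _.
  rewrite EFinM /Rintegral fineK; last exact: (integrable_fin_num measurableT (iY a)).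
  rewrite -ge0_integralZl ?lee_fin ?price_ge0//.
    by case/integrableP: (iY a).
  move=> p _; rewrite lee_fin mulr_ge0 ?sqr_ge0//.
  by case/andP: (weight01 hI a p f1).
have Een : (energy mu f Y <= en%:E)%E.
  rewrite EE lee_fin; apply: (@le_trans _ _ (\sum_a price q a * actionlim a)).
    by apply: ler_sum => a _; exact: YB.
  apply/ler_addgt0Pr => e e0.
  have c : \sum_a price q a * \int[muk k]_p (Yk k a p ^+ 2 * weight (fk k) a p) @[k --> F] -->
      \sum_a price q a * actionlim a.
    apply: cvg_big => [|a _]; first exact: add_continuous.
    by apply: cvgMr; exact: actionlim_cvg.
  apply: (cvgr_to_le c); apply: filterS (enF e0) => k.
  by rewrite (energyE q0 hI (Sk k)) lee_fin.
have Yfin : (energy mu f Y < +oo)%E by apply: (le_lt_trans Een); rewrite ltry.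
exists Y; split=> //; split=> //; first exact: limit_curve.
move=> eta tt i; have te := test_function_tfun tt.
have [_ _ ->] := pairing_integral q0 hI df mY Y0 i Yfin te.
have td : tfun (time_derivative eta : ST -> R^o) by exact: tfun_derive.
have ta a : tfun (dtest q i a eta) by exact: tfun_dtest.
have dE a : \int[mu]_p (dtest q i a eta p * (Y a p * weight f a p)) = momentum a (dtest q i a eta).
  rewrite /Y; case: ifPn => [/eqP pa|pa]; last by case: (HYa a) => _ _ -> //.
  rewrite Rintegral_eq0; last by move=> p; rewrite mul0r mulr0.
  have c := @momentum_cvg a _ (ta a).
  have c0 : \int[muk k]_p (dtest q i a eta p * (Yk k a p * weight (fk k) a p)) @[k --> F] --> (0 : R).
    apply: cvg_near_cst; apply: nearW => k.
    by apply: Rintegral_eq0 => p; rewrite (sol_price0 (Sk k) pa) mul0r mulr0.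
  exact: (cvg_unique _ c0 c).
under eq_bigr do rewrite dE.
have c : \int[muk k]_p (time_derivative eta p * fk k i p) +
    \sum_a \int[muk k]_p (dtest q i a eta p * (Yk k a p * weight (fk k) a p)) @[k --> F] -->
    \int[mu]_p (time_derivative eta p * f i p) + \sum_a momentum a (dtest q i a eta).
  apply: cvgD; first exact: limit_density.
  apply: cvg_big => [|a _]; first exact: add_continuous.
  by apply: momentum_cvg; exact: ta.
suff c0 : \int[muk k]_p (time_derivative eta p * fk k i p) +
    \sum_a \int[muk k]_p (dtest q i a eta p * (Yk k a p * weight (fk k) a p)) @[k --> F] --> (0 : R).
  exact: (cvg_unique _ c c0).
apply: cvg_near_cst; apply: nearW => k.
have [cr' smu' df' mY' Y0' Yfin' weak'] := Sk k.
have [_ _ E1] := pairing_integral q0 hI df' mY' Y0' i Yfin' te.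
by rewrite -E1; exact: weak'.
Qed.

End limit.

Theorem solution_exists (m0 m1 : vmeasure R d n) (en : R) : vprob Omega m0 ->
  (forall e, 0 < e -> exists rho mu f (Y : K -> X -> R), [/\ solution rho mu f Y,
     vmeasure_eq (rho 0) m0, vmeasure_eq (rho 1) m1 & (energy mu f Y <= (en + e)%:E)%E]) ->
  exists rho mu f (Y : K -> X -> R), [/\ solution rho mu f Y,
     vmeasure_eq (rho 0) m0, vmeasure_eq (rho 1) m1 & (energy mu f Y <= en%:E)%E].
Proof.
move=> p0 H.
have k0 (k : nat) : 0 < k.+1%:R^-1 :> R by rewrite invr_gt0.
have /choice[rk H1] := fun k => H _ (k0 k).
have /choice[muk H2] := H1; have /choice[fk H3] := H2; have {H1 H2}/choice[Yk Hk] := H3.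
have [F [uF nF]] := ultraFilterLemma eventually_filter.
have Sk k : solution (rk k) (muk k) (fk k) (Yk k) by case: (Hk k).
have rk0 k : vmeasure_eq (rk k 0) m0 by case: (Hk k).
have rk1 k : vmeasure_eq (rk k 1) m1 by case: (Hk k).
have EA k : (energy (muk k) (fk k) (Yk k) <= (en + 1)%:E)%E.
  by case: (Hk k) => _ _ _ h; apply: (le_trans h); rewrite lee_fin lerD2l invf_le1// ler1n.
have enF e : 0 < e -> \forall k \near F, (energy (muk k) (fk k) (Yk k) <= (en + e)%:E)%E.
  move=> e0; apply: nF; near=> k; case: (Hk k) => _ _ _ h; apply: (le_trans h).
  rewrite lee_fin lerD2l -[e]invrK lef_pV2 ?posrE ?invr_gt0//.
  apply: (@le_trans _ _ k%:R); last by rewrite ler_nat.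
  by near: k; exact: nbhs_infty_ger.
have [rho rhoE] := limit_exists p0 Sk rk0 EA uF.
have cl := limit_curve p0 Sk rk0 EA uF rhoE.
have [f df] := curve_dens cO cl.
have smu := stmeas_cmu cO cl.
have [Y [S EY]] := limit_solution p0 Sk rk0 EA uF enF rhoE smu df.
have [e0 e1] := limit_ends rk0 uF rhoE rk1.
by exists rho, (cmu cO cl), f, Y.
Unshelve. all: by end_near. Qed.

End Existence.

(** * Gluing and reversal *)

Section AffineTime.
Context (R : realType).
Local Notation T := (measurableTypeR R).
Local Notation leb := (@lebesgue_measure R).
Local Notation I01 := ([set` `[(0 : R), 1]] : set T).

Lemma measurable_affine (a c : R) : measurable_fun setT (fun s : T => a + c * s : T).
Proof. by apply: measurable_funD => //; apply: measurable_funM. Qed.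

Section affine.
Variables (a c : R).
Hypothesis c0 : c != 0.
Let phi (s : T) : T := a + c * s.
Let cn : {nonneg R} := NngNum (normr_ge0 c).
Let nu : {measure set T -> \bar R} := mscale cn
  (measure_function_pushforward__canonical__measure_function_Measure leb (measurable_affine a c)).

(** The scaled push-forward [nu] has the right value on half-open intervals. For negative [c] the
    preimage is half-open at the opposite end, which does not change its length. *)
Lemma lebesgue_affine (A : set T) : measurable A ->
  leb A = (`|c|%:E * leb ((fun s : T => (a + c * s)%R) @^-1` A))%E.
Proof.
move=> mA; rewrite (@lebesgue_measure_unique R nu)// => _ [[x y] _ <-].
rewrite /nu /= /mscale /= /pushforward -/phi.
have [xy|yx] := leP y x.
  by rewrite set_itv_ge ?bnd_simp -?leNgt// preimage_set0 !measure0 mule0.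
have [cp|cm] := ltP 0 c.
  rewrite (_ : phi @^-1` _ = [set` `](x - a) / c, (y - a) / c]]).
    rewrite !lebesgue_measure_itv /= !lte_fin ltr_pM2r ?invr_gt0// ltrD2r yx gtr0_norm//.
    by rewrite -!EFinB -EFinM; congr EFin; field.
  apply/seteqP; split=> s /=; rewrite !in_itv /= /phi ltr_pdivrMr// ler_pdivlMr//;
    move=> /andP[h1 h2]; apply/andP; split; lra.
have {cm}cm : c < 0 by rewrite lt_neqAle c0.
rewrite (_ : phi @^-1` _ = [set` `[(y - a) / c, (x - a) / c[]).
  rewrite !lebesgue_measure_itv /= !lte_fin ltr_nM2r ?invr_lt0// ltrD2r yx ltr0_norm//.
  by rewrite -!EFinB -EFinM; congr EFin; field.
apply/seteqP; split=> s /=; rewrite !in_itv /= /phi ltr_ndivlMr// ler_ndivrMr//;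
  move=> /andP[h1 h2]; apply/andP; split; lra.
Qed.

Lemma integral_affine (D : set T) (F : T -> \bar R) : measurable D -> measurable_fun setT F ->
  (forall t, 0 <= F t)%E -> (\int[leb]_(t in D) F t =
    `|c|%:E * \int[leb]_(s in (fun s : T => (a + c * s)%R) @^-1` D) F (a + c * s)%R)%E.
Proof.
move=> mD mF F0.
transitivity (\int[nu]_(t in D) F t)%E.
  by apply: eq_measure_integral => A mA _; exact: (lebesgue_affine mA).
rewrite ge0_integral_mscale//; last exact: measurable_funTS.
rewrite ge0_integral_pushforward//.
  exact: measurable_affine.
exact: measurable_funTS.
Qed.

End affine.

Lemma itv_off_ends (F G : T -> \bar R) : (forall s, 0 < s -> s < 1 -> F s = G s) ->
  (\int[leb]_(t in I01) F t = \int[leb]_(t in I01) G t)%E.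
Proof.
move=> FG; have mN : measurable ([set 0; 1] : set T) by apply: measurableU.
have N0 : leb ([set 0; 1] : set T) = 0%E.
  by apply: null_set_setU => //; exact: lebesgue_measure_set1.
apply: (integral_off_null mN N0) => t; rewrite /= in_itv /= => /andP[t0 t1] Nt.
apply: FG; rewrite lt_neqAle ?t0 ?t1 andbT; apply/eqP => h; apply: Nt; [left|right] => //.
Qed.

Lemma time_reverse (F : T -> \bar R) : measurable_fun setT F -> (forall t, 0 <= F t)%E ->
  (\int[leb]_(t in I01) F t = \int[leb]_(t in I01) F (1 - t)%R)%E.
Proof.
move=> mF F0; have m01 : measurable I01 by exact: measurable_itv.
have c0 : (-1 : R) != 0 by rewrite oppr_eq0 oner_eq0.
rewrite (integral_affine 1 c0 m01 mF F0) normrN1 mul1e.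
rewrite (_ : _ @^-1` _ = I01); first by apply: eq_integral => s _; rewrite mulN1r.
apply/seteqP; split=> s /=; rewrite !in_itv /= => /andP[h1 h2]; apply/andP; split; lra.
Qed.

Lemma time_split (lam : R) (F : T -> \bar R) : 0 < lam -> lam < 1 ->
  measurable_fun setT F -> (forall t, 0 <= F t)%E ->
  (\int[leb]_(t in I01) F t = lam%:E * \int[leb]_(t in I01) F (lam * t)%R +
    (1 - lam)%:E * \int[leb]_(t in I01) F (lam + (1 - lam) * t)%R)%E.
Proof.
move=> l0 l1 mF F0; have m1 : 0 < 1 - lam by rewrite subr_gt0.
rewrite [X in (\int[_]_(t in X) F t)%E](_ : I01 = [set` `[0, lam]] `|` [set` `]lam, 1]]); last first.
  apply/seteqP; split=> s /=; rewrite !in_itv /=.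
    by move=> /andP[-> ->]; rewrite andbT; have [?|?] := leP s lam; [left|right].
  by move=> [/andP[h1 h2]|/andP[h1 h2]]; apply/andP; split; lra.
rewrite ge0_integral_setU//; last 2 first.
- exact: measurable_funTS.
- apply/disj_set2P/seteqP; split=> // s [] /=; rewrite !in_itv /= => /andP[_ h1] /andP[h2 _].
  by move: h2; rewrite ltNge h1.
congr (_ + _)%E.
  rewrite (integral_affine 0 (lt0r_neq0 l0) (measurable_itv _) mF F0) gtr0_norm//.
  congr (_ * _)%E.
  rewrite (_ : _ @^-1` _ = I01); first by apply: eq_integral => s _; rewrite add0r.
  apply/seteqP; split=> s /=; rewrite !in_itv /= add0r => /andP[h1 h2]; apply/andP; split; nra.
rewrite (integral_affine lam (lt0r_neq0 m1) (measurable_itv _) mF F0) gtr0_norm//.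
congr (_ * _)%E.
rewrite (_ : _ @^-1` _ = [set` `]0, 1]]); last first.
  apply/seteqP; split=> s /=; rewrite !in_itv /= => /andP[h1 h2]; apply/andP; split; nra.
rewrite [X in _ = (\int[_]_(t in X) _)%E](_ : ([set` `[0, 1]] : set T) = [set` `]0, 1]] `|` [set (0 : R)]); last first.
  apply/seteqP; split=> s /=; rewrite !in_itv /=.
    by rewrite le_eqVlt => /andP[/predU1P[<-|->] ->]; [right|left].
  by move=> [/andP[h1 h2]|->]; apply/andP; split; lra.
have mF' : measurable_fun setT (fun s : T => F (lam + (1 - lam) * s)).
  by apply: (measurableT_comp mF); exact: measurable_affine.
rewrite ge0_integral_setU//; last 2 first.
- exact: measurable_funTS.
- by apply/disj_set2P/seteqP; split=> // s [] /= /[swap] ->; rewrite in_itv /= ltxx.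
rewrite [X in (_ + X)%E]null_set_integral ?adde0//; first exact: measurable_funTS.
exact: lebesgue_measure_set1.
Qed.

End AffineTime.

Section Reparametrization.
Context (R : realType) (d n : nat).
Local Notation E := ('rV[R]_d).
Local Notation Rd := (euclid R d).
Local Notation T := (measurableTypeR R).
Local Notation X := (Rd * T)%type.
Local Notation ST := (E * R^o)%type.
Local Notation leb := (@lebesgue_measure R).
Local Notation I01 := ([set` `[(0 : R), 1]] : set T).
Variables (Omega : set Rd) (q : 'I_n -> 'I_n -> R) (theta : R -> R -> R).
Hypothesis cO : closed (Omega : set E).
Hypothesis q0 : forall i j, 0 <= q i j.
Hypothesis hI : interpolation theta.
Local Notation K := (field_index d n).
Local Notation solution := (solution Omega q theta).
Local Notation energy := (energy q theta).
Local Notation weight := (weight theta).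
Local Notation pairing := (pairing q theta).

(** Functions continuous on [Omega] are extended to the whole space, and the clamped curve replaces
    continuity relative to the interval by continuity on the line. *)
Lemma curve_vprobI (rho : R -> vmeasure R d n) : (forall t, I01 t -> vprob Omega (rho t)) ->
  (forall i (phi : E -> R), Cb phi ->
     continuous (fun t : R => \int[rho (clamp t) i]_x phi x)) ->
  curve_vprob Omega 0 1 rho.
Proof.
move=> pr co t It; split; first exact: pr.
move=> i phi cphi [M phiM].
have [Phi [CPhi PhiE]] := Cb_extension cO cphi phiM.
have E1 s : I01 s -> \int[rho s i]_(x in Omega) phi x = \int[rho (clamp s) i]_x Phi x.
  move=> Is; rewrite clampK//; have [h _] := pr _ Is.
  rewrite -(Rintegral_Omega cO _ (h i)); apply: eq_Rintegral => x; rewrite inE => Ox.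
  by rewrite PhiE.
rewrite (E1 t It); have := @cvg_within_filter _ _ _ _ (nbhs_filter t) _ I01 (co i Phi CPhi t).
apply: cvg_trans.
by apply: near_eq_cvg; near=> s; rewrite E1//; near: s; exact: withinT.
Unshelve. all: by end_near. Qed.

Lemma slice_integral_measurable (rho : R -> vmeasure R d n) (h : X -> \bar R) :
  curve_vprob Omega 0 1 rho -> (forall p, 0 <= h p)%E -> measurable_fun setT h ->
  measurable_fun setT (fun t : T => \int[mbar (rho (clamp t))]_x h (x, t))%E.
Proof.
by move=> cr h0 mh; exact: (measurable_slice_integral (mbar_measurable cO cr) (ckernel_le1 cO cr)).
Qed.

(* [g] and [h] need to agree only for [0 < s < 1], the endpoints being null. *)
Definition reparam (a c : R) V (g : X -> V) (h : X -> V) :=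
  forall x s, 0 < s -> s < 1 -> g (x, a + c * s) = h (x, s).

Lemma dtest_affine i a (eta : ST -> R^o) (c e : R) p :
  dtest q i a (fun q => eta (affine_ST 1 c e q)) p = dtest q i a eta (affine_ST 1 c e p).
Proof.
case: a => -[i' k]; last by [].
rewrite /dtest derive_affine_ST.
by rewrite (_ : affine_ST 1 c 0 (delta_mx 0 k, 0) = (delta_mx 0 k, 0))// /affine_ST /= scale1r mulr0 addr0.
Qed.

(** Slowing time by [c] multiplies both the time derivative of the test function and the velocities
    by [c], so the whole pairing scales by [c]. *)
Lemma pairing_reparam (f f' : 'I_n -> X -> R) (Y Y' : K -> X -> R) eta i a c x s : smooth eta ->
  (forall i, f i (x, a + c * s) = f' i (x, s)) ->
  (forall b, c * Y b (x, a + c * s) = Y' b (x, s)) ->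
  c * pairing f Y eta i (x, a + c * s) =
  pairing f' Y' (fun p => eta (affine_ST 1 c a p)) i (x, s).
Proof.
move=> se fE YE; have pE : affine_ST 1 c a (x, s) = (x, a + c * s) :> ST.
  by rewrite /affine_ST /= scale1r addrC.
have wE b : weight f b (x, a + c * s) = weight f' b (x, s).
  by case: b => -[? ?] /=; rewrite !fE.
rewrite /pairing mulrDr mulr_sumr fE; congr (_ + _).
  rewrite /time_derivative derive_affine_ST pE.
  have -> : affine_ST 1 c 0 ((0, 1) : ST) = c *: ((0, 1) : ST).
    by rewrite /affine_ST; congr pair; rewrite /= ?scaler0// addr0 /GRing.scale.
  by rewrite deriveZdir// mulrA.
apply: eq_bigr => b _; rewrite dtest_affine pE wE -YE; ring.
Qed.

Lemma weight_reparam (f f' : 'I_n -> X -> R) b a c x s :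
  (forall i, f i (x, a + c * s) = f' i (x, s)) ->
  weight f b (x, a + c * s) = weight f' b (x, s).
Proof. by move=> fE; case: b => -[? ?] /=; rewrite !fE. Qed.

Lemma dens_reparam (rho rho' : R -> vmeasure R d n) f f' (a c : R) : c != 0 -> dens rho' f' ->
  (forall s, 0 < s -> s < 1 -> rho (a + c * s) = rho' s) -> (forall i, reparam a c (f i) (f' i)) ->
  exists N : set T, [/\ measurable N, leb N = 0%E &
    forall t, 0 < (t - a) / c -> (t - a) / c < 1 -> ~ N t -> good_time rho f t].
Proof.
move=> c0 [_ _ [N [mN N0 gN]]] rE fE.
pose M : set T := (fun t => - a / c + c^-1 * t) @^-1` N.
have mM : measurable M by rewrite -[M]setTI; exact: measurable_affine.
have ci0 : c^-1 != 0 by rewrite invr_eq0.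
exists M; split=> //.
  have := lebesgue_affine (- a / c) ci0 mN; rewrite N0 => /esym/eqP.
  by rewrite mule_eq0 eqe normr_eq0 (negbTE ci0) => /eqP.
move=> t s0 s1 Mt i A mA; set s := (t - a) / c in s0 s1.
have tE : t = a + c * s by rewrite /s; field.
have Is : I01 s by rewrite /= in_itv /= !ltW.
have Ns : ~ N s by move: Mt; rewrite /M /= (_ : - a / c + c^-1 * t = s)// /s; field.
rewrite tE rE// (gN s Is Ns i A mA); apply: eq_integral => x _.
by rewrite fE.
Qed.

Lemma pairing_window_integral rho mu f (Y : K -> X -> R) eta i : solution rho mu f Y -> tfun eta ->
  let h := fun p : X => \1_(`]0, 1[%classic : set R) p.2 * pairing f Y eta i p in
  mu.-integrable setT (EFin \o h) /\ \int[mu]_p h p = \int[rho 1 i]_x eta (x, 1) - \int[rho 0 i]_x eta (x, 0).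
Proof.
move=> S te h; split; last by rewrite (solution_boundary cO q0 hI S i te (lexx 0) ltr01 (lexx 1)).
have [cr smu df mY Y0 Yfin weak] := S.
have [_ iP _] := pairing_integral q0 hI df mY Y0 i Yfin te.
have [/measurable_EFinP mP _] := integrableP _ _ _ iP.
apply: (le_integrable _ _ iP).
  apply: measurable_funM => //.
  have m1 : measurable_fun setT (\1_(`]0, 1[%classic : set R) : T -> R).
    by apply: measurable_indic; exact: measurable_itv.
  exact: (measurableT_comp m1 measurable_snd).
move=> p; rewrite normrM indicE; case: (_ \in _); rewrite ?normr1 ?mul1r//.
by rewrite normr0 mul0r.
Qed.

End Reparametrization.

(** * Gluing two curves at an intermediate time *)

Section Glue.
Context (R : realType) (d n : nat).
Local Notation E := ('rV[R]_d).
Local Notation Rd := (euclid R d).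
Local Notation T := (measurableTypeR R).
Local Notation X := (Rd * T)%type.
Local Notation ST := (E * R^o)%type.
Local Notation leb := (@lebesgue_measure R).
Local Notation I01 := ([set` `[(0 : R), 1]] : set T).
Variables (Omega : set Rd) (q : 'I_n -> 'I_n -> R) (theta : R -> R -> R).
Hypothesis cO : closed (Omega : set E).
Hypothesis q0 : forall i j, 0 <= q i j.
Hypothesis hI : interpolation theta.
Local Notation K := (field_index d n).
Local Notation solution := (solution Omega q theta).
Local Notation energy := (energy q theta).
Local Notation weight := (weight theta).
Local Notation pairing := (pairing q theta).

Variable lam : R.
Hypothesis l0 : 0 < lam.
Hypothesis l1 : lam < 1.
Let m0 : 0 < 1 - lam. Proof. by rewrite subr_gt0. Qed.

Definition glue V (g1 g2 : R -> V) (t : R) : V :=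
  if t <= lam then g1 (t / lam) else g2 ((t - lam) / (1 - lam)).

Lemma glueL V (g1 g2 : R -> V) s : s < 1 -> glue g1 g2 (0 + lam * s) = g1 s.
Proof.
move=> s1; rewrite /glue add0r ifT; last by rewrite -[leRHS]mulr1 ler_pM2l// ltW.
by congr g1; field; exact: lt0r_neq0.
Qed.

Lemma glueR V (g1 g2 : R -> V) s : 0 < s -> glue g1 g2 (lam + (1 - lam) * s) = g2 s.
Proof.
move=> s0; rewrite /glue ifF; last by apply/negbTE; rewrite -ltNge ltrDl mulr_gt0.
by congr g2; field; exact: lt0r_neq0.
Qed.

Lemma measurable_glue dd (Z : measurableType dd) (g1 g2 : X -> Z) :
  measurable_fun setT g1 -> measurable_fun setT g2 ->
  measurable_fun setT (fun p : X => glue (fun s => g1 (p.1, s)) (fun s => g2 (p.1, s)) p.2).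
Proof.
move=> mg1 mg2; rewrite /glue.
have mA (a c : R) : measurable_fun setT (fun p : X => (p.1, a + c * p.2) : X).
  apply: measurable_fun_pair; first exact: measurable_fst.
  by apply: (measurableT_comp (measurable_affine a c)); exact: measurable_snd.
apply: measurable_fun_ifT.
- apply: (measurable_fun_ler (f := fun p : X => p.2) (g := cst lam)) => //; exact: measurable_snd.
- rewrite (_ : (fun _ => _) = g1 \o (fun p : X => (p.1, 0 + lam^-1 * p.2) : X)).
    exact: (measurableT_comp mg1 (mA _ _)).
  by apply/funext => p /=; rewrite add0r mulrC.
- rewrite (_ : (fun _ => _) = g2 \o (fun p : X => (p.1, - lam / (1 - lam) + (1 - lam)^-1 * p.2) : X)).
    exact: (measurableT_comp mg2 (mA _ _)).
  by apply/funext => p /=; congr (g2 (_, _)); field; exact: lt0r_neq0.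
Qed.

Variables (rho1 rho2 : R -> vmeasure R d n) (mu1 mu2 : {finite_measure set X -> \bar R}).
Variables (f1 f2 : 'I_n -> X -> R) (Y1 Y2 : K -> X -> R).
Hypothesis S1 : solution rho1 mu1 f1 Y1.
Hypothesis S2 : solution rho2 mu2 f2 Y2.
Hypothesis r12 : vmeasure_eq (rho1 1) (rho2 0).

Let rho := glue rho1 rho2.
Let f i (p : X) := glue (fun s => f1 i (p.1, s)) (fun s => f2 i (p.1, s)) p.2.
Let Y a (p : X) := glue (fun s => lam^-1 * Y1 a (p.1, s)) (fun s => (1 - lam)^-1 * Y2 a (p.1, s)) p.2.

Let glue_curve : curve_vprob Omega 0 1 rho.
Proof.
have c1 := sol_curve S1; have c2 := sol_curve S2.
apply: (curve_vprobI cO) => [t|i phi Cphi].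
  rewrite /= in_itv /= => /andP[t0 t1]; rewrite /rho /glue; case: (leP t lam) => tl.
    by apply: (proj1 (c1 _ _)); rewrite in_itv /= divr_ge0 ?(ltW l0)//= ler_pdivrMr// mul1r.
  apply: (proj1 (c2 _ _)); rewrite in_itv /= divr_ge0 ?subr_ge0 ?(ltW l1) ?(ltW tl)//=.
  by rewrite ler_pdivrMr// mul1r lerD2r.
pose F1 t := \int[rho1 (clamp t) i]_x phi x; pose F2 t := \int[rho2 (clamp t) i]_x phi x.
have k1 : continuous F1 by move=> t; exact: (curve_clamp_cvg cO c1).
have k2 : continuous F2 by move=> t; exact: (curve_clamp_cvg cO c2).
have F12 : F1 1 = F2 0.
  rewrite /F1 /F2 !clampK /= ?in_itv /= ?lexx ?ler01// /Rintegral; congr fine.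
  by apply: eq_measure_integral => A mA _; exact: r12.
have clamp_hi (t : R) : 1 <= t -> clamp t = 1.
  by move=> h; rewrite /clamp min_r// max_r.
have clamp_lo (t : R) : t <= 0 -> clamp t = 0.
  by move=> h; rewrite /clamp max_l// ge_min h.
have kc (F : R -> R) (a b : R) : continuous F -> continuous (fun t => F ((clamp t - a) / b)).
  move=> kF t; apply: continuous_comp; last exact: kF.
  by apply: cvgM; [apply: cvgB; [exact: clamp_continuous|exact: cvg_cst]|exact: cvg_cst].
(* Clamping freezes [F1] and [F2] at their end values, so at every time one of the two summands
   equals the common value [F1 1 = F2 0] and cancels against the last term. *)
rewrite (_ : (fun _ => _) = fun t => F1 ((clamp t - 0) / lam) + F2 ((clamp t - lam) / (1 - lam)) - F1 1).
  by move=> t; apply: cvgB; [apply: cvgD; [exact: kc k1 t|exact: kc k2 t]|exact: cvg_cst].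
apply/funext => t; rewrite subr0; have := clamp_I01 t; rewrite in_itv /= => /andP[t0 t1].
rewrite /rho /glue; case: (leP (clamp t) lam) => tl.
  rewrite (_ : F2 _ = F1 1) ?addrK; last first.
    have z : (clamp t - lam) / (1 - lam) <= 0 by rewrite pmulr_lle0 ?invr_gt0// subr_le0.
    by rewrite F12 /F2 (clamp_lo _ z) (clamp_lo 0).
  rewrite /F1 [clamp (clamp t / lam)]clampK// /= in_itv /= divr_ge0 ?(ltW l0)//=.
  by rewrite ler_pdivrMr// mul1r.
rewrite (_ : F1 (clamp t / lam) = F1 1); last first.
  have z : 1 <= clamp t / lam by rewrite ler_pdivlMr// mul1r ltW.
  by rewrite /F1 (clamp_hi _ z) (clamp_hi 1).
rewrite addrAC subrr add0r /F2 [clamp (_ / _)]clampK// /= in_itv /= divr_ge0 ?subr_ge0 ?(ltW l1) ?(ltW tl)//=.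
by rewrite ler_pdivrMr// mul1r lerD2r.
Qed.

Let mu := cmu cO glue_curve.
Let smu : stmeas rho mu := stmeas_cmu cO glue_curve.

Lemma glue_integral (h h1 h2 : X -> \bar R) :
  (forall p, 0 <= h p)%E -> (forall p, 0 <= h1 p)%E -> (forall p, 0 <= h2 p)%E ->
  measurable_fun setT h -> measurable_fun setT h1 -> measurable_fun setT h2 ->
  reparam 0 lam h h1 -> reparam lam (1 - lam) h h2 ->
  (\int[mu]_p h p = lam%:E * \int[mu1]_p h1 p + (1 - lam)%:E * \int[mu2]_p h2 p)%E.
Proof.
move=> h0 h10 h20 mh mh1 mh2 e1 e2.
rewrite (smu h0 mh) (sol_stmeas S1 h10 mh1) (sol_stmeas S2 h20 mh2).
have mH := slice_integral_measurable cO glue_curve h0 mh.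
have H0 t : (0 <= \int[mbar (rho (clamp t))]_x h (x, t))%E by apply: integral_ge0.
transitivity (\int[leb]_(t in I01) \int[mbar (rho (clamp t))]_x h (x, t))%E.
  by apply: itv_off_ends => s s0 s1; rewrite clampK//= in_itv /= !ltW.
rewrite (time_split l0 l1 mH H0).
have -> : (\int[leb]_(t in I01) \int[mbar (rho (clamp (lam * t)))]_x h (x, (lam * t)%R) =
    \int[leb]_(t in I01) \int[mbar (rho1 t)]_x h1 (x, t))%E.
  apply: itv_off_ends => s s0 s1.
  rewrite clampK; last by rewrite /= in_itv /= mulr_ge0 ?(ltW l0) ?(ltW s0)//= mulr_ile1// ltW.
  have -> : rho (lam * s) = rho1 s by rewrite /rho -{1}[lam * s]add0r glueL.
  by apply: eq_integral => x _; rewrite -e1// add0r.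
have -> // : (\int[leb]_(t in I01) \int[mbar (rho (clamp (lam + (1 - lam) * t)))]_x h (x, (lam + (1 - lam) * t)%R) =
    \int[leb]_(t in I01) \int[mbar (rho2 t)]_x h2 (x, t))%E.
apply: itv_off_ends => s s0 s1.
rewrite clampK; last first.
  rewrite /= in_itv /=; have := mulr_gt0 m0 s0; have : (1 - lam) * s < 1 - lam by rewrite gtr_pMr.
  by move=> u1 u2; rewrite addr_ge0 ?(ltW l0) ?(ltW u2)//= -lerBrDl ltW.
by rewrite /rho glueR//; apply: eq_integral => x _; rewrite -e2.
Qed.

Lemma glue_Rintegral (h h1 h2 : X -> R) :
  mu.-integrable setT (EFin \o h) -> mu1.-integrable setT (EFin \o h1) ->
  mu2.-integrable setT (EFin \o h2) -> reparam 0 lam h h1 -> reparam lam (1 - lam) h h2 ->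
  \int[mu]_p h p = lam * \int[mu1]_p h1 p + (1 - lam) * \int[mu2]_p h2 p.
Proof.
move=> ih ih1 ih2 e1 e2.
have [[mh _] [mh1 _] [mh2 _]] : [/\ measurable_fun setT (EFin \o h) /\ True,
    measurable_fun setT (EFin \o h1) /\ True & measurable_fun setT (EFin \o h2) /\ True].
  by split; split=> //; [have /integrableP[] := ih|have /integrableP[] := ih1|have /integrableP[] := ih2].
have pE := glue_integral (h := (EFin \o h)^\+%E) (h1 := (EFin \o h1)^\+%E) (h2 := (EFin \o h2)^\+%E)
  (funepos_ge0 _) (funepos_ge0 _) (funepos_ge0 _) (measurable_funepos mh)
  (measurable_funepos mh1) (measurable_funepos mh2).
have nE := glue_integral (h := (EFin \o h)^\-%E) (h1 := (EFin \o h1)^\-%E) (h2 := (EFin \o h2)^\-%E)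
  (funeneg_ge0 _) (funeneg_ge0 _) (funeneg_ge0 _) (measurable_funeneg mh)
  (measurable_funeneg mh1) (measurable_funeneg mh2).
rewrite /Rintegral integralE (integralE mu1) (integralE mu2) pE; last 2 first.
- by move=> x s s0 s1; rewrite !funeposE /= (e1 _ _ s0 s1).
- by move=> x s s0 s1; rewrite !funeposE /= (e2 _ _ s0 s1).
rewrite nE; last 2 first.
- by move=> x s s0 s1; rewrite !funenegE /= (e1 _ _ s0 s1).
- by move=> x s s0 s1; rewrite !funenegE /= (e2 _ _ s0 s1).
have := integrable_pos_fin_num measurableT ih1; have := integrable_neg_fin_num measurableT ih1.
have := integrable_pos_fin_num measurableT ih2; have := integrable_neg_fin_num measurableT ih2.
move=> /fineK<- /fineK<- /fineK<- /fineK<-.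
by rewrite /=; ring.
Qed.

Let glue_dens : dens rho f.
Proof.
have D1 := sol_dens S1; have D2 := sol_dens S2.
have [mf1 f11 _] := D1; have [mf2 f21 _] := D2.
split=> [i|i p|].
- by apply: measurable_glue; [exact: mf1|exact: mf2].
- by rewrite /f /glue; case: ifP => _; [exact: f11|exact: f21].
have [N1 [mN1 N10 H1]] := @dens_reparam _ _ _ rho _ f _ 0 lam (lt0r_neq0 l0) D1
  (fun s s0 s1 => glueL _ _ s1) (fun i x s s0 s1 => glueL _ _ s1).
have [N2 [mN2 N20 H2]] := @dens_reparam _ _ _ rho _ f _ lam (1 - lam) (lt0r_neq0 m0) D2
  (fun s s0 s1 => glueR _ _ s0) (fun i x s s0 s1 => glueR _ _ s0).
have mE : measurable ([set 0; lam; 1] : set T) by apply: measurableU => //; apply: measurableU.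
have E0 : leb ([set 0; lam; 1] : set T) = 0%E.
  apply: null_set_setU => //; first (by apply: measurableU); last exact: lebesgue_measure_set1.
  by apply: null_set_setU => //; exact: lebesgue_measure_set1.
exists ((N1 `|` N2) `|` [set 0; lam; 1]); split.
- by apply: measurableU => //; exact: measurableU.
- by apply: null_set_setU => //; [exact: measurableU|exact: null_set_setU].
move=> t; rewrite /= in_itv /= => /andP[t0 t1] Nt.
have t00 : 0 < t by rewrite lt_neqAle t0 andbT; apply/eqP => h; apply: Nt; right; left; left.
have t11 : t < 1 by rewrite lt_neqAle t1 andbT; apply/eqP => h; apply: Nt; right; right.
have tl : t != lam by apply/eqP => h; apply: Nt; right; left; right.
have [tl1|tl1|/eqP] := ltgtP t lam; last by rewrite (negbTE tl).
  by apply: H1; [rewrite subr0 divr_gt0|rewrite subr0 ltr_pdivrMr// mul1r|move=> h; apply: Nt; left; left].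
apply: H2; [by rewrite divr_gt0// subr_gt0| |by move=> h; apply: Nt; left; right].
by rewrite ltr_pdivrMr// mul1r ltrD2r.
Qed.

(** A curve run in time [lam] has its velocities multiplied by [lam^-1] and its duration by [lam],
    hence its action by [lam^-1]. The weak equation on each piece leaves boundary values only. *)
Lemma glue_exists (A1 A2 : R) : (energy mu1 f1 Y1 <= A1%:E)%E -> (energy mu2 f2 Y2 <= A2%:E)%E ->
  exists rho mu f (Y : K -> X -> R), [/\ solution rho mu f Y, vmeasure_eq (rho 0) (rho1 0),
    vmeasure_eq (rho 1) (rho2 1) & (energy mu f Y <= (A1 / lam + A2 / (1 - lam))%:E)%E].
Proof.
move=> EA1 EA2.
have [mf f01 _] := glue_dens.
have [mf1 f11 _] := sol_dens S1; have [mf2 f21 _] := sol_dens S2.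
have fE1 i : reparam 0 lam (f i) (f1 i) by move=> x s _ s1; exact: (glueL _ _ s1).
have fE2 i : reparam lam (1 - lam) (f i) (f2 i) by move=> x s s0 _; exact: (glueR _ _ s0).
have YE1 a : reparam 0 lam (Y a) (fun p => lam^-1 * Y1 a p) by move=> x s _ s1; exact: (glueL _ _ s1).
have YE2 a : reparam lam (1 - lam) (Y a) (fun p => (1 - lam)^-1 * Y2 a p).
  by move=> x s s0 _; exact: (glueR _ _ s0).
have mY a : measurable_fun setT (Y a).
  by apply: (measurable_glue (g1 := fun p => lam^-1 * Y1 a p) (g2 := fun p => (1 - lam)^-1 * Y2 a p));
    apply: measurable_funM => //; [exact: (sol_measurable S1)|exact: (sol_measurable S2)].
have Y0 a : price q a = 0 -> forall p, Y a p = 0.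
  move=> pa p; rewrite /Y /glue (sol_price0 S1 pa) (sol_price0 S2 pa) !mulr0.
  by case: ifP.
have en_term (g : 'I_n -> X -> R) (Z : K -> X -> R) a (mg : forall i, measurable_fun setT (g i))
    (g01 : forall i p, 0 <= g i p <= 1) (mZ : measurable_fun setT (Z a)) :
    (forall p, 0 <= (price q a * (Z a p ^+ 2 * weight g a p))%:E)%E /\
    measurable_fun setT (fun p => (price q a * (Z a p ^+ 2 * weight g a p))%:E).
  by split=> [p|]; [rewrite lee_fin (summand_ge0 q0 hI)|exact: (summand_measurable q hI)].
have Een : (energy mu f Y <= (A1 / lam + A2 / (1 - lam))%:E)%E.
  have -> : (energy mu f Y = (lam^-1)%:E * energy mu1 f1 Y1 + ((1 - lam)^-1)%:E * energy mu2 f2 Y2)%E.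
    rewrite /energy !ge0_sume_distrr; last 2 first.
    - by move=> a _; apply: integral_ge0 => p _; case: (en_term f2 Y2 a mf2 f21 (sol_measurable S2 a)).
    - by move=> a _; apply: integral_ge0 => p _; case: (en_term f1 Y1 a mf1 f11 (sol_measurable S1 a)).
    rewrite -big_split /=; apply: eq_bigr => a _.
    have [p0 mp] := en_term f Y a mf f01 (mY a).
    have [p10 mp1] := en_term f1 Y1 a mf1 f11 (sol_measurable S1 a).
    have [p20 mp2] := en_term f2 Y2 a mf2 f21 (sol_measurable S2 a).
    pose h1 (p : X) := ((lam^-1 ^+ 2)%:E * (price q a * (Y1 a p ^+ 2 * weight f1 a p))%:E)%E.
    pose h2 (p : X) := (((1 - lam)^-1 ^+ 2)%:E * (price q a * (Y2 a p ^+ 2 * weight f2 a p))%:E)%E.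
    rewrite (glue_integral (h1 := h1) (h2 := h2)) => //; first last.
    - move=> x s s0 s1; rewrite /h2 -EFinM; congr EFin.
      rewrite (YE2 a x s s0 s1) (weight_reparam _ _ (fun i => fE2 i x s s0 s1)); ring.
    - move=> x s s0 s1; rewrite /h1 -EFinM; congr EFin.
      rewrite (YE1 a x s s0 s1) (weight_reparam _ _ (fun i => fE1 i x s s0 s1)); ring.
    - exact: measurable_funeM.
    - exact: measurable_funeM.
    - by move=> p; apply: mule_ge0 => //; rewrite lee_fin sqr_ge0.
    - by move=> p; apply: mule_ge0 => //; rewrite lee_fin sqr_ge0.
    rewrite /h1 /h2 !ge0_integralZl ?lee_fin ?sqr_ge0// !muleA -!EFinM.
    by congr (_%:E * _ + _%:E * _)%E; field; exact: lt0r_neq0.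
  rewrite EFinD; apply: leeD; rewrite mulrC EFinM lee_pmul2l ?lte_fin ?invr_gt0//.
have Efin : (energy mu f Y < +oo)%E by apply: (le_lt_trans Een); rewrite ltry.
exists rho, mu, f, Y; split=> //.
- split; [exact: glue_curve|exact: smu|exact: glue_dens|exact: mY|exact: Y0|exact: Efin|].
  move=> eta te i; have tf := test_function_tfun te.
  have [_ iP _] := pairing_integral q0 hI glue_dens mY Y0 i Efin tf.
  pose e1 p := eta (affine_ST 1 lam 0 p); pose e2 p := eta (affine_ST 1 (1 - lam) lam p).
  have t1 : tfun e1 by apply: tfun_affine_ST => //; exact: lt0r_neq0.
  have t2 : tfun e2 by apply: tfun_affine_ST => //; exact: lt0r_neq0.
  have [i1 E1] := pairing_window_integral cO q0 hI i S1 t1.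
  have [i2 E2] := pairing_window_integral cO q0 hI i S2 t2.
  pose h1 (p : X) := lam^-1 * (\1_(`]0, 1[%classic : set R) p.2 * pairing f1 Y1 e1 i p).
  pose h2 (p : X) := (1 - lam)^-1 * (\1_(`]0, 1[%classic : set R) p.2 * pairing f2 Y2 e2 i p).
  have in1 s : 0 < s -> s < 1 -> \1_(`]0, 1[%classic : set R) s = 1 :> R.
    by move=> s0 s1; rewrite indicE mem_set//= in_itv /= s0 s1.
  rewrite (glue_Rintegral (h1 := h1) (h2 := h2)) => //; first last.
  - move=> x s s0 s1; rewrite /h2 /= in1// mul1r.
    rewrite -(pairing_reparam q theta (f := f) (Y := Y) _ (tfun_smooth tf) (fun i => fE2 i x s s0 s1)); last first.
      by move=> b; rewrite (YE2 b x s s0 s1); field; exact: lt0r_neq0.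
    by field; exact: lt0r_neq0.
  - move=> x s s0 s1; rewrite /h1 /= in1// mul1r.
    rewrite -(pairing_reparam q theta (f := f) (Y := Y) _ (tfun_smooth tf) (fun i => fE1 i x s s0 s1)); last first.
      by move=> b; rewrite (YE1 b x s s0 s1); field; exact: lt0r_neq0.
    by field; exact: lt0r_neq0.
  - by have := integrableZl measurableT (1 - lam)^-1 i2; exact: eq_integrable.
  - by have := integrableZl measurableT lam^-1 i1; exact: eq_integrable.
  rewrite /h1 /h2 !RintegralZl// E1 E2 !mulrA !mulfV ?lt0r_neq0// !mul1r.
  have aE c e (x : E) s : affine_ST 1 c e ((x, s) : ST) = (x, c * s + e) by rewrite /affine_ST /= scale1r.
  have z0 (m : {finite_measure set Rd -> \bar R}) (s : R) : ~ (0 < s < 1) -> \int[m]_x eta (x, s) = 0.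
    by move=> hs; apply: Rintegral_eq0 => x; exact: (test_function_eq0 te).
  rewrite /e1 /e2.
  have -> : \int[rho1 0 i]_x eta (affine_ST 1 lam 0 (x, 0)) = 0.
    by under eq_Rintegral do rewrite aE; apply: z0; rewrite mulr0 addr0 ltxx.
  have -> : \int[rho2 1 i]_x eta (affine_ST 1 (1 - lam) lam (x, 1)) = 0.
    by under eq_Rintegral do rewrite aE; apply: z0; rewrite mulr1 subrK ltxx andbF.
  (* The test function vanishes at the two outer ends; at the junction the boundary values of the
     two pieces cancel. *)
  have -> : \int[rho1 1 i]_x eta (affine_ST 1 lam 0 (x, 1)) = \int[rho2 0 i]_x eta (affine_ST 1 (1 - lam) lam (x, 0)).
    under eq_Rintegral do rewrite aE mulr1 addr0.
    under [RHS]eq_Rintegral do rewrite aE mulr0 add0r.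
    by rewrite /Rintegral; congr fine; apply: eq_measure_integral => A mA _; exact: r12.
  by rewrite subr0 add0r subrr.
- by move=> j A mA; rewrite /rho /glue (ltW l0) mul0r.
- by move=> j A mA; rewrite /rho /glue leNgt l1 /= divff// lt0r_neq0.
Qed.

End Glue.

(** * Time reversal *)

Section Reverse.
Context (R : realType) (d n : nat).
Local Notation E := ('rV[R]_d).
Local Notation Rd := (euclid R d).
Local Notation T := (measurableTypeR R).
Local Notation X := (Rd * T)%type.
Local Notation ST := (E * R^o)%type.
Local Notation leb := (@lebesgue_measure R).
Local Notation I01 := ([set` `[(0 : R), 1]] : set T).
Variables (Omega : set Rd) (q : 'I_n -> 'I_n -> R) (theta : R -> R -> R).
Hypothesis cO : closed (Omega : set E).
Hypothesis q0 : forall i j, 0 <= q i j.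
Hypothesis hI : interpolation theta.
Local Notation K := (field_index d n).
Local Notation solution := (solution Omega q theta).
Local Notation energy := (energy q theta).
Local Notation weight := (weight theta).
Local Notation pairing := (pairing q theta).

Variables (rho1 : R -> vmeasure R d n) (mu1 : {finite_measure set X -> \bar R}).
Variables (f1 : 'I_n -> X -> R) (Y1 : K -> X -> R).
Hypothesis S1 : solution rho1 mu1 f1 Y1.

Let rho t := rho1 (1 - t).
Let f i (p : X) := f1 i (p.1, 1 - p.2).
Let Y a (p : X) := - Y1 a (p.1, 1 - p.2).

Let rev_itv t : I01 t -> I01 (1 - t).
Proof. by rewrite /= !in_itv /= => /andP[? ?]; apply/andP; split; lra. Qed.

Let reverse_curve : curve_vprob Omega 0 1 rho.
Proof.
have c1 := sol_curve S1.
apply: (curve_vprobI cO) => [t It|i phi Cphi]; first exact: (proj1 (c1 _ (rev_itv It))).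
rewrite (_ : (fun _ => _) = (fun t => \int[rho1 (clamp t) i]_x phi x) \o (fun t => 1 - clamp t)).
  move=> t; apply: continuous_comp; last exact: (curve_clamp_cvg cO c1).
  by apply: cvgB; [exact: cvg_cst|exact: clamp_continuous].
apply/funext => t /=; rewrite [clamp (1 - _)]clampK//.
exact: (rev_itv (clamp_I01 t)).
Qed.

Let mu := cmu cO reverse_curve.
Let smu : stmeas rho mu := stmeas_cmu cO reverse_curve.

Lemma reverse_integral (h h1 : X -> \bar R) :
  (forall p, 0 <= h p)%E -> (forall p, 0 <= h1 p)%E ->
  measurable_fun setT h -> measurable_fun setT h1 -> reparam 1 (-1) h h1 ->
  (\int[mu]_p h p = \int[mu1]_p h1 p)%E.
Proof.
move=> h0 h10 mh mh1 e1.
rewrite (smu h0 mh) (sol_stmeas S1 h10 mh1).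
have mH := slice_integral_measurable cO reverse_curve h0 mh.
have H0 t : (0 <= \int[mbar (rho (clamp t))]_x h (x, t))%E by apply: integral_ge0.
transitivity (\int[leb]_(t in I01) \int[mbar (rho (clamp t))]_x h (x, t))%E.
  by apply: itv_off_ends => s s0 s1; rewrite clampK//= in_itv /= !ltW.
rewrite (time_reverse mH H0); apply: itv_off_ends => s s0 s1.
rewrite clampK; last by rewrite /= in_itv /=; apply/andP; split; lra.
by rewrite /rho subKr; apply: eq_integral => x _; rewrite -e1// mulN1r.
Qed.

Lemma reverse_Rintegral (h h1 : X -> R) :
  mu.-integrable setT (EFin \o h) -> mu1.-integrable setT (EFin \o h1) ->
  reparam 1 (-1) h h1 -> \int[mu]_p h p = \int[mu1]_p h1 p.
Proof.
move=> /integrableP[mh _] /integrableP[mh1 _] e1.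
rewrite /Rintegral integralE (integralE mu1); congr (fine (_ - _)%E).
  apply: reverse_integral => //; [exact: measurable_funepos|exact: measurable_funepos|].
  by move=> x s s0 s1; rewrite !funeposE /= (e1 _ _ s0 s1).
apply: reverse_integral => //; [exact: measurable_funeneg|exact: measurable_funeneg|].
by move=> x s s0 s1; rewrite !funenegE /= (e1 _ _ s0 s1).
Qed.

Let c0 : (-1 : R) != 0. Proof. by rewrite oppr_eq0 oner_eq0. Qed.
Let rK (s : R) : 1 - (1 + -1 * s) = s. Proof. ring. Qed.

Let mrev : measurable_fun setT (fun p : X => (p.1, 1 - p.2) : X).
Proof.
apply: measurable_fun_pair; first exact: measurable_fst.
have m1 := measurableT_comp (@measurable_affine R 1 (-1)) (@measurable_snd _ _ Rd T).
by apply: eq_measurable_fun m1 => p _; rewrite /= mulN1r.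
Qed.

Let reverse_dens : dens rho f.
Proof.
have D1 := sol_dens S1; have [mf1 f11 _] := D1.
split=> [i|i p|]; [exact: (measurableT_comp (mf1 i) mrev)|exact: f11|].
have [N [mN N0 H]] := @dens_reparam _ _ _ rho _ f _ 1 (-1) c0 D1
  (fun s _ _ => congr1 rho1 (rK s)) (fun i x s _ _ => congr1 (fun r => f1 i (x, r)) (rK s)).
have mE : measurable ([set 0; 1] : set T) by apply: measurableU.
have E0 : leb ([set 0; 1] : set T) = 0%E.
  by apply: null_set_setU => //; exact: lebesgue_measure_set1.
exists (N `|` [set 0; 1]); split; [exact: measurableU|exact: null_set_setU|].
move=> t; rewrite /= in_itv /= => /andP[t0 t1] Nt.
have t00 : 0 < t by rewrite lt_neqAle t0 andbT; apply/eqP => h; apply: Nt; right; left.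
have t11 : t < 1 by rewrite lt_neqAle t1 andbT; apply/eqP => h; apply: Nt; right; right.
by apply: H; [rewrite invrN1 mulrN1; lra|rewrite invrN1 mulrN1; lra|move=> h; apply: Nt; left].
Qed.

(** Reversal changes the sign of the time derivative, so negating the velocities negates the whole
    pairing, while the squares in the action are unchanged. *)
Lemma reverse_exists (A1 : R) : (energy mu1 f1 Y1 <= A1%:E)%E ->
  exists rho mu f (Y : K -> X -> R), [/\ solution rho mu f Y, vmeasure_eq (rho 0) (rho1 1),
    vmeasure_eq (rho 1) (rho1 0) & (energy mu f Y <= A1%:E)%E].
Proof.
move=> EA1.
have [mf f01 _] := reverse_dens.
have [mf1 f11 _] := sol_dens S1.
have fE i : reparam 1 (-1) (f i) (f1 i) by move=> x s _ _; exact: (congr1 (fun r => f1 i (x, r)) (rK s)).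
have YE a : reparam 1 (-1) (Y a) (fun p => - Y1 a p).
  by move=> x s _ _; exact: (congr1 (fun r => - Y1 a (x, r)) (rK s)).
have mY a : measurable_fun setT (Y a).
  by apply: measurableT_comp => //; exact: (measurableT_comp (sol_measurable S1 a) mrev).
have Y0 a : price q a = 0 -> forall p, Y a p = 0.
  by move=> pa p; rewrite /Y (sol_price0 S1 pa) oppr0.
have en_term (g : 'I_n -> X -> R) (Z : K -> X -> R) a (mg : forall i, measurable_fun setT (g i))
    (g01 : forall i p, 0 <= g i p <= 1) (mZ : measurable_fun setT (Z a)) :
    (forall p, 0 <= (price q a * (Z a p ^+ 2 * weight g a p))%:E)%E /\
    measurable_fun setT (fun p => (price q a * (Z a p ^+ 2 * weight g a p))%:E).
  by split=> [p|]; [rewrite lee_fin (summand_ge0 q0 hI)|exact: (summand_measurable q hI)].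
have Een : energy mu f Y = energy mu1 f1 Y1.
  apply: eq_bigr => a _.
  have [p0 mp] := en_term f Y a mf f01 (mY a).
  have [p10 mp1] := en_term f1 Y1 a mf1 f11 (sol_measurable S1 a).
  apply: reverse_integral => // x s s0 s1.
  by rewrite (YE a x s s0 s1) sqrrN (weight_reparam _ _ (fun i => fE i x s s0 s1)).
have Efin : (energy mu f Y < +oo)%E by rewrite Een; exact: sol_energy S1.
exists rho, mu, f, Y; split; last by rewrite Een.
- split; [exact: reverse_curve|exact: smu|exact: reverse_dens|exact: mY|exact: Y0|exact: Efin|].
  move=> eta te i; have tf := test_function_tfun te.
  have [_ iP _] := pairing_integral q0 hI reverse_dens mY Y0 i Efin tf.
  pose e1 p := eta (affine_ST 1 (-1) 1 p).
  have t1 : tfun e1 by apply: tfun_affine_ST.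
  have [i1 E1] := pairing_window_integral cO q0 hI i S1 t1.
  pose h1 (p : X) := -1 * (\1_(`]0, 1[%classic : set R) p.2 * pairing f1 Y1 e1 i p).
  rewrite (reverse_Rintegral (h1 := h1)) => //; first last.
  - move=> x s s0 s1; rewrite /h1 /= indicE mem_set/=; last by rewrite in_itv /= s0.
    rewrite mul1r -(pairing_reparam q theta (f := f) (Y := Y) _ (tfun_smooth tf) (fun i => fE i x s s0 s1)).
      by rewrite mulrA mulrNN !mul1r.
    by move=> b; rewrite (YE b x s s0 s1) mulrNN mul1r.
  - by have := integrableZl measurableT (-1) i1; exact: eq_integrable.
  rewrite /h1 RintegralZl// E1.
  have aE c e (x : E) s : affine_ST 1 c e ((x, s) : ST) = (x, c * s + e) by rewrite /affine_ST /= scale1r.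
  have z0 (m : {finite_measure set Rd -> \bar R}) (s : R) : ~ (0 < s < 1) -> \int[m]_x eta (x, s) = 0.
    by move=> hs; apply: Rintegral_eq0 => x; exact: (test_function_eq0 te).
  rewrite /e1; under eq_Rintegral do rewrite aE.
  under [X in _ - X]eq_Rintegral do rewrite aE.
  by rewrite mulr1 addNr mulr0 add0r !z0 ?subrr ?mulr0// ltxx ?andbF.
- by move=> j A mA; rewrite /rho subr0.
- by move=> j A mA; rewrite /rho subrr.
Qed.

End Reverse.

(** * Curves of zero action *)

Section ZeroEnergy.
Context (R : realType) (d n : nat).
Local Notation E := ('rV[R]_d).
Local Notation Rd := (euclid R d).
Local Notation T := (measurableTypeR R).
Local Notation X := (Rd * T)%type.
Local Notation ST := (E * R^o)%type.
Local Notation leb := (@lebesgue_measure R).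
Local Notation I01 := ([set` `[(0 : R), 1]] : set T).
Variables (Omega : set Rd) (q : 'I_n -> 'I_n -> R) (theta : R -> R -> R).
Hypothesis cO : closed (Omega : set E).
Hypothesis q0 : forall i j, 0 <= q i j.
Hypothesis hI : interpolation theta.
Local Notation K := (field_index d n).
Local Notation solution := (solution Omega q theta).
Local Notation energy := (energy q theta).
Local Notation weight := (weight theta).
Local Notation pairing := (pairing q theta).

Lemma tfun_time_constant (eta : ST -> R^o) : tfun eta -> exists zeta : ST -> R^o,
  [/\ tfun zeta, forall x t, `|t| <= 1 -> zeta (x, t) = eta (x, 1) &
    forall x t, `|t| <= 1 -> time_derivative zeta (x, t) = 0].
Proof.
move=> [se [M eM]]; pose r : R := (`|M| + 1)^-1.
have r0 : 0 < r by rewrite invr_gt0 ltr_wpDl.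
pose g : ST -> R^o := fun p => eta (affine_ST 1 0 1 p).
have sg : smooth g.
  move=> k; apply: (@Ck_on_affine R _ _ (affine_ST 1 0 0)); last exact: se.
  - by move=> w v s; exact: affine_ST_linear.
  - by move=> w; exact: differentiable_affine_ST.
have tc : tfun (cutoff r : ST -> R^o) by apply: tfun_cutoff; exact: lt0r_neq0.
exists (fun p => g p * cutoff r p); split; first exact: tfunM.
  move=> x t t1; rewrite /g /affine_ST /= scale1r mul0r add0r.
  have [xM|xM] := ltP M `|(x, 1 : R^o) : ST|; first by rewrite eM// mul0r.
  rewrite cutoff_eq1 ?mulr1//= ?(ltW r0)//.
    have : `|x| <= M by move: xM; rewrite prod_normE /= ge_max => /andP[].
    move=> xM'; rewrite mulrC ler_pdivrMr ?ltr_wpDl//.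
    by have := ler_norm M; have := normr_ge0 M; lra.
  by rewrite (le_trans t1)// ler1n.
move=> x t t1; rewrite /time_derivative derive_mul//; last exact: tfun_smooth tc.
rewrite cutoff_derive_time ?lt0r_neq0//=; last by rewrite (le_lt_trans t1)// ltr1n.
rewrite mulr0 add0r /g derive_affine_ST.
have -> : affine_ST 1 0 0 ((0, 1) : ST) = 0 *: ((0, 1) : ST).
  by rewrite scale0r /affine_ST /= scaler0 mul0r addr0.
by rewrite deriveZdir// mul0r mulr0.
Qed.

(** Against a test function constant in time only momentum terms remain. With zero action each is at
    most [C * kappa] for every positive [kappa], hence zero. *)
Lemma zero_energy rho mu f (Y : K -> X -> R) : solution rho mu f Y ->
  (energy mu f Y <= 0%:E)%E -> vmeasure_eq (rho 0) (rho 1).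
Proof.
move=> S E0 i; apply: (tfun_slice_unique (t := 1)) => eta te.
have [zeta [tz zE zD]] := tfun_time_constant te.
have n1 : `|1 : R| <= 1 by rewrite normr1.
have n0 : `|0 : R| <= 1 by rewrite normr0.
have -> : \int[rho 0 i]_x eta (x, 1) = \int[rho 0 i]_x zeta (x, 0).
  by apply: eq_Rintegral => x _; rewrite zE.
have -> : \int[rho 1 i]_x eta (x, 1) = \int[rho 1 i]_x zeta (x, 1).
  by apply: eq_Rintegral => x _; rewrite zE.
apply/esym/eqP; rewrite -subr_eq0; have [iP <-] := pairing_window_integral cO q0 hI i S tz.
have [cr smu df mY Y0 Yfin weak] := S.
pose ind (p : X) : R := \1_(`]0, 1[%classic : set R) p.2.
have mind : measurable_fun setT ind.
  have m1 : measurable_fun setT (\1_(`]0, 1[%classic : set R) : T -> R).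
    by apply: measurable_indic; exact: measurable_itv.
  exact: (measurableT_comp m1 measurable_snd).
have [C [C0 HC]] := tfun_dtest_bounded q tz.
pose g a p := ind p * dtest q i a zeta p.
have mg a : measurable_fun setT (g a).
  by apply: measurable_funM => //; apply: tfun_measurable; exact: tfun_dtest.
have gC a p : `|g a p| <= C.
  rewrite /g /ind indicE; case: (_ \in _); rewrite ?mul1r ?mul0r ?normr0//; exact: HC.
have ig a := pair_integrable q0 hI df mY Y0 a Yfin (mg a) (gC a).
have -> : \int[mu]_p (ind p * pairing f Y zeta i p) =
    \int[mu]_p (\sum_a g a p * (Y a p * weight f a p)).
  apply: eq_Rintegral => -[x t] _; rewrite /pairing /g /ind /= indicE.
  have [|_] := boolP (t \in _); last by rewrite mul0r big1// => a _; rewrite !mul0r.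
  rewrite inE /= in_itv /= => /andP[t0 t1]; rewrite zD; last by rewrite ger0_norm ltW.
  by rewrite mul0r add0r mul1r; apply: eq_bigr => a _; rewrite mul1r.
rewrite (proj2 (Rintegral_sum _ ig)) big1// => a _; apply/eqP; rewrite -normr_le0.
apply/ler_addgt0Pr => e e0; rewrite add0r.
have k0 : 0 < e / (C + 1) by rewrite divr_gt0// ltr_wpDl.
have g0 p : p.2 <= 0 \/ 1 <= p.2 -> g a p = 0.
  move=> [h|h]; rewrite /g /ind indicE memNset ?mul0r//= in_itv /=; apply/negP.
    by rewrite negb_and -!leNgt h.
  by rewrite negb_and -!leNgt h orbT.
apply: (le_trans (pair_bound cO q0 hI S E0 a (mg a) (gC a) k0 (lexx 0) ler01 (lexx 1) g0)).
rewrite subr0 mulr1 !mulr0 mul0r addr0 mulrCA -[leRHS]mulr1 ler_pM2l//.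
by rewrite ler_pdivrMr ?ltr_wpDl// mul1r lerDl.
Qed.

End ZeroEnergy.

(** * Finiteness *)

Lemma convex_segment (R : realType) (V : lmodType R) (A : set V) x y r :
  convex_set (A : set (convex_lmodType V)) -> A x -> A y -> 0 <= r -> r <= 1 ->
  A (x + r *: (y - x)).
Proof.
move=> cA Ax Ay r0 r1; have := cA y x (Itv01 r0 r1) (mem_set Ay) (mem_set Ax).
rewrite inE; congr A.
rewrite [LHS](_ : _ = r *: y + (1 - r) *: x)//.
by rewrite scalerBl scale1r scalerBr addrCA.
Qed.

Lemma Rintegral_fpush dd dd' (Y : measurableType dd) (Z : measurableType dd') (R : realType)
  (m : {finite_measure set Y -> \bar R}) (f : Y -> Z) (mf : measurable_fun setT f) (h : Z -> R) :
  measurable_fun setT h -> \int[fpush m mf]_z h z = \int[m]_y h (f y).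
Proof.
move=> /measurable_EFinP mh; rewrite /Rintegral integralE [in RHS]integralE; congr (fine (_ - _)%E).
  transitivity (\int[m]_y (EFin \o h)^\+%E (f y))%E.
    exact: (ge0_integral_fpush m mf (measurable_funepos mh) (funepos_ge0 _)).
  by apply: eq_integral => y _; rewrite !funeposE.
transitivity (\int[m]_y (EFin \o h)^\-%E (f y))%E.
  exact: (ge0_integral_fpush m mf (measurable_funeneg mh) (funeneg_ge0 _)).
by apply: eq_integral => y _; rewrite !funenegE.
Qed.

Lemma derive_split (R : realType) d (f : 'rV[R]_d * R^o -> R^o) (p v : 'rV[R]_d * R^o) :
  differentiable f p -> 'D_v f p =
  v.2 * 'D_((0, 1) : 'rV[R]_d * R^o) f p +
  \sum_k v.1 0 k * 'D_((delta_mx 0 k, 0) : 'rV[R]_d * R^o) f p.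
Proof.
move=> df; rewrite !deriveE//; under eq_bigr do rewrite deriveE//.
have {1}-> : v = v.2 *: ((0, 1) : 'rV[R]_d * R^o) +
    \sum_k v.1 0 k *: ((delta_mx 0 k, 0) : 'rV[R]_d * R^o).
  have -> : \sum_k v.1 0 k *: ((delta_mx 0 k, 0) : 'rV[R]_d * R^o) = (v.1, 0).
    rewrite {2}(row_sum_delta v.1).
    elim/big_rec2 : _ => [//|k x y _ ->]; congr pair; by rewrite /= scaler0 add0r.
  case: v => v1 v2; congr pair; rewrite /= ?scaler0 ?add0r// addr0.
  by rewrite /GRing.scale /= mulr1.
rewrite linearD linearZ linear_sum /=; congr (_ + _); apply: eq_bigr => k _.
by rewrite linearZ.
Qed.

Section TimeFubini.
Context (R : realType) (d : nat).
Local Notation Rd := (euclid R d).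
Local Notation T := (measurableTypeR R).
Local Notation X := (Rd * T)%type.
Local Notation leb := (@lebesgue_measure R).
Local Notation I01 := ([set` `[(0 : R), 1]] : set T).

Lemma integral01_cst (c : \bar R) : (\int[leb]_(t in I01) c = c)%E.
Proof.
rewrite integral_cst; last exact: measurable_itv.
by rewrite -[RHS]mule1; congr (_ * _)%E; exact: leb01.
Qed.

Lemma time_Fubini (m : {finite_measure set Rd -> \bar R}) (g : X -> R) (b : Rd -> R) :
  measurable_fun setT g -> m.-integrable setT (EFin \o b) -> (forall p, `|g p| <= b p.1) ->
  \int[leb]_(t in I01) (\int[m]_x g (x, t)) = \int[m]_x (\int[leb]_(t in I01) g (x, t)).
Proof.
move=> mg ib gb; have m01 : measurable I01 by exact: measurable_itv.
have [/measurable_EFinP mb fb] := integrableP _ _ _ ib.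
have b0 x : 0 <= b x by apply: le_trans (gb (x, 0)).
pose f (p : X) : \bar R := (g p * \1_I01 p.2)%:E.
have mi : measurable_fun setT (fun p : X => \1_I01 p.2 : R).
  have m1 : measurable_fun setT (\1_I01 : T -> R) by exact: measurable_indic.
  exact: (measurableT_comp m1 measurable_snd).
have mf : measurable_fun setT f by apply/measurable_EFinP; exact: measurable_funM.
have fle p : (`|f p| <= (b p.1)%:E * (\1_I01 p.2)%:E)%E.
  by rewrite /f /= -EFinM lee_fin normrM ler_pM// indicE; case: (_ \in _); rewrite ?normr1 ?normr0.
have iI (x : Rd) : (\int[leb]_t ((b x)%:E * (\1_I01 t)%:E) = (b x)%:E)%E.
  rewrite -[RHS]integral01_cst [RHS]integral_mkcond; apply: eq_integral => t _.
  by rewrite patchE indicE; case: (_ \in _); rewrite ?mule1 ?mule0.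
have mfa : measurable_fun setT (abse \o f) by exact: measurableT_comp.
have imf : (m \x leb)%E.-integrable setT f.
  apply/(integrable12ltyP _ _ mf); apply: (@le_lt_trans _ _ (\int[m]_x (b x)%:E)%E).
    apply: ge0_le_integral => //.
    - by move=> x _; apply: integral_ge0.
    - exact: (@measurable_fun_fubini_tonelli_F _ _ _ _ _ leb (abse \o f) mfa (fun=> abse_ge0 _)).
    - exact/measurable_EFinP.
    - move=> x _; rewrite -[leRHS]iI; apply: ge0_le_integral => //.
      + apply: measurableT_comp => //; apply: (measurableT_comp mf).
        by apply: measurable_fun_pair => //; exact: measurable_cst.
      + by apply/measurable_EFinP; apply: measurable_funM => //; exact: measurable_indic.
  apply: le_lt_trans fb; rewrite le_eqVlt; apply/orP; left; apply/eqP/eq_integral => x _.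
  by rewrite /= ger0_norm.
have mgx x : measurable_fun setT (fun t : T => g (x, t)).
  by apply: (measurableT_comp mg); apply: measurable_fun_pair => //; exact: measurable_cst.
have mgt t : measurable_fun setT (fun x : Rd => g (x, t)).
  by apply: (measurableT_comp mg); exact: measurable_slice.
have ix x : (\int[leb]_t f (x, t) = (\int[leb]_(t in I01) g (x, t))%:E)%E.
  have -> : (\int[leb]_t f (x, t) = \int[leb]_(t in I01) (g (x, t))%:E)%E.
    rewrite [RHS]integral_mkcond; apply: eq_integral => t _.
    by rewrite patchE /f /= indicE; case: (_ \in _); rewrite ?mulr1 ?mulr0.
  have ig : leb.-integrable I01 (EFin \o (fun t : T => g (x, t))); last first.
    by rewrite fineK//; exact: (integrable_fin_num m01 ig).
  apply: measurable_bounded_integrable => //.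
  - have h : (leb I01 < +oo)%E.
      have -> : leb I01 = 1%E by exact: leb01.
      exact: ltry.
    exact: h.
  - exact: measurable_funTS.
  - exists (b x); split; first exact: num_real.
    by move=> M bM t _; apply: (le_trans (gb (x, t))); exact: ltW.
have it t : (\int[m]_x f (x, t) = (\int[m]_x g (x, t) * \1_I01 t)%:E)%E.
  rewrite /f indicE /=; case: (_ \in _); last first.
    by rewrite mulr0 integral0_eq// => x _; rewrite mulr0.
  rewrite mulr1 fineK; first by apply: eq_integral => x _; rewrite mulr1.
  apply: integrable_fin_num => //; apply: (le_integrable _ _ ib) => // x.
  by rewrite (ger0_norm (b0 x)); exact: (gb (x, t)).
have := Fubini imf.
under eq_integral do rewrite ix.
under [X in _ = X -> _]eq_integral do rewrite it.
move=> h; rewrite /Rintegral; congr fine.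
transitivity (\int[leb]_t (\int[m]_x g (x, t) * \1_I01 t)%:E)%E; last exact: esym h.
rewrite integral_mkcond; apply: eq_integral => t _.
by rewrite patchE indicE; case: (_ \in _); rewrite ?mulr1 ?mulr0.
Qed.

End TimeFubini.

(** * Contraction of a measure to a point *)

Section Contraction.
Context (R : realType) (d n : nat).
Local Notation E := ('rV[R]_d).
Local Notation Rd := (euclid R d).
Local Notation T := (measurableTypeR R).
Local Notation X := (Rd * T)%type.
Local Notation ST := (E * R^o)%type.
Local Notation leb := (@lebesgue_measure R).
Local Notation I01 := ([set` `[(0 : R), 1]] : set T).
Variables (Omega : set Rd) (q : 'I_n -> 'I_n -> R) (theta : R -> R -> R).
Hypothesis cO : closed (Omega : set E).
Hypothesis q0 : forall i j, 0 <= q i j.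
Hypothesis hI : interpolation theta.
Local Notation K := (field_index d n).
Local Notation solution := (solution Omega q theta).
Local Notation energy := (energy q theta).
Local Notation weight := (weight theta).
Local Notation pairing := (pairing q theta).

Lemma vprobI (m : vmeasure R d n) : (forall i, m i (~` Omega) = 0%E) -> mbar m setT = 1%E ->
  vprob Omega m.
Proof.
move=> m0 m1; split=> //; rewrite -m1 /mbar; apply: eq_bigr => i _.
have mO := measurable_Omega cO.
have : m i setT = (m i Omega + m i (~` Omega))%E.
  by have := measureU (m i) mO (measurableC mO) (setICr _); rewrite setUv.
by rewrite m0 adde0 => ->.
Qed.

Hypothesis convO : convex_set (Omega : set (convex_lmodType 'rV[R]_d)).
Variables (m : vmeasure R d n) (x0 : E) (s : R).
Hypothesis pm : vprob2 Omega m.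
Hypothesis Ox0 : Omega x0.
Hypothesis s0 : 0 <= s.
Hypothesis s1 : s <= 1.

Definition shrink (t : R) (y : Rd) : Rd := (y : E) + (s * t) *: (x0 - y).

Lemma measurable_shrink t : measurable_fun setT (shrink t).
Proof.
apply: measurable_to_Rd => // k; rewrite (_ : (fun _ => _) =
    fun y : Rd => (y : E) 0 k + s * t * (x0 0 k - (y : E) 0 k)).
  apply: measurable_funD; first exact: measurable_coord.
  apply: measurable_funM => //; apply: measurable_funB => //; exact: measurable_coord.
by apply/funext => y; rewrite /shrink !mxE.
Qed.

Definition shrunk t : vmeasure R d n := fun i => fpush (m i) (measurable_shrink t).

Let shrink_Omega t y : I01 t -> Omega y -> Omega (shrink t y).
Proof.
rewrite /= in_itv /= => /andP[t0 t1] Oy; apply: convex_segment => //; first exact: mulr_ge0.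
by rewrite mulr_ile1.
Qed.

Lemma shrunk_vprob t : I01 t -> vprob Omega (shrunk t).
Proof.
move=> It; have [p1 _] := pm; apply: vprobI => [i|].
  rewrite -[LHS]/(m i (shrink t @^-1` (~` Omega))).
  apply/eqP; rewrite eq_le measure_ge0 andbT; have [p0 _] := p1; rewrite -(p0 i).
  have mC := measurableC (measurable_Omega cO).
  apply: le_measure; rewrite ?inE//.
    by rewrite -[X in measurable X]setTI; exact: measurable_shrink.
  by move=> y /= h Oy; apply: h; exact: shrink_Omega.
exact: (mbar1 cO p1).
Qed.

Lemma shrunk_curve : curve_vprob Omega 0 1 shrunk.
Proof.
apply: (curve_vprobI cO) => [t It|i phi Cphi]; first exact: shrunk_vprob.
have [cphi [M phiM]] := Cphi.
have mphi := continuous_measurable_Rd cphi.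
rewrite (_ : (fun _ => _) = fun t => \int[m i]_y phi (shrink (clamp t) y)); last first.
  by apply/funext => t; rewrite Rintegral_fpush.
move=> t; apply/(@cvg_nbhsP R R^o) => u ut.
apply: (@dominated_Rcvg _ _ _ (m i) (fun k y => phi (shrink (clamp (u k)) y)) _ (cst `|M|)).
- by move=> k; apply: (measurableT_comp mphi); exact: measurable_shrink.
- by apply: (@bounded_integrable _ _ _ _ _ `|M|) => // y; rewrite normr_id.
- by move=> k y; rewrite (le_trans (phiM _))// ler_norm.
move=> y; have cg : continuous (fun r : R => phi ((y : E) + (s * clamp r) *: (x0 - y))).
  move=> r; apply: continuous_comp; last exact: cphi.
  apply: cvgD; first exact: cvg_cst.
  apply: cvgZl; apply: cvgM; first exact: cvg_cst.
  exact: clamp_continuous.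
exact: (cvg_comp _ _ ut (cg t)).
Qed.

Let mu := cmu cO shrunk_curve.
Let smu : stmeas shrunk mu := stmeas_cmu cO shrunk_curve.

(* [powR _ (-1)] is the inverse on positive numbers, and measurable everywhere. *)
Definition shrink_velocity (a : K) (p : X) : R :=
  match a with
  | inl (_, k) => s * (x0 0 k - (p.1 : E) 0 k) * powR (1 - s * p.2) (-1)
  | inr _ => 0
  end.

Let Y := shrink_velocity.

Let mY a : measurable_fun setT (Y a).
Proof.
case: a => -[i k] //=; last exact: measurable_cst.
apply: measurable_funM.
  apply: measurable_funM => //; apply: measurable_funB => //.
  exact: (measurableT_comp (measurable_coord k) measurable_fst).
have mp : measurable_fun setT (fun p : X => 1 - s * p.2).
  by apply: measurable_funB => //; apply: measurable_funM => //; exact: measurable_snd.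
by apply: (measurableT_comp (f := fun x : R => powR x (-1)) _ mp); exact: measurable_powR.
Qed.

Let Y0 a : price q a = 0 -> forall p, Y a p = 0.
Proof. by case: a => -[i j] //= /eqP; rewrite oner_eq0. Qed.

(** Since [x0 - shrink t y = (1 - s * t) * (x0 - y)], dividing [s * (x0 - x)] by [1 - s * t] gives
    each particle its constant velocity. Open times keep the divisor positive even for [s = 1]. *)
Let Y_shrink i k t y : 0 < t -> t < 1 -> Y (inl (i, k)) (shrink t y, t) = s * (x0 0 k - (y : E) 0 k).
Proof.
move=> t0 t1; have st : 0 < 1 - s * t by rewrite subr_gt0 (le_lt_trans _ t1)// ler_piMl// ltW.
rewrite /Y /shrink_velocity /= powR_inv1 ?ltW// /shrink !mxE; field; exact: lt0r_neq0.
Qed.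

(* [s = 0] gives the constant curve, [s = 1] the contraction to [x0]. *)
Lemma contraction (C : R) :
  (forall i k, (\int[m i]_y ((x0 0 k - (y : E) 0 k) ^+ 2)%:E <= C%:E)%E) -> 0 <= C ->
  exists rho mu f (Y : K -> X -> R), [/\ solution rho mu f Y, vmeasure_eq (rho 0) m,
    (forall i A, measurable A -> rho 1 i A = m i (shrink 1 @^-1` A)) &
    (energy mu f Y <= (s ^+ 2 * C * #|K|%:R)%:E)%E].
Proof.
move=> mC C0; have [f df] := curve_dens cO shrunk_curve.
have [mf f1 [N [mN N0 gN]]] := df.
have [pr _] := pm.
have w0 a p : 0 <= weight f a p by case/andP: (weight01 hI a p f1).
have mt0 : measurable ([set 0; 1] : set T) by apply: measurableU.
have l00 : leb ([set 0; 1] : set T) = 0%E.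
  by apply: null_set_setU => //; exact: lebesgue_measure_set1.
pose N' : set T := N `|` [set 0; 1].
have mN' : measurable N' by exact: measurableU.
have N'0 : leb N' = 0%E by exact: null_set_setU.
have good t : I01 t -> ~ N' t -> [/\ 0 < t, t < 1 & good_time shrunk f t].
  move=> It Nt; have := It; rewrite /= in_itv /= => /andP[t0 t1]; split.
  - by rewrite lt_neqAle t0 andbT; apply/eqP => h; apply: Nt; right; left.
  - by rewrite lt_neqAle t1 andbT; apply/eqP => h; apply: Nt; right; right.
  - by apply: gN => // h; apply: Nt; left.
have Een : (energy mu f Y <= (s ^+ 2 * C * #|K|%:R)%:E)%E.
  rewrite /energy (@le_trans _ _ (\sum_(a : K) (s ^+ 2 * C)%:E)%E)//; last first.
    by rewrite sumEFin sumr_const mulr_natr.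
  apply: lee_sum => a _; case: a => -[i k]; last first.
    rewrite integral0_eq ?lee_fin ?mulr_ge0 ?sqr_ge0// => p _.
    by rewrite /Y /= expr0n mul0r mulr0.
  pose h (p : X) : \bar R := ((Y (inl (i, k)) p ^+ 2)%:E * (f i p)%:E)%E.
  have h0 p : (0 <= h p)%E by rewrite /h -EFinM lee_fin mulr_ge0 ?sqr_ge0//; case/andP: (f1 i p).
  have mY2 : measurable_fun setT (fun p => (Y (inl (i, k)) p ^+ 2)%:E).
    by apply/measurable_EFinP; apply: measurable_funX; exact: mY.
  have mh : measurable_fun setT h.
    by apply: emeasurable_funM => //; exact/measurable_EFinP.
  rewrite (eq_integral h); last by move=> p _; rewrite /h -EFinM /= mul1r.
  rewrite (smu h0 mh); apply: (@le_trans _ _ (\int[leb]_(t in I01) (s ^+ 2 * C)%:E)%E); last first.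
    by rewrite integral01_cst.
  have E1 t : 0 < t -> t < 1 -> good_time shrunk f t ->
      (\int[mbar (shrunk t)]_x h (x, t) = (s ^+ 2)%:E * \int[m i]_y ((x0 0 k - (y : E) 0 k) ^+ 2)%:E)%E.
    move=> t0 t1 gt; have mYt := slice_fun t mY2.
    rewrite -(good_integral mf f1 gt i mYt) ge0_integral_fpush//; last first.
      by move=> y; rewrite lee_fin sqr_ge0.
    rewrite -ge0_integralZl//.
    - apply: eq_integral => y _; rewrite (Y_shrink i k y t0 t1) -EFinM; congr EFin; ring.
    - apply/measurable_EFinP; apply: measurable_funX; apply: measurable_funB => //.
      exact: measurable_coord.
    - by move=> y _; rewrite lee_fin sqr_ge0.
    - by rewrite lee_fin sqr_ge0.
  rewrite (integral_off_null mN' N'0 (g := fun t => (s ^+ 2)%:E * \int[m i]_y ((x0 0 k - (y : E) 0 k) ^+ 2)%:E)%E).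
    rewrite !integral01_cst [(s ^+ 2 * C)%:E]EFinM; apply: lee_wpmul2l => //.
    by rewrite lee_fin sqr_ge0.
  by move=> t It /(good t It)[t0 t1 gt]; exact: E1.
have Efin : (energy mu f Y < +oo)%E by apply: (le_lt_trans Een); rewrite ltry.
exists shrunk, mu, f, Y; split=> //; last first.
  move=> i A mA; rewrite -[LHS]/(m i (shrink 0 @^-1` A)); congr (m i _).
  by apply/funext => y; rewrite /preimage /shrink /= mulr0 scale0r addr0.
split=> //; [exact: shrunk_curve|].
move=> eta te i; have tf := test_function_tfun te.
have [_ iP _] := pairing_integral q0 hI df mY Y0 i Efin tf.
have [/measurable_EFinP mP _] := integrableP _ _ _ iP.
rewrite -(stmeas_Rintegral cO shrunk_curve smu iP).
pose v (y : E) : ST := (s *: (x0 - y), 1).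
pose g (p : X) : R := time_derivative eta (shrink p.2 p.1, p.2) +
  \sum_k s * (x0 0 k - (p.1 : E) 0 k) * 'D_((delta_mx 0 k, 0) : ST) eta (shrink p.2 p.1, p.2).
(* Followed along the trajectory of [y], the pairing is the derivative of [eta] on a straight line
   in space-time, so its time integral is a difference of values of [eta] at the two end times,
   where it vanishes. *)
have gE y t : g (y, t) = 'D_(v y) eta (((y : E), 0 : R^o) + t *: v y).
  have -> : ((y : E), 0 : R^o) + t *: v y = (shrink t y, t).
    congr pair; rewrite /= ?scalerA /shrink ?[t * s]mulrC// add0r.
    by rewrite /GRing.scale /= mulr1.
  rewrite derive_split /=; last exact: smooth_differentiable (tfun_smooth tf).
  rewrite mul1r /g; congr (_ + _); apply: eq_bigr => k _; by rewrite !mxE.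
rewrite (Rintegral_off_null mN' N'0 (g := fun t => \int[m i]_y g (y, t))); last first.
  move=> t It /(good t It)[t0 t1 gt].
  pose P (x : Rd) := time_derivative eta (x, t) +
    \sum_k 'D_((delta_mx 0 k, 0) : ST) eta (x, t) * Y (inl (i, k)) (x, t).
  have mD w : measurable_fun setT (fun x : Rd => 'D_w eta (x, t)).
    exact: (slice_fun t (tfun_measurable (tfun_derive w tf))).
  have mPt : measurable_fun setT P.
    apply: measurable_funD; first exact: mD.
    apply: measurable_sum => k; apply: measurable_funM; first exact: mD.
    exact: (slice_fun t (mY _)).
  transitivity (\int[mbar (shrunk t)]_x (P x * f i (x, t))).
    apply: eq_Rintegral => x _; rewrite /pairing sum_index [X in _ + (_ + X)]big1 ?addr0; last first.
      by move=> i' _; rewrite big1// => j _; rewrite /Y /= mul0r mulr0.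
    rewrite (bigD1 i)//= [X in _ + (_ + X)]big1 ?addr0; last first.
      by move=> i' /negbTE ii; rewrite big1// => k _; rewrite /= ii !mul0r.
    rewrite mulrDl; congr (_ + _); rewrite mulr_suml; apply: eq_bigr => k _.
    by rewrite /= eqxx mul1r mulrA.
  rewrite -(good_Rintegral mf f1 gt i mPt) Rintegral_fpush//.
  apply: eq_Rintegral => y _; rewrite /P /g /=; congr (_ + _); apply: eq_bigr => k _.
  by rewrite -(Y_shrink i k y t0 t1) mulrC.
have /choice[D HD] : forall w : 'I_d + unit, exists Dw : R, `|Dw| = Dw /\ forall p,
    match w with inl k => `|'D_((delta_mx 0 k, 0) : ST) eta p| <= Dw
    | inr _ => `|time_derivative eta p| <= Dw end.
  move=> [k|[]].
    have [D [D0 HD]] := tfun_bounded (tfun_derive ((delta_mx 0 k, 0) : ST) tf).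
    by exists D; split=> //; exact: ger0_norm.
  have [D [D0 HD]] := tfun_bounded (tfun_derive ((0, 1) : ST) tf).
  by exists D; split=> //; exact: ger0_norm.
(* A bound uniform in time for exchanging the integrals: [1 + z ^+ 2] dominates [|z|] and is
   integrable by the second moments. *)
pose b (y : Rd) := D (inr tt) + \sum_k (1 + (x0 0 k - (y : E) 0 k) ^+ 2) * D (inl k).
have msh : measurable_fun setT (fun p : X => (shrink p.2 p.1, p.2) : X).
  apply: measurable_fun_pair; last exact: measurable_snd.
  apply: measurable_to_Rd => // k; rewrite (_ : (fun _ => _) =
      fun p : X => (p.1 : E) 0 k + s * p.2 * (x0 0 k - (p.1 : E) 0 k)); last first.
    by apply/funext => p; rewrite /shrink !mxE.
  have mk : measurable_fun setT (fun p : X => (p.1 : E) 0 k).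
    exact: (measurableT_comp (measurable_coord k) measurable_fst).
  apply: measurable_funD => //; apply: measurable_funM; last exact: measurable_funB.
  by apply: measurable_funM => //; exact: measurable_snd.
have mg : measurable_fun setT g.
  have mD w : measurable_fun setT (fun p : X => 'D_w eta (shrink p.2 p.1, p.2)).
    exact: (measurableT_comp (tfun_measurable (tfun_derive w tf)) msh).
  apply: measurable_funD; first exact: mD.
  apply: measurable_sum => k; apply: measurable_funM; last exact: mD.
  apply: measurable_funM => //; apply: measurable_funB => //.
  exact: (measurableT_comp (measurable_coord k) measurable_fst).
have ic (c : R) : (m i).-integrable setT (EFin \o cst c).
  by apply: (@bounded_integrable _ _ _ _ _ `|c|).
have isq k : (m i).-integrable setT (EFin \o (fun y : Rd => (x0 0 k - (y : E) 0 k) ^+ 2)).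
  apply/integrableP; split.
    apply/measurable_EFinP; apply: measurable_funX; apply: measurable_funB => //.
    exact: measurable_coord.
  apply: (@le_lt_trans _ _ C%:E); last exact: ltry.
  apply: le_trans (mC i k); rewrite le_eqVlt; apply/orP; left; apply/eqP/eq_integral => y _.
  by rewrite /= ger0_norm// sqr_ge0.
have ib : (m i).-integrable setT (EFin \o b).
  have i1 k : (m i).-integrable setT (EFin \o (fun y : Rd => (1 + (x0 0 k - (y : E) 0 k) ^+ 2) * D (inl k))).
    have h1 := integrableD measurableT (ic 1) (isq k).
    have := integrableZl measurableT (D (inl k)) h1; apply: eq_integrable => // y _ /=.
    by rewrite -EFinD -EFinM mulrC.
  have [i2 _] := Rintegral_sum (index_enum 'I_d) i1.
  by have := integrableD measurableT (ic (D (inr tt))) i2; exact: eq_integrable.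
rewrite (time_Fubini mg ib); last first.
  move=> [y t]; rewrite /g /b (le_trans (ler_normD _ _))// lerD//.
    by case: (HD (inr tt)) => _; apply.
  rewrite (le_trans (ler_norm_sum _ _ _))//; apply: ler_sum => k _ /=.
  have [_ Hk] := HD (inl k); rewrite normrM; apply: ler_pM => //.
  rewrite normrM (ger0_norm s0); set z := x0 0 k - _.
  have h1 : s * `|z| <= `|z| by rewrite ler_piMl.
  have := sqr_ge0 (`|z| - 1); rewrite sqrrB real_normK ?num_real// => h2.
  have := normr_ge0 z; nra.
apply: Rintegral_eq0 => y; under eq_Rintegral do rewrite gE.
rewrite (line_FTC _ _ (tfun_smooth tf)).
rewrite (test_function_eq0 te); last by rewrite /= add0r ltxx andbF.
by rewrite (test_function_eq0 te) ?subrr//= ltxx.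
Qed.

End Contraction.

(** * Flows on the graph with prescribed divergence *)

Section Flows.
Context (R : realType) (n : nat).
Variable q : 'I_n -> 'I_n -> R.

(** [psi i j] moves mass from [j] to [i], and [b] is the net gain of each node; the factor one half
    is that of the continuity equation. *)
Definition is_flow (b : 'I_n -> R) (psi : 'I_n -> 'I_n -> R) :=
  (forall i j, q i j = 0 -> psi i j = 0) /\
  (forall i, 2^-1 * \sum_j (psi i j - psi j i) = b i).

Lemma flowD b b' : (exists psi, is_flow b psi) -> (exists psi, is_flow b' psi) ->
  exists psi, is_flow (fun i => b i + b' i) psi.
Proof.
move=> [u [u0 ub]] [v [v0 vb]]; exists (fun i j => u i j + v i j); split.
  by move=> i j qij; rewrite u0// v0// addr0.
move=> i; rewrite -ub -vb -mulrDr -big_split /=; congr (_ * _).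
by apply: eq_bigr => j _; ring.
Qed.

Lemma flowZ c b : (exists psi, is_flow b psi) -> exists psi, is_flow (fun i => c * b i) psi.
Proof.
move=> [u [u0 ub]]; exists (fun i j => c * u i j); split.
  by move=> i j qij; rewrite u0// mulr0.
move=> i; rewrite -ub mulrCA; congr (_ * _); rewrite mulr_sumr.
by apply: eq_bigr => j _; ring.
Qed.

Lemma flow_sum (I : Type) (s : seq I) (b : I -> 'I_n -> R) :
  (forall k, exists psi, is_flow (b k) psi) ->
  exists psi, is_flow (fun i => \sum_(k <- s) b k i) psi.
Proof.
move=> bk; elim: s => [|k s IH].
  exists (fun _ _ => 0); split=> // i; rewrite big_nil big1 ?mulr0// => j _.
  by rewrite subrr.
have [psi [p0 pb]] := flowD (bk k) IH; exists psi; split=> // i.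
by rewrite pb big_cons.
Qed.

Lemma flow_edge x y : 0 < q x y -> exists psi, is_flow (fun i => (i == x)%:R - (i == y)%:R) psi.
Proof.
move=> xy; exists (fun i j => 2 * ((i == x)%:R * (j == y)%:R)); split.
  move=> i j qij; have [ix|_] := eqVneq i x; last by rewrite mul0r mulr0.
  have [jy|_] := eqVneq j y; last by rewrite mulr0 mulr0.
  by move: xy; rewrite -ix -jy qij ltxx.
move=> i; rewrite sumrB -!mulr_sumr -mulr_suml.
have S z : \sum_(j < n) (j == z)%:R = 1 :> R.
  by rewrite (bigD1 z)//= eqxx big1 ?addr0// => j /negbTE ->.
by rewrite !S; field.
Qed.

Lemma flow_connect x y : connect (fun a b => 0 < q a b) x y ->
  exists psi, is_flow (fun i => (i == x)%:R - (i == y)%:R) psi.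
Proof.
move=> /connectP[p]; elim: p x => [|z p IH] x /=.
  move=> _ ->; exists (fun _ _ => 0); split=> // i; rewrite big1 ?mulr0 ?subrr// => j _.
move=> /andP[xz zp] yl; have [psi [p0 pb]] := flowD (flow_edge xz) (IH _ zp yl).
by exists psi; split=> // i; rewrite pb; ring.
Qed.

(** Every node [y] hands the share [a y / n] to every node [x], along a path of edges with positive
    weights; summing over all pairs leaves [n^-1] at each node. *)
Lemma flow_to_uniform (a : 'I_n -> R) : weight_connected q -> \sum_i a i = 1 ->
  exists psi, is_flow (fun i => n%:R^-1 - a i) psi.
Proof.
move=> qc a1; have n0 : n%:R != 0 :> R.
  rewrite pnatr_eq0; apply/eqP => n0; move: a1; rewrite big1; last first.
    by move=> i _; have := ltn_ord i; rewrite {2}n0.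
  by move/eqP; rewrite eq_sym oner_eq0.
have := @flow_sum _ (index_enum ('I_n * 'I_n)%type)
  (fun xy i => a xy.2 / n%:R * ((i == xy.1)%:R - (i == xy.2)%:R)).
case=> [[x y]|psi [p0 pb]]; first by apply: flowZ; apply: flow_connect; exact: qc.
exists psi; split=> // i; rewrite pb -(pair_bigA _ (fun x y =>
  a y / n%:R * ((i == x)%:R - (i == y)%:R))) /=.
under eq_bigr do under eq_bigr do rewrite mulrBr.
under eq_bigr do rewrite sumrB -mulr_suml -mulr_suml a1 mul1r.
rewrite sumrB -mulr_sumr (bigD1 i)//= eqxx big1 ?addr0 ?mulr1; last first.
  by move=> j /negbTE; rewrite eq_sym => ->.
congr (_ - _); rewrite sumr_const card_ord (bigD1 i)//= eqxx big1; last first.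
  by move=> j /negbTE; rewrite eq_sym => ->; rewrite mulr0.
by rewrite addr0 mulr1 -[LHS]mulr_natr mulfVK.
Qed.

End Flows.

Section PointMass.
Context (R : realType) (d : nat).
Local Notation Rd := (euclid R d).
Variables (c : {nonneg R}) (x0 : Rd).

Lemma point_mass_subproof : is_fmeasure (mscale c (\d_x0 : {measure set Rd -> \bar R})).
Proof.
split=> [|A||A mA]; [exact: measure0|exact: measure_ge0|exact: measure_semi_sigma_additive|].
by rewrite /mscale /= fin_numM// fin_num_measure.
Qed.

Definition point_mass : {finite_measure set Rd -> \bar R} := fmeasure point_mass_subproof.

Lemma point_massE A : point_mass A = (c%:num%:E * \d_x0 A)%E.
Proof. by []. Qed.

Lemma point_mass_integral (h : Rd -> \bar R) : measurable_fun setT h ->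
  (\int[point_mass]_x h x = h x0 * c%:num%:E)%E.
Proof.
move=> mh; rewrite (@density_integral_all _ _ _ point_mass (\d_x0 : {finite_measure set Rd -> \bar R})
  (cst c%:num))//.
- rewrite integral_dirac//; first by rewrite diracT mul1e.
  by apply: emeasurable_funM => //; apply/measurable_EFinP; exact: measurable_cst.
- by move=> A mA; exact: esym (integral_cst _ mA _).
Qed.

End PointMass.

(** * Making the masses at a point uniform *)

Section Mixing.
Context (R : realType) (d n : nat).
Local Notation E := ('rV[R]_d).
Local Notation Rd := (euclid R d).
Local Notation T := (measurableTypeR R).
Local Notation X := (Rd * T)%type.
Local Notation ST := (E * R^o)%type.
Local Notation leb := (@lebesgue_measure R).
Local Notation I01 := ([set` `[(0 : R), 1]] : set T).
Variables (Omega : set Rd) (q : 'I_n -> 'I_n -> R) (theta : R -> R -> R).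
Hypothesis cO : closed (Omega : set E).
Hypothesis q0 : forall i j, 0 <= q i j.
Hypothesis hI : interpolation theta.
Local Notation K := (field_index d n).
Local Notation solution := (solution Omega q theta).
Local Notation energy := (energy q theta).
Local Notation weight := (weight theta).
Local Notation pairing := (pairing q theta).

Variables (a : 'I_n -> R) (x0 : Rd) (psi : 'I_n -> 'I_n -> R).
Hypothesis a0 : forall i, 0 <= a i.
Hypothesis a1 : \sum_i a i = 1.
Hypothesis Ox0 : Omega x0.
Let b i := n%:R^-1 - a i.
Hypothesis fl : is_flow q b psi.

Let n0 : 0 < n%:R :> R.
Proof.
rewrite ltr0n lt0n; apply/eqP => n0; move: a1; rewrite big1; last first.
  by move=> i _; have := ltn_ord i; rewrite {2}n0.
by move/eqP; rewrite eq_sym oner_eq0.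
Qed.

(* The quadratic clock keeps the action bounded, since [theta >= t ^+ 2 / n] along the curve. *)
Definition mix i (t : R) := a i + b i * clamp t ^+ 2.

Let c01 (t : R) : 0 <= clamp t <= 1. Proof. by have := clamp_I01 t; rewrite in_itv. Qed.

Let mix_ge i t : clamp t ^+ 2 / n%:R <= mix i t.
Proof.
have /andP[t0 t1] := c01 t; have : clamp t ^+ 2 <= 1 by rewrite exprn_ile1.
rewrite /mix /b => h; have := mulr_ge0 (a0 i) (_ : 0 <= 1 - clamp t ^+ 2).
by rewrite subr_ge0 => /(_ h); lra.
Qed.

Let mix_ge0 i t : 0 <= mix i t.
Proof. by apply: le_trans (mix_ge i t); rewrite mulr_ge0 ?sqr_ge0// invr_ge0 ltW. Qed.

Let mix_sum t : \sum_i mix i t = 1.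
Proof.
rewrite big_split /= a1 -mulr_suml sumrB a1 sumr_const card_ord -[n%:R^-1 *+ n]mulr_natr.
by rewrite mulVf ?gt_eqF// subrr mul0r addr0.
Qed.

Let mix_le1 i t : mix i t <= 1.
Proof. by rewrite -(mix_sum t) (bigD1 i)//= lerDl sumr_ge0. Qed.

Definition mixing t : vmeasure R d n := fun i => point_mass (NngNum (mix_ge0 i t)) x0.

Let mbar_mixing t A : mbar (mixing t) A = \d_x0 A.
Proof.
rewrite /mbar /mixing; under eq_bigr do rewrite point_massE /=.
by rewrite -ge0_sume_distrl ?sumEFin ?mix_sum ?mul1e// => i _; rewrite lee_fin.
Qed.

Let mbar_integral t (h : Rd -> \bar R) : measurable_fun setT h ->
  (\int[mbar (mixing t)]_x h x = h x0)%E.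
Proof.
move=> mh; transitivity (\int[\d_x0]_x h x)%E.
  by apply: eq_measure_integral => A _ _; exact: mbar_mixing.
by rewrite integral_dirac// diracT mul1e.
Qed.

Let mixing_curve : curve_vprob Omega 0 1 mixing.
Proof.
apply: (curve_vprobI cO) => [t _|i phi [cphi _]].
  apply: (vprobI cO) => [i|]; last by rewrite mbar_mixing diracT.
  by rewrite point_massE diracE memNset ?mule0//; apply.
rewrite (_ : (fun _ => _) = fun t => phi x0 * (a i + b i * clamp t ^+ 2)).
  move=> t; apply: cvgM; first exact: cvg_cst.
  apply: cvgD; first exact: cvg_cst.
  apply: cvgM; first exact: cvg_cst.
  by apply: cvgM; exact: clamp_continuous.
apply/funext => t; rewrite /Rintegral point_mass_integral; last first.
  by apply/measurable_EFinP; exact: continuous_measurable_Rd.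
by rewrite /= /mix (clampK (clamp_I01 t)).
Qed.

Let mu := cmu cO mixing_curve.
Let smu : stmeas mixing mu := stmeas_cmu cO mixing_curve.
Let f i (p : X) := mix i p.2.

(** Obtained by solving [q i j * v i j * theta = 2 * t * psi i j]: the right-hand side is the flow
    times the derivative of the clock [t ^+ 2]. *)
Definition mixing_velocity (e : K) (p : X) : R :=
  match e with
  | inl _ => 0
  | inr (i, j) => 2 * psi i j / q i j * clamp p.2 * powR (theta (f i p) (f j p)) (-1)
  end.
Let Y := mixing_velocity.

Let mclamp : measurable_fun setT (fun p : X => clamp p.2).
Proof.
have mc : measurable_fun setT (@clamp R : T -> R).
  by apply: continuous_measurable_fun; exact: clamp_continuous.
exact: (measurableT_comp mc measurable_snd).
Qed.

Let mf i : measurable_fun setT (f i).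
Proof.
by apply: measurable_funD => //; apply: measurable_funM => //; exact: measurable_funX.
Qed.

Let f01 i p : 0 <= f i p <= 1. Proof. by rewrite mix_ge0 mix_le1. Qed.

Let f_dens : dens mixing f.
Proof.
split; [exact: mf|exact: f01|exists set0; split; [exact: measurable0|exact: measure0|]].
move=> t It _ i A mA.
rewrite point_massE /= (eq_measure_integral (\d_x0 : {measure set Rd -> \bar R})); last first.
  by move=> B _ _; exact: mbar_mixing.
exact: esym (integral_cst _ mA _).
Qed.

Let mY e : measurable_fun setT (Y e).
Proof.
case: e => [?|[i j]]; first exact: measurable_cst.
apply: measurable_funM; first exact: measurable_funM.
have mp : measurable_fun setT (fun p : X => theta (f i p) (f j p)).
  by apply: (measurable_theta hI) => // p; [case/andP: (f01 i p)|case/andP: (f01 j p)].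
by apply: (measurableT_comp (f := fun x : R => powR x (-1)) _ mp); exact: measurable_powR.
Qed.

Let Y0 e : price q e = 0 -> forall p, Y e p = 0.
Proof.
case: e => [[i k]|[i j]] /=; first by move=> /eqP; rewrite oner_eq0.
by move=> qij p; rewrite (proj1 fl) ?mulr0 ?mul0r//; lra.
Qed.

Let weight_ge i j p : clamp p.2 ^+ 2 / n%:R <= theta (f i p) (f j p).
Proof.
have h0 : 0 <= clamp p.2 ^+ 2 / n%:R by rewrite mulr_ge0 ?sqr_ge0// invr_ge0 ltW.
rewrite -{1}(theta_diag hI h0); apply: (theta_mono hI); rewrite h0 /=; exact: mix_ge.
Qed.

(** A mobility can vanish only at the start, where the prescribed flux [2 * t * psi i j] vanishes as
    well; so division by it is harmless. *)
Let clamp_eq0 i j p : theta (f i p) (f j p) = 0 -> clamp p.2 = 0.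
Proof.
move=> w0; have := weight_ge i j p; rewrite w0 pmulr_lle0 ?invr_gt0// => h.
by apply/eqP; rewrite -sqrf_eq0 eq_le h sqr_ge0.
Qed.

Let YwE i j p : q i j * (Y (inr (i, j)) p * weight f (inr (i, j)) p) = 2 * psi i j * clamp p.2.
Proof.
have [q00|qn] := eqVneq (q i j) 0; first by rewrite q00 mul0r (proj1 fl)// mulr0 mul0r.
have /andP[w0 _] := weight01 hI (inr (i, j)) p f01.
rewrite /Y /mixing_velocity /=; move: w0; rewrite /= le_eqVlt => /predU1P[w0|w0].
  by rewrite -w0 (clamp_eq0 (esym w0)) !mulr0.
by rewrite powR_inv1 ?ltW//; field; rewrite qn gt_eqF.
Qed.

(** The integrand is [2 * t ^+ 2 * psi i j ^+ 2] divided by [q i j] and by the mobility, and the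
    latter is at least [t ^+ 2 / n]. *)
Let energy_le e p : price q e * (Y e p ^+ 2 * weight f e p) <=
  match e with inl _ => 0 | inr (i, j) => 2 * n%:R * psi i j ^+ 2 / q i j end.
Proof.
case: e => [[i k]|[i j]]; first by rewrite /Y /= expr0n mul0r mulr0.
have [q00|qn] := eqVneq (q i j) 0; first by rewrite /= q00 !mul0r invr0 mulr0.
have qp : 0 < q i j by rewrite lt_neqAle eq_sym qn q0.
have -> : price q (inr (i, j) : K) * (Y (inr (i, j)) p ^+ 2 * weight f (inr (i, j)) p) =
    Y (inr (i, j)) p * (psi i j * clamp p.2).
  have -> : psi i j * clamp p.2 = 2^-1 * (q i j * (Y (inr (i, j)) p * weight f (inr (i, j)) p)).
    by rewrite YwE; field.
  by rewrite -[price q _]/(q i j / 2); ring.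
have /andP[w0 _] := weight01 hI (inr (i, j)) p f01.
rewrite /Y /mixing_velocity /=; move: w0; rewrite /= le_eqVlt => /predU1P[w0|w0].
  rewrite (clamp_eq0 (esym w0)) !mulr0 divr_ge0 ?(ltW qp)// mulr_ge0 ?sqr_ge0//.
rewrite powR_inv1; last exact: ltW.
have -> : 2 * psi i j / q i j * clamp p.2 * (theta (f i p) (f j p))^-1 * (psi i j * clamp p.2) =
  (2 * psi i j ^+ 2 / q i j) * (clamp p.2 ^+ 2 / theta (f i p) (f j p)) by ring.
have -> : 2 * n%:R * psi i j ^+ 2 / q i j = (2 * psi i j ^+ 2 / q i j) * n%:R by ring.
apply: ler_wpM2l; first by rewrite divr_ge0 ?(ltW qp)// mulr_ge0 ?sqr_ge0.
by rewrite ler_pdivrMr// mulrC -ler_pdivrMr//; exact: weight_ge.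
Qed.

Let smooth_snd : smooth (fun p : ST => p.2 : R^o).
Proof.
move=> k; case: k => [|k]; first by move=> p _; exact: continuous_snd.
split=> [p _|v]; first exact: differentiable_snd.
rewrite (_ : 'D_v _ = cst v.2); first exact: Ck_on_cst.
have AL (w h : ST) (r : R) : (r *: h + w).2 = r *: h.2 + w.2 :> R^o by [].
rewrite -[X in 'D_v X]/(id \o (fun p : ST => p.2 : R^o)) (derive_affine AL).
by apply/funext => p /=; exact: derive_id.
Qed.

Let derive_snd (p : ST) : 'D_((0, 1) : ST) (fun p : ST => p.2 : R^o) p = 1.
Proof.
have AL (w h : ST) (r : R) : (r *: h + w).2 = r *: h.2 + w.2 :> R^o by [].
have := derive_affine (A := fun p : ST => p.2 : R^o) (L := fun p : ST => p.2 : R^o) AL id ((0, 1) : ST).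
by move=> /(congr1 (fun g => g p)) h; exact: etrans h (derive_id _ _).
Qed.

Lemma mixing_solution : exists rho mu f (Y : K -> X -> R), [/\ solution rho mu f Y,
  (forall i A, measurable A -> rho 0 i A = ((a i)%:E * \d_x0 A)%E) &
  (forall i A, measurable A -> rho 1 i A = ((n%:R^-1)%:E * \d_x0 A)%E)].
Proof.
have t00 : clamp (0 : R) = 0 by rewrite clampK//= in_itv /= lexx ler01.
have t11 : clamp (1 : R) = 1 by rewrite clampK//= in_itv /= lexx ler01.
have Efin : (energy mu f Y < +oo)%E.
  apply: lte_sum_pinfty => e _;
  pose Be := match e with inl _ => 0 | inr (i, j) => 2 * n%:R * psi i j ^+ 2 / q i j end.
  apply: (@le_lt_trans _ _ (\int[mu]_p Be%:E)%E).
    apply: ge0_le_integral => //.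
    - by move=> p _; rewrite lee_fin (summand_ge0 q0 hI).
    - exact: (summand_measurable q hI).
    - by move=> p _; rewrite lee_fin; exact: energy_le.
  have ib : mu.-integrable setT (EFin \o cst Be) by apply: (@bounded_integrable _ _ _ _ _ `|Be|).
  by have := integrable_fin_num measurableT ib; rewrite fin_numE => /andP[_]; rewrite -ltey.
exists mixing, mu, f, Y; split; last 2 first.
- by move=> i A _; rewrite point_massE /= /mix t00 expr0n mulr0 addr0.
- by move=> i A _; rewrite point_massE /= /mix t11 expr1n mulr1 /b addrC subrK.
split; [exact: mixing_curve|exact: smu|exact: f_dens|exact: mY|exact: Y0|exact: Efin|].
move=> eta te i; have tf := test_function_tfun te; have se := tfun_smooth tf.
have [_ iP _] := pairing_integral q0 hI f_dens mY Y0 i Efin tf.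
have [/measurable_EFinP mP _] := integrableP _ _ _ iP.
rewrite -(stmeas_Rintegral cO mixing_curve smu iP).
pose P : ST -> R^o := fun p => a i + b i * (p.2 * p.2).
have sP : smooth P.
  apply: smoothD; first exact: smooth_cst.
  by apply: smoothM; [exact: smooth_cst|exact: smoothM].
(* [P] is the mass of node [i] written without [clamp], hence smooth. At the fixed point [x0] the
   equation is an ordinary one, and the pairing is the time derivative of [eta * P]. *)
pose G : ST -> R^o := fun p => eta p * P p.
have DP p : 'D_((0, 1) : ST) P p = b i * (2 * p.2).
  rewrite derive_add; [|exact: smooth_cst|by apply: smoothM; [exact: smooth_cst|exact: smoothM]].
  rewrite derive_cst add0r derive_cstM; last exact: smoothM.
  by rewrite derive_mul// derive_snd; ring.
transitivity (\int[leb]_(t in I01) 'D_((0, 1) : ST) G ((x0 : E, 0 : R^o) + t *: ((0, 1) : ST))).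
  apply: eq_Rintegral => t; rewrite inE => It; rewrite time_lineE.
  rewrite {1}/Rintegral mbar_integral; last first.
    by apply/measurable_EFinP; exact: (slice_fun t mP).
  rewrite /= /G derive_mul// DP /pairing sum_index [X in _ + (X + _)]big1 ?add0r; last first.
    by move=> i' _; rewrite big1// => k _; rewrite /Y /= mul0r mulr0.
  have E1 i' j : dtest q i (inr (i', j)) eta (x0, t) *
      (Y (inr (i', j)) (x0, t) * weight f (inr (i', j)) (x0, t)) =
      eta (x0, t) * t * (((i' == i)%:R - (j == i)%:R) * psi i' j).
    transitivity (2^-1 * ((i' == i)%:R - (j == i)%:R) * eta (x0, t) *
        (q i' j * (Y (inr (i', j)) (x0, t) * weight f (inr (i', j)) (x0, t)))).
      by rewrite /dtest; ring.
    by rewrite YwE /= (clampK It); field.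
  under eq_bigr => i' _ do under eq_bigr => j _ do rewrite E1.
  under eq_bigr do rewrite -mulr_sumr; rewrite -mulr_sumr.
  have -> : \sum_i' \sum_j (((i' == i)%:R - (j == i)%:R) * psi i' j) = \sum_j (psi i j - psi j i).
    under eq_bigr do under eq_bigr do rewrite mulrBl.
    under eq_bigr do rewrite sumrB; rewrite !sumrB; congr (_ - _).
      rewrite (bigD1 i)//= [X in _ + X]big1 ?addr0; last first.
        by move=> i' /negbTE ->; rewrite big1// => j _; rewrite mul0r.
      by apply: eq_bigr => j _; rewrite eqxx mul1r.
    apply: eq_bigr => i' _; rewrite (bigD1 i)//= eqxx mul1r big1 ?addr0//.
    by move=> j /negbTE ->; rewrite mul0r.
  have -> : \sum_j (psi i j - psi j i) = 2 * b i by rewrite -(proj2 fl i); field.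
  rewrite -[X in _ = _ + _ * X]/(time_derivative eta (x0, t)).
  by set D := time_derivative eta (x0, t); rewrite /f /mix /P /= (clampK It) expr2; ring.
rewrite line_FTC; last exact: smoothM.
rewrite /G (test_function_eq0 te); last by rewrite /= add0r ltxx andbF.
by rewrite mul0r (test_function_eq0 te) ?mul0r ?subrr//= ltxx.
Qed.

End Mixing.

(** * The distance *)

Section Metric.
Context (R : realType) (d n : nat).
Local Notation E := ('rV[R]_d).
Local Notation Rd := (euclid R d).
Local Notation T := (measurableTypeR R).
Local Notation X := (Rd * T)%type.
Local Notation ST := (E * R^o)%type.
Local Notation leb := (@lebesgue_measure R).
Local Notation I01 := ([set` `[(0 : R), 1]] : set T).
Variables (Omega : set Rd) (q : 'I_n -> 'I_n -> R) (theta : R -> R -> R).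
Hypothesis cO : closed (Omega : set E).
Hypothesis q0 : forall i j, 0 <= q i j.
Hypothesis qC : weight_symmetric q.
Hypothesis hI : interpolation theta.
Local Notation K := (field_index d n).
Local Notation solution := (solution Omega q theta).
Local Notation energy := (energy q theta).
Local Notation weight := (weight theta).
Local Notation pairing := (pairing q theta).

Local Notation W2 := (W2 Omega q theta).

(** Curves of action at most the real number [A]. Upper bounds compose under gluing and reversal,
    which keeps extended reals and infima out of the metric arguments. *)
Definition reach (m0 m1 : vmeasure R d n) (A : R) := exists rho mu f (Y : K -> X -> R),
  [/\ solution rho mu f Y, vmeasure_eq (rho 0) m0, vmeasure_eq (rho 1) m1 &
    (energy mu f Y <= A%:E)%E].

Lemma vmeasure_eq_sym (m0 m1 : vmeasure R d n) : vmeasure_eq m0 m1 -> vmeasure_eq m1 m0.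
Proof. by move=> h i A mA; rewrite h. Qed.

Lemma vmeasure_eq_trans (m0 m1 m2 : vmeasure R d n) :
  vmeasure_eq m0 m1 -> vmeasure_eq m1 m2 -> vmeasure_eq m0 m2.
Proof. by move=> h k i A mA; rewrite h// k. Qed.

Lemma reach_ge0 m0 m1 A : reach m0 m1 A -> 0 <= A.
Proof. by move=> [rho [mu [f [Y [S _ _ EA]]]]]; exact: (energy_ge0 q0 hI S EA). Qed.

Lemma reachW m0 m1 A B : A <= B -> reach m0 m1 A -> reach m0 m1 B.
Proof.
move=> AB [rho [mu [f [Y [S r0 r1 EA]]]]]; exists rho, mu, f, Y; split=> //.
by rewrite (le_trans EA)// lee_fin.
Qed.

Lemma reach_eq m0 m1 m0' m1' A : vmeasure_eq m0 m0' -> vmeasure_eq m1 m1' ->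
  reach m0 m1 A -> reach m0' m1' A.
Proof.
move=> e0 e1 [rho [mu [f [Y [S r0 r1 EA]]]]]; exists rho, mu, f, Y; split=> //.
  exact: vmeasure_eq_trans r0 e0.
exact: vmeasure_eq_trans r1 e1.
Qed.

Lemma reach_sym m0 m1 A : reach m0 m1 A -> reach m1 m0 A.
Proof.
move=> [rho [mu [f [Y [S r0 r1 EA]]]]]; apply: (reach_eq r1 r0).
exact: (reverse_exists cO q0 hI S EA).
Qed.

Lemma reach_glue m0 m1 m2 A B lam : 0 < lam -> lam < 1 -> reach m0 m1 A -> reach m1 m2 B ->
  reach m0 m2 (A / lam + B / (1 - lam)).
Proof.
move=> l0 l1 [rho [mu [f [Y [S r0 r1 EA]]]]] [rho' [mu' [f' [Y' [S' r0' r1' EB]]]]].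
apply: (reach_eq r0 r1').
have r12 := vmeasure_eq_trans r1 (vmeasure_eq_sym r0').
exact: (glue_exists cO q0 hI l0 l1 S S' r12 EA EB).
Qed.

Lemma reach_zero m0 m1 : reach m0 m1 0 -> vmeasure_eq m0 m1.
Proof.
move=> [rho [mu [f [Y [S r0 r1 EA]]]]].
apply: (vmeasure_eq_trans (vmeasure_eq_sym r0)).
exact: vmeasure_eq_trans (zero_energy cO q0 hI S EA) r1.
Qed.

Lemma reach_W2 m0 m1 A : reach m0 m1 A -> (W2 m0 m1 <= A%:E)%E.
Proof.
move=> [rho [mu [f [Y [S r0 r1 EA]]]]].
have [u [v [[ce _ _] av]]] := solution_action cO q0 qC hI S.
by apply: le_trans EA; apply: ereal_inf_lbound; exists rho, u, v; rewrite av.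
Qed.

Lemma action_ge0 m0 m1 rho u v : connecting Omega q theta m0 m1 rho u v ->
  (0 <= action Omega q theta rho u v)%E.
Proof.
move=> co; have [afin|afin] := ltP (action Omega q theta rho u v) +oo%E; last first.
  exact: le_trans afin.
have [mu [f [Y [S <-]]]] := action_solution cO q0 qC hI co afin.
by have [_ f01 _] := sol_dens S; exact: (energy_nonneg q0 hI).
Qed.

(** Once the infimum is finite it is approached by curves of finite action, to which the existence
    theorem applies with [en] equal to the infimum. *)
Lemma W2_attained m0 m1 B : vprob Omega m0 -> reach m0 m1 B ->
  exists w, W2 m0 m1 = w%:E /\ reach m0 m1 w.
Proof.
move=> p0 rB; have W0 : (0 <= W2 m0 m1)%E.
  apply: le_ereal_inf_tmp => _ [rho [u [v [co ->]]]]; exact: (action_ge0 co).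
have Wfin : W2 m0 m1 \is a fin_num.
  by rewrite ge0_fin_numE// (le_lt_trans (reach_W2 rB))// ltry.
exists (fine (W2 m0 m1)); split; first by rewrite fineK.
apply: (solution_exists cO q0 hI p0) => e e0.
have [_ [rho [u [v [co ->]]]] lte] := lb_ereal_inf_adherent e0 Wfin.
have afin : (action Omega q theta rho u v < +oo)%E.
  apply: (lt_trans lte); rewrite -[ereal_inf _]/(W2 m0 m1) -(fineK Wfin) -EFinD; exact: ltry.
have [mu [f [Y [S EY]]]] := action_solution cO q0 qC hI co afin.
have [_ r0 r1] := co; exists rho, mu, f, Y; split=> //.
by rewrite EY EFinD fineK// ltW.
Qed.

Hypothesis convO : convex_set (Omega : set (convex_lmodType 'rV[R]_d)).
Hypothesis qc : weight_connected q.

Lemma vprob_point (m : vmeasure R d n) : vprob Omega m -> exists x0, Omega x0.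
Proof.
move=> [_ m1]; apply: contrapT => nO.
have O0 : Omega = set0 by apply/seteqP; split=> // x Ox; apply: nO; exists x.
by move: m1; rewrite O0 big1 => [/eqP|i _]; rewrite ?measure0// eq_sym onee_eq0.
Qed.

Lemma second_moment (m : vmeasure R d n) (x0 : E) : vprob2 Omega m -> exists C, 0 <= C /\
  forall i k, (\int[m i]_y ((x0 0 k - (y : E) 0 k) ^+ 2)%:E <= C%:E)%E.
Proof.
move=> [[m0 _] m2].
have mc k : measurable_fun setT (fun y : Rd => (y : E) 0 k) by exact: measurable_coord.
have msq : measurable_fun setT (fun y : Rd => enorm y ^+ 2).
  rewrite (_ : (fun _ => _) = fun y : Rd => \sum_k (y : E) 0 k ^+ 2).
    by apply: measurable_sum => k; exact: measurable_funX.
  by apply/funext => y; rewrite enormE.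
have ie i : (m i).-integrable setT (EFin \o (fun y : Rd => enorm y ^+ 2)).
  apply/integrableP; split; first exact/measurable_EFinP.
  apply: le_lt_trans (m2 i); rewrite (integral_Omega cO)// le_eqVlt; apply/orP; left.
  by apply/eqP/eq_integral => y _; rewrite /= ger0_norm// sqr_ge0.
have ig i k : (m i).-integrable setT (EFin \o (fun y : Rd => 2 * x0 0 k ^+ 2 + 2 * enorm y ^+ 2)).
  have i1 : (m i).-integrable setT (EFin \o cst (2 * x0 0 k ^+ 2)).
    by apply: (@bounded_integrable _ _ _ _ _ `|2 * x0 0 k ^+ 2|).
  have := integrableD measurableT i1 (integrableZl measurableT 2 (ie i)).
  by apply: eq_integrable => // y _; rewrite /= EFinD EFinM.
have ik i k : (m i).-integrable setT (EFin \o (fun y : Rd => (x0 0 k - (y : E) 0 k) ^+ 2)).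
  apply: (le_integrable _ _ (ig i k)).
    by apply: measurable_funX; apply: measurable_funB.
  move=> y; rewrite (ger0_norm (sqr_ge0 _)) ger0_norm; last first.
    by rewrite addr_ge0// mulr_ge0// sqr_ge0.
  have h : (y : E) 0 k ^+ 2 <= enorm y ^+ 2.
    rewrite enormE (bigD1 k)//= lerDl; apply: sumr_ge0 => l _; exact: sqr_ge0.
  have := sqr_ge0 (x0 0 k + (y : E) 0 k); nra.
pose c i k := fine (\int[m i]_y ((x0 0 k - (y : E) 0 k) ^+ 2)%:E).
have c0 i k : 0 <= c i k.
  by apply: fine_ge0; apply: integral_ge0 => y _; rewrite lee_fin sqr_ge0.
exists (\sum_i \sum_k c i k); split=> [|i k].
  by apply: sumr_ge0 => i _; apply: sumr_ge0.
rewrite -(fineK (integrable_fin_num measurableT (ik i k))) lee_fin.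
rewrite (bigD1 i)//= (bigD1 k)//= -addrA lerDl addr_ge0//; first exact: sumr_ge0.
by apply: sumr_ge0 => j _; apply: sumr_ge0.
Qed.

Lemma reach_refl (m : vmeasure R d n) : vprob2 Omega m -> reach m m 0.
Proof.
move=> pm; have [x0 Ox0] := vprob_point (proj1 pm).
have [C [C0 HC]] := second_moment x0 pm.
have [rho [mu [f [Y [S r0 r1 EA]]]]] :=
  contraction cO q0 hI convO pm Ox0 (lexx 0) ler01 HC C0.
exists rho, mu, f, Y; split=> //.
  move=> i A mA; rewrite r1//; congr (m i _); apply/seteqP; split=> y.
    by rewrite /preimage /shrink /= mul0r scale0r addr0.
  by rewrite /preimage /shrink /= mul0r scale0r addr0.
by apply: (le_trans EA); rewrite expr0n !mul0r.
Qed.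

(** The target depends only on [x0], so it serves as a common relay between any two measures:
    contraction collects all mass at [x0], and mixing equalizes the nodes. *)
Lemma reach_uniform_dirac (m : vmeasure R d n) (x0 : Rd) (c0 : 0 <= n%:R^-1 :> R) : vprob2 Omega m -> Omega x0 ->
  exists A, reach m (fun=> point_mass (NngNum c0) x0) A.
Proof.
move=> pm Ox0; have [C [C0 HC]] := second_moment (x0 : E) pm.
have [pr _] := pm.
have [rho [mu [f [Y [S r0 r1 EA]]]]] :=
  contraction cO q0 hI convO pm Ox0 ler01 (lexx 1) HC C0.
pose a i := fine (m i setT).
have a0 i : 0 <= a i by exact: fine_ge0.
have a1 : \sum_i a i = 1.
  apply: EFin_inj; rewrite -sumEFin -(mbar1 cO pr); apply: eq_bigr => i _.
  by rewrite fineK// fin_num_measure.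
have [psi fl] := flow_to_uniform qc a1.
have [rho' [mu' [f' [Y' [S' r0' r1']]]]] := mixing_solution cO q0 hI a0 a1 Ox0 fl.
pose B := fine (energy mu' f' Y').
have R1 : reach m (rho' 0) (1 ^+ 2 * C * #|K|%:R).
  exists rho, mu, f, Y; split=> // i A mA; rewrite r1// r0'//.
  have sh : shrink x0 1 1 = cst x0.
    by apply/funext => y; rewrite /shrink mulr1 scale1r addrC subrK.
  rewrite sh preimage_cst diracE; case: ifPn => _; last by rewrite measure0 mule0.
  by rewrite mule1 /a fineK// fin_num_measure.
have R2 : reach (rho' 0) (fun=> point_mass (NngNum c0) x0) B.
  exists rho', mu', f', Y'; split=> //.
  rewrite /B fineK// ge0_fin_numE; first exact: sol_energy S'.
  by have [_ f01 _] := sol_dens S'; exact: (energy_nonneg q0 hI).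
have h1 : 0 < 2^-1 :> R by rewrite invr_gt0.
have h2 : 2^-1 < 1 :> R by rewrite invf_lt1// ltr1n.
by eexists; exact: (reach_glue h1 h2 R1 R2).
Qed.

Lemma reach_exists m0 m1 : vprob2 Omega m0 -> vprob2 Omega m1 -> exists A, reach m0 m1 A.
Proof.
move=> p0 p1; have [x0 Ox0] := vprob_point (proj1 p0).
have c0 : 0 <= n%:R^-1 :> R by rewrite invr_ge0.
have [A RA] := reach_uniform_dirac c0 p0 Ox0.
have [B RB] := reach_uniform_dirac c0 p1 Ox0.
have h1 : 0 < 2^-1 :> R by rewrite invr_gt0.
have h2 : 2^-1 < 1 :> R by rewrite invf_lt1// ltr1n.
by eexists; exact: (reach_glue h1 h2 RA (reach_sym RB)).
Qed.

Lemma W2_finite m0 m1 : vprob2 Omega m0 -> vprob2 Omega m1 ->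
  exists w, W2 m0 m1 = w%:E /\ reach m0 m1 w.
Proof.
by move=> p0 p1; have [A RA] := reach_exists p0 p1; exact: (W2_attained (proj1 p0) RA).
Qed.

(* Gluing at time [a / (a + b)] optimizes the cost [A / lam + B / (1 - lam)]. *)
Lemma reach_triangle m0 m1 m2 A B a b : 0 < a -> 0 < b -> A <= a ^+ 2 -> B <= b ^+ 2 ->
  reach m0 m1 A -> reach m1 m2 B -> reach m0 m2 ((a + b) ^+ 2).
Proof.
move=> a0 b0 Aa Bb RA RB; have ab : 0 < a + b by exact: addr_gt0.
have l0 : 0 < a / (a + b) by rewrite divr_gt0.
have l1 : a / (a + b) < 1 by rewrite ltr_pdivrMr// mul1r ltrDl.
have -> : (a + b) ^+ 2 = a ^+ 2 / (a / (a + b)) + b ^+ 2 / (1 - a / (a + b)).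
  by field; rewrite !gt_eqF// addrAC subrr add0r.
exact: (reach_glue l0 l1 (reachW Aa RA) (reachW Bb RB)).
Qed.

End Metric.

Theorem theorem1p2 (R : realType) (d n : nat) (Omega : set 'rV[R]_d)
  (q : 'I_n -> 'I_n -> R) (theta : R -> R -> R) :
  closed Omega ->
  convex_set (Omega : set (convex_lmodType 'rV[R]_d)) ->
  (forall i j, 0 <= q i j) ->
  weight_symmetric q ->
  weight_connected q ->
  interpolation theta ->
  is_metric_on (@vmeasure_eq R d n) (vprob2 (Omega : set (euclid R d)))
    (W (Omega : set (euclid R d)) q theta) /\
  (forall mu nu : vmeasure R d n,
     vprob2 (Omega : set (euclid R d)) mu ->
     vprob2 (Omega : set (euclid R d)) nu ->
     exists (rho : R -> vmeasure R d n) (u : velocity R d n)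
            (v : edge_velocity R d n),
       connecting (Omega : set (euclid R d)) q theta mu nu rho u v /\
       action (Omega : set (euclid R d)) q theta rho u v =
         W2 (Omega : set (euclid R d)) q theta mu nu).
Proof.
move=> cO convO q0 qC qc hI.
have fin := W2_finite cO q0 qC hI convO qc.
have WE mu nu w : W2 Omega q theta mu nu = w%:E -> W Omega q theta mu nu = (Num.sqrt w)%:E.
  by rewrite /W => ->.
split; last first.
  move=> mu nu pm pn; have [w [Ww [rho [mm [f [Y [S r0 r1 Ew]]]]]]] := fin _ _ pm pn.
  have [u [v [[ce _ _] av]]] := solution_action cO q0 qC hI S.
  have co : connecting Omega q theta mu nu rho u v by [].
  exists rho, u, v; split=> //; apply/eqP; rewrite eq_le; apply/andP; split.
    by rewrite av Ww.
  by apply: ereal_inf_lbound; exists rho, u, v.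
have wsym mu nu w w' : vprob2 (Omega : set (euclid R d)) mu -> vprob2 (Omega : set (euclid R d)) nu ->
    W2 Omega q theta mu nu = w%:E -> W2 Omega q theta nu mu = w'%:E -> w <= w'.
  move=> pm pn Ww Ww'; have [w1 [Ww1 R1]] := fin _ _ pn pm.
  move: Ww'; rewrite Ww1 => -[<-].
  by rewrite -lee_fin -Ww; exact: (reach_W2 cO q0 qC hI (reach_sym cO q0 hI R1)).
split.
- move=> mu nu pm pn; have [w [Ww _]] := fin _ _ pm pn.
  by rewrite (WE _ _ _ Ww) lee_fin sqrtr_ge0 ltry.
- move=> mu nu pm pn; have [w [Ww Rw]] := fin _ _ pm pn; have w0 := reach_ge0 q0 hI Rw.
  rewrite (WE _ _ _ Ww); split=> [[/eqP]|emn].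
    rewrite sqrtr_eq0 => wle; have w00 : w = 0 by apply/eqP; rewrite eq_le wle.
    by apply: (reach_zero cO q0 hI); rewrite -w00.
  have R0 : reach Omega q theta mu nu 0.
    by apply: (reach_eq (fun i A mA => erefl) emn); exact: (reach_refl cO q0 hI convO pm).
  have := reach_W2 cO q0 qC hI R0; rewrite Ww lee_fin => wle.
  by congr EFin; apply/eqP; rewrite sqrtr_eq0.
- move=> mu nu pm pn; have [w [Ww _]] := fin _ _ pm pn; have [w' [Ww' _]] := fin _ _ pn pm.
  rewrite (WE _ _ _ Ww) (WE _ _ _ Ww'); congr (Num.sqrt _)%:E; apply/eqP.
  by rewrite eq_le (wsym _ _ _ _ pm pn Ww Ww') (wsym _ _ _ _ pn pm Ww' Ww).
move=> mu nu la pm pn pl.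
have [w1 [W1 R1]] := fin _ _ pm pn; have [w2 [W2' R2]] := fin _ _ pn pl.
have [w3 [W3 R3]] := fin _ _ pm pl.
rewrite (WE _ _ _ W1) (WE _ _ _ W2') (WE _ _ _ W3) -EFinD lee_fin.
apply/ler_addgt0Pr => e e0.
have e2 : 0 < e / 2 by rewrite divr_gt0.
(* Adding [e / 2] to each distance keeps both lengths positive, so that the gluing time lies
   strictly between 0 and 1 even when a distance is 0. *)
have sq w : 0 <= w -> w <= (Num.sqrt w + e / 2) ^+ 2.
  move=> w0; rewrite -{1}(sqr_sqrtr w0) ler_pXn2r ?nnegrE ?addr_ge0 ?sqrtr_ge0 ?(ltW e2)//.
  by rewrite lerDl ltW.
have a0 : 0 < Num.sqrt w1 + e / 2 by rewrite ltr_wpDl// sqrtr_ge0.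
have b0 : 0 < Num.sqrt w2 + e / 2 by rewrite ltr_wpDl// sqrtr_ge0.
have Rt := reach_triangle cO q0 hI a0 b0 (sq _ (reach_ge0 q0 hI R1)) (sq _ (reach_ge0 q0 hI R2)) R1 R2.
have := reach_W2 cO q0 qC hI Rt; rewrite W3 lee_fin => /ler_wsqrtr.
rewrite sqrtr_sqr ger0_norm; last by rewrite addr_ge0 ?ltW.
by move=> h; apply: (le_trans h); lra.
Qed.
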